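(* Let $G$ be a connected reductive algebraic group over $\mathbb{C}$, and let $T\subset B\subset P\subset G$ be a maximal torus, a Borel subgroup and a standard parabolic subgroup. Let $S\subset T$ be a subgroup (not necessarily connected), and let $$Y_S:=\{v\in W^P:\ B^S\cdot vP/P=vP/P\}.$$ Then $$\sum_{v\in Y_S}\#\Big(W((G^S)^o)/W\big((G^S)^o\cap(vPv^{-1})\big)\Big)=\#W^P.$$ In particular, $$\#Y_S\ \ge\ \frac{\#W^P}{\#W((G^S)^o)}.$$ For $P=B$, in fact we have the equality $$\#Y_S=\frac{\#W}{\#W((G^S)^o)}.$$
   Context: $W$ is the Weyl group of $G$, $W_P$ the Weyl group of $P$ (i.e. of its Levi component), and $W^P\subset W$ is the set of minimal length coset representatives of $W/W_P$. $G^S$ and $B^S$ denote the fixed subgroups of $G$ and $B$ under the conjugation action of $S$, and $(G^S)^o$ is the identity component of $G^S$. $W(H)$ denotes the Weyl group of $H$ (with respect to $T$); for $v\in Y_S$ the group $(G^S)^o\cap(vPv^{-1})$ is a parabolic subgroup of $(G^S)^o$, and the Weyl group of a parabolic subgroup is by definition the Weyl group of its Levi component. *)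

(* Defs.v *)
From HB Require Import structures.
From mathcomp Require Import all_boot all_order all_algebra.
From mathcomp Require Import finmap.
From mathcomp Require Import all_classical reals topology.
From mathcomp Require Import complex.
From mathcomp.multinomials Require mpoly.

Set Implicit Arguments.
Unset Strict Implicit.
Unset Printing Implicit Defensive.

Import Order.TTheory GRing.Theory Num.Theory.

Local Open Scope classical_set_scope.
Local Open Scope ring_scope.

(* An affine algebraic group over the complex numbers R[i] is represented by a
   Zariski closed subgroup of some GL_n, as a set of n x n matrices. *)

Definition polyfun (R : realType) (n : nat)
    (p : mpoly.mpoly (n * n) R[i]) (x : 'M[R[i]]_n) : R[i] :=
  mpoly.meval (fun k => mxvec x 0 k) p.

(* Alias of 'M_n carrying the Zariski topology of affine n^2-space, generated
   by the principal open sets. *)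
Definition zariski (R : realType) (n : nat) := 'M[R[i]]_n.

HB.instance Definition _ (R : realType) (n : nat) :=
  Choice.on (zariski R n).

HB.instance Definition _ (R : realType) (n : nat) :=
  @isSubBaseTopological.Build (zariski R n) (set (zariski R n))
    [set U | exists p : mpoly.mpoly (n * n) R[i],
               U = [set x | polyfun p x != 0]] id.

Section Groups.
Variables (R : realType) (n : nat).
Local Notation M := 'M[R[i]]_n.
Implicit Types (G H L N Q T B P S X Y : set M).

Definition mulset X Y : set M := [set x *m y | x in X & y in Y].
Definition invset X : set M := [set invmx x | x in X].
Definition conjset X Y : set M := mulset (mulset X Y) (invset X).

Definition subgroup : set (set M) := [set X |
  [/\ X `<=` [set x | x \in unitmx], X 1%:M,
      (forall x y, X x -> X y -> X (x *m y)) &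
      (forall x, X x -> X (invmx x))]].

Definition normal_in G N : Prop :=
  N `<=` G /\ (forall g x, G g -> N x -> N (g *m x *m invmx g)).

Definition normalizer G X : set M := [set g | G g /\ conjset [set g] X = X].

(* Both the centralizer of X in G and the set of points of G fixed under the
   conjugation action of X. *)
Definition fixed G X : set M :=
  [set g | G g /\ (forall x, X x -> x *m g *m invmx x = g)].

Definition derived_subgroup G : set M :=
  smallest subgroup
    [set x *m y *m invmx x *m invmx y | x in G & y in G].

Definition solvable_group G : Prop :=
  exists k, iter k derived_subgroup G = [set 1%:M].

Definition algebraic_group G : Prop :=
  subgroup G /\
  (exists2 Z : set (zariski R n), closed Z & G = Z `&` [set x | x \in unitmx]).

Definition connected_group G : Prop := connected (G : set (zariski R n)).

Definition identity_component G : set M :=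
  connected_component (G : set (zariski R n)) 1%:M.

Definition unipotent_group G : Prop :=
  forall x, G x -> exists k : nat, (x - 1%:M) ^+ k = 0.

(* The closed connected normal unipotent subgroups of an algebraic group have
   a largest element, which is therefore their union. *)
Definition unipotent_radical G : set M :=
  \bigcup_(U in [set U | [/\ algebraic_group U, connected_group U,
                             normal_in G U & unipotent_group U]]) U.

Definition connected_reductive G : Prop :=
  [/\ algebraic_group G, connected_group G &
      unipotent_radical G = [set 1%:M]].

Definition torus T : Prop :=
  [/\ algebraic_group T, connected_group T &
      exists2 g : M, g \in unitmx &
        forall t, T t -> is_diag_mx (g *m t *m invmx g)].

Definition maximal_torus G T : Prop :=
  [/\ torus T, T `<=` G &
      forall T', torus T' -> T' `<=` G -> T `<=` T' -> T' = T].

Definition connected_solvable B : Prop :=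
  [/\ algebraic_group B, connected_group B & solvable_group B].

Definition borel_subgroup G B : Prop :=
  [/\ connected_solvable B, B `<=` G &
      forall B', connected_solvable B' -> B' `<=` G -> B `<=` B' -> B' = B].

Definition parabolic_subgroup G P : Prop :=
  [/\ algebraic_group P, P `<=` G &
      exists2 B, borel_subgroup G B & B `<=` P].

(* The Levi component of Q containing T; it is unique when Q is a parabolic
   subgroup of a connected reductive group with maximal torus T `<=` Q. *)
Definition levi Q T : set M :=
  xget set0 [set L | [/\ algebraic_group L, T `<=` L,
                         mulset L (unipotent_radical Q) = Q &
                         L `&` unipotent_radical Q = [set 1%:M]]].

(* N_H(T) / T, whose elements are the cosets x T viewed as sets of matrices.
   The group law is mulset and the identity element is T. *)
Definition weyl H T : set (set M) :=
  [set mulset [set x] T | x in normalizer H T].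

Definition weyl_parabolic Q T : set (set M) := weyl (levi Q T) T.

Definition weyl_cosets (W W' : set (set M)) : set (set (set M)) :=
  [set [set mulset w u | u in W'] | w in W].

(* Tangent space at the identity of the Zariski closed set G. *)
Definition lie G : set M :=
  [set A | forall p : mpoly.mpoly (n * n) R[i],
     (forall x, G x -> polyfun p x = 0) ->
     \sum_(k < n * n) polyfun (mpoly.mderiv k p) 1%:M * mxvec A 0 k = 0].

(* Nontrivial weights of T on the Lie algebra of H, written multiplicatively.
   A character of T is encoded as a function on all matrices that vanishes
   outside T, so that equal characters are equal functions. *)
Definition roots H T : set (M -> R[i]) :=
  [set a | [/\ forall t, ~ T t -> a t = 0,
               exists2 t, T t & a t != 1 &
               exists A, [/\ lie H A, A != 0 &
                 forall t, T t -> t *m A *m invmx t = a t *: A]]].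

(* The positive roots are the roots of B; the simple ones are those that are
   not a sum of two positive roots. *)
Definition simple_roots B T : set (M -> R[i]) :=
  [set a | roots B T a /\
     (forall b c, roots B T b -> roots B T c -> a <> (fun t => b t * c t))].

(* The reflection s_a is the nontrivial element of the Weyl group of the
   centralizer in G of the torus (ker a)^o. *)
Definition root_reflections G T (a : M -> R[i]) : set (set M) :=
  weyl (fixed G (identity_component [set t | T t /\ a t = 1])) T `\ T.

Definition simple_reflections G B T : set (set M) :=
  \bigcup_(a in simple_roots B T) root_reflections G T a.

Definition has_word G B T (w : set M) (k : nat) : Prop :=
  exists s : seq (set M), [/\ size s = k,
    forall r, r \in s -> simple_reflections G B T r & w = foldr mulset T s].

Definition weyl_length G B T (w : set M) : nat :=
  xget 0%N [set k | has_word G B T w k /\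
                    (forall j, has_word G B T w j -> (k <= j)%N)].

Definition min_coset_reps G B T P : set (set M) :=
  [set w | weyl G T w /\
     (forall u, weyl_parabolic P T u ->
        (weyl_length G B T w <= weyl_length G B T (mulset w u))%N)].

(* The point w P / P of G / P is the coset mulset w P (recall T `<=` P), and
   the condition says that its orbit under B^S is reduced to itself. *)
Definition fixed_reps G B T P S : set (set M) :=
  [set v | min_coset_reps G B T P v /\
     [set mulset [set b] (mulset v P) | b in fixed B S] = [set mulset v P]].

End Groups.

(* Zero on infinite sets; the sets counted here are all finite, since Weyl
   groups are. *)
Definition ncard (X : choiceType) (A : set X) : nat := #|` fset_set A|.

(* Main.v *)
(** Write P as the parabolic of a cocharacter l, so that W^P is identified with the orbit W l. A class
    v lies in Y_S exactly when v l is dominant for the roots of B^S in H = (G^S)^o, and the Weyl group of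
    H \cap vPv^-1 is the stabilizer of v l in W(H). As each W(H)-orbit in W l contains exactly one
    dominant element, the sum counts W l orbit by orbit. Reductivity enters through the nondegeneracy
    of the trace form on the Lie algebra; cocharacters and exponentials of nilpotents replace the Bruhat
    decomposition. *)

Require Import Defs.
From HB Require Import structures.
From mathcomp Require Import all_boot all_order all_algebra fingroup perm.
From mathcomp Require Import finmap.
From mathcomp Require Import all_classical reals topology.
From mathcomp Require Import complex mxtens.
From mathcomp.multinomials Require mpoly.
From mathcomp Require Import zify ring lra.
Import -(notations) mpoly.

Set Implicit Arguments.
Unset Strict Implicit.
Unset Printing Implicit Defensive.

Import Order.TTheory GRing.Theory Num.Theory.

Local Open Scope classical_set_scope.
Local Open Scope ring_scope.

(** The link between groups and Lie algebras is made by annihilators. An algebraic group consists of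
    the invertible matrices that preserve, in every polynomial representation, the covectors
    vanishing on the orbit of a vector. These spaces are stable under the Lie algebra, hence under
    exponentials of its nilpotent elements, and they split along generalized eigenspaces, which puts
    rational replicas of semisimple parts back into the group. In a basis diagonalizing T,
    cocharacters are rational row vectors permuted coordinatewise by the Weyl group; the dot product
    is therefore invariant, it is the trace form, and roots are kept as vectors of the same space.
    The obstacle is disconnectedness: centralizers and parabolics must be identified as groups, not
    only by Lie algebras. For centralizers, the rational projection of a big cell onto its Levi
    factor transports irreducibility. For P, the trace of the adjoint action on the orthogonal of
    its Lie algebra is invariant under all of P and singles out its cocharacter, the sum of the
    roots of P whose opposites are not roots of P. The pair of T and (G^S)^o enters through the same
    properties as T and G. *)

Lemma mpoly_ring_ind (N : nat) (A : comNzRingType) (Q : mpoly N A -> Prop) :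
  (forall c, Q (mpolyC N c)) -> (forall i, Q (mpolyX A (mnm1 i))) ->
  (forall p q, Q p -> Q q -> Q (p + q)) ->
  (forall p q, Q p -> Q q -> Q (p * q)) -> forall p, Q p.
Proof.
move=> Qc QX QD QM p; rewrite [p]mpolyE.
have Q0 : Q 0 by rewrite -(mpolyC0 N A).
have Q1 : Q 1 by rewrite -[1](mpolyC1 N A).
apply: (big_ind Q Q0 QD) => m _; rewrite -mul_mpolyC; apply: (QM) => //.
rewrite mpolyXE_id; apply: (big_ind Q Q1 QM) => i _.
by elim: (m i) => [|k IHk]; rewrite ?expr0 // exprS; apply: QM.
Qed.

Lemma mnm_subv (N : nat) (m : multinom N) : mnm_sub m m = mnm0.
Proof. by apply/mnmP => i; rewrite mnmBE subnn mnm0E. Qed.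

(** * Polynomial functions on matrices and their derivatives along polynomial curves *)

Section PolynomialFunctions.
Variables (R : realType) (n : nat).
Local Notation C := R[i].
Local Notation M := 'M[C]_n.

Lemma polyfunD p q (x : M) : polyfun (p + q) x = polyfun p x + polyfun q x :> C.
Proof. by rewrite /polyfun mevalD. Qed.

Lemma polyfunM p q (x : M) : polyfun (p * q) x = polyfun p x * polyfun q x :> C.
Proof. by rewrite /polyfun mevalM. Qed.

Definition is_poly (f : M -> C) := exists p, forall x, f x = polyfun p x.

Lemma is_poly_ext f g : f =1 g -> is_poly f -> is_poly g.
Proof. by move=> fg [p fp]; exists p => x; rewrite -fg. Qed.

Lemma is_poly_cst c : is_poly (fun=> c).
Proof. by exists (mpolyC _ c) => x; rewrite /polyfun mevalC. Qed.

Lemma is_poly_entry i j : is_poly (fun x => x i j).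
Proof.
exists (mpolyX _ (mnm1 (mxvec_index i j))) => x.
by rewrite /polyfun mevalXU mxvecE.
Qed.

Lemma is_polyD f g : is_poly f -> is_poly g -> is_poly (fun x => f x + g x).
Proof.
move=> [p fp] [q gq]; exists (p + q) => x.
by rewrite /polyfun mevalD fp gq.
Qed.

Lemma is_polyM f g : is_poly f -> is_poly g -> is_poly (fun x => f x * g x).
Proof.
move=> [p fp] [q gq]; exists (p * q) => x.
by rewrite /polyfun mevalM fp gq.
Qed.

Lemma is_polyN f : is_poly f -> is_poly (fun x => - f x).
Proof.
move=> /(is_polyM (is_poly_cst (-1))); apply: is_poly_ext => x.
by rewrite mulN1r.
Qed.

Lemma is_polyB f g : is_poly f -> is_poly g -> is_poly (fun x => f x - g x).
Proof. by move=> hf /is_polyN; apply: is_polyD. Qed.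

Lemma is_poly_sum (I : Type) (r : seq I) (P : pred I) (F : I -> M -> C) :
  (forall i, P i -> is_poly (F i)) -> is_poly (fun x => \sum_(i <- r | P i) F i x).
Proof.
move=> hF; elim: r => [|i r IHr].
  by apply: is_poly_ext (is_poly_cst 0) => x; rewrite big_nil.
case Pi: (P i); last by apply: is_poly_ext IHr => x; rewrite big_cons Pi.
by apply: is_poly_ext (is_polyD (hF _ Pi) IHr) => x; rewrite big_cons Pi.
Qed.

Lemma is_poly_prod (I : Type) (r : seq I) (P : pred I) (F : I -> M -> C) :
  (forall i, P i -> is_poly (F i)) -> is_poly (fun x => \prod_(i <- r | P i) F i x).
Proof.
move=> hF; elim: r => [|i r IHr].
  by apply: is_poly_ext (is_poly_cst 1) => x; rewrite big_nil.
case Pi: (P i); last by apply: is_poly_ext IHr => x; rewrite big_cons Pi.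
by apply: is_poly_ext (is_polyM (hF _ Pi) IHr) => x; rewrite big_cons Pi.
Qed.

Lemma is_polyX f k : is_poly f -> is_poly (fun x => f x ^+ k).
Proof.
move=> hf; apply: (is_poly_ext _ (is_poly_prod (index_enum 'I_k)
  (P := xpredT) (fun _ _ => hf))) => x.
by rewrite prodr_const card_ord.
Qed.

Lemma is_poly_ind (Q : (M -> C) -> Prop) :
  (forall f g, f =1 g -> Q f -> Q g) ->
  (forall c, Q (fun=> c)) -> (forall i j, Q (fun x => x i j)) ->
  (forall f g, is_poly f -> is_poly g -> Q f -> Q g -> Q (fun x => f x + g x)) ->
  (forall f g, is_poly f -> is_poly g -> Q f -> Q g -> Q (fun x => f x * g x)) ->
  forall f, is_poly f -> Q f.
Proof.
move=> Qext Qc QX QD QM f [p fp].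
apply: (Qext (polyfun p)) => [x|]; first by rewrite fp.
have hp (q : mpoly (n * n) C) : is_poly (polyfun q) by exists q.
elim/mpoly_ring_ind: p {fp} => [c|k|p q hp1 hq1|p q hp1 hq1].
- by apply: (Qext _ _ _ (Qc c)) => x; rewrite /polyfun mevalC.
- case/mxvec_indexP: k => i j; apply: (Qext _ _ _ (QX i j)) => x.
  by rewrite /polyfun mevalXU mxvecE.
- by apply: (Qext _ _ _ (QD _ _ (hp p) (hp q) hp1 hq1)) => x; rewrite /polyfun mevalD.
- by apply: (Qext _ _ _ (QM _ _ (hp p) (hp q) hp1 hq1)) => x; rewrite /polyfun mevalM.
Qed.

Definition is_polymx p q (F : M -> 'M[C]_(p, q)) :=
  forall i j, is_poly (fun x => F x i j).

Lemma is_polymx_cst p q (A : 'M[C]_(p, q)) : is_polymx (fun=> A).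
Proof. by move=> i j; apply: is_poly_cst. Qed.

Lemma is_polymx_id : is_polymx id.
Proof. by move=> i j; apply: is_poly_entry. Qed.

Lemma is_polymxM p q r (F : M -> 'M[C]_(p, q)) (H : M -> 'M[C]_(q, r)) :
  is_polymx F -> is_polymx H -> is_polymx (fun x => F x *m H x).
Proof.
move=> hF hH i j; have hS : is_poly (fun x => \sum_k F x i k * H x k j).
  by apply: is_poly_sum => k _; apply: is_polyM.
by apply: is_poly_ext hS => x; rewrite mxE.
Qed.

Lemma is_polymxD p q (F H : M -> 'M[C]_(p, q)) :
  is_polymx F -> is_polymx H -> is_polymx (fun x => F x + H x).
Proof.
by move=> hF hH i j; apply: is_poly_ext (is_polyD (hF i j) (hH i j)) => x; rewrite mxE.
Qed.

Lemma is_polymxN p q (F : M -> 'M[C]_(p, q)) :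
  is_polymx F -> is_polymx (fun x => - F x).
Proof. by move=> hF i j; apply: is_poly_ext (is_polyN (hF i j)) => x; rewrite mxE. Qed.

Lemma is_poly_det p (F : M -> 'M[C]_p) :
  is_polymx F -> is_poly (fun x => \det (F x)).
Proof.
move=> hF; apply: is_poly_sum => s _; apply: is_polyM; first exact: is_poly_cst.
by apply: is_poly_prod => i _; apply: hF.
Qed.

Lemma is_polymx_adj p (F : M -> 'M[C]_p) :
  is_polymx F -> is_polymx (fun x => \adj (F x)).
Proof.
move=> hF i j.
apply: (@is_poly_ext (fun x => (-1) ^+ (j + i) * \det (row' j (col' i (F x))))).
  by move=> x; rewrite mxE.
apply: is_polyM; first exact: is_poly_cst.
apply: is_poly_det => k l; apply: (is_poly_ext _ (hF (lift j k) (lift i l))) => x.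
by rewrite !mxE.
Qed.

Lemma is_poly_comp f (F : M -> M) : is_poly f -> is_polymx F -> is_poly (f \o F).
Proof.
move=> hf hF; elim/is_poly_ind: f / hf => [f g fg|c|i j|f g _ _|f g _ _].
- by apply: is_poly_ext => x /=.
- exact: is_poly_cst.
- exact: hF.
- exact: is_polyD.
- exact: is_polyM.
Qed.

Lemma is_poly_mulr f (a b : M) : is_poly f -> is_poly (fun x => f (a *m x *m b)).
Proof.
move=> hf; apply: (is_poly_comp hf); apply: is_polymxM; last exact: is_polymx_cst.
by apply: is_polymxM; [exact: is_polymx_cst | exact: is_polymx_id].
Qed.

(** In characteristic zero the naturals are an infinite set of test points. Identities first known
    for integral parameters, such as powers of a matrix, extend to all parameters in this way. *)
Lemma poly_nat_inj (p q : {poly C}) : (forall k : nat, p.[k%:R] = q.[k%:R]) -> p = q.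
Proof.
move=> pq; apply/eqP; rewrite -subr_eq0; apply/negPn/negP => nz.
pose s : seq C := [seq k%:R | k <- iota 0 (size (p - q))].
suff : (size s < size (p - q)%R)%N by rewrite size_map size_iota ltnn.
apply: max_poly_roots => //.
  by apply/allP => _ /mapP[k _ ->]; rewrite rootE hornerD hornerN pq subrr.
by rewrite map_inj_uniq ?iota_uniq // => i j /eqP; rewrite eqr_nat => /eqP.
Qed.

Lemma poly_zero_except (p : {poly C}) : (forall c, c != 0 -> p.[c] = 0) -> p = 0.
Proof.
move=> p0; suff : p * 'X = 0 by move/eqP; rewrite mulf_eq0 polyX_eq0 orbF => /eqP.
apply: poly_nat_inj => k; rewrite hornerM hornerX horner0.
have [->|k0] := eqVneq (k%:R : C) 0; first by rewrite mulr0.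
by rewrite p0 // mul0r.
Qed.

Definition is_uni (g : C -> C) := exists q : {poly C}, forall c, g c = q.[c].

Lemma is_uni_ext f g : f =1 g -> is_uni f -> is_uni g.
Proof. by move=> fg [q fq]; exists q => c; rewrite -fg. Qed.

Lemma is_uni_cst a : is_uni (fun=> a).
Proof. by exists a%:P => c; rewrite hornerC. Qed.

Lemma is_uni_id : is_uni id.
Proof. by exists 'X => c; rewrite hornerX. Qed.

Lemma is_uniD f g : is_uni f -> is_uni g -> is_uni (fun c => f c + g c).
Proof. by move=> [p fp] [q gq]; exists (p + q) => c; rewrite hornerD fp gq. Qed.

Lemma is_uniM f g : is_uni f -> is_uni g -> is_uni (fun c => f c * g c).
Proof. by move=> [p fp] [q gq]; exists (p * q) => c; rewrite hornerM fp gq. Qed.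

Lemma is_uniX f k : is_uni f -> is_uni (fun c => f c ^+ k).
Proof. by move=> [p fp]; exists (p ^+ k) => c; rewrite horner_exp fp. Qed.

Lemma is_uni_sum (I : Type) (r : seq I) (P : pred I) (F : I -> C -> C) :
  (forall i, P i -> is_uni (F i)) -> is_uni (fun x => \sum_(i <- r | P i) F i x).
Proof.
move=> hF; elim: r => [|i r IHr].
  by apply: is_uni_ext (is_uni_cst 0) => x; rewrite big_nil.
case Pi: (P i); last by apply: is_uni_ext IHr => x; rewrite big_cons Pi.
by apply: is_uni_ext (is_uniD (hF _ Pi) IHr) => x; rewrite big_cons Pi.
Qed.

Lemma is_poly_uni f (g : C -> M) :
  is_poly f -> (forall i j, is_uni (fun c => g c i j)) -> is_uni (fun c => f (g c)).
Proof.
move=> hf hg; elim/is_poly_ind: f / hf => [f h fh|c|i j|f h _ _|f h _ _].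
- by apply: is_uni_ext => x /=.
- exact: is_uni_cst.
- exact: hg.
- exact: is_uniD.
- exact: is_uniM.
Qed.

Lemma is_uni_zero g : is_uni g -> (forall c, c != 0 -> g c = 0) -> forall c, g c = 0.
Proof.
move=> [q gq] g0 c; rewrite gq (poly_zero_except (p := q)) ?horner0 // => d d0.
by rewrite -gq g0.
Qed.

Lemma is_uni_nat g : is_uni g -> (forall k : nat, g k%:R = 0) -> forall c, g c = 0.
Proof.
move=> [q gq] g0 c; rewrite gq (poly_nat_inj (p := q) (q := 0)) ?horner0 // => k.
by rewrite -gq g0 horner0.
Qed.

(** A curve of matrices is stored as a matrix of polynomials, so that its derivative is the formal
    one. *)
Definition mxcurve (G : 'M[{poly C}]_n) (c : C) : M := map_mx (fun p : {poly C} => p.[c]) G.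
Definition mxdcurve (G : 'M[{poly C}]_n) (c : C) : M :=
  map_mx (fun p : {poly C} => p^`().[c]) G.

(** The differential of [p] at [x] in the direction [A]; at the identity it is the expression that
    defines [lie]. *)
Definition tangent (p : mpoly (n * n) C) (x A : M) : C :=
  \sum_(k < n * n) polyfun (mderiv k p) x * mxvec A 0 k.

Lemma tangentD p x A B : tangent p x (A + B) = tangent p x A + tangent p x B.
Proof.
rewrite /tangent -big_split; apply: eq_bigr => k _ /=.
by rewrite linearD !mxE mulrDr.
Qed.

Lemma tangentZ p x a A : tangent p x (a *: A) = a * tangent p x A.
Proof.
rewrite /tangent mulr_sumr; apply: eq_bigr => k _ /=.
by rewrite linearZ !mxE mulrCA.
Qed.

Lemma chain_rule p G : exists q : {poly C}, forall c,
  polyfun p (mxcurve G c) = q.[c] /\ q^`().[c] = tangent p (mxcurve G c) (mxdcurve G c).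
Proof.
elim/mpoly_ring_ind: p => [a|k|p q [p' hp] [q' hq]|p q [p' hp] [q' hq]].
- exists a%:P => c; rewrite /polyfun mevalC hornerC derivC horner0; split=> //.
  rewrite /tangent big1 // => k _.
  by rewrite mderivC /polyfun meval0 mul0r.
- case/mxvec_indexP: k => i j; exists (G i j) => c.
  rewrite /polyfun mevalXU mxvecE mxE; split=> //.
  rewrite /tangent (bigD1 (mxvec_index i j)) //= mxvecE mxE big1 ?addr0.
    by rewrite mderivX mnm1E eqxx scale1r mnm_subv mpolyX0
      /polyfun meval1 mul1r.
  move=> k ki; rewrite mderivX mnm1E eq_sym (negbTE ki) scale0r.
  by rewrite /polyfun meval0 mul0r.
- exists (p' + q') => c; have [h1 h2] := hp c; have [h3 h4] := hq c.
  rewrite polyfunD hornerD h1 h3; split; first by [].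
  rewrite derivD hornerD h2 h4 /tangent -big_split /=; apply: eq_bigr => k _.
  by rewrite mderivD polyfunD mulrDl.
- exists (p' * q') => c; have [h1 h2] := hp c; have [h3 h4] := hq c.
  rewrite polyfunM hornerM h1 h3; split; first by [].
  rewrite derivM hornerD !hornerM h2 h4 -h1 -h3 /tangent mulr_suml mulr_sumr -big_split /=.
  apply: eq_bigr => k _.
  rewrite mderivM polyfunD !polyfunM mulrDl.
  by congr (_ + _); rewrite ?mulrA // -!mulrA [_ * polyfun q _]mulrC.
Qed.

Lemma chain_rule_at p G q c : (forall c, polyfun p (mxcurve G c) = q.[c]) ->
  q^`().[c] = tangent p (mxcurve G c) (mxdcurve G c).
Proof.
move=> hq; have [q' hq'] := chain_rule p G.
suff -> : q = q' by case: (hq' c).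
by apply: poly_nat_inj => k; rewrite -hq; case: (hq' k%:R).
Qed.

Definition line (A : M) : 'M[{poly C}]_n := map_mx polyC 1%:M + 'X *: map_mx polyC A.

Lemma line_curve A c : mxcurve (line A) c = 1%:M + c *: A.
Proof. by apply/matrixP => i j; rewrite !mxE !hornerE. Qed.

Lemma line_dcurve A c : mxdcurve (line A) c = A.
Proof. by apply/matrixP => i j; rewrite !mxE !derivE !hornerE. Qed.

Lemma hadamard p : exists2 b : 'I_(n * n) -> M -> C, forall k, is_poly (b k) &
  (forall x, polyfun p x = polyfun p 1%:M + \sum_k b k x * mxvec (x - 1%:M) 0 k) /\
  (forall k, b k 1%:M = polyfun (mderiv k p) 1%:M).
Proof.
elim/mpoly_ring_ind: p => [a|k|p q [b hb [h1 h2]] [b' hb' [h3 h4]]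
  |p q [b hb [h1 h2]] [b' hb' [h3 h4]]].
- exists (fun _ _ => 0) => [k|]; first exact: is_poly_cst.
  split=> [x|k]; last by rewrite mderivC /polyfun meval0.
  by rewrite /polyfun !mevalC big1 ?addr0 // => k _; rewrite mul0r.
- exists (fun l _ => (l == k)%:R) => [l|]; first exact: is_poly_cst.
  split=> [x|l]; last first.
    rewrite mderivX mnm1E eq_sym; case: eqP => [->|_]; last by rewrite scale0r /polyfun meval0.
    by rewrite scale1r mnm_subv mpolyX0 /polyfun meval1.
  rewrite (bigD1 k) //= eqxx mul1r big1 ?addr0; last by move=> l /negbTE ->; rewrite mul0r.
  by case/mxvec_indexP: k => i j; rewrite /polyfun !mevalXU !mxvecE !mxE [RHS]addrC subrK.
- exists (fun k x => b k x + b' k x) => [k|]; first exact: is_polyD.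
  split=> [x|k]; last by rewrite mderivD polyfunD h2 h4.
  rewrite !polyfunD h1 h3 addrACA -big_split /=.
  by congr (_ + _); apply: eq_bigr => k _; rewrite mulrDl.
- exists (fun k x => b k x * polyfun q x + polyfun p 1%:M * b' k x) => [k|].
    by apply: is_polyD; apply: is_polyM; rewrite //; [exists q | exact: is_poly_cst].
  split=> [x|k]; last by rewrite mderivM polyfunD !polyfunM h2 h4.
  rewrite !polyfunM.
  have -> : \sum_k (b k x * polyfun q x + polyfun p 1%:M * b' k x) * mxvec (x - 1%:M) 0 k
      = (\sum_k b k x * mxvec (x - 1%:M) 0 k) * polyfun q x
        + polyfun p 1%:M * (\sum_k b' k x * mxvec (x - 1%:M) 0 k).
    rewrite mulr_suml mulr_sumr -big_split; apply: eq_bigr => k _ /=.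
    by rewrite mulrDl mulrAC -[_ * b' k x * _]mulrA.
  have -> : \sum_k b k x * (mxvec (x - 1%:M)) 0 k = polyfun p x - polyfun p 1%:M.
    by rewrite h1 addrAC subrr add0r.
  have -> : \sum_k b' k x * (mxvec (x - 1%:M)) 0 k = polyfun q x - polyfun q 1%:M.
    by rewrite h3 addrAC subrr add0r.
  ring.
Qed.

End PolynomialFunctions.

(** * The Zariski topology through polynomial functions: connectedness, irreducibility, algebraic
    groups *)

Section Zariski.
Variables (R : realType) (n : nat).
Local Notation C := R[i].
Local Notation M := 'M[C]_n.
Implicit Types (K H A B U X Y : set M) (x y : M) (f g : M -> C).

(** A basic open set is a finite intersection of principal ones, and the product of their equations
    describes it. *)
Lemma open_basic (U : set (zariski R n)) x : open U -> U x ->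
  exists f, [/\ is_poly f, f x != 0 & forall y, f y != 0 -> U y].
Proof.
move=> [D' sD <-] [A D'A Ax]; have [F sF eqF] := sD _ D'A.
pose p (V : set (zariski R n)) := xget 0 [set p | V = [set y | polyfun p y != 0]].
have pE V : V \in F -> V = [set y | polyfun (p V) y != 0].
  by move=> /sF /set_mem [q Vq]; rewrite /p; case: xgetP => [q' _ //|/(_ q)].
exists (fun y => \prod_(V <- F) polyfun (p V) y); split.
- by apply: is_poly_prod => V _; exists (p V).
- rewrite prodf_seq_neq0; apply/allP => V VF /=.
  by move: Ax; rewrite -eqF => /(_ _ VF); rewrite {1}(pE _ VF).
- move=> y; rewrite prodf_seq_neq0 => /allP h; suff Ay : A y by exists A.
  by rewrite -eqF => V VF; rewrite (pE _ VF); apply: h.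
Qed.

Lemma open_principal f : is_poly f -> open ([set x | f x != 0] : set (zariski R n)).
Proof.
move=> [p fp]; exists [set [set x | f x != 0]]; last by rewrite bigcup_set1.
move=> _ ->; apply: (@finI_from1 _ _ _ (fun V : set (zariski R n) => V)).
by exists p; apply/seteqP; split=> y /=; rewrite fp.
Qed.

Lemma open_union (F : set (M -> C)) : (forall f, F f -> is_poly f) ->
  open ([set x | exists2 f, F f & f x != 0] : set (zariski R n)).
Proof.
move=> hF; have -> : [set x | exists2 f, F f & f x != 0]
    = \bigcup_(f in F) [set x | f x != 0] :> set (zariski R n).
  by apply/seteqP; split=> x [f Ff fx]; exists f.
by apply: bigcup_open => f /hF; apply: open_principal.
Qed.

(** Relative openness by principal neighbourhoods of points, so that no open set of the ambient
    space has to be named. *)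
Definition zopen_in K U := forall x, U x ->
  exists f, [/\ is_poly f, f x != 0 & forall y, K y -> f y != 0 -> U y].

Lemma zopen_inP K U : U `<=` K -> zopen_in K U ->
  exists2 O : set (zariski R n), open O & U = K `&` O.
Proof.
move=> UK hU; exists [set x | exists2 f, (is_poly f /\ forall y, K y -> f y != 0 -> U y)
  & f x != 0]; first by apply: open_union => f [].
apply/seteqP; split=> [x Ux|x [Kx [f [_ h] fx]]]; last exact: h.
by split; [exact: UK | have [f [h1 h2 h3]] := hU _ Ux; exists f].
Qed.

Lemma connected_groupP K : connected_group K <->
  forall U, U `<=` K -> U !=set0 -> zopen_in K U -> zopen_in K (K `\` U) -> U = K.
Proof.
split=> [cK U UK U0 oU oU'|h U U0 [O oO UO] [Z cZ UZ]].
  apply: (cK U U0); first exact: zopen_inP.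
  have [|O oO eO] := zopen_inP (K := K) (U := K `\` U) _ oU'; first by move=> x [].
  exists (~` O); first by rewrite closedC.
  apply/seteqP; split=> [x Ux|x [Kx nOx]].
    split; first exact: UK.
    by move=> Ox; have: (K `\` U) x by [rewrite eO; split=> //; apply: UK]; case.
  by apply: contrapT => nUx; apply: nOx; have : (K `\` U) x by []; rewrite eO => -[].
apply: h U0 _ _; first by rewrite UO => x [].
  move=> x; rewrite UO => -[Kx /(open_basic oO)[f [h1 h2 h3]]]; by exists f; split=> // y Ky /h3.
have oZ : open (~` Z : set (zariski R n)) by rewrite openC.
move=> x [Kx nUx]; have nZx : (~` Z) x by move=> Zx; apply: nUx; rewrite UZ.
have [f [h1 h2 h3]] := open_basic oZ nZx; exists f; split=> // y Ky /h3 nZy.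
by split=> //; rewrite UZ => -[].
Qed.

Definition irreducible A := forall f g, is_poly f -> is_poly g ->
  (forall x, A x -> f x * g x = 0) ->
  (forall x, A x -> f x = 0) \/ (forall x, A x -> g x = 0).

Lemma irreducible_connected K : irreducible K -> connected_group K.
Proof.
move=> hK; apply/connected_groupP => U UK [x Ux] oU oU'.
apply/seteqP; split=> // y Ky; apply: contrapT => nUy.
have [f [pf fx hf]] := oU _ Ux.
have [g [pg gy hg]] := oU' _ (conj Ky nUy).
have [z Kz|h|h] := hK f g pf pg.
- have [->|fz] := eqVneq (f z) 0; first by rewrite mul0r.
  have [->|gz] := eqVneq (g z) 0; first by rewrite mulr0.
  by have [_ []] := hg z Kz gz; apply: hf.
- by move: fx; rewrite h ?eqxx //; apply: UK.
- by move: gy; rewrite h ?eqxx.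
Qed.

Lemma irreducible_wit A : (forall f g x y, is_poly f -> is_poly g ->
   A x -> A y -> f x != 0 -> g y != 0 -> exists2 z, A z & f z * g z != 0) ->
  irreducible A.
Proof.
move=> h f g pf pg h0; apply: contrapT => /not_orP[].
move=> /existsNP[x /not_implyP[Ax /eqP fx]] /existsNP[y /not_implyP[Ay /eqP gy]].
by have [z Az] := h f g x y pf pg Ax Ay fx gy; rewrite h0 ?eqxx.
Qed.

Lemma irreducibleP A : irreducible A -> forall f g x y, is_poly f -> is_poly g ->
   A x -> A y -> f x != 0 -> g y != 0 -> exists2 z, A z & f z * g z != 0.
Proof.
move=> hA f g x y pf pg Ax Ay fx gy; apply: contrapT => h.
have [z Az|h1|h1] := hA f g pf pg.
- by apply/eqP/negPn/negP => nz; apply: h; exists z.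
- by move: fx; rewrite h1 ?eqxx.
- by move: gy; rewrite h1 ?eqxx.
Qed.

Lemma irreducible_pts A : (forall x y, A x -> A y ->
   exists B, [/\ B `<=` A, irreducible B, B x & B y]) -> irreducible A.
Proof.
move=> h; apply: irreducible_wit => f g x y pf pg Ax Ay fx gy.
have [B [BA iB Bx By]] := h _ _ Ax Ay.
have [z Bz nz] := irreducibleP iB pf pg Bx By fx gy.
by exists z => //; apply: BA.
Qed.

Lemma irreducible_set1 x : irreducible [set x].
Proof. by apply: irreducible_wit => f g _ _ _ _ -> -> fx gx; exists x; rewrite ?mulf_neq0. Qed.

Lemma irreducible_curve (h : C -> M) :
  (forall i j, is_uni (fun c => h c i j)) -> irreducible (range h).
Proof.
move=> hh; apply: irreducible_wit => f g _ _ pf pg [c _ <-] [d _ <-].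
have [p fp] := is_poly_uni pf hh; have [q gq] := is_poly_uni pg hh.
rewrite fp gq => pc qd.
have p0 : p != 0 by apply: contraNneq pc => ->; rewrite horner0.
have q0 : q != 0 by apply: contraNneq qd => ->; rewrite horner0.
apply: contrapT => hn; move: (mulf_neq0 p0 q0) => /negP; apply; apply/eqP; apply: poly_nat_inj => k; rewrite horner0 hornerM -fp -gq.
by apply/eqP/negPn/negP => nz; apply: hn; exists (h k%:R).
Qed.

(** With the left factors fixed, irreducibility of [B] gives one right factor at which both test
    functions are nonzero; irreducibility of [A] then gives a common left factor. *)
Lemma irreducible_mulset A B : irreducible A -> irreducible B -> irreducible (mulset A B).
Proof.
move=> iA iB; apply: irreducible_wit => f g _ _ pf pg [a Aa [b Bb <-]] [a' Aa' [b' Bb' <-]] fx gx.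
have pl h c : is_poly h -> is_poly (fun y => h (c *m y)).
  move=> ph; apply: (is_poly_comp ph).
  by apply: is_polymxM; [exact: is_polymx_cst | exact: is_polymx_id].
have pr h c : is_poly h -> is_poly (fun y => h (y *m c)).
  move=> ph; apply: (is_poly_comp ph).
  by apply: is_polymxM; [exact: is_polymx_id | exact: is_polymx_cst].
have [b1 Bb1] := irreducibleP iB (pl _ a pf) (pl _ a' pg) Bb Bb' fx gx.
rewrite mulf_eq0 negb_or => /andP[fb gb].
have [a1 Aa1 nz] := irreducibleP iA (pr _ b1 pf) (pr _ b1 pg) Aa Aa' fb gb.
by exists (a1 *m b1) => //; exists a1 => //; exists b1.
Qed.

Lemma irreducible_chain (A : nat -> set M) : (forall i j, (i <= j)%N -> A i `<=` A j) ->
  (forall i, irreducible (A i)) -> irreducible (\bigcup_i A i).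
Proof.
move=> mA iA; apply: irreducible_pts => x y [i _ Ax] [j _ Ay].
exists (A (maxn i j)); split=> //; first by move=> z Az; exists (maxn i j).
  by apply: mA Ax; apply: leq_maxl.
by apply: mA Ay; apply: leq_maxr.
Qed.

Lemma irreducible_dense A B : A `<=` B -> irreducible A ->
  (forall f, is_poly f -> (forall x, A x -> f x = 0) -> forall x, B x -> f x = 0) ->
  irreducible B.
Proof.
move=> AB iA hd f g pf pg h.
by have [x /AB /h //|h1|h1] := iA f g pf pg; [left | right]; apply: hd.
Qed.

Lemma connected_image (F : M -> M) K : is_polymx F -> connected_group K ->
  connected_group (F @` K).
Proof.
move=> pF /connected_groupP cK; apply/connected_groupP => U UK [z0 Uz0] oU oU'.
have [x Kx xE] := UK _ Uz0; rewrite -xE in Uz0 => {xE}.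
apply/seteqP; split=> // _ [y Ky <-].
suff E : K `&` [set z | U (F z)] = K by move: Ky; rewrite -E => -[].
apply: cK; first by move=> z [].
- by exists x.
- move=> z [Kz Uz]; have [f [pf fz hf]] := oU _ Uz.
  exists (f \o F); split=> //; first exact: is_poly_comp.
  by move=> w Kw fw; split=> //; apply: hf => //; exists w.
- move=> z [Kz nU]; have Uz : (F @` K `\` U) (F z).
    by split; [exists z | move=> Uz; apply: nU].
  have [f [pf fz hf]] := oU' _ Uz.
  exists (f \o F); split=> //; first exact: is_poly_comp.
  move=> w Kw fw; split=> // -[_ UFw].
  by have [] := hf (F w) _ fw; first by exists w.
Qed.

Section Subgroup.
Variables (K : set M) (sK : subgroup K).

Lemma sg_unit x : K x -> x \in unitmx.
Proof. by case: sK => h _ _ _; apply: h. Qed.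

Lemma sg1 : K 1%:M. Proof. by case: sK. Qed.

Lemma sgM x y : K x -> K y -> K (x *m y).
Proof. by case: sK => _ _ h _; apply: h. Qed.

Lemma sgV x : K x -> K (invmx x).
Proof. by case: sK => _ _ _; apply. Qed.

Lemma sgMl x y : K x -> K (x *m y) -> K y.
Proof. by move=> Kx Kxy; rewrite -[y](mulKmx (sg_unit Kx)); apply: sgM => //; apply: sgV. Qed.

Lemma sgMr x y : K y -> K (x *m y) -> K x.
Proof. by move=> Ky Kxy; rewrite -[x](mulmxK (sg_unit Ky)); apply: sgM => //; apply: sgV. Qed.

Lemma sgJ x y : K x -> K y -> K (x *m y *m invmx x).
Proof. by move=> Kx Ky; apply: sgM; [apply: sgM | apply: sgV]. Qed.

(** Translates of the principal open set show that [Q] and all its cosets are open, so [Q] is open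
    and closed in [K]. *)
Lemma open_subgroup_conn Q f x0 : connected_group K -> subgroup Q -> Q `<=` K ->
  is_poly f -> K x0 -> f x0 != 0 -> (forall y, K y -> f y != 0 -> Q y) -> Q = K.
Proof.
move=> /connected_groupP cK sQ QK pf Kx0 fx0 hf.
have [Q1 QM QV] : [/\ Q 1%:M, forall x y, Q x -> Q y -> Q (x *m y) &
  forall x, Q x -> Q (invmx x)] by case: sQ.
have Qx0 : Q x0 by apply: hf.
have pl a : is_poly (fun y => f (a *m y)).
  apply: (is_poly_comp pf).
  by apply: is_polymxM; [exact: is_polymx_cst | exact: is_polymx_id].
have tr x y : K x -> K y -> f (x0 *m invmx x *m y) != 0 -> Q (invmx x *m y).
  move=> Kx Ky nz; have := hf _ _ nz; rewrite -mulmxA => h.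
  rewrite -[invmx x *m y](mulKmx (sg_unit Kx0)); apply: QM; first exact: QV.
  by apply: h; apply: sgM => //; apply: sgM => //; apply: sgV.
apply: cK => //; first by exists 1%:M.
- move=> x Qx; have Kx := QK _ Qx; exists (fun y => f (x0 *m invmx x *m y)); split=> //.
    by rewrite -mulmxA mulVmx ?mulmx1 // sg_unit.
  move=> y Ky /(tr _ _ Kx Ky) h.
  by rewrite -[y](mulKVmx (sg_unit Kx)); apply: QM.
- move=> x [Kx nQx]; exists (fun y => f (x0 *m invmx x *m y)); split=> //.
    by rewrite -mulmxA mulVmx ?mulmx1 // sg_unit.
  move=> y Ky /(tr _ _ Kx Ky) h; split=> // Qy; apply: nQx.
  have := QM _ _ Qy (QV _ h).
  have yU := sg_unit Ky; have xU := sg_unit Kx.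
  suff -> : y *m invmx (invmx x *m y) = x by [].
  have ui : invmx x *m y \in unitmx by rewrite unitmx_mul unitmx_inv xU.
  apply: (can_inj (mulmxK ui)); rewrite /= mulmxKV //.
  by rewrite mulmxA mulmxV // mul1mx.
Qed.

End Subgroup.

Lemma alg_subgroup K : algebraic_group K -> subgroup K. Proof. by case. Qed.

Lemma alg_mem K x : algebraic_group K -> x \in unitmx ->
  (forall f, is_poly f -> (forall y, K y -> f y = 0) -> f x = 0) -> K x.
Proof.
move=> [sK [Z cZ KZ]] xU h; rewrite KZ; split=> //; apply: contrapT => nZ.
have oZ : open (~` Z : set (zariski R n)) by rewrite openC.
have [f [pf fx hf]] := open_basic oZ nZ.
move: fx; rewrite h ?eqxx // => y; rewrite KZ => -[Zy _].
by apply/eqP/negPn/negP => /hf.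
Qed.

Lemma alg_intro K (F : set (M -> C)) : subgroup K -> (forall f, F f -> is_poly f) ->
  (forall x, K x <-> x \in unitmx /\ forall f, F f -> f x = 0) -> algebraic_group K.
Proof.
move=> sK pF hK; split=> //; exists (~` [set x | exists2 f, F f & f x != 0]).
  by rewrite closedC; apply: open_union.
apply/seteqP; split=> x; first by case/hK=> xU h; split=> // -[f /h ->]; rewrite eqxx.
move=> [nx xU]; apply/hK; split=> // f Ff; apply/eqP/negPn/negP => nz.
by apply: nx; exists f.
Qed.

Lemma alg_cut K Q (F : set (M -> C)) : algebraic_group K -> subgroup Q ->
  (forall f, F f -> is_poly f) ->
  (forall x, Q x <-> K x /\ forall f, F f -> f x = 0) -> algebraic_group Q.
Proof.
move=> aK sQ pF hQ.
pose F' := [set f | F f \/ (is_poly f /\ forall y, K y -> f y = 0)].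
apply: (alg_intro (F := F') sQ) => [f [/pF //|[]//]|x]; split.
  move=> /[dup] Qx /hQ[Kx h]; split; first exact: sg_unit Qx.
  by move=> f [/h //|[_]]; apply.
move=> [xU h]; apply/hQ; split; last by move=> f Ff; apply: h; left.
by apply: (alg_mem aK xU) => f pf hf; apply: h; right.
Qed.

Lemma alg_setI K Q : algebraic_group K -> algebraic_group Q -> algebraic_group (K `&` Q).
Proof.
move=> aK aQ; have sK := alg_subgroup aK; have sQ := alg_subgroup aQ.
apply: (alg_cut (F := [set f | is_poly f /\ forall y, Q y -> f y = 0]) aK).
- split; first by move=> x [Kx _]; apply: sg_unit Kx.
  + by split; apply: sg1.
  + by move=> x y [? ?] [? ?]; split; apply: sgM.
  + by move=> x [? ?]; split; apply: sgV.
- by move=> f [].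
- move=> x; split=> [[Kx Qx]|[Kx h]]; first by split=> // f [_]; apply.
  split=> //; apply: (alg_mem aQ) => [|f pf hf]; first exact: sg_unit Kx.
  by apply: h.
Qed.

Section IdentityComponent.
Variables (K : set M) (aK : algebraic_group K).
Let sK := alg_subgroup aK.
Local Notation H := (identity_component K).

Lemma idcomp_sub : H `<=` K.
Proof. exact: (@connected_component_sub (zariski R n)). Qed.

Lemma idcomp_connected : connected_group H.
Proof. exact: (@component_connected (zariski R n)). Qed.

Lemma idcomp_max A : connected_group A -> A 1%:M -> A `<=` K -> A `<=` H.
Proof. by move=> cA A1 AK; apply: (@connected_component_max (zariski R n)). Qed.

Lemma idcomp1 : H 1%:M.
Proof. by apply: (@connected_component_refl (zariski R n)); apply: sg1. Qed.

Lemma idcomp_subgroup : subgroup H.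
Proof.
have hV x y : H x -> H y -> H (invmx x *m y).
  move=> Hx Hy; have Kx := idcomp_sub Hx.
  have cl : connected_group ((fun z => invmx x *m z) @` H).
    apply: connected_image; last exact: idcomp_connected.
    by apply: is_polymxM; [exact: is_polymx_cst | exact: is_polymx_id].
  apply: (idcomp_max cl); last by exists y.
    by exists x => //; rewrite mulVmx // (sg_unit sK).
  by move=> _ [z /idcomp_sub Kz <-]; apply: sgM => //; apply: sgV.
have H1 := idcomp1.
have HV x : H x -> H (invmx x) by move=> Hx; rewrite -[invmx x]mulmx1; apply: hV.
split=> // [x /idcomp_sub|x y Hx Hy]; first exact: sg_unit.
by rewrite -[x]invmxK; apply: hV => //; apply: HV.
Qed.

(** The closure [H'] of the component in [K] is again connected, because a relatively open subset of
    [H'] that misses [H] is empty; maximality gives equality. *)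
Lemma idcomp_algebraic : algebraic_group H.
Proof.
apply: (alg_cut (F := [set f | is_poly f /\ forall y, H y -> f y = 0]) aK).
- exact: idcomp_subgroup.
- by move=> f [].
pose H' := K `&` [set x | forall f, is_poly f -> (forall y, H y -> f y = 0) -> f x = 0].
have HH' : H `<=` H' by move=> x Hx; split; [exact: idcomp_sub | move=> f _; apply].
suff cH' : connected_group H'.
  move=> x; split=> [Hx|[Kx h]]; first by split; [exact: idcomp_sub | move=> f [_]; apply].
  apply: (idcomp_max cH'); first exact/HH'/idcomp1.
    by move=> y [].
  by split=> // f pf hf; apply: h.
have /connected_groupP cH := idcomp_connected.
have dense V : V `<=` H' -> zopen_in H' V -> V `&` H = set0 -> V = set0.
  move=> VH' oV V0; rewrite -subset0 => x Vx.
  have [f [pf fx hf]] := oV _ Vx; have [_ h] := VH' _ Vx.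
  move/eqP: fx; apply; apply: h => // y Hy; apply/eqP/negPn/negP => fy.
  by have : (V `&` H) y by [split=> //; apply: hf => //; apply: HH']; rewrite V0.
have restr V : zopen_in H' V -> zopen_in H (V `&` H).
  move=> oV x [Vx Hx]; have [f [pf fx hf]] := oV _ Vx; exists f; split=> // y Hy fy.
  by split=> //; apply: hf => //; apply: HH'.
apply/connected_groupP => U UH' U0 oU oU'.
have UH0 : U `&` H !=set0.
  apply/set0P/eqP => /(dense _ UH' oU) E; move: U0; rewrite E.
  by case.
have UHE : U `&` H = H.
  apply: cH => //; first exact: restr.
  move=> x [Hx nU]; have [f [pf fx hf]] := oU' x (conj (HH' _ Hx) (fun Ux => nU (conj Ux Hx))).
  exists f; split=> // y Hy fy; split=> // -[Uy _].
  by have [] := hf y (HH' _ Hy) fy.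
have E : H' `\` U = set0.
  apply: dense => //.
  apply/seteqP; split=> // x [[_ nU] Hx]; apply: nU.
  by move: Hx; rewrite -UHE => -[].
apply/seteqP; split=> // x H'x; apply: contrapT => nU.
by have : (H' `\` U) x by []; rewrite E.
Qed.

End IdentityComponent.

End Zariski.

(** Factor [X = A B] through its rank: [B A] is nilpotent of smaller size, has the same trace, and
    its powers bound those of [X]. *)
Lemma nilpotent_facts (F : fieldType) n (X : 'M[F]_n) k :
  X ^+ k = 0 -> X ^+ n = 0 /\ \tr X = 0.
Proof.
elim: n {-2}n (leqnn n) X k => [|N IH] n nN X k Xk.
  move: nN; rewrite leqn0 => /eqP n0; subst n.
  by rewrite /mxtrace big_ord0; split=> //; apply/matrixP => -[].
have [full|rn] := eqVneq (\rank X) n.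
  have Xu : X \in unitmx by rewrite -row_full_unit /row_full full.
  have : (X ^+ k) \in unitmx.
    by elim: k {Xk} => [|k IHk]; rewrite ?expr0 ?unitmx1 // exprS unitmx_mul Xu.
  rewrite Xk => u0; have z0 (A : 'M[F]_n) : A = 0.
    by rewrite -[A]mul1mx -(mulVmx u0) mulmx0 mul0mx.
  by rewrite [X]z0 mxtrace0; split=> //; apply: z0.
have {}rn : (\rank X < n)%N by rewrite ltn_neqAle rn rank_leq_row.
set r := \rank X in rn.
pose A : 'M_(n, r) := col_base X; pose B : 'M_(r, n) := row_base X.
have XE : X = A *m B by rewrite mulmx_base.
have XBA j : X ^+ j.+1 = A *m (B *m A) ^+ j *m B.
  elim: j => [|j IHj]; first by rewrite expr1 expr0 mulmx1.
  by rewrite exprS IHj {1}XE -!mulmxE exprS -!mulmxE !mulmxA.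
have BAX j : (B *m A) ^+ j.+1 = B *m X ^+ j *m A.
  elim: j => [|j IHj]; first by rewrite expr1 expr0 mulmx1.
  by rewrite exprSr IHj exprSr XE -!mulmxE !mulmxA.
have [||h1 h2] := IH r _ (B *m A) k.+1.
- by rewrite -ltnS (leq_trans rn).
- by rewrite BAX Xk mulmx0 mul0mx.
split; last by rewrite XE mxtrace_mulC.
have -> : X ^+ n = X ^+ (n - r.+1) * X ^+ r.+1 by rewrite -exprD subnK.
by rewrite XBA h1 mulmx0 mul0mx mulr0.
Qed.

(** * Exponentials of nilpotent matrices and logarithms of unipotent ones *)

Section Exponential.
Variables (R : realType) (n : nat).
Local Notation C := R[i].
Local Notation M := 'M[C]_n.
Implicit Types (X Y Z W A B u : M) (P Q L : 'M[{poly C}]_n).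

Lemma mxcurveM P Q c : mxcurve (P *m Q) c = mxcurve P c *m mxcurve Q c.
Proof.
apply/matrixP => i j; rewrite !mxE horner_sum; apply: eq_bigr => k _.
by rewrite hornerM !mxE.
Qed.

Lemma mxdcurveM P Q c :
  mxdcurve (P *m Q) c = mxdcurve P c *m mxcurve Q c + mxcurve P c *m mxdcurve Q c.
Proof.
apply/matrixP => i j; rewrite !mxE raddf_sum horner_sum -big_split; apply: eq_bigr => k _ /=.
by rewrite derivM hornerD !hornerM !mxE.
Qed.

(** The equation expresses each coefficient of [L], up to a positive integer, through the preceding
    ones, and the constant term is zero. *)
Lemma ode_zero L A B :
  (forall k : nat, mxdcurve L k%:R = A *m mxcurve L k%:R + mxcurve L k%:R *m B) ->
  mxcurve L 0 = 0 -> L = 0.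
Proof.
move=> hL L0.
have E i j : (L i j)^`() = \sum_l A i l *: L l j + \sum_l B l j *: L i l.
  apply: poly_nat_inj => k; have /matrixP/(_ i j) := hL k.
  rewrite !mxE hornerD !horner_sum => ->; congr (_ + _); apply: eq_bigr => l _.
    by rewrite hornerZ !mxE.
  by rewrite hornerZ !mxE mulrC.
suff h k : forall i j, (L i j)`_k = 0.
  by apply/matrixP => i j; apply/polyP => k; rewrite mxE coef0.
elim: k => [|k IH] i j.
  by have /matrixP/(_ i j) := L0; rewrite !mxE horner_coef0.
have := congr1 (fun p : {poly C} => p`_k) (E i j); rewrite coef_deriv coefD !coef_sum.
rewrite !big1 ?addr0 => [/eqP|l _|l _]; last 2 first.
- by rewrite coefZ IH mulr0.
- by rewrite coefZ IH mulr0.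
by rewrite mulrn_eq0 /= => /eqP.
Qed.

Lemma ode_uniq L P A B :
  (forall k : nat, mxdcurve L k%:R = A *m mxcurve L k%:R + mxcurve L k%:R *m B) ->
  (forall k : nat, mxdcurve P k%:R = A *m mxcurve P k%:R + mxcurve P k%:R *m B) ->
  mxcurve L 0 = mxcurve P 0 -> L = P.
Proof.
have subE c : mxcurve (L - P) c = mxcurve L c - mxcurve P c.
  by apply/matrixP => i j; rewrite !mxE hornerD hornerN.
move=> hL hP h0; apply/eqP; rewrite -subr_eq0; apply/eqP; apply: (@ode_zero _ A B) => [k|].
  rewrite subE mulmxBr mulmxBl addrACA -opprD -hL -hP.
  by apply/matrixP => i j; rewrite !mxE derivB hornerD hornerN.
by rewrite subE h0 subrr.
Qed.

(** The coefficient of degree [k] of [P] is [X ^+ k] divided by the factorial of [k], so the powers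
    of [X] vanish beyond the degree of [P]. *)
Lemma ode_nilpotent P X : (forall k : nat, mxdcurve P k%:R = mxcurve P k%:R *m X) ->
  mxcurve P 0 = 1%:M -> X ^+ n = 0.
Proof.
move=> hP P0.
have E i j : (P i j)^`() = \sum_l X l j *: P i l.
  apply: poly_nat_inj => k; have /matrixP/(_ i j) := hP k.
  by rewrite !mxE horner_sum => ->; apply: eq_bigr => l _; rewrite hornerZ !mxE mulrC.
have hk k : forall i j, (P i j)`_k *+ k`! = (X ^+ k) i j.
  elim: k => [|k IH] i j.
    have /matrixP/(_ i j) := P0; rewrite !mxE horner_coef0 => ->.
    by rewrite fact0 mulr1n.
  rewrite factS mulrnA -coef_deriv E coef_sum -sumrMnl exprSr mxE.
  apply: eq_bigr => l _; rewrite coefZ -IH mulrC.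
  by rewrite mulrnAl.
have [k kP] : exists k : nat, forall i j, (size (P i j) <= k)%N.
  exists (\max_(p : 'I_n * 'I_n) size (P p.1 p.2)) => i j.
  exact: (leq_bigmax (i, j)).
apply: (nilpotent_facts (k := k) _).1; apply/matrixP => i j.
by rewrite -hk nth_default ?mul0rn ?mxE.
Qed.

Lemma expmxZ X c k : (c *: X) ^+ k = c ^+ k *: X ^+ k.
Proof.
elim: k => [|k IH]; first by rewrite !expr0 scale1r.
by rewrite !exprS IH -!mulmxE -scalemxAl -scalemxAr scalerA.
Qed.

Fact expm_key : unit. Proof. by []. Qed.

(* Truncation at n costs nothing, since only nilpotent X are exponentiated. *)
Definition expm X : M := locked_with expm_key (\sum_(k < n) (k`!%:R)^-1 *: X ^+ k).

Lemma expmE X : expm X = \sum_(k < n) (k`!%:R)^-1 *: X ^+ k.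
Proof. by rewrite /expm; case: expm_key. Qed.

Definition exp_curve X : 'M[{poly C}]_n :=
  \matrix_(i, j) \sum_(k < n) ((k`!%:R)^-1 * (X ^+ k) i j) *: 'X^k.

Lemma exp_curveE X c : mxcurve (exp_curve X) c = expm (c *: X).
Proof.
apply/matrixP => i j; rewrite !mxE horner_sum !expmE summxE; apply: eq_bigr => k _.
by rewrite hornerZ hornerXn expmxZ !mxE -mulrA [c ^+ k * _]mulrC.
Qed.

Lemma expm0 : expm 0 = 1%:M.
Proof.
rewrite !expmE; case: n => [|m] /=; first by rewrite thinmx0 [RHS]thinmx0.
rewrite big_ord_recl expr0 fact0 invr1 scale1r big1 ?addr0 // => k _.
by rewrite expr0n /= scaler0.
Qed.

Lemma expm_comm X Y : X *m Y = Y *m X -> X *m expm Y = expm Y *m X.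
Proof.
move=> XY; rewrite !expmE mulmx_sumr mulmx_suml; apply: eq_bigr => k _.
rewrite -scalemxAr -scalemxAl; congr (_ *: _).
by rewrite mulmxE; apply: commrX.
Qed.

Lemma exp_dcurve X c : X ^+ n = 0 -> mxdcurve (exp_curve X) c = expm (c *: X) *m X.
Proof.
move=> Xn; apply/matrixP => i j.
transitivity (\sum_(k < n) ((k`!%:R)^-1 * (c ^+ k * (X ^+ k.+1) i j))); last first.
  rewrite !expmE mulmx_suml summxE; apply: eq_bigr => k _.
  rewrite expmxZ -!scalemxAl exprSr -mulmxE [RHS]mxE; congr (_ * _).
  by rewrite [RHS]mxE.
rewrite !mxE raddf_sum horner_sum /=.
case: n i j X Xn => [|m] i j X Xn; first by case: i.
rewrite big_ord_recl /= expr0 alg_polyC derivC horner0 add0r.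
rewrite big_ord_recr /= Xn mxE mulr0 mulr0 addr0; apply: eq_bigr => k _.
rewrite derivZ derivXn hornerZ hornerMn hornerXn /bump /= add1n factS natrM invfM.
have k0 : k.+1%:R != 0 :> C by rewrite pnatr_eq0.
have f0 : k`!%:R != 0 :> C by rewrite pnatr_eq0 -lt0n fact_gt0.
rewrite add0n -[c ^+ k *+ _]mulr_natr.
move: (k.+1%:R) k0 (k`!%:R) f0 (c ^+ k) ((X ^+ k.+1) i j) => u u0 w w0 a b.
by field; rewrite u0 w0.
Qed.

Lemma expm_conj u X : u \in unitmx ->
  u *m expm X *m invmx u = expm (u *m X *m invmx u).
Proof.
move=> uu; rewrite !expmE mulmx_sumr mulmx_suml; apply: eq_bigr => k _.
rewrite -scalemxAr -scalemxAl; congr (_ *: _).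
elim: {k}(k : nat) => [|k IH]; first by rewrite !expr0 mulmx1 mulmxV.
by rewrite !exprS -!mulmxE -IH !mulmxA mulmxKV.
Qed.

Lemma expm_uniq P X : (forall k : nat, mxdcurve P k%:R = mxcurve P k%:R *m X) ->
  mxcurve P 0 = 1%:M -> forall c, mxcurve P c = expm (c *: X).
Proof.
move=> hP P0 c; have Xn := ode_nilpotent hP P0; rewrite -exp_curveE.
rewrite (@ode_uniq P (exp_curve X) 0 X) // => [k|k|].
- by rewrite mul0mx add0r.
- by rewrite mul0mx add0r exp_dcurve // exp_curveE.
- by rewrite P0 exp_curveE scale0r expm0.
Qed.

(** The product of the two exponential curves solves the equation of the sum. This yields the
    nilpotency of [X + Y] and the formula together. *)
Lemma expm_add X Y : X ^+ n = 0 -> Y ^+ n = 0 -> X *m Y = Y *m X ->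
  (X + Y) ^+ n = 0 /\ expm (X + Y) = expm X *m expm Y.
Proof.
move=> Xn Yn XY; pose P := exp_curve X *m exp_curve Y.
have PE c : mxcurve P c = expm (c *: X) *m expm (c *: Y).
  by have -> := mxcurveM (exp_curve X) (exp_curve Y) c; congr (_ *m _); apply: exp_curveE.
have hP (k : nat) : mxdcurve P k%:R = mxcurve P k%:R *m (X + Y).
  have -> := mxdcurveM (exp_curve X) (exp_curve Y) k%:R.
  rewrite (PE k%:R) (exp_dcurve _ Xn) (exp_dcurve _ Yn).
  rewrite (exp_curveE X k%:R) (exp_curveE Y k%:R) mulmxDr -!mulmxA.
  have -> : X *m expm (k%:R *: Y) = expm (k%:R *: Y) *m X.
    by apply: expm_comm; rewrite -scalemxAr XY scalemxAl.
  by [].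
have P0 : mxcurve P 0 = 1%:M by rewrite (PE 0) !scale0r expm0 mulmx1.
split; first exact: ode_nilpotent hP P0.
have := expm_uniq hP P0 1; rewrite (PE 1) (scale1r X) (scale1r Y) => ->.
by rewrite (scale1r (X + Y)).
Qed.

Lemma nilpotentZ X a : X ^+ n = 0 -> (a *: X) ^+ n = 0.
Proof. by move=> Xn; rewrite expmxZ Xn scaler0. Qed.

Lemma expmZD X a b : X ^+ n = 0 -> expm ((a + b) *: X) = expm (a *: X) *m expm (b *: X).
Proof.
move=> Xn; have h := @expm_add (a *: X) (b *: X) (nilpotentZ a Xn) (nilpotentZ b Xn).
rewrite scalerDl; have [|_ ->] := h; last by [].
by rewrite -!scalemxAl -!scalemxAr scalerA mulrC -scalerA.
Qed.

Lemma expmN X : X ^+ n = 0 -> expm X *m expm (- X) = 1%:M.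
Proof.
move=> Xn; have := expmZD 1 (-1) Xn.
by rewrite subrr scale0r expm0 scale1r scaleN1r => <-.
Qed.

Lemma expm_unit X : X ^+ n = 0 -> expm X \in unitmx.
Proof. by move=> Xn; exact: (mulmx1_unit (expmN Xn)).1. Qed.

Lemma expm_inv X : X ^+ n = 0 -> invmx (expm X) = expm (- X).
Proof.
move=> Xn; rewrite -[RHS]mul1mx -(mulVmx (expm_unit Xn)) -mulmxA expmN //.
by rewrite mulmx1.
Qed.

Lemma expm_nat X k : X ^+ n = 0 -> expm (k%:R *: X) = expm X ^+ k.
Proof.
move=> Xn; elim: k => [|k IH]; first by rewrite scale0r expm0.
by rewrite -addn1 natrD expmZD // IH scale1r exprD expr1.
Qed.

(* Both sides, as functions of c in exp (c X), solve the equation L' = X L. *)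
Lemma expm_ad X Y Z W : X ^+ n = 0 ->
  X *m Y = Y *m X + Z -> X *m Z = Z *m X + W -> X *m W = W *m X ->
  expm X *m Y = (Y + Z + 2%:R^-1 *: W) *m expm X.
Proof.
move=> Xn XY XZ XW.
pose G : 'M[{poly C}]_n := map_mx polyC Y + 'X *: map_mx polyC Z
  + (2%:R^-1 *: 'X^2) *: map_mx polyC W.
have GE c : mxcurve G c = Y + c *: Z + (2%:R^-1 * c ^+ 2) *: W.
  by apply/matrixP => i j; rewrite !mxE !hornerE.
have dGE c : mxdcurve G c = Z + c *: W.
  apply/matrixP => i j; rewrite !mxE !derivD !derivM derivZ derivXn derivX !derivC !hornerE /=; by field.
have cE (A : M) c : mxcurve (map_mx polyC A) c = A.
  by apply/matrixP => i j; rewrite !mxE hornerC.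
have cdE (A : M) c : mxdcurve (map_mx polyC A) c = 0.
  by apply/matrixP => i j; rewrite !mxE derivC horner0.
have eX c : X *m expm (c *: X) = expm (c *: X) *m X.
  by apply: expm_comm; rewrite -scalemxAr -scalemxAl.
suff : exp_curve X *m map_mx polyC Y = G *m exp_curve X.
  move/(congr1 (fun P => mxcurve P 1)); rewrite !mxcurveM exp_curveE cE GE.
  by rewrite !scale1r expr1n mulr1.
apply: (@ode_uniq _ _ X 0) => [k|k|].
- rewrite mulmx0 addr0 mxdcurveM !mxcurveM cE cdE mulmx0 addr0 exp_dcurve // exp_curveE.
  by rewrite -eX mulmxA.
- rewrite mulmx0 addr0 mxdcurveM !mxcurveM exp_dcurve // exp_curveE -eX GE dGE !mulmxA -mulmxDl.
  congr (_ *m _); rewrite !mulmxDl !mulmxDr -!scalemxAl -!scalemxAr XY XZ XW.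
  rewrite scalerDr !addrA; congr (_ + _).
  by rewrite [LHS](ACl (3*1*4*2))%AC.
- by rewrite !mxcurveM exp_curveE cE GE scale0r expm0 mul1mx mulmx1 expr0n mulr0 !scale0r !addr0.
Qed.

Lemma sum_trunc (V : zmodType) (F : nat -> V) a b : (a <= b)%N ->
  (forall i, (a <= i)%N -> F i = 0) -> \sum_(i < b) F i = \sum_(i < a) F i.
Proof.
move=> ab h; rewrite -!(big_mkord xpredT) (@big_cat_nat _ _ _ a) //= -[RHS]addr0; congr (_ + _).
by rewrite big_nat_cond big1 // => i /andP[/andP[/h]].
Qed.

(** The binomial coefficient as a polynomial in its upper argument; with it the powers of a
    unipotent matrix are interpolated by a polynomial curve. *)
Definition binom_poly k : {poly C} := (k`!%:R)^-1 *: \prod_(i < k) ('X - (i%:R)%:P).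

Lemma binom_polyE k j : (binom_poly k).[j%:R] = 'C(j, k)%:R.
Proof.
have -> : (binom_poly k).[j%:R] = (k`!%:R)^-1 * (j ^_ k)%:R.
  rewrite hornerZ; congr (_ * _); elim: k => [|k IH]; first by rewrite big_ord0 hornerC ffactn0.
  rewrite big_ord_recr /= hornerM IH hornerXsubC ffactnSr natrM.
  have [kj|jk] := leqP k j; first by rewrite natrB.
  by rewrite ffact_small // !mul0r.
by rewrite -bin_ffact natrM mulrCA mulVf ?mulr1 // pnatr_eq0 -lt0n fact_gt0.
Qed.

(** Newton's series gives a polynomial curve [P] through the powers of [u], and the logarithm is its
    derivative at 0. The expansion with [a 0 = 0] lets the logarithm inherit properties of [u - 1]
    such as strict triangularity or commutation. *)
Lemma unipotent_log u : (u - 1%:M) ^+ n = 0 -> exists2 X, X ^+ n = 0 & expm X = u /\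
  exists2 a : nat -> C, a 0 = 0 & X = \sum_(k < n) a k *: (u - 1%:M) ^+ k.
Proof.
set y := u - 1%:M => yn.
pose P : 'M[{poly C}]_n := \matrix_(i, j) \sum_(k < n) (y ^+ k) i j *: binom_poly k.
have PE c : mxcurve P c = \sum_(k < n) (binom_poly k).[c] *: y ^+ k.
  apply/matrixP => i j; rewrite !mxE horner_sum summxE; apply: eq_bigr => k _.
  by rewrite hornerZ mxE mulrC.
have dPE c : mxdcurve P c = \sum_(k < n) ((binom_poly k)^`()).[c] *: y ^+ k.
  apply/matrixP => i j; rewrite !mxE raddf_sum horner_sum summxE; apply: eq_bigr => k _ /=.
  by rewrite derivZ hornerZ mxE mulrC.
have yk k : (n <= k)%N -> y ^+ k = 0.
  by move=> nk; rewrite -(subnK nk) exprD yn mulr0.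
have Pn (k : nat) : mxcurve P k%:R = u ^+ k.
  rewrite PE; have -> : u = y + 1 by rewrite /y subrK.
  rewrite exprD1n -(@sum_trunc _ (fun i => (binom_poly i).[k%:R] *: y ^+ i) n (n + k.+1)) ?leq_addr //.
    rewrite -(@sum_trunc _ (fun i => y ^+ i *+ 'C(k, i)) k.+1 (n + k.+1)) ?leq_addl //.
      by apply: eq_bigr => i _; rewrite binom_polyE scaler_nat.
    by move=> i ki; rewrite bin_small.
  by move=> i /yk ->; rewrite scaler0.
pose X := mxdcurve P 0.
have P0 : mxcurve P 0 = 1%:M by rewrite (Pn 0%N) expr0.
have hP (k : nat) : mxdcurve P k%:R = mxcurve P k%:R *m X.
  (* Shifting the argument of [P] by [k] multiplies it by [u ^+ k]; the derivative at 0 of this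
     identity is the differential equation at [k]. *)
  pose Q : 'M[{poly C}]_n := map_mx (fun p : {poly C} => p \Po ('X + (k%:R)%:P)) P.
  have QE : Q = map_mx polyC (u ^+ k) *m P.
    apply/matrixP => i j; apply: poly_nat_inj => l.
    have /matrixP/(_ i j) : mxcurve P (l + k)%:R = u ^+ k *m mxcurve P l%:R.
      by rewrite !Pn addnC exprD.
    rewrite !mxE horner_comp !hornerE natrD => ->; rewrite horner_sum.
    by apply: eq_bigr => m _; rewrite hornerM !mxE hornerC.
  have : mxdcurve Q 0 = mxdcurve P k%:R.
    by apply/matrixP => i j; rewrite !mxE deriv_comp derivD derivX derivC addr0 mulr1 horner_comp !hornerE.
  rewrite QE mxdcurveM => <-.
  have -> : mxdcurve (map_mx polyC (u ^+ k)) 0 = 0.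
    by apply/matrixP => i j; rewrite !mxE derivC horner0.
  rewrite mul0mx add0r Pn; congr (_ *m _).
  by apply/matrixP => i j; rewrite !mxE hornerC.
exists X; first exact: ode_nilpotent hP P0.
split; first by rewrite -[X]scale1r -(expm_uniq hP P0) (Pn 1%N) expr1.
exists (fun k => ((binom_poly k)^`()).[0]); last exact: dPE.
by rewrite /binom_poly big_ord0 alg_polyC derivC horner0.
Qed.

End Exponential.

(** * Separation of generalized eigenvectors modulo a stable subspace *)

Section SpectralSplit.
Variables (F : fieldType) (V : lmodType F) (A : {linear V -> V}) (I : set V).
Hypothesis Ilin : forall a u v, I u -> I v -> I (a *: u + v).
Hypothesis Istable : forall v, I v -> I (A v).
Let B t v := A v - t *: v.

Let I0 v : I v -> I 0.
Proof. by move=> Iv; rewrite -(subrr v) addrC -scaleN1r; apply: Ilin. Qed.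

Let IZ a v : I v -> I (a *: v).
Proof. by move=> Iv; rewrite -[a *: v]addr0; apply: Ilin => //; apply: I0 Iv. Qed.

Let ID u v : I u -> I v -> I (u + v).
Proof. by move=> Iu Iv; rewrite -[u]scale1r; apply: Ilin. Qed.

Let IB t v : I v -> I (B t v).
Proof. by move=> Iv; rewrite /B -scaleNr; apply: ID; [apply: Istable | apply: IZ]. Qed.

Let BC s t v : B s (B t v) = B t (B s v).
Proof.
have hA u w : A (u - w) = A u - A w := linearB A u w.
have hZ a u : A (a *: u) = a *: A u := linearZ_LR A a u.
rewrite /B !hA !hZ !scalerBr !scalerA !opprB [s * t]mulrC.
by rewrite addrACA [RHS]addrACA; congr (_ + _); rewrite addrC.
Qed.

Let iterBC k s t v : iter k (B s) (B t v) = B t (iter k (B s) v).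
Proof. by elim: k => //= k ->; rewrite BC. Qed.

Let split1 s t k v : s != t -> I (iter k (B s) v) -> I (B t v) -> I v.
Proof.
move=> st; elim: k v => [//|k IHk] v h Iv.
have Iw : I (B s v).
  by apply: IHk; [rewrite -iterSr | rewrite BC; apply: IB].
have -> : v = (s - t)^-1 *: (B t v + (-1) *: B s v).
  have -> : B t v + (-1) *: B s v = (s - t) *: v.
    by rewrite scaleN1r /B opprB scalerBl addrC addrA subrK.
  by rewrite scalerA mulVf ?scale1r // subr_eq0.
by apply/IZ/ID => //; apply: IZ.
Qed.

(** Applying [B t] lowers one exponent, so by induction all [B t (v x)] lie in [I]. For [x] other
    than [t] the operators [B x] and [B t] differ by a nonzero scalar, which puts [v x] into [I],
    and [v t] is what remains of the sum. *)
Lemma spectral_split (s : seq F) (k : F -> nat) (v : F -> V) : uniq s ->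
  (forall t, t \in s -> I (iter (k t) (B t) (v t))) ->
  I (\sum_(t <- s) v t) -> forall t, t \in s -> I (v t).
Proof.
move=> us; move: {2}(\sum_(t <- s) k t)%N (erefl (\sum_(t <- s) k t)%N) => m.
elim: m k v => [|m IHm] k v mE h hs.
  move=> t ts; have := h _ ts; suff -> : k t = 0%N by [].
  apply/eqP; rewrite -leqn0 -mE (big_rem t) //=; exact: leq_addr.
have [t ts kt] : exists2 t, t \in s & (0 < k t)%N.
  apply: contrapT => hn; move: mE; rewrite big_seq big1 // => t ts.
  by apply/eqP; rewrite -leqn0 leqNgt; apply/negP => kt; apply: hn; exists t.
pose k' x := if x == t then (k t).-1 else k x.
have hB : forall x, x \in s -> I (B t (v x)).
  apply: (IHm k' (fun x => B t (v x))).
  - apply/eqP; rewrite -eqSS -mE (big_rem t) //= [X in _ == X](big_rem t) //=.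
    rewrite {1}/k' eqxx -addSn prednK //; apply/eqP; congr (_ + _)%N.
    rewrite big_seq [RHS]big_seq; apply: eq_bigr => x; rewrite mem_rem_uniq // inE => /andP[xt _].
    by rewrite /k' (negbTE xt).
  - move=> x xs; rewrite /k'; case: eqP => [->|_].
      by rewrite -iterSr prednK //; apply: h.
    by rewrite iterBC; apply/IB/h.
  - have := IB t hs; rewrite /B linear_sum scaler_sumr -sumrB; exact.
have hne x : x \in s -> x != t -> I (v x).
  by move=> xs xt; apply: (split1 xt (h _ xs)); apply: hB.
move=> x xs; have [->|xt] := eqVneq x t; last exact: hne.
have -> : v t = \sum_(y <- s) v y + (-1) *: \sum_(y <- s | y != t) v y.
  by rewrite (bigD1_seq t) //= scaleN1r addrK.
apply/ID/IZ => //; rewrite big_seq_cond; apply: (big_ind I).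
- exact: I0 hs.
- by move=> *; apply: ID.
- by move=> y /andP[ys yt]; apply: hne.
Qed.

End SpectralSplit.

(** * Polynomial representations and their differentials *)

Lemma tensmx_diag (F : comNzRingType) D D' (u : 'rV[F]_D) (v : 'rV[F]_D') :
  diag_mx u *t diag_mx v =
  diag_mx (\row_k (u 0 (mxtens_unindex k).1 * v 0 (mxtens_unindex k).2)).
Proof.
apply/matrixP => k l; rewrite !mxE.
have -> : (k == l) = ((mxtens_unindex k).1 == (mxtens_unindex l).1)
    && ((mxtens_unindex k).2 == (mxtens_unindex l).2).
  by rewrite -(can_eq (@mxtens_unindexK D D')) -pair_eqE.
by do 2?case: (_ == _); rewrite ?mulr1n ?mulr0n ?mul0r ?mulr0.
Qed.

Lemma tensmx11 (F : comNzRingType) D D' : (1%:M : 'M[F]_D) *t (1%:M : 'M[F]_D') = 1%:M.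
Proof.
rewrite -!diag_const_mx tensmx_diag; congr diag_mx.
by apply/rowP => k; rewrite !mxE mulr1.
Qed.

Section Representations.
Variables (R : realType) (n : nat).
Local Notation C := R[i].
Local Notation M := 'M[C]_n.
Implicit Types (x y g : M) (d : 'rV[C]_n).

Definition weight_row D (wt : 'I_D -> 'I_n -> nat) d : 'rV[C]_D :=
  \row_a \prod_j d 0 j ^+ wt a j.

(* Polynomial representations of the monoid M, in a basis of weight vectors
   for the diagonal matrices. *)
Record is_rep D (rho : M -> 'M[C]_D) (wt : 'I_D -> 'I_n -> nat) : Prop := IsRep {
  rep1 : rho 1%:M = 1%:M;
  repM : forall x y, rho (x *m y) = rho x *m rho y;
  rep_poly : is_polymx rho;
  rep_diag : forall d, rho (diag_mx d) = diag_mx (weight_row wt d) }.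

Lemma tensmx_eval D D' (e : 'rV[C]_D) (e' : 'rV[C]_D') A A' (c : 'cV[C]_D) (c' : 'cV[C]_D') :
  (e *m A *m c) 0 0 * (e' *m A' *m c') 0 0 =
  ((\row_k (e 0 (mxtens_unindex k).1 * e' 0 (mxtens_unindex k).2)) *m (A *t A')
   *m (\col_k (c (mxtens_unindex k).1 0 * c' (mxtens_unindex k).2 0))) 0 0.
Proof.
rewrite !mxE mulr_sum; apply: eq_bigr => k _; rewrite !mxE mulrACA; congr (_ * _).
by rewrite mulr_sum; apply: eq_bigr => l _; rewrite !mxE mulrACA.
Qed.

Lemma is_rep_cst : @is_rep 1 (fun=> 1%:M) (fun _ _ => 0%N).
Proof.
split=> [||i j|d].
- by [].
- by move=> x y; rewrite mulmx1.
- exact: is_poly_cst.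
- rewrite -diag_const_mx; apply: congr1; apply/rowP => k.
  by rewrite [LHS]mxE [RHS]mxE big1.
Qed.

Lemma is_rep_id : @is_rep n id (fun a k => (a == k) : nat).
Proof.
split=> [||i j|d].
- by [].
- by [].
- exact: is_poly_entry.
- apply: congr1; apply/rowP => k; rewrite [RHS]mxE (bigD1 k) //= eqxx expr1.
  by rewrite big1 ?mulr1 // => l lk; rewrite eq_sym (negbTE lk).
Qed.

Section SumTensor.
Variables (D D' : nat) (rho : M -> 'M[C]_D) (rho' : M -> 'M[C]_D').
Variables (wt : 'I_D -> 'I_n -> nat) (wt' : 'I_D' -> 'I_n -> nat).
Hypotheses (h : is_rep rho wt) (h' : is_rep rho' wt').

Lemma is_rep_sum : is_rep (fun x => block_mx (rho x) 0 0 (rho' x))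
  (fun k => match fintype.split k with inl a => wt a | inr a => wt' a end).
Proof.
split.
- by rewrite (rep1 h) (rep1 h') -scalar_mx_block.
- by move=> x y; rewrite mulmx_block !mulmx0 !mul0mx !addr0 !add0r (repM h) (repM h').
- move=> k l; rewrite -[k]splitK -[l]splitK.
  case: (fintype.split k) => a; case: (fintype.split l) => b /=.
  + by apply: is_poly_ext (rep_poly h a b) => x; rewrite block_mxEul.
  + by apply: is_poly_ext (is_poly_cst _ 0) => x; rewrite block_mxEur mxE.
  + by apply: is_poly_ext (is_poly_cst _ 0) => x; rewrite block_mxEdl mxE.
  + by apply: is_poly_ext (rep_poly h' a b) => x; rewrite block_mxEdr.
- move=> d; rewrite (rep_diag h) (rep_diag h') -diag_mx_row; apply: congr1; apply/rowP => k.
  rewrite [RHS]mxE -{1}[k]splitK.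
  by case: (fintype.split k) => a /=; rewrite ?row_mxEl ?row_mxEr [LHS]mxE.
Qed.

Lemma is_rep_tensor : is_rep (fun x => rho x *t rho' x)
  (fun k j => wt (mxtens_unindex k).1 j + wt' (mxtens_unindex k).2 j)%N.
Proof.
split.
- by rewrite (rep1 h) (rep1 h') tensmx11.
- by move=> x y; rewrite (repM h) (repM h') tensmx_mul.
- move=> k l; have := is_polyM (rep_poly h (mxtens_unindex k).1 (mxtens_unindex l).1)
    (rep_poly h' (mxtens_unindex k).2 (mxtens_unindex l).2).
  by apply: is_poly_ext => x; rewrite [RHS]mxE.
- move=> d; rewrite (rep_diag h) (rep_diag h') tensmx_diag; apply: congr1.
  apply/rowP => k; rewrite [LHS]mxE [RHS]mxE; under [RHS]eq_bigr do rewrite exprD.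
  by rewrite big_split [X in X * _ = _]mxE [X in _ * X = _]mxE.
Qed.

End SumTensor.

Definition matrix_coef (f : M -> C) := exists D (rho : M -> 'M[C]_D) wt (e : 'rV_D) (c : 'cV_D),
  is_rep rho wt /\ forall x, f x = (e *m rho x *m c) 0 0.

Lemma matrix_coef_cst a : matrix_coef (fun=> a).
Proof.
exists 1%N, (fun=> 1%:M), (fun _ _ => 0%N), 1%:M, (const_mx a).
by split=> [|x]; [exact: is_rep_cst | rewrite mul1mx mul1mx mxE].
Qed.

Lemma matrix_coef_entry i j : matrix_coef (fun x => x i j).
Proof.
exists n, id, (fun a k => (a == k) : nat), (delta_mx 0 i), (delta_mx j 0).
by split=> [|x]; [exact: is_rep_id | rewrite -rowE -colE !mxE].
Qed.

Lemma matrix_coefD (f g : M -> C) : matrix_coef f -> matrix_coef g -> matrix_coef (fun x => f x + g x).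
Proof.
move=> [D [rho [wt [e [c [h he]]]]]] [D' [rho' [wt' [e' [c' [h' he']]]]]].
exists (D + D')%N, (fun x => block_mx (rho x) 0 0 (rho' x)),
  (fun k => match fintype.split k with inl a => wt a | inr a => wt' a end),
  (row_mx e e'), (col_mx c c'); split; first exact: is_rep_sum.
move=> x; rewrite mul_row_block !mulmx0 addr0 add0r mul_row_col mxE.
by rewrite he he'.
Qed.

Lemma matrix_coefM (f g : M -> C) : matrix_coef f -> matrix_coef g -> matrix_coef (fun x => f x * g x).
Proof.
move=> [D [rho [wt [e [c [h he]]]]]] [D' [rho' [wt' [e' [c' [h' he']]]]]].
exists (D * D')%N, (fun x => rho x *t rho' x),
  (fun k j => wt (mxtens_unindex k).1 j + wt' (mxtens_unindex k).2 j)%N,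
  (\row_k (e 0 (mxtens_unindex k).1 * e' 0 (mxtens_unindex k).2)),
  (\col_k (c (mxtens_unindex k).1 0 * c' (mxtens_unindex k).2 0)).
by split=> [|x]; [exact: is_rep_tensor | rewrite he he' tensmx_eval].
Qed.

(** Constants and coordinates are matrix coefficients; sums come from direct sums of representations
    and products from tensor products. *)
Lemma rep_exists (f : M -> C) : is_poly f -> matrix_coef f.
Proof.
elim/is_poly_ind => {f} [f h fh|a|i j|f h pf ph|f h pf ph].
- move=> [D [rho [wt [e [c [hr he]]]]]]; exists D, rho, wt, e, c; split=> // x.
  by rewrite -fh.
- exact: matrix_coef_cst.
- exact: matrix_coef_entry.
- exact: matrix_coefD.
- exact: matrix_coefM.
Qed.

Section Rep.
Variables (D : nat) (rho : M -> 'M[C]_D) (wt : 'I_D -> 'I_n -> nat) (hr : is_rep rho wt).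

Lemma rep_unit x : x \in unitmx -> rho x \in unitmx.
Proof.
move=> xu; have : rho x *m rho (invmx x) = 1%:M by rewrite -(repM hr) mulmxV // (rep1 hr).
by move=> h; exact: (mulmx1_unit h).1.
Qed.

Lemma rep_inv x : x \in unitmx -> rho (invmx x) = invmx (rho x).
Proof.
move=> xu; apply: (can_inj (mulKmx (rep_unit xu))).
by rewrite -(repM hr) !mulmxV ?rep_unit // (rep1 hr).
Qed.

Lemma rep_curve G : exists Q : 'M[{poly C}]_D, forall c, mxcurve Q c = rho (mxcurve G c).
Proof.
have h i j : exists q : {poly C}, forall c, rho (mxcurve G c) i j = q.[c].
  apply: (is_poly_uni (rep_poly hr i j)) => k l; exists (G k l) => c.
  by rewrite mxE.
pose Q i j := xget (0 : {poly C}) [set q | forall c, rho (mxcurve G c) i j = q.[c]].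
exists (\matrix_(i, j) Q i j) => c; apply/matrixP => i j; rewrite !mxE /Q.
by case: xgetP => [q _ /= ->//|/= hn]; have [q /hn] := h i j.
Qed.

(** The differential of [rho] at the identity. The entries of [rho] are given as functions, so
    polynomials representing them are chosen by [xget]. *)
Definition drho (X : M) : 'M[C]_D :=
  \matrix_(a, b) tangent (xget 0 [set p | forall x, rho x a b = polyfun p x]) 1%:M X.

Let drho_p a b : exists2 p, (forall x, rho x a b = polyfun p x) &
  (forall X, drho X a b = tangent p 1%:M X).
Proof.
exists (xget 0 [set p | forall x, rho x a b = polyfun p x]); last by move=> X; rewrite mxE.
by case: xgetP => [//|hn]; have [p /hn] := rep_poly hr a b.
Qed.

Lemma drhoD X Y : drho (X + Y) = drho X + drho Y.
Proof.
apply/matrixP => a b; rewrite [RHS]mxE; have [p _ h] := drho_p a b.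
by rewrite !h tangentD.
Qed.

Lemma drho_curve G Q : (forall c, mxcurve Q c = rho (mxcurve G c)) -> mxcurve G 0 = 1%:M ->
  mxdcurve Q 0 = drho (mxdcurve G 0).
Proof.
move=> hQ G0; apply/matrixP => a b; have [p hp ->] := drho_p a b.
rewrite mxE -G0; apply: chain_rule_at => c.
by rewrite -hp -hQ mxE.
Qed.

Lemma drho_tangent p (e : 'rV_D) (c : 'cV_D) X :
  (forall x, polyfun p x = (e *m rho x *m c) 0 0) -> tangent p 1%:M X = (e *m drho X *m c) 0 0.
Proof.
move=> hp; have [Q hQ] := rep_curve (line X).
have l0 : mxcurve (line X) 0 = 1%:M by rewrite line_curve scale0r addr0.
have hd := drho_curve hQ l0; rewrite line_dcurve in hd.
pose q : {poly C} := \sum_b (\sum_a (e 0 a)%:P * Q a b) * (c b 0)%:P.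
have hq t : polyfun p (mxcurve (line X) t) = q.[t].
  rewrite hp -hQ mxE horner_sum; apply: eq_bigr => b _; rewrite hornerM hornerC mxE horner_sum.
  by congr (_ * _); apply: eq_bigr => a _; rewrite hornerM hornerC mxE.
have := @chain_rule_at _ _ _ _ _ 0 hq; rewrite l0 line_dcurve => <-.
rewrite /q raddf_sum horner_sum mxE; apply: eq_bigr => b _ /=.
rewrite derivM derivC mulr0 addr0 hornerM hornerC mxE raddf_sum horner_sum.
congr (_ * _); apply: eq_bigr => a _ /=.
by rewrite derivM derivC mul0r add0r hornerM hornerC -hd mxE.
Qed.

Lemma drho_conj g X : g \in unitmx ->
  drho (invmx g *m X *m g) = invmx (rho g) *m drho X *m rho g.
Proof.
move=> gu; have [Q hQ] := rep_curve (line X).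
have l0 (Y : M) : mxcurve (line Y) 0 = 1%:M by rewrite line_curve scale0r addr0.
rewrite -{2}(line_dcurve X 0) -(drho_curve hQ (l0 X)) -(line_dcurve (invmx g *m X *m g) 0).
pose Q' := map_mx polyC (invmx (rho g)) *m Q *m map_mx polyC (rho g).
have cE (A : 'M[C]_D) c : mxcurve (map_mx polyC A) c = A.
  by apply/matrixP => i j; rewrite !mxE hornerC.
have cdE (A : 'M[C]_D) c : mxdcurve (map_mx polyC A) c = 0.
  by apply/matrixP => i j; rewrite !mxE derivC horner0.
rewrite -(@drho_curve _ Q') ?l0 //; last first.
  move=> c; rewrite !mxcurveM !cE hQ -rep_inv // -!(repM hr) !line_curve; congr rho.
  by rewrite mulmxDr mulmxDl mulmx1 mulVmx // -scalemxAr -scalemxAl.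
by rewrite !mxdcurveM mxcurveM !cE !cdE mul0mx add0r mulmx0 addr0.
Qed.

Lemma drho_diag (s : 'rV[C]_n) : drho (diag_mx s) = diag_mx (\row_a \sum_j (wt a j)%:R * s 0 j).
Proof.
rewrite -{1}(line_dcurve (diag_mx s) 0).
pose Q : 'M[{poly C}]_D :=
  diag_mx (\row_a \prod_j (1 + (s 0 j)%:P * 'X) ^+ wt a j).
rewrite -(@drho_curve _ Q); first last.
- by rewrite line_curve scale0r addr0.
- move=> c; rewrite line_curve.
  have -> : 1%:M + c *: diag_mx s = diag_mx (\row_j (1 + s 0 j * c)).
    apply/matrixP => i j; rewrite !mxE; case: eqP => [->|_] /=; last by rewrite !mulr0n mulr0 addr0.
    by rewrite !mulr1n mulrC.
  rewrite (rep_diag hr); apply/matrixP => i j; rewrite !mxE hornerMn; congr (_ *+ _).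
  by rewrite horner_prod; apply: eq_bigr => k _; rewrite !mxE !hornerE.
apply/matrixP => i j; rewrite !mxE derivMn hornerMn; congr (_ *+ _).
suff [] : (\prod_l (1 + (s 0 l)%:P * 'X) ^+ wt i l).[0] = 1 /\
  (\prod_l (1 + (s 0 l)%:P * 'X) ^+ wt i l)^`().[0] = \sum_l (wt i l)%:R * s 0 l by [].
apply: (big_ind2 (fun (p : {poly C}) v => p.[0] = 1 /\ p^`().[0] = v)).
- by rewrite -polyC1 derivC !hornerC.
- move=> p v q w [p1 <-] [q1 <-]; rewrite hornerM p1 q1 mulr1; split=> //.
  by rewrite derivM hornerD !hornerM p1 q1 mulr1 mul1r.
- move=> l _; have l1 : (1 + (s 0 l)%:P * 'X).[0] = 1 by rewrite !hornerE.
  rewrite horner_exp l1 expr1n; split=> //.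
  rewrite deriv_exp hornerMn hornerM horner_exp l1 expr1n mulr1 -mulr_natl.
  by congr (_ * _); rewrite derivD derivM derivX derivC -polyC1 derivC !hornerE.
Qed.

End Rep.

End Representations.

(** * Linear subspaces given as sets *)

Definition linset (F : fieldType) (V : lmodType F) (G : set V) :=
  G 0 /\ forall a u v, G u -> G v -> G (a *: u + v).

Section LinearSets.
Variables (F : fieldType).

Section Closure.
Variables (V : lmodType F) (G : set V) (lG : linset G).

Lemma linsetZ a u : G u -> G (a *: u).
Proof. by case: lG => G0 h Gu; rewrite -[a *: u]addr0; apply: h. Qed.

Lemma linsetD u v : G u -> G v -> G (u + v).
Proof. by case: lG => _ h Gu Gv; rewrite -[u]scale1r; apply: h. Qed.

Lemma linsetN u : G u -> G (- u).
Proof. by rewrite -scaleN1r; apply: linsetZ. Qed.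

Lemma linsetB u v : G u -> G v -> G (u - v).
Proof. by move=> Gu /linsetN; apply: linsetD. Qed.

Lemma linset_sum (I : Type) (r : seq I) (P : pred I) (f : I -> V) :
  (forall i, P i -> G (f i)) -> G (\sum_(i <- r | P i) f i).
Proof.
by move=> h; apply: (big_ind G) => //; [case: lG | exact: linsetD].
Qed.

End Closure.

(** Turns membership of the rows of a matrix into membership of its row space; [linset_mx] then
    takes a matrix of largest rank with rows in [G]. *)
Lemma linset_mulmx N (G : set 'rV[F]_N) : linset G ->
  forall k (A : 'M_(k, N)) u, (forall i, G (row i A)) -> (u <= A)%MS -> G u.
Proof.
move=> lG k A u hA /submxP[w ->]; rewrite mulmx_sum_row.
by apply: (linset_sum lG) => i _; apply: (linsetZ lG).
Qed.

Lemma linset_mx N (G : set 'rV[F]_N) : linset G ->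
  exists B : 'M[F]_N, forall u, G u <-> (u <= B)%MS.
Proof.
move=> lG; pose P r := `[< exists2 B : 'M[F]_N, (forall i, G (row i B)) & \rank B = r >].
have exP : exists r, P r.
  exists (\rank (0 : 'M[F]_N)); apply/asboolP; exists 0 => // i.
  by rewrite row0; case: lG.
have ubP r : P r -> (r <= N)%N by case/asboolP => B _ <-; apply: rank_leq_col.
have [r /asboolP[B hB rB] maxr] := ex_maxnP exP ubP.
exists B => u; split=> [Gu|]; last exact: linset_mulmx.
pose B' := (B + u)%MS.
have hB' i : G (row i B').
  have : (row i B' <= col_mx B u)%MS by rewrite -addsmxE row_sub.
  apply: (linset_mulmx lG) => k; rewrite -[k]splitK.
  by case: (fintype.split k) => l /=; rewrite ?rowKu ?rowKd // row_id.
have : (\rank B' <= r)%N by apply: maxr; apply/asboolP; exists B'.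
rewrite -rB /B' (geq_leqif (mxrank_leqif_sup (addsmxSl B u))).
exact/submx_trans/addsmxSr.
Qed.

Lemma linset_full N (G : set 'rV[F]_N) : linset G ->
  (forall A : 'cV_N, (forall u, G u -> u *m A = 0) -> A = 0) -> forall u, G u.
Proof.
move=> lG h u; have [B hB] := linset_mx lG; apply/hB/submx_full.
suff c0 : cokermx B = 0.
  by rewrite -col_leq_rank; have := mxrank_coker B; rewrite c0 mxrank0 => /eqP; rewrite eq_sym subn_eq0.
apply/trmx_inj/row_matrixP => i; rewrite trmx0 row0 -tr_col.
rewrite (h (col i (cokermx B))) ?trmx0 // => v /hB /submxP[w ->].
by rewrite colE mulmxA -(mulmxA w) mulmx_coker mulmx0 mul0mx.
Qed.

End LinearSets.

Lemma finite_set_bound (T : choiceType) (K : set T) (N : nat) :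
  (forall s : seq T, uniq s -> (forall x, x \in s -> K x) -> (size s <= N)%N) -> finite_set K.
Proof.
move=> hN; apply: contrapT => infK.
have [s [us hs ss]] : exists s : seq T, [/\ uniq s, (forall x, x \in s -> K x) & size s = N.+1].
  elim: N.+1 => [|k [s [us hs ss]]]; first by exists [::].
  have [x Kx xs] : exists2 x, K x & x \notin s.
    apply: contrapT => hn; apply: infK; apply/finite_seqP; exists s.
    apply/seteqP; split=> x /=; last exact: hs.
    by move=> Kx; apply/negPn/negP => xs; apply: hn; exists x.
  exists (x :: s); rewrite /= xs us ss; split=> // y; rewrite inE => /orP[/eqP ->//|].
  exact: hs.
by have := hN s us hs; rewrite ss ltnn.
Qed.

(** * Lie algebras, one-parameter subgroups, adjoint action and brackets *)

Section LieAlgebra.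
Variables (R : realType) (n : nat).
Local Notation C := R[i].
Local Notation M := 'M[C]_n.
Implicit Types (x y g X Y Z : M) (K : set M).

Fact tdiag_key : unit. Proof. by []. Qed.
Fact cochar_key : unit. Proof. by []. Qed.

Definition tdiag g (s : 'rV[C]_n) : M := locked_with tdiag_key (invmx g *m diag_mx s *m g).
Definition cochar g (m : 'I_n -> int) (c : C) : M :=
  locked_with cochar_key (tdiag g (\row_j (c ^ m j))).

Lemma tdiagE g s : tdiag g s = invmx g *m diag_mx s *m g.
Proof. by rewrite /tdiag; case: tdiag_key. Qed.

Lemma cocharE g m c : cochar g m c = tdiag g (\row_j (c ^ m j)).
Proof. by rewrite /cochar; case: cochar_key. Qed.

(** Multiplication by [c ^ B] clears the negative exponents, after which infinitely many zeros
    remain. *)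
Lemma laurent_poly N (k : 'I_N -> int) (a : 'I_N -> C) :
  (forall c, c != 0 -> \sum_i a i * c ^ k i = 0) -> exists2 B : nat,
  (forall i, 0 <= k i + B%:Z) & \sum_i a i *: 'X^(absz (k i + B%:Z)) = 0 :> {poly C}.
Proof.
move=> h; pose B : nat := (\sum_i `|k i|)%N.
have kB i : 0 <= k i + B%:Z.
  have : (`|k i| <= B)%N by rewrite /B (bigD1 i) //= leq_addr.
  lia.
exists B => //; apply: poly_zero_except => c c0; rewrite horner_sum.
transitivity ((\sum_i a i * c ^ k i) * c ^ B%:Z); last by rewrite h // mul0r.
rewrite mulr_suml; apply: eq_bigr => i _; rewrite hornerZ hornerXn -mulrA -expfzDr //.
by rewrite -{2}(gez0_abs (kB i)).
Qed.

Lemma laurent_zero N (k : 'I_N -> int) (a : 'I_N -> C) :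
  (forall c, c != 0 -> \sum_i a i * c ^ k i = 0) -> forall m, \sum_(i | k i == m) a i = 0.
Proof.
move=> /laurent_poly[B kB p0] m.
case: (lerP 0 (m + B%:Z)) => [mB|mB]; last first.
  rewrite big_pred0 // => i; apply/negP => /eqP ki; have := kB i.
  by rewrite ki leNgt mB.
have := congr1 (fun q : {poly C} => q`_(absz (m + B%:Z))) p0.
rewrite coef0 coef_sum => E; rewrite -[RHS]E big_mkcond; apply: eq_bigr => i _.
rewrite coefZ coefXn; have -> : (absz (m + B%:Z) == absz (k i + B%:Z)) = (k i == m).
  by move: (kB i) mB; lia.
by case: ifP; rewrite ?mulr1 ?mulr0.
Qed.

(** This is the derivative at 1 of the Laurent identity. The shift by [B] contributes [B] times the
    value at 1, which is zero. *)
Lemma laurent_deriv N (k : 'I_N -> int) (a : 'I_N -> C) :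
  (forall c, c != 0 -> \sum_i a i * c ^ k i = 0) -> \sum_i a i * (k i)%:~R = 0.
Proof.
move=> h; have [B kB p0] := laurent_poly h.
have a0 : \sum_i a i = 0.
  rewrite -[RHS](h 1) ?oner_eq0 //; apply: eq_bigr => i _.
  by rewrite exp1rz mulr1.
have E : \sum_i a i * (k i + B%:Z)%:~R = 0.
  have := congr1 (fun q : {poly C} => q^`().[1]) p0; rewrite deriv0 horner0 raddf_sum horner_sum.
  move=> E; rewrite -[RHS]E; apply: eq_bigr => i _ /=.
  rewrite derivZ hornerZ derivXn hornerMn hornerXn expr1n.
  by congr (_ * _); rewrite -{1}(gez0_abs (kB i)).
transitivity (\sum_i a i * (k i + B%:Z)%:~R - (\sum_i a i) * B%:R).
  rewrite mulr_suml -sumrB; apply: eq_bigr => i _.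
  by rewrite rmorphD /= mulrDr -[B%:~R]pmulrn addrK.
by rewrite E a0 mul0r subr0.
Qed.

Section RepTorus.
Variables (D : nat) (rho : M -> 'M[C]_D) (wt : 'I_D -> 'I_n -> nat) (hr : is_rep rho wt).
Variables (g : M) (gu : g \in unitmx).

Lemma rep_tdiag (s : 'rV_n) :
  rho (tdiag g s) = invmx (rho g) *m diag_mx (weight_row wt s) *m rho g.
Proof. by rewrite tdiagE !(repM hr) (rep_diag hr) (rep_inv hr). Qed.

Lemma drho_tdiag (s : 'rV_n) :
  drho rho (tdiag g s) = invmx (rho g) *m diag_mx (\row_a \sum_j (wt a j)%:R * s 0 j) *m rho g.
Proof. by rewrite tdiagE (drho_conj hr _ gu) (drho_diag hr). Qed.

Lemma weight_row_cochar (m : 'I_n -> int) (c : C) a : c != 0 ->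
  weight_row wt (\row_j (c ^ m j)) 0 a = c ^ (\sum_j (wt a j)%:Z * m j).
Proof.
move=> c0; rewrite mxE (big_morph _ (fun u v : int => expfzDr u v c0) (erefl (c ^ 0%:Z))).
by apply: eq_bigr => j _; rewrite mxE exprnP exprz_exp mulrC.
Qed.

End RepTorus.

Lemma mulmx_diag_sum D (e : 'rV[C]_D) (u : 'rV[C]_D) (c : 'cV[C]_D) :
  (e *m diag_mx u *m c) 0 0 = \sum_a e 0 a * c a 0 * u 0 a.
Proof. by rewrite mul_mx_diag mxE; apply: eq_bigr => a _; rewrite mxE mulrAC. Qed.

Lemma lie_linset K : linset (lie K).
Proof.
split=> [p hp|a X Y hX hY p hp]; rewrite -/(tangent p 1%:M _).
  by rewrite -[0](scale0r (0 : M)) tangentZ mul0r.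
rewrite tangentD tangentZ.
have := hX p hp; have := hY p hp; rewrite -!/(tangent p 1%:M _) => -> ->.
by rewrite mulr0 addr0.
Qed.

Lemma lie_tangent K X p : lie K X -> (forall x, K x -> polyfun p x = 0) -> tangent p 1%:M X = 0.
Proof. by move=> h /h. Qed.

Lemma lie_mono K K' : K `<=` K' -> lie K `<=` lie K'.
Proof. by move=> KK' X hX p hp; apply: hX => x /KK'; apply: hp. Qed.

Lemma lie_curve K G : (forall c, K (mxcurve G c)) -> mxcurve G 0 = 1%:M -> lie K (mxdcurve G 0).
Proof.
move=> hG G0 p hp; rewrite -/(tangent p 1%:M _) -G0.
have hq c : polyfun p (mxcurve G c) = (0 : {poly C}).[c] by rewrite horner0 hp.
by rewrite -(chain_rule_at (R := R) (n := n) 0 hq) deriv0 horner0.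
Qed.

Lemma lie_curve_in K X G p : lie K X -> (forall x, K x -> polyfun p x = 0) ->
  mxcurve G 0 = 1%:M -> mxdcurve G 0 = X ->
  forall q : {poly C}, (forall c, polyfun p (mxcurve G c) = q.[c]) -> q^`().[0] = 0.
Proof.
move=> hX hp G0 GX q hq.
by rewrite (chain_rule_at (R := R) (n := n) 0 hq) G0 GX; apply: lie_tangent hp.
Qed.

Lemma mxcurve_cst (A : M) c : mxcurve (map_mx polyC A) c = A.
Proof. by apply/matrixP => i j; rewrite !mxE hornerC. Qed.

Lemma mxdcurve_cst (A : M) c : mxdcurve (map_mx polyC A) c = 0.
Proof. by apply/matrixP => i j; rewrite !mxE derivC horner0. Qed.

(* An equation [h = 0] polynomial in x, valid on K, may be differentiated. *)
Lemma lie_poly_curve K X (h : M -> C) G : is_poly h -> (forall x, K x -> h x = 0) -> lie K X ->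
  mxcurve G 0 = 1%:M -> mxdcurve G 0 = X ->
  forall q : {poly C}, (forall c, h (mxcurve G c) = q.[c]) -> q^`().[0] = 0.
Proof.
move=> [p hp] hK hX G0 GX q hq; apply: (lie_curve_in (p := p) hX _ G0 GX) => [x /hK <-|c].
  by rewrite hp.
by rewrite -hq hp.
Qed.

(** Serves to pass linear conditions on a group to its Lie algebra: vanishing of entries, equality
    of diagonal entries, commutation with a fixed matrix. *)
Lemma lie_linear_eq K X (l : M -> C) : is_poly l ->
  (forall a u v, l (a *: u + v) = a * l u + l v) ->
  (forall x, K x -> l x = l 1%:M) -> lie K X -> l X = 0.
Proof.
move=> pl ll hK hX.
have l0 : l 0 = 0 by have := ll (-1) 0 0; rewrite scaler0 add0r mulN1r addNr.
have h := @lie_poly_curve K X (fun x => l x - l 1%:M) (line X)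
  (is_polyB pl (is_poly_cst _ _)) _ hX _ (line_dcurve X 0).
have : ((l X)%:P * 'X)^`().[0] = 0.
  apply: h => [x /hK ->|| c]; first by rewrite subrr.
    by rewrite line_curve scale0r addr0.
  by rewrite line_curve [1%:M + _]addrC ll addrK !hornerE mulrC.
by rewrite derivM derivC mul0r add0r derivX !hornerE.
Qed.

Section Group.
Variables (K : set M) (aK : algebraic_group K).
Let sK := alg_subgroup aK.

Lemma lie_Ad_norm L g X : g \in unitmx -> (forall x, L x -> L (g *m x *m invmx g)) -> lie L X ->
  lie L (g *m X *m invmx g).
Proof.
move=> gu Lg hX p hp.
pose G := map_mx polyC g *m line X *m map_mx polyC (invmx g).
have G0 : mxcurve G 0 = 1%:M.
  by rewrite !mxcurveM !mxcurve_cst line_curve scale0r addr0 mulmx1 mulmxV.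
have GX : mxdcurve G 0 = g *m X *m invmx g.
  by rewrite !mxdcurveM !mxcurveM !mxcurve_cst !mxdcurve_cst line_dcurve mulmx0 mul0mx addr0 add0r.
have [q hq] := chain_rule p G.
rewrite -/(tangent p 1%:M _) -GX -{1}G0 -(hq 0).2.
apply: (@lie_poly_curve L X (fun x => polyfun p (g *m x *m invmx g)) (line X) _ _ hX _ (line_dcurve X 0)).
- by apply: is_poly_mulr; exists p.
- by move=> x Lx; rewrite hp //; apply: Lg.
- by rewrite line_curve scale0r addr0.
- by move=> c; rewrite -(hq c).1 !mxcurveM !mxcurve_cst.
Qed.

Lemma lie_Ad g X : K g -> lie K X -> lie K (g *m X *m invmx g).
Proof. by move=> Kg; apply: lie_Ad_norm; [exact: (sg_unit sK Kg) | move=> x; apply: sgJ]. Qed.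

(** The map sending [x] to [x Y x^-1] is differentiated along [X]. The inverse is replaced by the
    adjugate, which is polynomial and differs from it on [K] by a nonzero scalar. *)
Lemma lie_ideal L X Y : (forall x, K x -> lie L (x *m Y *m invmx x)) -> lie K X -> lie L (X *m Y - Y *m X).
Proof.
move=> LY hX p hp; rewrite -/(tangent p 1%:M _).
have hY : lie L Y by have := LY _ (sg1 sK); rewrite invmx1 mulmx1 mul1mx.
pose h x := tangent p 1%:M (x *m Y *m \adj x).
have tp (F : M -> M) : is_polymx F -> is_poly (fun x => tangent p 1%:M (F x)).
  move=> pF; apply: is_poly_sum => k _; apply: is_polyM; first exact: is_poly_cst.
  case/mxvec_indexP: k => i j; apply: (is_poly_ext _ (pF i j)) => x.
  by rewrite mxvecE.
have ph : is_poly h.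
  apply: tp; apply: is_polymxM; last by apply: is_polymx_adj; apply: is_polymx_id.
  by apply: is_polymxM; [exact: is_polymx_id | exact: is_polymx_cst].
have hK x : K x -> h x = 0.
  move=> Kx; rewrite /h; have -> : \adj x = \det x *: invmx x.
    by rewrite /invmx (sg_unit sK Kx) scalerA divff ?scale1r // -unitfE -unitmxE (sg_unit sK Kx).
  by rewrite -scalemxAr tangentZ (lie_tangent (LY x Kx) hp) mulr0.
(* Derivative of adj at 1 in the direction X is tr(X) - X, since x adj(x) = det x. *)
pose A : 'M[{poly C}]_n := \adj (line X); pose G := line X *m map_mx polyC Y *m A.
have cA c : mxcurve A c = \adj (mxcurve (line X) c).
  by rewrite /mxcurve -[map_mx _ A]/(map_mx (horner_eval c) _) map_mx_adj.
have l0 : mxcurve (line X) 0 = 1%:M by rewrite line_curve scale0r addr0.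
have dA : exists a, mxdcurve A 0 = a%:M - X.
  exists ((\det (line X))^`()).[0].
  have E : mxdcurve (line X *m A) 0 = ((\det (line X))^`()).[0]%:M.
    rewrite mul_mx_adj; apply/matrixP => i j; rewrite !mxE.
    by case: eqP => _; rewrite ?mulr1n // mulr0n derivC horner0.
  move: E; rewrite mxdcurveM cA l0 line_dcurve adj1 mulmx1 mul1mx => <-.
  by rewrite addrAC subrr add0r.
have [a daE] := dA.
pose t : {poly C} := \sum_(k < n * n) (polyfun (mderiv k p) 1%:M)%:P * mxvec G 0 k.
have : t^`().[0] = 0.
  apply: (@lie_poly_curve K X h (line X) ph hK hX l0 (line_dcurve X 0)) => c.
  rewrite /h -cA -[X in X *m mxcurve A c](_ : mxcurve (line X *m map_mx polyC Y) c = _); last first.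
    by rewrite mxcurveM mxcurve_cst.
  rewrite -mxcurveM /t horner_sum; apply: eq_bigr => k _; rewrite hornerM hornerC.
  by congr (_ * _); case/mxvec_indexP: k => i j; rewrite !mxvecE mxE.
have -> : t^`().[0] = tangent p 1%:M (mxdcurve G 0).
  rewrite raddf_sum horner_sum; apply: eq_bigr => k _ /=.
  rewrite derivM derivC mul0r add0r hornerM hornerC.
  by congr (_ * _); case/mxvec_indexP: k => i j; rewrite mxvecE [in RHS]mxvecE [RHS]mxE.
have -> : mxdcurve G 0 = (X *m Y - Y *m X) + a *: Y.
  rewrite !mxdcurveM mxdcurve_cst mxcurveM mxcurve_cst cA l0 line_dcurve adj1 daE.
  rewrite mulmx0 addr0 mulmx1 mul1mx mulmxBr -addrA [- _ + _]addrC; congr (_ + (_ - _)).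
  by rewrite scalar_mxC mul_scalar_mx.
by rewrite tangentD tangentZ (lie_tangent hY hp) mulr0 addr0.
Qed.

Lemma lie_bracket X Y : lie K X -> lie K Y -> lie K (X *m Y - Y *m X).
Proof. by move=> hX hY; apply: lie_ideal hX => x Kx; apply: lie_Ad. Qed.

End Group.
End LieAlgebra.

(** The spaces [N U] and [N B^-1] coincide. The first description respects the upper parts of the
    grading and the second the lower parts, so this common space is graded; comparison of lowest
    terms then puts [N] inside it. *)
Lemma graded_stable (F : fieldType) D (N U B : 'M[F]_D) (mu : 'I_D -> int) :
  let pi (P : pred int) : 'M[F]_D := diag_mx (\row_a (P (mu a))%:R) in
  (forall t, (N *m pi (pred1 t) <= N)%MS) -> U \in unitmx -> B \in unitmx ->
  (forall a b, (U - 1%:M) a b != 0 -> mu a < mu b) ->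
  (forall a b, B a b != 0 -> mu b <= mu a) ->
  (N *m U *m B <= N)%MS -> (N *m U <= N)%MS.
Proof.
move=> pi grN Uu Bu hU hB hN.
have piE (P : pred int) (A : 'M[F]_D) a b : (pi P *m A) a b = (P (mu a))%:R * A a b.
  by rewrite mul_diag_mx !mxE.
have piEr (P : pred int) (A : 'M[F]_D) a b : (A *m pi P) a b = A a b * (P (mu b))%:R.
  by rewrite mul_mx_diag !mxE.
have pipi P Q : pi P *m pi Q = pi (predI P Q).
  apply/matrixP => a b; rewrite piE !mxE /=; case: eqP => [->|_]; last by rewrite !mulr0n mulr0.
  by rewrite !mulr1n -natrM mulnb.
have pi0 P : (forall a, ~~ P (mu a)) -> pi P = 0.
  move=> h; apply/matrixP => a b; rewrite !mxE (negbTE (h a)).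
  by rewrite mul0rn.
have piC P : pi P + pi (predC P) = 1%:M.
  apply/matrixP => a b; rewrite !mxE -mulrnDl -natrD /=.
  by case: (P _); rewrite ?addn0 ?add0n.
pose vals : seq int := undup (codom mu).
have pisum (A : 'M[F]_D) : A = \sum_(t <- vals) A *m pi (pred1 t).
  apply/matrixP => a b; rewrite summxE (bigD1_seq (mu b)) ?undup_uniq ?mem_undup ?codom_f //=.
  rewrite piEr /= eqxx mulr1 big1 ?addr0 // => t tb.
  by rewrite piEr /= eq_sym (negbTE tb) mulr0.
have grP P : (N *m pi P <= N)%MS.
  rewrite [N *m pi P]pisum; apply: summx_sub => t _; rewrite -mulmxA pipi.
  case Pt: (P t).
    suff -> : pi (predI P (pred1 t)) = pi (pred1 t) by [].
    by congr diag_mx; apply/rowP => a; rewrite !mxE /=; case: eqP => [->|]; rewrite ?Pt ?andbF.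
  rewrite pi0 ?mulmx0 ?sub0mx // => a /=.
  by apply/negP => /andP[Pa /eqP ta]; rewrite ta Pt in Pa.
pose N' := N *m U; pose iB := invmx B.
have rN' : \rank N' = \rank N by rewrite mxrankMfree // row_free_unit.
have iBu : iB \in unitmx by rewrite unitmx_inv.
have NiB : (N *m iB <= N')%MS.
  have NE : (N <= N' *m B)%MS.
    rewrite -(geq_leqif (mxrank_leqif_sup hN)).
    by rewrite mxrankMfree ?row_free_unit // -/N' rN'.
  by rewrite -[N'](mulmxK Bu); apply: submxMr.
pose p (k : int) := pi (fun x : int => k <= x); pose q (k : int) := pi (predC (fun x : int => k <= x)).
have pq k : p k + q k = 1%:M by apply: piC.
have pqk0 k : p k *m q k = 0.
  by rewrite pipi pi0 // => a /=; rewrite andbN.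
have qpk0 k : q k *m p k = 0.
  by rewrite pipi pi0 // => a /=; rewrite andNb.
have pUq k : p k *m U *m q k = 0.
  apply/matrixP => a b; rewrite piEr piE mxE /=.
  case ka: (k <= mu a); last by rewrite mul0r mul0r.
  case kb: (k <= mu b); first by rewrite mulr0.
  rewrite mul1r mulr1; have [Uab|/hU] := eqVneq ((U - 1%:M) a b) 0; last by lia.
  move: Uab; rewrite !mxE => /eqP; rewrite subr_eq0 => /eqP ->.
  by case: eqP => [ab|//]; rewrite ab kb in ka.
have qBp k : q k *m B *m p k = 0.
  apply/matrixP => a b; rewrite piEr piE mxE /=.
  case ka: (k <= mu a); first by rewrite mul0r mul0r.
  case kb: (k <= mu b); last by rewrite mulr0.
  rewrite mul1r mulr1; apply/eqP/negPn/negP => /hB; lia.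
have qiBp k : q k *m iB *m p k = 0.
  have h1 : (q k *m B <= q k)%MS.
    have -> : q k *m B = q k *m B *m q k by rewrite -[LHS]mulmx1 -(pq k) mulmxDr qBp add0r.
    exact: submxMl.
  have h2 : (q k <= q k *m B)%MS.
    by rewrite -(geq_leqif (mxrank_leqif_sup h1)) mxrankMfree // row_free_unit.
  have /submxP[w ->] : (q k *m iB <= q k)%MS.
    by rewrite -[X in (_ <= X)%MS](mulmxK Bu); apply: submxMr.
  by rewrite -mulmxA qpk0 mulmx0.
(* [R1] lives in degrees at least [k] and [R2] in degrees below [k]; the sum of their ranks is at
   least that of [N'], so together they fill [N']. *)
have stab k : (N' *m p k <= N')%MS.
  pose R1 := N *m p k *m U; pose R2 := N *m q k *m iB.
  have hR1 : (R1 <= N')%MS by apply: submxMr; apply: grP.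
  have hR2 : (R2 <= N')%MS by apply: (submx_trans _ NiB); apply: submxMr; apply: grP.
  have R1q : R1 *m q k = 0 by rewrite /R1 -!mulmxA [p k *m _]mulmxA pUq mulmx0.
  have R2p : R2 *m p k = 0 by rewrite /R2 -!mulmxA [q k *m _]mulmxA qiBp mulmx0.
  have R1p : R1 *m p k = R1 by rewrite -[RHS]mulmx1 -(pq k) mulmxDr R1q addr0.
  have cap0 : (R1 :&: R2)%MS = 0.
    apply/eqP; rewrite -submx0; have /submxP[w1 E1] := capmxSl R1 R2.
    have /submxP[w2 E2] := capmxSr R1 R2.
    have -> : (R1 :&: R2)%MS = (R1 :&: R2)%MS *m p k.
      by rewrite {2}E1 -mulmxA R1p -E1.
    by rewrite E2 -mulmxA R2p mulmx0 submx0.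
  have hN' : (N' <= R1 + R2)%MS.
    have hs : (R1 + R2 <= N')%MS by rewrite addsmx_sub hR1 hR2.
    rewrite -(geq_leqif (mxrank_leqif_sup hs)) (mxrank_disjoint_sum cap0) rN'.
    have Uf : row_free U by rewrite row_free_unit.
    have iBf : row_free iB by rewrite row_free_unit.
    rewrite /R1 /R2 (mxrankMfree _ Uf) (mxrankMfree _ iBf).
    apply: leq_trans (mxrank_adds_leqif _ _); apply: mxrankS.
    by rewrite -{1}[N]mulmx1 -(pq k) mulmxDr addmx_sub_adds.
  apply: (submx_trans (submxMr (p k) hN')); rewrite addsmxMr R2p addsmx0_id R1p.
  exact: hR1.
suff NN' : (N <= N')%MS.
  by rewrite -(geq_leqif (mxrank_leqif_sup NN')) rN'.
(* A vector of degree [t] is the lowest term of its image under [U], and [q (t + 1)] cuts this term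
   out. *)
rewrite [N]pisum; apply: summx_sub => t _.
have h1 : (N *m pi (pred1 t) *m U <= N')%MS by apply: submxMr; apply: grP.
have h2 : (N *m pi (pred1 t) *m U *m q (t + 1)%R <= N')%MS.
  have -> : q (t + 1) = 1%:M - p (t + 1) by rewrite -(pq (t + 1)) [RHS]addrAC subrr add0r.
  rewrite mulmxBr mulmx1; apply: addmx_sub => //; rewrite eqmx_opp.
  exact: submx_trans (submxMr _ h1) (stab _).
suff -> : N *m pi (pred1 t) = N *m pi (pred1 t) *m U *m q (t + 1) by [].
rewrite -!mulmxA; congr (_ *m _); apply/matrixP => a b.
rewrite mulmxA piEr piE !mxE /=; case: (eqVneq (mu a) t) => [at_|]; last by rewrite !mul0r mul0rn.
have [Uab|Uab] := eqVneq ((U - 1%:M) a b) 0; last first.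
  have := hU _ _ Uab; rewrite at_ => tb.
  have -> : (a == b) = false by apply/eqP => ab; move: tb; rewrite -ab at_ ltxx.
  by rewrite mulr0n [t + 1 <= _]lezD1 tb /= mulr0.
move: Uab; rewrite !mxE => /eqP; rewrite subr_eq0 => /eqP ->.
case: eqP => [<-|_]; last by rewrite !mulr0n mulr0 mul0r.
by rewrite at_ [t + 1 <= _]lezD1 ltxx /= !mulr1n mulr1 mulr1.
Qed.

(** * From the Lie algebra back to the group: exponentials, replicas, finiteness *)

Section LieGroups.
Variables (R : realType) (n : nat).
Local Notation C := R[i].
Local Notation M := 'M[C]_n.
Implicit Types (x y g X Y Z : M).

Lemma mxdcurve_shift D (Q : 'M[{poly C}]_D) a :
  mxdcurve (map_mx (fun p : {poly C} => p \Po ('X + a%:P)) Q) 0 = mxdcurve Q a.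
Proof.
apply/matrixP => i j.
by rewrite !mxE deriv_comp derivD derivX derivC addr0 mulr1 horner_comp !hornerE.
Qed.

(** The image under [rho] of the exponential curve is polynomial and multiplicative in the
    parameter, so it solves the exponential equation of [drho rho X]. *)
Lemma drho_exp D (rho : M -> 'M[C]_D) wt (hr : is_rep rho wt) X : X ^+ n = 0 ->
  (drho rho X) ^+ D = 0 /\ forall c, rho (expm (c *: X)) = expm (c *: drho rho X).
Proof.
move=> Xn; have [Q hQ] := rep_curve hr (exp_curve X).
have Q0 : mxcurve Q 0 = 1%:M by rewrite hQ exp_curveE scale0r expm0 (rep1 hr).
have e0 : mxcurve (exp_curve X) 0 = 1%:M by rewrite exp_curveE scale0r expm0.
have dQ0 : mxdcurve Q 0 = drho rho X.
  rewrite (drho_curve hr hQ e0); apply: congr1.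
  by rewrite (exp_dcurve _ Xn) scale0r expm0 mul1mx.
have hQ' (k : nat) : mxdcurve Q k%:R = mxcurve Q k%:R *m drho rho X.
  rewrite -mxdcurve_shift -dQ0.
  have -> : map_mx (fun p : {poly C} => p \Po ('X + (k%:R)%:P)) Q
      = map_mx polyC (mxcurve Q k%:R) *m Q.
    apply/matrixP => i j; apply: poly_nat_inj => l.
    have /matrixP/(_ i j) : mxcurve Q (k%:R + l%:R) = mxcurve Q k%:R *m mxcurve Q l%:R.
      by rewrite !hQ !exp_curveE (expmZD _ _ Xn) (repM hr).
    rewrite [in LHS]mxE => E; rewrite [in LHS]mxE horner_comp hornerD hornerX hornerC addrC E.
    rewrite [in RHS]mxE [LHS]mxE horner_sum; apply: eq_bigr => m _.
    by rewrite hornerM [in RHS]mxE hornerC [X in _ * X = _]mxE.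
  by rewrite mxdcurveM mxdcurve_cst mul0mx add0r mxcurve_cst.
split; first exact: ode_nilpotent hQ' Q0.
by move=> c; rewrite -exp_curveE -hQ; apply: expm_uniq.
Qed.

Variables (K : set M) (aK : algebraic_group K).
Let sK := alg_subgroup aK.

Section Annihilator.
Variables (D : nat) (rho : M -> 'M[C]_D) (wt : 'I_D -> 'I_n -> nat) (hr : is_rep rho wt).
Variables (c : 'cV[C]_D).

Definition ann : set 'rV[C]_D := [set e | forall k, K k -> (e *m rho k *m c) 0 0 = 0].

Lemma ann_linset : linset ann.
Proof.
split=> [k _|a u v hu hv k Kk]; first by rewrite !mul0mx mxE.
by rewrite !mulmxDl -!scalemxAl mxE [X in X + _]mxE (hu k Kk) (hv k Kk) mulr0 addr0.
Qed.

Lemma ann_stable k e : K k -> ann e -> ann (e *m rho k).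
Proof. by move=> Kk he k' Kk'; rewrite -(mulmxA e) -(repM hr); apply: he; apply: sgM. Qed.

Lemma ann_lie X e : lie K X -> ann e -> ann (e *m drho rho X).
Proof.
move=> hX he k Kk; rewrite -mulmxA.
have pf : is_poly (fun x => (e *m rho x *m (rho k *m c)) 0 0).
  apply: is_polymxM; last exact: is_polymx_cst.
  by apply: is_polymxM; [exact: is_polymx_cst | exact: rep_poly hr].
have [p hp] := pf.
rewrite -(drho_tangent hr (p := p)) => [|x]; last by rewrite -hp.
apply: lie_tangent hX _ => x Kx.
by rewrite -hp mulmxA -(mulmxA e) -(repM hr) he //; apply: sgM.
Qed.

End Annihilator.

(** An equation [f] of [K] is the matrix coefficient of some [e] and [c]. Then [e] annihilates the
    orbit of [c], so does [e rho(x)], and evaluation at the identity gives [f x = 0]. *)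
Lemma alg_mem_ann x : x \in unitmx ->
  (forall D (rho : M -> 'M[C]_D) wt (c : 'cV_D), is_rep rho wt ->
     forall e, ann rho c e -> ann rho c (e *m rho x)) -> K x.
Proof.
move=> xu h; apply: (alg_mem aK xu) => f pf hf.
have [D [rho [wt [e [c [hr he]]]]]] := rep_exists pf.
have : ann rho c (e *m rho x) by apply: (h _ _ _ _ hr) => k Kk; rewrite -he hf.
by move=> /(_ _ (sg1 sK)); rewrite (rep1 hr) mulmx1 -he.
Qed.

(** Annihilators are stable under [drho rho X], hence under every polynomial in it, in particular
    under its truncated exponential series. *)
Lemma lie_exp X c : lie K X -> X ^+ n = 0 -> K (expm (c *: X)).
Proof.
move=> hX Xn; apply: alg_mem_ann; first exact/expm_unit/nilpotentZ.
move=> D rho wt c0 hr e he; rewrite (drho_exp hr Xn).2.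
have lA := ann_linset rho c0; rewrite !expmE mulmx_sumr; apply: (linset_sum lA) => k _.
rewrite -scalemxAr; apply: (linsetZ lA); rewrite expmxZ -scalemxAr; apply: (linsetZ lA).
elim: {k}(k : nat) => [|k IH]; first by rewrite expr0 mulmx1.
by rewrite exprSr -mulmxE mulmxA; apply: (ann_lie hr).
Qed.

(** The powers of [u] lie in [K], and an equation of [K] restricted to the curve is a polynomial
    vanishing at all naturals. *)
Lemma unipotent_curve u X : K u -> X ^+ n = 0 -> expm X = u -> forall c, K (expm (c *: X)).
Proof.
move=> Ku Xn uE c; apply: (alg_mem aK); first exact/expm_unit/nilpotentZ.
move=> f pf hf; have hu : is_uni (fun c => f (expm (c *: X))).
  apply: (is_poly_uni pf) => i j; exists (exp_curve X i j) => d.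
  by rewrite -exp_curveE mxE.
apply: (is_uni_nat hu) => k; apply: hf; rewrite expm_nat // uE.
elim: k => [|k IH]; first exact: sg1.
by rewrite exprS; apply: sgM.
Qed.

Lemma unipotent_lie X : X ^+ n = 0 -> (forall c, K (expm (c *: X))) -> lie K X.
Proof.
move=> Xn h; have := @lie_curve _ _ K (exp_curve X).
rewrite (exp_dcurve _ Xn) scale0r expm0 mul1mx; apply.
  by move=> c; rewrite exp_curveE.
by rewrite exp_curveE scale0r expm0.
Qed.

Lemma torus_lie g (m : 'I_n -> int) : g \in unitmx ->
  (forall c, c != 0 -> K (cochar g m c)) -> lie K (tdiag g (\row_j (m j)%:~R)).
Proof.
move=> gu hm p hp; rewrite -/(tangent p 1%:M _).
have pf : is_poly (polyfun p) by exists p.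
have [D [rho [wt [e [c [hr he]]]]]] := rep_exists pf.
rewrite (drho_tangent hr _ he) (drho_tdiag hr gu) !mulmxA -mulmxA mulmx_diag_sum.
rewrite -[RHS](@laurent_deriv R D (fun a => \sum_j (wt a j)%:Z * m j)
  (fun a => (e *m invmx (rho g)) 0 a * (rho g *m c) a 0)).
  apply: eq_bigr => a _; congr (_ * _); rewrite mxE rmorph_sum /=; apply: eq_bigr => j _.
  by rewrite mxE rmorphM /=.
move=> d d0; rewrite -[RHS](hp _ (hm d d0)) he cocharE (rep_tdiag hr gu).
set W := diag_mx _.
have -> : e *m (invmx (rho g) *m W *m rho g) *m c = (e *m invmx (rho g)) *m W *m (rho g *m c).
  by rewrite !mulmxA.
rewrite mulmx_diag_sum.
by apply: eq_bigr => a _; rewrite (weight_row_cochar _ _ _ d0).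
Qed.

(** Along the cocharacter the annihilation condition is a Laurent identity in [c]; its coefficient
    of degree [t] is the condition for the component of weight [t]. *)
Lemma ann_cochar D (rho : M -> 'M[C]_D) wt (hr : is_rep rho wt) (c : 'cV_D) g (m : 'I_n -> int) e t :
  g \in unitmx -> (forall c, c != 0 -> K (cochar g m c)) -> ann rho c (e *m rho g) ->
  ann rho c (e *m diag_mx (\row_a ((\sum_j (wt a j)%:Z * m j) == t)%:R) *m rho g).
Proof.
move=> gu hm he k Kk; rewrite -!mulmxA [in rho g *m _]mulmxA mulmxA mulmx_diag_sum.
have := @laurent_zero R D (fun a => \sum_j (wt a j)%:Z * m j)
  (fun a => e 0 a * (rho g *m rho k *m c) a 0) _ t.
rewrite big_mkcond /= => E; rewrite -[RHS]E => [|d d0].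
  by apply: eq_bigr => a _; rewrite mxE; case: eqP; rewrite ?mulr1 ?mulr0.
have := he _ (sgM sK (hm d d0) Kk); rewrite (repM hr) cocharE (rep_tdiag hr gu).
rewrite !mulmxA (mulmxK (rep_unit hr gu)) -!mulmxA [X in e *m (_ *m X)]mulmxA mulmxA.
rewrite mulmx_diag_sum => E2; rewrite -[RHS]E2.
by apply: eq_bigr => a _; rewrite (weight_row_cochar _ _ _ d0) mulmxA.
Qed.

Section Replicas.
Variables (g : M) (gu : g \in unitmx) (s : 'rV[C]_n) (N : M).
Hypotheses (hX : lie K (tdiag g s + N)) (SN : tdiag g s *m N = N *m tdiag g s)
  (Nn : N ^+ n = 0).

(** The annihilator is stable under the differential of the sum of semisimple and nilpotent part. By
    [spectral_split] it contains the components along the eigenspaces of the semisimple part, on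
    which any function of that part acts by scalars. *)
Lemma ann_fun D (rho : M -> 'M[C]_D) wt (hr : is_rep rho wt) (c : 'cV_D) (phi : C -> C) e :
  ann rho c e -> ann rho c
    (e *m (invmx (rho g) *m diag_mx (\row_a phi (\sum_j (wt a j)%:R * s 0 j)) *m rho g)).
Proof.
move=> he; pose sg a := \sum_j (wt a j)%:R * s 0 j.
have Au := rep_unit hr gu; set A := rho g in Au *.
pose P (t : C) : 'M[C]_D := invmx A *m diag_mx (\row_a (sg a == t)%:R) *m A.
pose vals := undup (codom sg).
have sumE (psi : C -> C) : invmx A *m diag_mx (\row_a psi (sg a)) *m A
    = \sum_(t <- vals) psi t *: P t.
  transitivity (invmx A *m (\sum_(t <- vals) psi t *: diag_mx (\row_a (sg a == t)%:R)) *m A).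
    congr (_ *m _ *m _); apply/matrixP => a b; rewrite summxE.
    rewrite (bigD1_seq (sg a)) ?undup_uniq ?mem_undup ?codom_f //= !mxE eqxx.
    rewrite big1 ?addr0; first by rewrite mulrnAr mulr1.
    by move=> t ta; rewrite !mxE eq_sym (negbTE ta) mul0rn mulr0.
  rewrite mulmx_sumr mulmx_suml; apply: eq_bigr => t _.
  by rewrite -scalemxAr -scalemxAl.
have lA := ann_linset rho c.
suff h t : t \in vals -> ann rho c (e *m P t).
  rewrite sumE mulmx_sumr big_seq; apply: (linset_sum lA) => t ts.
  by rewrite -scalemxAr; apply/(linsetZ lA)/h.
set S := tdiag g s; pose dS := drho rho S; pose dN := drho rho N.
have [dNn eN] := drho_exp hr Nn.
have dSE : dS = invmx A *m diag_mx (\row_a sg a) *m A by rewrite /dS /S (drho_tdiag hr gu).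
have PS u : P u *m dS = u *: P u.
  rewrite dSE /P !mulmxA mulmxK // scalemxAl; congr (_ *m A).
  rewrite -mulmxA scalemxAr; congr (_ *m _); apply/matrixP => a b; rewrite mul_mx_diag !mxE.
  case: (a =P b) => [->|_]; last by rewrite !mulr0n mul0r mulr0.
  by rewrite !mulr1n; case: eqP => [->|_]; rewrite ?mul1r ?mulr1 // mul0r mulr0.
have dSN : dS *m dN = dN *m dS.
  have E : map_mx polyC dS *m exp_curve dN = exp_curve dN *m map_mx polyC dS.
    apply/matrixP => i j; apply: poly_nat_inj => k.
    have /matrixP/(_ i j) : mxcurve (map_mx polyC dS *m exp_curve dN) k%:R
        = mxcurve (exp_curve dN *m map_mx polyC dS) k%:R.
      rewrite !mxcurveM mxcurve_cst exp_curveE -eN.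
      have eu : expm (k%:R *: N) \in unitmx by apply/expm_unit/nilpotentZ.
      have := drho_conj hr S eu; have -> : invmx (expm (k%:R *: N)) *m S *m expm (k%:R *: N) = S.
        rewrite -mulmxA expm_comm ?mulKmx // -scalemxAl -scalemxAr; congr (_ *: _).
        exact: SN.
      by rewrite -/dS => E; rewrite [in RHS]E -!mulmxA mulKVmx ?(rep_unit hr eu).
    by rewrite [LHS]mxE [RHS]mxE.
  have := congr1 (fun Q => mxdcurve Q 0) E; rewrite !mxdcurveM !mxdcurve_cst !mxcurve_cst.
  by rewrite mul0mx mulmx0 add0r addr0 (exp_dcurve _ dNn) scale0r expm0 mul1mx.
have iterE j t0 : iter j (fun v : 'rV_D => v *m (dS + dN) - t0 *: v) (e *m P t0) = e *m P t0 *m dN ^+ j.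
  elim: j => [|j IH]; first by rewrite expr0 mulmx1.
  rewrite iterS IH exprSr -mulmxE mulmxDr mulmxA.
  have -> : e *m P t0 *m dN ^+ j *m dS = t0 *: (e *m P t0 *m dN ^+ j).
    have cc : dN ^+ j *m dS = dS *m dN ^+ j by rewrite mulmxE; apply/commr_sym/commrX.
    by rewrite -mulmxA cc mulmxA -[e *m _ *m dS]mulmxA PS -scalemxAr -scalemxAl.
  by rewrite addrC addKr.
move=> tv; apply: (@spectral_split C 'rV_D (mulmxr (dS + dN)) (ann rho c) _ _ vals (fun=> D)
  (fun t => e *m P t)) tv => [a u v hu hv|v hv||t0 _|].
- exact: lA.2.
- by rewrite /= -(drhoD hr); apply: (ann_lie hr).
- exact: undup_uniq.
- by rewrite /= iterE dNn mulmx0; exact: lA.1.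
- rewrite -mulmx_sumr.
  have := sumE (fun=> 1); rewrite (eq_bigr P) => [<-|u _]; last by rewrite scale1r.
  have -> : \row_(a < D) (1 : C) = const_mx 1 by apply/rowP => a; rewrite !mxE.
  by rewrite diag_const_mx mulmx1 mulVmx // mulmx1.
Qed.

Lemma lie_semisimple : lie K (tdiag g s).
Proof.
move=> p hp; rewrite -/(tangent p 1%:M _).
have pf : is_poly (polyfun p) by exists p.
have [D [rho [wt [e [c [hr he]]]]]] := rep_exists pf.
rewrite (drho_tangent hr _ he) (drho_tdiag hr gu).
have ae : ann rho c e by move=> k Kk; rewrite -he hp.
have := @ann_fun _ _ _ hr c id e ae _ (sg1 sK).
by rewrite (rep1 hr) mulmx1.
Qed.

(** Chevalley's replicas at the level of the group: the hypothesis makes the action of [tdiag g d]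
    in every representation a function of the eigenvalues of the differential of [tdiag g s], so
    that [ann_fun] applies. *)
Lemma replica_mem (d : 'rV[C]_n) : (forall j, d 0 j != 0) ->
  (forall w w' : 'I_n -> nat, \sum_j (w j)%:R * s 0 j = \sum_j (w' j)%:R * s 0 j ->
     \prod_j d 0 j ^+ w j = \prod_j d 0 j ^+ w' j) -> K (tdiag g d).
Proof.
move=> d0 hd; apply: alg_mem_ann.
  rewrite tdiagE !unitmx_mul unitmx_inv gu andbT /= unitmxE det_diag unitfE.
  by apply/prodf_neq0 => j _.
move=> D rho wt c hr e he; rewrite (rep_tdiag hr gu).
pose phi t := if [pick a | \sum_j (wt a j)%:R * s 0 j == t] is Some a then weight_row wt d 0 a else 0.
have := @ann_fun _ _ _ hr c phi e he.
suff -> : \row_a phi (\sum_j (wt a j)%:R * s 0 j) = weight_row wt d by [].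
apply/rowP => a; rewrite mxE /phi; case: pickP => [b /eqP E|/(_ a)]; last by rewrite eqxx.
by rewrite !mxE; apply: hd.
Qed.

End Replicas.

(** The differentials at 1 of the equations of [K] span all covectors, so some polynomial [h] is 1
    at the identity and 0 elsewhere on [K]. Written as a matrix coefficient of dimension [D], the
    function [h (x y^-1)] factors the identity matrix on any list of points of [K] through [D]
    dimensions, so [K] has at most [D] points. *)
Lemma lie0_finite : (forall X, lie K X -> X = 0) -> finite_set K.
Proof.
move=> h0.
pose I p := forall x, K x -> polyfun p x = 0.
pose grad (p : mpoly (n * n) C) : 'rV[C]_(n * n) := \row_k polyfun (mderiv k p) 1%:M.
pose G : set 'rV[C]_(n * n) := [set u | exists2 p, I p & u = grad p].
have lG : linset G.
  split.
    exists 0 => [x _|]; first by rewrite /polyfun meval0.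
    by apply/rowP => k; rewrite !mxE mderiv0 /polyfun meval0.
  move=> a u v [p hp ->] [q hq ->]; exists (mpolyC _ a * p + q).
    by move=> x Kx; rewrite polyfunD polyfunM hp // hq // mulr0 addr0.
  apply/rowP => k; rewrite !mxE mderivD mderiv_mulC polyfunD polyfunM.
  by congr (_ * _ + _); rewrite /polyfun mevalC.
have fG : forall u, G u.
  apply: linset_full lG _ => A hA; pose X := vec_mx A^T.
  have : lie K X.
    move=> p hp; have /(congr1 (fun B : 'M_1 => B 0 0)) := hA (grad p) (ex_intro2 _ _ p hp erefl).
    rewrite !mxE => E; rewrite -[RHS]E; apply: eq_bigr => k _.
    by rewrite vec_mxK !mxE.
  by move/h0 => X0; apply/trmx_inj; rewrite -[A^T]vec_mxK -/X X0 linear0 trmx0.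
have fk k : exists2 b : 'I_(n * n) -> M -> C, forall l, is_poly (b l) &
    (forall x, K x -> \sum_l b l x * mxvec (x - 1%:M) 0 l = 0) /\
    (forall l, b l 1%:M = (k == l)%:R).
  have [p hp pE] := fG (delta_mx 0 k); have [b pb [h1 h2]] := hadamard p; exists b => //.
  split=> [x Kx|l]; first by have := h1 x; rewrite (hp x Kx) (hp _ (sg1 sK)) add0r.
  by rewrite h2; have /rowP/(_ l) := pE; rewrite !mxE eqxx /= eq_sym.
pose b k := xget (fun _ _ => 0) [set b : 'I_(n * n) -> M -> C | [/\ forall l, is_poly (b l),
    (forall x, K x -> \sum_l b l x * mxvec (x - 1%:M) 0 l = 0) &
    (forall l, b l 1%:M = (k == l)%:R)]].
have bP k : [/\ forall l, is_poly (b k l),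
    (forall x, K x -> \sum_l b k l x * mxvec (x - 1%:M) 0 l = 0) &
    (forall l, b k l 1%:M = (k == l)%:R)].
  by rewrite /b; case: xgetP => [//|hn]; have [b0 p0 [p1 p2]] := fk k; case: (hn b0).
pose B x : 'M[C]_(n * n) := \matrix_(k, l) b k l x.
(* For [x] in [K] the matrix [B x] kills the vector [x - 1], and [B 1] is the identity. *)
pose h x := \det (B x).
have ph : is_poly h.
  by apply: is_poly_det => k l; have [pb _ _] := bP k; apply: (is_poly_ext _ (pb l)) => x; rewrite mxE.
have h1 : h 1%:M = 1.
  have B1 : B 1%:M = 1%:M by apply/matrixP => k l; rewrite !mxE; case: (bP k).
  by rewrite /h B1 det1.
have hK x : K x -> x != 1%:M -> h x = 0.
  move=> Kx x1; apply: contraNeq x1 => hx; rewrite -subr_eq0.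
  have Bv : B x *m (mxvec (x - 1%:M))^T = 0.
    apply/matrixP => k l; rewrite [RHS]mxE [LHS]mxE.
    by case: (bP k) => _ h2 _; rewrite -[RHS](h2 _ Kx); apply: eq_bigr => m _; rewrite !mxE !ord1.
  have : \adj (B x) *m (B x *m (mxvec (x - 1%:M))^T) = 0 by rewrite Bv mulmx0.
  rewrite mulmxA mul_adj_mx mul_scalar_mx => /eqP; rewrite scaler_eq0 (negbTE hx) /=.
  by rewrite trmx_eq0 mxvec_eq0.
have [D [rho [wt [e [c [hr he]]]]]] := rep_exists ph.
apply: (@finite_set_bound _ K D) => s us hs; pose N := size s.
pose si (i : 'I_N) := s`_i.
have Ksi i : K (si i) by apply: hs; apply: mem_nth.
pose U : 'M[C]_(N, D) := \matrix_(i, a) (e *m rho (si i)) 0 a.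
pose V : 'M[C]_(D, N) := \matrix_(a, j) (rho (invmx (si j)) *m c) a 0.
have UV : U *m V = 1%:M.
  apply/matrixP => i j; rewrite [RHS]mxE; transitivity (h (si i *m invmx (si j))).
    rewrite he (repM hr) !mulmxA -[_ *m c]mulmxA [RHS]mxE [LHS]mxE.
    by apply: eq_bigr => a _; rewrite !mxE.
  have [->|ij] := eqVneq i j; first by rewrite mulmxV ?h1 // (sg_unit sK (Ksi j)).
  apply: hK; first by apply: sgM => //; apply: sgV.
  apply: contraNneq ij => /(congr1 (fun z => z *m si j)).
  rewrite mulmxKV ?(sg_unit sK (Ksi j)) // mul1mx => /eqP.
  by rewrite /si nth_uniq.
have rN : \rank (U *m V) = N by rewrite UV mxrank1.
apply: (@leq_trans (\rank (U *m V))); first by rewrite rN.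
by apply: leq_trans (mxrankM_maxl _ _) _; apply: rank_leq_col.
Qed.

End LieGroups.

Lemma mxBE (V : zmodType) p q (A B : 'M[V]_(p, q)) i j : (A - B) i j = A i j - B i j.
Proof. by rewrite !mxE. Qed.

(** * Matrices graded by rational weights *)

Section Weights.
Variables (F : numFieldType) (n : nat) (la : 'I_n -> rat).
Implicit Types (A B : 'M[F]_n).

(** Entry [(i, j)] is given the weight [la i - la j]; the three predicates allow nonnegative,
    positive and zero weights only. *)
Definition wle A := forall i j, A i j != 0 -> la j <= la i.
Definition wlt A := forall i j, A i j != 0 -> la j < la i.
Definition weq A := forall i j, A i j != 0 -> la j = la i.

Lemma mulmx_neq0 A B i j : (A *m B) i j != 0 -> exists k, A i k != 0 /\ B k j != 0.
Proof.
rewrite mxE => h; apply: contrapT => hn; move: h; rewrite big1 ?eqxx // => k _.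
have [->|Ak] := eqVneq (A i k) 0; first by rewrite mul0r.
have [->|Bk] := eqVneq (B k j) 0; first by rewrite mulr0.
by case: hn; exists k.
Qed.

Lemma addmx_neq0 A B i j : (A + B) i j != 0 -> A i j != 0 \/ B i j != 0.
Proof.
rewrite mxE => h; have [A0|] := eqVneq (A i j) 0; last by left.
by right; move: h; rewrite A0 add0r.
Qed.

Lemma wle1 : wle 1%:M.
Proof. by move=> i j; rewrite mxE; case: (i =P j) => [->//|_]; rewrite eqxx. Qed.

Lemma wleM A B : wle A -> wle B -> wle (A *m B).
Proof. by move=> hA hB i j /mulmx_neq0[k [/hA ki /hB jk]]; apply: le_trans ki. Qed.

Lemma wleD A B : wle A -> wle B -> wle (A + B).
Proof. by move=> hA hB i j /addmx_neq0[/hA|/hB]. Qed.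

Lemma wlt_wle A : wlt A -> wle A.
Proof. by move=> hA i j /hA/ltW. Qed.

Lemma weq_wle A : weq A -> wle A.
Proof. by move=> hA i j /hA ->. Qed.

Lemma wltD A B : wlt A -> wlt B -> wlt (A + B).
Proof. by move=> hA hB i j /addmx_neq0[/hA|/hB]. Qed.

Lemma wltZ a A : wlt A -> wlt (a *: A).
Proof. by move=> hA i j; rewrite mxE mulf_eq0 negb_or => /andP[_ /hA]. Qed.

Lemma wltMl A B : wlt A -> wle B -> wlt (A *m B).
Proof. by move=> hA hB i j /mulmx_neq0[k [/hA ki /hB jk]]; apply: le_lt_trans ki. Qed.

Lemma wltMr A B : wle A -> wlt B -> wlt (A *m B).
Proof. by move=> hA hB i j /mulmx_neq0[k [/hA ki /hB jk]]; apply: lt_le_trans ki. Qed.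

Definition wdiag A : 'M[F]_n := \matrix_(i, j) (if la i == la j then A i j else 0).

Lemma wdiag_weq A : weq (wdiag A).
Proof. by move=> i j; rewrite mxE; case: (la i =P la j) => [->//|_]; rewrite eqxx. Qed.

Lemma wdiag_id A : weq A -> wdiag A = A.
Proof.
move=> hA; apply/matrixP => i j; rewrite mxE; case: eqP => // h.
by apply/esym/eqP/negPn/negP => /hA ij; apply: h.
Qed.

Lemma wdiag_wlt A : wle A -> wlt (A - wdiag A).
Proof.
move=> hA i j; rewrite !mxE; case: (la i =P la j) => [_|ij]; first by rewrite subrr eqxx.
by rewrite subr0 => /hA; rewrite lt_neqAle => ->; rewrite andbT eq_sym; apply/eqP.
Qed.

Definition wmx : 'M[F]_n := diag_mx (\row_i ratr (la i)).

Lemma weqP A : weq A <-> A *m wmx = wmx *m A.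
Proof.
split=> [hA|E i j Aij].
  apply/matrixP => i j; rewrite mul_mx_diag mul_diag_mx !mxE.
  have [->|/hA ->] := eqVneq (A i j) 0; first by rewrite mul0r mulr0.
  by rewrite mulrC.
have /matrixP/(_ i j) := E; rewrite mul_mx_diag mul_diag_mx !mxE mulrC.
by move/(mulIf Aij)/fmorph_inj.
Qed.

Lemma weq_inv A : A \in unitmx -> weq A -> weq (invmx A).
Proof.
move=> Au /weqP h; apply/weqP; apply: (can_inj (mulKmx Au)) => /=.
by rewrite mulmxA mulmxV // mul1mx mulmxA h -mulmxA mulmxV // mulmx1.
Qed.

(* The image of [q] is stable under [B], hence under its inverse. *)
Lemma wle_inv A : A \in unitmx -> wle A -> wle (invmx A).
Proof.
move=> Au hA i j; apply: contraNT; rewrite -ltNge => ij.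
pose q : 'M[F]_n := diag_mx (\row_k (la k <= la i)%R%:R).
have h1 : (q *m A <= q)%MS.
  suff -> : q *m A = q *m A *m q by apply: submxMl.
  apply/matrixP => k l; rewrite mul_mx_diag !mul_diag_mx !mxE.
  case ki: (la k <= la i); last by rewrite mul0r mul0r.
  have [->|/hA kl] := eqVneq (A k l) 0; first by rewrite mulr0 mul0r.
  by rewrite (le_trans kl ki) !mul1r mulr1.
have h2 : (q <= q *m A)%MS.
  by rewrite -(geq_leqif (mxrank_leqif_sup h1)) mxrankMfree // row_free_unit.
have /submxP[w E] : (q *m invmx A <= q)%MS.
  by rewrite -[X in (_ <= X)%MS](mulmxK Au); apply: submxMr.
have /matrixP/(_ i j) := E; rewrite mul_diag_mx mul_mx_diag !mxE lexx mul1r => ->.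
by rewrite leNgt ij mulr0.
Qed.

(** A nonzero entry of the [k]-th power in row [i] requires a strictly descending chain, hence [k]
    indices of weight below [la i]. *)
Lemma wlt_nilpotent A : wlt A -> A ^+ n = 0.
Proof.
move=> hA; apply: (nilpotent_facts (k := n.+1) _).1.
have h k i j : (A ^+ k) i j != 0 -> (k <= #|[pred l : 'I_n | (la l < la i)%R]|)%N.
  elim: k i j => [//|k IH] i j; rewrite exprS => /mulmx_neq0[l [/hA li /IH]].
  move=> kl; apply: leq_ltn_trans kl _; apply: proper_card; apply/properP; split.
    by apply/fintype.subsetP => x; rewrite !inE => /lt_trans; apply.
  by exists l; rewrite inE ?li ?ltxx.
apply/matrixP => i j; rewrite [RHS]mxE; apply/eqP/negPn/negP => /h hc.
by have := max_card [pred l | (la l < la i)%R]; rewrite card_ord leqNgt hc.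
Qed.

End Weights.

(** * Limits along a cocharacter; parabolic, Levi and unipotent parts of a group *)

Section BigCell.
Variables (R : realType) (n : nat).
Local Notation C := R[i].
Local Notation M := 'M[C]_n.
Implicit Types (x y u X Y Z : M).
Variables (g : M) (gu : g \in unitmx).

Fact ent_key : unit. Proof. by []. Qed.
Fact deform_key : unit. Proof. by []. Qed.

(** The matrix in the coordinates given by [g], in which the torus of interest becomes diagonal. *)
Definition ent x : M := locked_with ent_key (g *m x *m invmx g).
Definition unent x : M := locked_with ent_key (invmx g *m x *m g).

Lemma entE x : ent x = g *m x *m invmx g.
Proof. by rewrite /ent; case: ent_key. Qed.

Lemma unentE x : unent x = invmx g *m x *m g.
Proof. by rewrite /unent; case: ent_key. Qed.

Lemma entK x : unent (ent x) = x.
Proof. by rewrite !unentE !entE !mulmxA mulVmx // mul1mx mulmxKV. Qed.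

Lemma unentK x : ent (unent x) = x.
Proof. by rewrite !unentE !entE !mulmxA mulmxV // mul1mx mulmxK. Qed.

Lemma entM x y : ent (x *m y) = ent x *m ent y.
Proof. by rewrite !entE -!mulmxA mulKmx. Qed.

Lemma entD x y : ent (x + y) = ent x + ent y.
Proof. by rewrite !entE mulmxDr mulmxDl. Qed.

Lemma entB x y : ent (x - y) = ent x - ent y.
Proof. by rewrite !entE mulmxBr mulmxBl. Qed.

Lemma entZ a x : ent (a *: x) = a *: ent x.
Proof. by rewrite !entE -scalemxAr -scalemxAl. Qed.

Lemma ent0 : ent 0 = 0.
Proof. by rewrite !entE mulmx0 mul0mx. Qed.

Lemma ent1 : ent 1%:M = 1%:M.
Proof. by rewrite !entE mulmx1 mulmxV. Qed.

Lemma entX x k : ent (x ^+ k) = ent x ^+ k.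
Proof.
elim: k => [|k IH]; first by rewrite !expr0 ent1.
by rewrite !exprS -!mulmxE entM IH.
Qed.

Lemma ent_sum (I : Type) (r : seq I) (P : pred I) (f : I -> M) :
  ent (\sum_(i <- r | P i) f i) = \sum_(i <- r | P i) ent (f i).
Proof.
by rewrite entE mulmx_sumr mulmx_suml; apply: eq_bigr => i _; rewrite entE.
Qed.

Lemma ent_unit x : (ent x \in unitmx) = (x \in unitmx).
Proof. by rewrite !entE !unitmx_mul unitmx_inv gu andbT. Qed.

Lemma unent_unit x : (unent x \in unitmx) = (x \in unitmx).
Proof. by rewrite !unentE !unitmx_mul unitmx_inv gu andbT. Qed.

Lemma ent_inj x y : ent x = ent y -> x = y.
Proof. by move=> E; rewrite -[x]entK E entK. Qed.

Lemma ent_neq0 x : x != 0 -> exists i j, ent x i j != 0.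
Proof.
move=> x0; apply: contrapT => ne; move/eqP: x0; apply; apply: ent_inj; rewrite ent0.
by apply/matrixP => i j; rewrite [RHS]mxE; apply: contrapT => /eqP h; apply: ne; exists i, j.
Qed.

Lemma ent_inv x : x \in unitmx -> ent (invmx x) = invmx (ent x).
Proof.
move=> xu; apply: (can_inj (mulKmx (x := ent x) _)); first by rewrite ent_unit.
by rewrite /= -entM !mulmxV ?ent_unit // ent1.
Qed.

Lemma ent_tdiag s : ent (tdiag g s) = diag_mx s.
Proof. by rewrite tdiagE -unentE unentK. Qed.

Lemma det_ent x : \det (ent x) = \det x.
Proof. by rewrite !entE !det_mulmx mulrAC -det_mulmx mulmxV // det1 mul1r. Qed.

Lemma is_polymx_ent : is_polymx ent.
Proof.
move=> i j; apply: (@is_poly_ext _ _ (fun x => (g *m x *m invmx g) i j)) => [x|].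
  by rewrite entE.
apply: is_polymxM; last exact: is_polymx_cst.
by apply: is_polymxM; [exact: is_polymx_cst | exact: is_polymx_id].
Qed.

Lemma is_polymx_unent (F : M -> M) : is_polymx F -> is_polymx (fun x => unent (F x)).
Proof.
move=> hF i j; apply: (@is_poly_ext _ _ (fun x => (invmx g *m F x *m g) i j)) => [x|].
  by rewrite unentE.
apply: is_polymxM; last exact: is_polymx_cst.
by apply: is_polymxM; first exact: is_polymx_cst.
Qed.

Lemma expm_ent X : ent (expm X) = expm (ent X).
Proof. by rewrite !entE expm_conj. Qed.

Lemma ent_expm_wlt la X : wlt la (ent X) -> X ^+ n = 0.
Proof.
move=> /wlt_nilpotent h; apply: ent_inj; rewrite ent0 -h.
by rewrite entX.
Qed.

Lemma ent_cochar m c : ent (cochar g m c) = diag_mx (\row_j (c ^ m j)).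
Proof. by rewrite cocharE ent_tdiag. Qed.

Lemma cochar_unit m c : c != 0 -> cochar g m c \in unitmx.
Proof.
move=> c0; rewrite -ent_unit ent_cochar unitmxE det_diag unitfE.
by apply/prodf_neq0 => j _; rewrite mxE expfz_neq0.
Qed.

Lemma rep_cochar D (rho : M -> 'M[C]_D) wt (hr : is_rep rho wt) m c :
  rho (cochar g m c) = invmx (rho g) *m diag_mx (weight_row wt (\row_j (c ^ m j))) *m rho g.
Proof. by rewrite cocharE (rep_tdiag hr gu). Qed.

(** For [t] nonzero and [x] of nonnegative weights this is the conjugate of [x] by [cochar g m t].
    The absolute value of the exponent makes it polynomial in [t], so that the limit at [t = 0] is
    defined. *)
Definition deform (m : 'I_n -> int) x (t : C) : M :=
  locked_with deform_key (unent (\matrix_(i, j) (ent x i j * t ^+ absz (m i - m j)))).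

Lemma deformE0 m x t :
  deform m x t = unent (\matrix_(i, j) (ent x i j * t ^+ absz (m i - m j))).
Proof. by rewrite /deform; case: deform_key. Qed.

Lemma ent_deform m x t :
  ent (deform m x t) = \matrix_(i, j) (ent x i j * t ^+ absz (m i - m j)).
Proof. by rewrite deformE0 unentK. Qed.

Lemma deform_uni m x i j : is_uni (fun t => deform m x t i j).
Proof.
apply: (@is_uni_ext _ (fun t => \sum_l (\sum_k invmx g i k *
  (ent x k l * t ^+ absz (m k - m l))) * g l j)).
  move=> t; rewrite deformE0 unentE mxE; apply: eq_bigr => l _; rewrite mxE; congr (_ * _).
  by apply: eq_bigr => k _; rewrite [in RHS]mxE.
apply: is_uni_sum => l _; apply: is_uniM; last exact: is_uni_cst.
apply: is_uni_sum => k _; apply: is_uniM; first exact: is_uni_cst.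
by apply: is_uniM; [exact: is_uni_cst | apply/is_uniX/is_uni_id].
Qed.

Definition ile (m : 'I_n -> int) x := forall i j, ent x i j != 0 -> m j <= m i.

Lemma deformE m x t : ile m x -> t != 0 -> cochar g m t *m x = deform m x t *m cochar g m t.
Proof.
move=> hx t0; apply: ent_inj; rewrite !entM ent_deform ent_cochar.
apply/matrixP => i j; rewrite mul_diag_mx mul_mx_diag !mxE.
have [->|xij] := eqVneq (ent x i j) 0; first by rewrite mulr0 !mul0r.
rewrite mulrC -mulrA; congr (_ * _); rewrite exprnP -expfzDr //; congr (_ ^ _).
by have := hx _ _ xij; lia.
Qed.

Lemma deform0 m x la : (forall i j, (m i == m j) = (la i == la j)) ->
  deform m x 0 = unent (wdiag la (ent x)).
Proof.
move=> h; apply: ent_inj; rewrite ent_deform unentK; apply/matrixP => i j; rewrite !mxE expr0n absz_eq0 subr_eq0 h.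
by case: ifP; rewrite ?mulr1 ?mulr0.
Qed.

(** The determinant is constant away from 0, hence everywhere, so the limit at [t = 0] is still
    invertible. *)
Lemma det_deform m x : ile m x -> forall t, \det (deform m x t) = \det x.
Proof.
move=> hx; have [q hq] : is_uni (fun t => \det (deform m x t)).
  apply: (is_poly_uni (f := fun y => \det y)) => [|i j]; last exact: deform_uni.
  exact/is_poly_det/is_polymx_id.
have : is_uni (fun t => \det (deform m x t) - \det x).
  by exists (q - (\det x)%:P) => t; rewrite hq !hornerE.
move/is_uni_zero => h t; apply/eqP; rewrite -subr_eq0; apply/eqP; apply: h => {}t t0.
have E := congr1 determinant (deformE hx t0).
rewrite (det_mulmx (cochar g m t)) (det_mulmx (deform m x t)) mulrC in E.
have c0 : \det (cochar g m t) != 0 by rewrite -unitfE -unitmxE cochar_unit.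
by rewrite (mulIf c0 E) subrr.
Qed.

Section RepOrder.
Variables (D : nat) (rho : M -> 'M[C]_D) (wt : 'I_D -> 'I_n -> nat) (hr : is_rep rho wt).
Variable (m : 'I_n -> int).
Let mu a := \sum_j (wt a j)%:Z * m j.
Let A := rho g.
Let r x := A *m rho x *m invmx A.
Let Au : A \in unitmx := rep_unit hr gu.

Let r_deform x t a b : ile m x -> t != 0 ->
  t ^ mu a * r x a b = r (deform m x t) a b * t ^ mu b.
Proof.
move=> hx t0; have := congr1 rho (deformE hx t0); rewrite !(repM hr) (rep_cochar hr).
set W := diag_mx _ => E.
have : W *m r x = r (deform m x t) *m W.
  apply: (can_inj (mulKmx (x := invmx A) _)); first by rewrite unitmx_inv.
  apply: (can_inj (mulmxK Au)) => /=; rewrite /r !mulmxA mulVmx // mul1mx.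
  by rewrite !mulmxKV // E !mulmxA.
move/matrixP/(_ a b); rewrite mul_diag_mx mul_mx_diag !mxE.
have := weight_row_cochar wt m a t0; have := weight_row_cochar wt m b t0.
by rewrite [LHS]mxE => ->; rewrite [LHS]mxE => ->.
Qed.

Let r_uni x a b : is_uni (fun t => r (deform m x t) a b).
Proof.
apply: (is_poly_uni (f := fun y => r y a b)) => [|i j]; last exact: deform_uni.
apply: is_polymxM; last exact: is_polymx_cst.
by apply: is_polymxM; [exact: is_polymx_cst | exact: rep_poly hr].
Qed.

(** The conjugation formula is a polynomial identity in [t]; at [t = 0] a positive power of [t]
    would kill the entry. *)
Lemma rep_ile x a b : ile m x -> r x a b != 0 -> mu b <= mu a.
Proof.
move=> hx; apply: contraNT; rewrite -ltNge => ab; apply/eqP.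
have h (t : C) : r (deform m x t) a b * t ^+ absz (mu b - mu a) + (- r x a b) = 0.
  apply: (is_uni_zero (g := fun t => r (deform m x t) a b * t ^+ absz (mu b - mu a) + (- r x a b))).
    apply: is_uniD; last exact: is_uni_cst.
    by apply: is_uniM; [exact: r_uni | apply/is_uniX/is_uni_id].
  move=> {}t t0; apply/eqP; rewrite subr_eq0; apply/eqP.
  have ta : t ^ mu a != 0 by apply: expfz_neq0.
  apply: (mulfI ta); rewrite (r_deform a b hx t0) mulrC -mulrA; congr (_ * _).
  by rewrite exprnP -expfzDr //; congr (_ ^ _); lia.
have := h 0; rewrite expr0n absz_eq0 subr_eq0; case: eqP => [E|_]; first by rewrite E ltxx in ab.
by rewrite mulr0 add0r => /eqP; rewrite oppr_eq0 => /eqP.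
Qed.

Lemma rep_ilt x a b : (forall i j, ent (x - 1%:M) i j != 0 -> m j < m i) ->
  (r x - 1%:M) a b != 0 -> mu b < mu a.
Proof.
move=> hx; have hx' : ile m x.
  move=> i j; have -> : x = (x - 1%:M) + 1%:M by rewrite subrK.
  rewrite entD ent1 => /addmx_neq0[/hx/ltW //|]; rewrite mxE.
  by case: (i =P j) => [->//|_]; rewrite eqxx.
have x0 : deform m x 0 = 1%:M.
  apply: ent_inj; rewrite ent_deform ent1; apply/matrixP => i j; rewrite !mxE.
  rewrite expr0n absz_eq0 subr_eq0; have := hx i j; rewrite entB ent1 !mxE.
  case: (m i =P m j) => [E|ij] h.
    rewrite mulr1; apply/eqP; rewrite -subr_eq0; apply/negPn/negP => /h.
    by rewrite E ltxx.
  by rewrite mulr0; case: eqP => // E; case: ij; rewrite E.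
have r1 : r 1%:M = 1%:M by rewrite /r (rep1 hr) mulmx1 mulmxV.
have [E|ne] := eqVneq (mu a) (mu b); last first.
  rewrite mxBE => h; rewrite lt_neqAle eq_sym ne /=; apply: (rep_ile hx').
  apply: contraNneq h => ->; rewrite [1%:M a b]mxE.
  have [ab|_] := eqVneq a b; last by rewrite subrr.
  by rewrite ab eqxx in ne.
have h (t : C) : r (deform m x t) a b + (- r x a b) = 0.
  apply: (is_uni_zero (g := fun t => r (deform m x t) a b + (- r x a b))).
    by apply: is_uniD; [exact: r_uni | exact: is_uni_cst].
  move=> {}t t0; have ta : t ^ mu b != 0 by apply: expfz_neq0.
  have := r_deform a b hx' t0; rewrite E mulrC => /(mulIf ta) ->.
  by rewrite subrr.
have := h 0; rewrite x0 r1 => /eqP; rewrite subr_eq0 => /eqP E1.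
by rewrite mxBE -E1 subrr eqxx.
Qed.

End RepOrder.

Variables (K : set M) (aK : algebraic_group K).
Let sK := alg_subgroup aK.

(** Only a positive multiple of [la] has to be integral, so that the cocharacters of a torus form a
    rational vector space. *)
Definition ratcochar (la : 'I_n -> rat) := exists2 m : 'I_n -> int,
  (exists2 N : nat, (0 < N)%N & forall j, (m j)%:~R = N%:R * la j) &
  forall c, c != 0 -> K (cochar g m c).

(** For a cocharacter [la], these are the points of [K] whose conjugates by it have a limit at 0,
    are constant, or tend to the identity. *)
Definition Pgrp la := K `&` [set x | wle la (ent x)].
Definition Lgrp la := K `&` [set x | weq la (ent x)].
Definition Ugrp la := K `&` [set x | wlt la (ent (x - 1%:M))].
Definition negw (la : 'I_n -> rat) j := - la j.

Lemma ratcochar_le (la : 'I_n -> rat) (m : 'I_n -> int) (N : nat) i j : (0 < N)%N -> (forall j, (m j)%:~R = N%:R * la j) ->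
  ((m i <= m j) = (la i <= la j)) * ((m i == m j) = (la i == la j)).
Proof.
move=> N0 h; have Nr : 0 < N%:R :> rat by rewrite ltr0n.
split; first by rewrite -(ler_int rat) !h ler_pM2l.
by rewrite -(eqr_int rat) !h (inj_eq (mulfI _)) // gt_eqF.
Qed.

(* Factors of an element of K along opposite parabolics lie in K, since the
   annihilator of K in a representation is graded by the cocharacter. *)
Lemma opposite_factors la u (b : M) : ratcochar la -> u \in unitmx -> b \in unitmx ->
  wlt (negw la) (ent (u - 1%:M)) -> wle la (ent b) -> K (u *m b) -> K u /\ K b.
Proof.
move=> [m [N N0 hm] hK] uu bu hu hb Kub.
suff Ku : K u by split=> //; apply: sgMl Kub.
apply: (alg_mem_ann aK) => // D rho wt c hr e he.
pose A := rho g; have Au : A \in unitmx := rep_unit hr gu.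
pose G : set 'rV[C]_D := [set e | ann K rho c (e *m A)].
have lA := ann_linset K rho c.
have lG : linset G.
  split; first by rewrite /G /= mul0mx; case: lA.
  by move=> a v w hv hw; rewrite /G /= mulmxDl -scalemxAl; apply: lA.2.
have [B hB] := linset_mx lG.
pose mu a := \sum_j (wt a j)%:Z * m j.
have NuN := @graded_stable C D B (A *m rho u *m invmx A) (A *m rho b *m invmx A) mu.
have {NuN} NuN : (B *m (A *m rho u *m invmx A) <= B)%MS.
  apply: NuN.
  - move=> t; apply/row_subP => i; apply/hB.
    have hi : G (row i B) by apply/hB/row_sub.
    rewrite row_mul.
    exact: (@ann_cochar _ _ K aK D rho wt hr c g m (row i B) t gu hK hi).
  - by rewrite !unitmx_mul unitmx_inv Au (rep_unit hr).
  - by rewrite !unitmx_mul unitmx_inv Au (rep_unit hr).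
  - move=> a b' h.
    have sN (x : 'I_D) : \sum_j (wt x j)%:Z * - m j = - mu x.
      by rewrite -sumrN; apply: eq_bigr => j _; rewrite mulrN.
    rewrite -ltrN2 -!sN; apply: (@rep_ilt D rho wt hr (fun j => - m j) u a b') => [i j /hu|].
      by rewrite /negw !ltrN2 => ij; rewrite ltNge (ratcochar_le _ _ N0 hm) -ltNge.
    exact: h.
  - move=> a b' h; apply: (rep_ile hr (m := m) (x := b)) h => i j /hb.
    by rewrite (ratcochar_le _ _ N0 hm).
  - rewrite -mulmxA.
    have -> : A *m rho u *m invmx A *m (A *m rho b *m invmx A) = A *m rho (u *m b) *m invmx A.
      by rewrite (repM hr) !mulmxA mulmxKV.
    apply/row_subP => i; apply/hB; rewrite row_mul /G /= !mulmxA mulmxKV //.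
    by apply: (ann_stable aK hr) => //; apply/hB/row_sub.
have Ge : G (e *m invmx A) by rewrite /G /= mulmxKV.
have /hB : (e *m invmx A *m (A *m rho u *m invmx A) <= B)%MS.
  by apply: submx_trans NuN; apply: submxMr; apply/hB.
by rewrite /G /= !mulmxA !mulmxKV.
Qed.

(** The weight-zero part is the limit of the conjugates of [b]; an equation of [K] vanishes on these
    for [t] nonzero, hence at the limit. *)
Lemma levi_part la b : ratcochar la -> Pgrp la b -> Lgrp la (unent (wdiag la (ent b))).
Proof.
move=> [m [N N0 hm] hK] [Kb hb]; split; last by rewrite /= unentK; apply: wdiag_weq.
have hb' : ile m b by move=> i j /hb; rewrite (ratcochar_le _ _ N0 hm).
rewrite -(@deform0 m) => [|i j]; last by rewrite (ratcochar_le _ _ N0 hm).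
apply: (alg_mem aK) => [|f pf hf].
  by rewrite unitmxE det_deform // -unitmxE (sg_unit sK).
have uf : is_uni (fun t => f (deform m b t)) by apply: (is_poly_uni pf) => i j; apply: deform_uni.
apply: (is_uni_zero uf) => t t0; apply: hf.
have := deformE hb' t0 => E; apply: (sgMr sK (hK t t0)); rewrite -E.
exact: (sgM sK (hK t t0) Kb).
Qed.

Definition levi_proj la x := unent (wdiag la (ent x)).

Lemma levi_decomp la b : ratcochar la -> Pgrp la b ->
  exists2 u, Ugrp la u & b = levi_proj la b *m u.
Proof.
move=> hla hb; have hl := levi_part hla hb; rewrite -/(levi_proj la b) in hl.
set l := levi_proj la b in hl *.
have lu := sg_unit sK hl.1; exists (invmx l *m b); last by rewrite mulKVmx.
split; first by apply: sgM hb.1 => //; apply: sgV hl.1.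
rewrite /= -(mulVmx lu) -mulmxBr entM entB unentK ent_inv //; apply: wltMr.
  by apply/weq_wle/weq_inv; rewrite ?ent_unit //; case: hl.
by apply: wdiag_wlt; case: hb.
Qed.

End BigCell.

Lemma unipotent_unit (F : fieldType) n (N : 'M[F]_n) : N ^+ n = 0 -> 1%:M + N \in unitmx.
Proof.
move=> Nn; rewrite -row_free_unit -kermx_eq0; apply/eqP; set w := kermx _.
have E : w = w *m (- N).
  apply/eqP; rewrite mulmxN -subr_eq0 opprK -{1}[w]mulmx1 -mulmxDr mulmx_ker.
  exact: eqxx.
have Ek k : w = w *m (- N) ^+ k.
  elim: k => [|k IH]; first by rewrite expr0 mulmx1.
  by rewrite exprS -mulmxE mulmxA -E.
by rewrite (Ek n) exprNn Nn mulr0 mulmx0.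
Qed.

(** * Block elimination with respect to a weight *)

Section TriangularDecomposition.
Variables (F : numFieldType) (n : nat) (la : 'I_n -> rat).
Implicit Types (y A : 'M[F]_n).

Definition wvals : seq rat := undup (codom la).
Definition wabove t : 'M[F]_n := diag_mx (\row_k (t < la k)%R%:R).
Definition wproj t : 'M[F]_n := diag_mx (\row_k (la k == t)%:R).
(** The block of [y] on the indices of weight above [t], completed by the identity. With its
    inverse, [lower_elim] clears from the rows of weight [t] all columns of larger weight, as in
    Gaussian elimination. *)
Definition minor_mx t y := wabove t *m y *m wabove t + (1%:M - wabove t).
Definition lower_elim y :=
  1%:M - \sum_(t <- wvals) wproj t *m y *m wabove t *m invmx (minor_mx t y).

Let aboveE t A i j : (wabove t *m A) i j = (t < la i)%R%:R * A i j.
Proof. by rewrite mul_diag_mx !mxE. Qed.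

Let aboveEr t A i j : (A *m wabove t) i j = A i j * (t < la j)%R%:R.
Proof. by rewrite mul_mx_diag !mxE. Qed.

Let projE t A i j : (wproj t *m A) i j = (la i == t)%:R * A i j.
Proof. by rewrite mul_diag_mx !mxE. Qed.

Let aboveM t : wabove t *m wabove t = wabove t.
Proof.
apply/matrixP => i j; rewrite aboveE !mxE; case: (i =P j) => [->|_]; last by rewrite !mulr0n mulr0.
by case: (_ < _)%R; rewrite !mulr1n ?mulr1 ?mulr0.
Qed.

Let minorq t y : minor_mx t y *m wabove t = wabove t *m y *m wabove t.
Proof. by rewrite mulmxDl mulmxBl mul1mx aboveM subrr addr0 -mulmxA aboveM. Qed.

Let qminor t y : wabove t *m minor_mx t y = wabove t *m y *m wabove t.
Proof. by rewrite mulmxDr mulmxBr mulmx1 aboveM subrr addr0 !mulmxA aboveM. Qed.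

Let qinv t y : minor_mx t y \in unitmx ->
  wabove t *m invmx (minor_mx t y) = invmx (minor_mx t y) *m wabove t.
Proof.
move=> u; apply: (can_inj (mulKmx u)); rewrite mulmxA minorq -qminor.
by rewrite -mulmxA mulmxV // mulmx1 mulKVmx.
Qed.

Lemma lower_elim_lower y : (forall t, t \in wvals -> minor_mx t y \in unitmx) ->
  wlt (negw la) (lower_elim y - 1%:M).
Proof.
move=> hu i j; rewrite /lower_elim addrAC subrr add0r mxE oppr_eq0 summxE => h.
have [t tv h'] : exists2 t, t \in wvals &
    (wproj t *m y *m wabove t *m invmx (minor_mx t y)) i j != 0.
  apply: contrapT => hn; move: h; rewrite big_seq big1 ?eqxx // => t tv.
  by apply/eqP/negPn/negP => h; apply: hn; exists t.
have h2 : (wproj t *m (y *m invmx (minor_mx t y)) *m wabove t) i j != 0.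
  by rewrite -!mulmxA -(qinv (hu t tv)) !mulmxA.
move: h2; rewrite aboveEr projE; case: (la i =P t) => [<-|_]; last by rewrite !mul0r eqxx.
case tj: (la i < la j)%R; last by rewrite mulr0 eqxx.
by rewrite /negw ltrN2.
Qed.

Lemma lower_elim_upper y : (forall t, t \in wvals -> minor_mx t y \in unitmx) ->
  wle la (lower_elim y *m y).
Proof.
move=> hu i j; rewrite leNgt; apply: contraNN => ij.
pose t := la i; have tv : t \in wvals by rewrite mem_undup codom_f.
have pv : wproj t *m lower_elim y
    = wproj t - wproj t *m y *m wabove t *m invmx (minor_mx t y).
  rewrite mulmxBr mulmx1; congr (_ - _); rewrite mulmx_sumr (bigD1_seq t) ?undup_uniq //=.
  rewrite big1 ?addr0 => [|s st].
    rewrite !mulmxA; congr (_ *m _ *m _ *m _); apply/matrixP => k l.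
    by rewrite projE !mxE; case: (_ == t); rewrite ?mul1r // mul0r mul0rn.
  rewrite !mulmxA; have -> : wproj t *m wproj s = 0; last by rewrite !mul0mx.
  apply/matrixP => k l; rewrite projE !mxE; case: eqP => [->|_]; last by rewrite mul0r.
  by rewrite eq_sym (negbTE st) mul0rn mulr0.
have E : wproj t *m (lower_elim y *m y) *m wabove t = 0.
  rewrite mulmxA pv mulmxBl mulmxBl -!mulmxA.
  have -> : wabove t *m (invmx (minor_mx t y) *m (y *m wabove t)) = wabove t.
    rewrite mulmxA qinv ?hu // -[invmx _ *m _ *m _]mulmxA [wabove t *m _]mulmxA -minorq.
    by rewrite mulKmx // hu.
  by rewrite subrr.
have /matrixP/(_ i j) := E; rewrite aboveEr projE eqxx mul1r ij mulr1 mxE => ->.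
by rewrite mxE.
Qed.

Lemma lower_elim_unit y : (forall t, t \in wvals -> minor_mx t y \in unitmx) ->
  lower_elim y \in unitmx.
Proof.
move=> hu; have := wlt_nilpotent (lower_elim_lower hu).
by move/unipotent_unit; rewrite addrC subrK.
Qed.

Lemma weq_minor t y : y \in unitmx -> weq la y -> minor_mx t y \in unitmx.
Proof.
move=> yu hy; have cq z : weq la z -> wabove t *m z = z *m wabove t.
  move=> hz; apply/matrixP => i j; rewrite aboveE aboveEr.
  by have [->|/hz ->] := eqVneq (z i j) 0; rewrite ?mul0r ?mulr0 // mulrC.
have E : minor_mx t y *m minor_mx t (invmx y) = 1%:M.
  rewrite [X in _ *m X]/minor_mx mulmxDr mulmxBr mulmx1 !mulmxA minorq.
  have -> : wabove t *m y *m wabove t *m invmx y *m wabove t = wabove t.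
    by rewrite -(mulmxA _ (wabove t) (invmx y)) (cq _ (weq_inv yu hy)) !mulmxA mulmxK // !aboveM.
  by rewrite /minor_mx [X in _ + (X - _)]addrC addrK addrC subrK.
by have [] := mulmx1_unit E.
Qed.

Lemma weq_lower_elim y : weq la y -> lower_elim y = 1%:M.
Proof.
move=> hy; rewrite /lower_elim big1 ?subr0 // => t _.
have -> : wproj t *m y *m wabove t = 0; last by rewrite mul0mx.
apply/matrixP => i j; rewrite aboveEr projE mxE.
have [->|/hy ij] := eqVneq (y i j) 0; first by rewrite mulr0 mul0r.
case: eqP => [<-|_]; last by rewrite !mul0r.
by rewrite ij ltxx mulr0.
Qed.

End TriangularDecomposition.

(** * Rational functions with a fixed denominator and the big cell *)

Section RationalFunctions.
Variables (R : realType) (n : nat).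
Local Notation C := R[i].
Local Notation M := 'M[C]_n.
Variables (den : M -> C) (pden : is_poly den).

(** Regularity off the zeros of [den] is expressed by clearing a power of [den], so that
    nonvanishing tests can be carried out on polynomials. *)
Definition ratfun (f : M -> C) := exists N p, is_poly p /\
  forall x, den x != 0 -> den x ^+ N * f x = p x.

Lemma ratfun_ext f h : (forall x, den x != 0 -> f x = h x) -> ratfun f -> ratfun h.
Proof. by move=> fh [N [p [pp E]]]; exists N, p; split=> // x dx; rewrite -fh // E. Qed.

Lemma ratfun_poly f : is_poly f -> ratfun f.
Proof. by move=> pf; exists 0%N, f; split=> // x _; rewrite expr0 mul1r. Qed.

Lemma ratfunD f h : ratfun f -> ratfun h -> ratfun (fun x => f x + h x).
Proof.
move=> [N [p [pp E]]] [N' [p' [pp' E']]].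
exists (N + N')%N, (fun x => den x ^+ N' * p x + den x ^+ N * p' x); split.
  by apply: is_polyD; apply: is_polyM => //; apply: is_polyX.
move=> x dx; rewrite -E // -E' // exprD mulrDr; congr (_ + _); last by rewrite mulrA.
by rewrite mulrCA mulrA.
Qed.

Lemma ratfunM f h : ratfun f -> ratfun h -> ratfun (fun x => f x * h x).
Proof.
move=> [N [p [pp E]]] [N' [p' [pp' E']]].
exists (N + N')%N, (fun x => p x * p' x); split; first exact: is_polyM.
by move=> x dx; rewrite -E // -E' // exprD mulrACA.
Qed.

Lemma ratfun_sum (I : Type) (r : seq I) (P : pred I) (f : I -> M -> C) :
  (forall i, P i -> ratfun (f i)) -> ratfun (fun x => \sum_(i <- r | P i) f i x).
Proof.
move=> hf; elim: r => [|i r IH].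
  by apply: ratfun_ext (ratfun_poly (is_poly_cst _ 0)) => x _; rewrite big_nil.
case Pi: (P i); last by apply: ratfun_ext IH => x _; rewrite big_cons Pi.
by apply: ratfun_ext (ratfunD (hf _ Pi) IH) => x _; rewrite big_cons Pi.
Qed.

Definition ratmx (f : M -> M) := forall i j, ratfun (fun x => f x i j).

Lemma ratmxM f h : ratmx f -> ratmx h -> ratmx (fun x => f x *m h x).
Proof.
move=> hf hh i j; have E : ratfun (fun x => \sum_k f x i k * h x k j).
  by apply: ratfun_sum => k _; apply: ratfunM.
by apply: ratfun_ext E => x _; rewrite mxE.
Qed.

Lemma ratmx_poly f : is_polymx f -> ratmx f.
Proof. by move=> hf i j; apply: ratfun_poly. Qed.

Lemma ratmx_comp f (h : M -> M) : is_poly f -> ratmx h -> ratfun (fun x => f (h x)).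
Proof.
move=> pf hh; elim/is_poly_ind: f / pf => [f f' ff'|c|i j|f f' _ _|f f' _ _].
- by apply: ratfun_ext => x _ /=.
- exact/ratfun_poly/is_poly_cst.
- exact: hh.
- exact: ratfunD.
- exact: ratfunM.
Qed.

Lemma ratmx_inv f rest : is_polymx f -> is_poly rest ->
  (forall x, den x = \det (f x) * rest x) -> ratmx (fun x => invmx (f x)).
Proof.
move=> pf pr hd i j.
apply: (@ratfun_ext (fun x => (\det (f x))^-1 * (\adj (f x)) i j)) => [x|].
  rewrite hd mulf_eq0 negb_or => /andP[dx _].
  by rewrite /invmx unitmxE unitfE dx [RHS]mxE.
apply: ratfunM; last exact/ratfun_poly/is_polymx_adj.
exists 1%N, rest; split=> // x; rewrite expr1 hd mulf_eq0 negb_or => /andP[dx _].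
by rewrite mulrAC mulfV // mul1r.
Qed.

End RationalFunctions.

Section OpenCell.
Variables (R : realType) (n : nat).
Local Notation C := R[i].
Local Notation M := 'M[C]_n.
Variables (g : M) (gu : g \in unitmx).
Local Notation ent := (ent g).
Local Notation unent := (unent g).
Implicit Types (la : 'I_n -> rat).

(** Where it is nonzero, elimination succeeds and [cell_levi] is the middle factor of the resulting
    factorization. *)
Definition cell_den la (x : M) : C := \prod_(t <- wvals la) \det (minor_mx la t (ent x)).
Definition cell_levi la (x : M) : M := levi_proj g la (unent (lower_elim la (ent x)) *m x).

Let poly_minor la t : is_polymx (fun x : M => minor_mx la t (ent x)).
Proof.
apply: is_polymxD; last exact: is_polymx_cst.
apply: is_polymxM; last exact: is_polymx_cst.
by apply: is_polymxM; [exact: is_polymx_cst | exact: is_polymx_ent].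
Qed.

Lemma cell_den_poly la : is_poly (cell_den la).
Proof. by apply: is_poly_prod => t _; apply: is_poly_det; apply: poly_minor. Qed.

Let minor_unit la x : cell_den la x != 0 ->
  forall t, t \in wvals la -> minor_mx la t (ent x) \in unitmx.
Proof.
rewrite prodf_seq_neq0 => /allP h t /h /=.
by rewrite unitmxE unitfE.
Qed.

Lemma cell_levi_rat la : ratmx (cell_den la) (cell_levi la).
Proof.
have pd := cell_den_poly la.
have h1 t : t \in wvals la -> ratmx (cell_den la) (fun x => invmx (minor_mx la t (ent x))).
  move=> tv; apply: (ratmx_inv (rest := fun x => \prod_(s <- wvals la | s != t) \det (minor_mx la s (ent x)))).
  - exact: poly_minor.
  - by apply: is_poly_prod => s _; apply: is_poly_det; apply: poly_minor.
  - by move=> x; rewrite /cell_den (bigD1_seq t) ?undup_uniq.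
have h2 : ratmx (cell_den la) (fun x => lower_elim la (ent x)).
  move=> i j; apply: (@ratfun_ext _ _ _ (fun x => (1%:M : M) i j
    + (-1) * \sum_(t <- wvals la | t \in wvals la)
      (wproj C la t *m ent x *m wabove C la t *m invmx (minor_mx la t (ent x))) i j)) => [x _|].
    by rewrite mxBE -big_seq summxE mulN1r.
  apply: (ratfunD pd); first exact/ratfun_poly/is_poly_cst.
  apply: ratfunM; first exact/ratfun_poly/is_poly_cst.
  apply: (ratfun_sum pd) => t tv; apply: (ratmxM pd); last exact: h1.
  apply: ratmx_poly; apply: is_polymxM; last exact: is_polymx_cst.
  by apply: is_polymxM; [exact: is_polymx_cst | exact: is_polymx_ent].
have h3 : is_polymx (levi_proj g la).
  apply: is_polymx_unent => i j.
  apply: (@is_poly_ext _ _ (fun x => if la i == la j then ent x i j else 0)) => [x|].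
    by rewrite mxE.
  by case: (la i == la j); [exact: is_polymx_ent | exact: is_poly_cst].
move=> i j; apply: (ratmx_comp pd (f := fun x => levi_proj g la x i j)
  (h := fun x => unent (lower_elim la (ent x)) *m x)); first exact: h3.
apply: (ratmxM pd); last exact/ratmx_poly/is_polymx_id.
move=> k l; apply: (ratmx_comp pd (f := fun x => unent x k l)); last exact: h2.
by apply: is_polymx_unent; apply: is_polymx_id.
Qed.

Variables (K : set M) (aK : algebraic_group K).
Let sK := alg_subgroup aK.

(** Elimination gives factors that are plain matrices; [opposite_factors] shows that they belong to
    [K]. *)
Lemma cellP la x : ratcochar g K la -> K x -> cell_den la x != 0 ->
  [/\ Lgrp g K la (cell_levi la x) & exists u u', [/\ Ugrp g K (negw la) u, Ugrp g K la u' &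
     x = u *m cell_levi la x *m u']].
Proof.
move=> hla Kx /minor_unit hu; pose v := lower_elim la (ent x).
have vu : v \in unitmx by apply: lower_elim_unit.
have v'u : unent v \in unitmx by rewrite unent_unit.
pose b := unent v *m x; pose u := invmx (unent v).
have xE : x = u *m b by rewrite mulKmx.
have entu : ent u = invmx v by rewrite ent_inv // unentK.
have entb : ent b = v *m ent x by rewrite entM // unentK.
have hv := lower_elim_lower hu; rewrite -/v in hv.
have hv1 : wle (negw la) v.
  by rewrite -[v](subrK 1%:M); apply: wleD; [exact: wlt_wle | exact: wle1].
have hu1 : wlt (negw la) (ent (u - 1%:M)).
  rewrite entB entu ent1 // -(mulVmx vu) -[X in X - _]mulmx1 -mulmxBr -opprB mulmxN -scaleN1r.
  by apply: wltZ; apply: wltMr => //; apply: wle_inv.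
have hb : wle la (ent b) by rewrite entb; apply: lower_elim_upper.
have [Ku Kb] : K u /\ K b.
  have uu : u \in unitmx by rewrite unitmx_inv.
  have bu : b \in unitmx by rewrite unitmx_mul v'u (sg_unit sK Kx).
  by apply: (opposite_factors gu aK hla uu bu hu1 hb); rewrite -xE.
have hPb : Pgrp g K la b by split.
split; first exact: (levi_part gu aK hla hPb).
have [u' hu' bE] := levi_decomp gu aK hla hPb.
exists u, u'; split; [exact: (conj Ku hu1) | exact: hu' | by rewrite -mulmxA -bE].
Qed.

Lemma cell_Lgrp la l : Lgrp g K la l -> cell_den la l != 0 /\ cell_levi la l = l.
Proof.
move=> [Kl hl]; have lu := sg_unit sK Kl; split.
  rewrite prodf_seq_neq0; apply/allP => t _ /=; rewrite -unitfE -unitmxE.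
  by apply: weq_minor => //; rewrite ent_unit.
rewrite /cell_levi weq_lower_elim //.
have -> : unent 1%:M = 1%:M by apply: (ent_inj gu); rewrite unentK // ent1.
by rewrite mul1mx /levi_proj wdiag_id // entK.
Qed.

(** [cell_levi] is a rational retraction of an open part of [K] onto the Levi part, so test
    functions pull back to [K]. This replaces the connectedness theorem for centralizers of tori. *)
Lemma Lgrp_irreducible la : irreducible K -> ratcochar g K la -> irreducible (Lgrp g K la).
Proof.
move=> iK hla; apply: irreducible_wit => f h l l' pf ph Ll Ll' fl hl'.
have [N [p [pp Ep]]] := ratmx_comp (cell_den_poly la) pf (@cell_levi_rat la).
have [N' [p' [pp' Ep']]] := ratmx_comp (cell_den_poly la) ph (@cell_levi_rat la).
have pd := cell_den_poly la.
have [[d1 e1] [d2 e2]] := (cell_Lgrp Ll, cell_Lgrp Ll').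
have n1 : cell_den la l * p l != 0
  by rewrite -(Ep _ d1) e1; exact: (mulf_neq0 d1 (mulf_neq0 (expf_neq0 N d1) fl)).
have n2 : cell_den la l' * p' l' != 0
  by rewrite -(Ep' _ d2) e2; exact: (mulf_neq0 d2 (mulf_neq0 (expf_neq0 N' d2) hl')).
have [x Kx] := irreducibleP iK (is_polyM pd pp) (is_polyM pd pp') Ll.1 Ll'.1 n1 n2.
rewrite mulrACA !mulf_eq0 !negb_or => /andP[/andP[dx _] /andP[px p'x]].
move: px p'x; rewrite -(Ep _ dx) -(Ep' _ dx) !mulf_eq0 !negb_or => /andP[_ fx] /andP[_ hx].
exists (cell_levi la x); first by have [hL _] := cellP hla Kx dx; exact: hL.
exact: mulf_neq0 fx hx.
Qed.

End OpenCell.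

Section StrictWeights.
Variables (F : numFieldType) (n : nat) (la : 'I_n -> rat).
Implicit Types A : 'M[F]_n.

Lemma wltX A k : wlt la A -> wlt la (A ^+ k.+1).
Proof.
move=> hA; elim: k => [|k IH]; first by rewrite expr1.
by rewrite exprS; apply: wltMl => //; apply: wlt_wle.
Qed.

Lemma wlt_sum (I : Type) (r : seq I) (P : pred I) (f : I -> 'M[F]_n) :
  (forall i, P i -> wlt la (f i)) -> wlt la (\sum_(i <- r | P i) f i).
Proof.
move=> h; elim/big_ind: _ => //; last exact: wltD.
by move=> i j; rewrite mxE eqxx.
Qed.

End StrictWeights.

Lemma wlt_expm (R : realType) n (la : 'I_n -> rat) (A : 'M[R[i]]_n) : wlt la A -> wlt la (expm A - 1%:M).
Proof.
case: n A la => [|m] A la hA; first by move=> i; case: i.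
rewrite expmE big_ord_recl fact0 invr1 scale1r expr0 addrAC subrr add0r.
by apply: wlt_sum => i _; apply: wltZ; apply: wltX.
Qed.

(** * Structure and Lie algebras of the parabolic, Levi and unipotent parts *)

Section GroupPieces.
Variables (R : realType) (n : nat).
Local Notation C := R[i].
Local Notation M := 'M[C]_n.
Variables (g : M) (gu : g \in unitmx).
Local Notation ent := (ent g).
Implicit Types (la : 'I_n -> rat) (K : set M).

Lemma entry_cut K (p : 'I_n -> 'I_n -> bool) (Q : set M) :
  algebraic_group K -> subgroup Q ->
  (forall x, Q x <-> K x /\ forall i j, ~~ p i j -> ent (x - 1%:M) i j = 0) -> algebraic_group Q.
Proof.
move=> aK sQ hQ.
apply: (alg_cut (F := [set f | exists ij : 'I_n * 'I_n, ~~ p ij.1 ij.2 /\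
  f = fun x : M => ent (x - 1%:M) ij.1 ij.2]) aK sQ).
  move=> _ [[i j] [_ ->]] /=.
  apply: (is_poly_comp (f := fun x : M => ent x i j) (F := fun x : M => x - 1%:M)).
    exact: is_polymx_ent.
  move=> k l; apply: (is_poly_ext (f := fun x => x k l - (1%:M : M) k l)) => [x|]; first by rewrite mxBE.
  by apply: is_polyB; [exact: is_poly_entry | exact: is_poly_cst].
move=> x; rewrite hQ; split=> -[Kx h]; split=> //.
  by move=> _ [[i j] [pij ->]]; apply: h.
by move=> i j pij; apply: (h (fun x : M => ent (x - 1%:M) i j)); exists (i, j).
Qed.

Lemma lie_cut K (p : 'I_n -> 'I_n -> bool) X :
  (forall x, K x -> forall i j, ~~ p i j -> ent (x - 1%:M) i j = 0) -> lie K X ->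
  forall i j, ent X i j != 0 -> p i j.
Proof.
move=> h hX i j; apply: contraNT => /h pij; apply/eqP.
apply: (lie_linear_eq (K := K) (l := fun x => ent x i j)) => //.
- exact: is_polymx_ent.
- by move=> a u v; rewrite entD entZ 2!mxE.
by move=> x Kx; apply/eqP; rewrite -subr_eq0 -mxBE -entB; apply/eqP/pij.
Qed.

Section Parts.
Variables (K : set M) (aK : algebraic_group K).
Let sK := alg_subgroup aK.
Local Notation Pgrp := (Pgrp g K).
Local Notation Lgrp := (Lgrp g K).
Local Notation Ugrp := (Ugrp g K).

Lemma ent_sub1 x i j : i != j -> ent (x - 1%:M) i j = ent x i j.
Proof. by move=> ij; rewrite entB ent1 // mxBE !mxE (negPf ij) subr0. Qed.

Lemma wle_cut la x : wle la (ent x) <-> forall i j, ~~ (la j <= la i) -> ent (x - 1%:M) i j = 0.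
Proof.
split=> h i j.
  move=> hij; rewrite ent_sub1; last by apply: contraNneq hij => ->.
  by apply/eqP; apply: contraNT hij => /h.
have [->//|ij] := eqVneq i j.
by apply: contraNT => /h; rewrite ent_sub1 // => ->.
Qed.

Lemma weq_cut la x : weq la (ent x) <-> forall i j, ~~ (la j == la i) -> ent (x - 1%:M) i j = 0.
Proof.
split=> h i j.
  move=> hij; rewrite ent_sub1; last by apply: contraNneq hij => ->.
  by apply/eqP; apply: contraNT hij => /h ->.
have [->//|ij] := eqVneq i j.
by move=> e; apply/eqP; apply: contraNT e => /h; rewrite ent_sub1 // => ->.
Qed.

Lemma wlt_cut la x : wlt la (ent (x - 1%:M)) <->
  forall i j, ~~ (la j < la i) -> ent (x - 1%:M) i j = 0.
Proof.
split=> h i j; last by apply: contraNT => /h ->.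
by move=> hij; apply/eqP; apply: contraNT hij => /h.
Qed.

Lemma Pgrp_subgroup la : subgroup (Pgrp la).
Proof.
split=> [x [Kx _]||x y [Kx hx] [Ky hy]|x [Kx hx]].
- exact: (sg_unit sK Kx).
- by split; [exact: (sg1 sK) | rewrite /= ent1 //; exact: wle1].
- by split; [exact: (sgM sK Kx Ky) | rewrite /= entM //; exact: wleM].
split; first exact: (sgV sK Kx).
by rewrite /= ent_inv ?(sg_unit sK Kx) //; apply: wle_inv; rewrite // ent_unit // (sg_unit sK Kx).
Qed.

Lemma Lgrp_subgroup la : subgroup (Lgrp la).
Proof.
split=> [x [Kx _]||x y [Kx hx] [Ky hy]|x [Kx hx]].
- exact: (sg_unit sK Kx).
- split; first exact: (sg1 sK).
  by move=> i j; rewrite ent1 // mxE; case: (i =P j) => [->//|_]; rewrite eqxx.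
- split; first exact: (sgM sK Kx Ky).
  by rewrite /= entM //; apply/weqP; move/weqP: hx => hx; move/weqP: hy => hy; rewrite -mulmxA hy !mulmxA hx.
split; first exact: (sgV sK Kx).
by rewrite /= ent_inv ?(sg_unit sK Kx) //; apply: weq_inv; rewrite // ent_unit // (sg_unit sK Kx).
Qed.

Lemma wlt_unip_wle la x : wlt la (ent (x - 1%:M)) -> wle la (ent x).
Proof.
move=> h; rewrite -[x](subrK 1%:M) entD ent1 //; apply: wleD; [exact: wlt_wle | exact: wle1].
Qed.

Lemma Ugrp_subgroup la : subgroup (Ugrp la).
Proof.
split=> [x [Kx _]||x y [Kx hx] [Ky hy]|x [Kx hx]].
- exact: (sg_unit sK Kx).
- by split; [exact: (sg1 sK) | rewrite /= subrr ent0 => i j; rewrite mxE eqxx].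
- split; first exact: (sgM sK Kx Ky).
  rewrite /=; have -> : x *m y - 1%:M = (x - 1%:M) *m y + (y - 1%:M) by rewrite mulmxBl mul1mx addrA subrK.
  by rewrite entD entM //; apply: wltD => //; apply: wltMl => //; apply: wlt_unip_wle.
have xu := sg_unit sK Kx.
split; first exact: (sgV sK Kx).
rewrite /=; have -> : invmx x - 1%:M = (-1) *: (invmx x *m (x - 1%:M)).
  by rewrite mulmxBr mulVmx // mulmx1 scaleN1r opprB.
rewrite entZ entM //; apply: wltZ; apply: wltMr => //.
by rewrite ent_inv //; apply: wle_inv; rewrite ?ent_unit //; apply: wlt_unip_wle.
Qed.

Lemma Pgrp_algebraic la : algebraic_group (Pgrp la).
Proof.
apply: (entry_cut (p := fun i j => la j <= la i) aK (Pgrp_subgroup la)) => x.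
by split=> -[Kx h]; split=> //; apply/wle_cut.
Qed.

Lemma Lgrp_algebraic la : algebraic_group (Lgrp la).
Proof.
apply: (entry_cut (p := fun i j => la j == la i) aK (Lgrp_subgroup la)) => x.
by split=> -[Kx h]; split=> //; apply/weq_cut.
Qed.

Lemma Ugrp_algebraic la : algebraic_group (Ugrp la).
Proof.
apply: (entry_cut (p := fun i j => la j < la i) aK (Ugrp_subgroup la)) => x.
by split=> -[Kx h]; split=> //; apply/wlt_cut.
Qed.

Lemma lie_Pgrp la X : lie (Pgrp la) X -> wle la (ent X).
Proof.
apply: lie_cut => x [_ hx]; exact/wle_cut.
Qed.

Lemma lie_Lgrp la X : lie (Lgrp la) X -> weq la (ent X).
Proof.
move=> hX i j h; apply/eqP; move: i j h; apply: (lie_cut (p := fun i j => la j == la i)) hX => x [_ hx].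
exact/weq_cut.
Qed.

Lemma lie_Ugrp la X : lie (Ugrp la) X -> wlt la (ent X).
Proof.
apply: lie_cut => x [_ hx]; exact/wlt_cut.
Qed.

Lemma Ugrp_unipotent la x : Ugrp la x -> (x - 1%:M) ^+ n = 0.
Proof. by move=> [_ h]; apply: (ent_inj gu); rewrite entX // ent0; apply: wlt_nilpotent h. Qed.

Lemma Ugrp_log la u : Ugrp la u -> exists X, [/\ lie K X, wlt la (ent X), X ^+ n = 0 & expm X = u].
Proof.
move=> hu; have [X Xn [eX [a a0 XE]]] := unipotent_log (Ugrp_unipotent hu).
exists X; split=> //.
  exact: (unipotent_lie Xn (unipotent_curve aK hu.1 Xn eX)).
rewrite XE ent_sum; apply: wlt_sum => -[k kn] _; rewrite entZ; case: k kn => [|k] kn /=.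
  by rewrite a0 scale0r => i j; rewrite mxE eqxx.
by apply: wltZ; rewrite entX //; apply: wltX; case: hu.
Qed.

Lemma Ugrp_exp la X : lie K X -> wlt la (ent X) -> Ugrp la (expm X).
Proof.
move=> lX hX; have Xn := ent_expm_wlt gu hX; split.
  by have := lie_exp aK 1 lX Xn; rewrite scale1r.
by rewrite /= entB expm_ent // ent1 //; apply: wlt_expm.
Qed.

(** Two points are joined by the exponential of the segment between their logarithms, which is a
    polynomial curve. *)
Lemma Ugrp_irreducible la : irreducible (Ugrp la).
Proof.
apply: irreducible_pts => _ _ /Ugrp_log[X [lX hX Xn <-]] /Ugrp_log[Y [lY hY Yn <-]].
pose h (c : C) := expm (X + c *: (Y - X)).
have hUe c : Ugrp la (h c).
  apply: Ugrp_exp.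
    by apply: (linsetD (lie_linset K) lX); apply/(linsetZ (lie_linset K))/(linsetB (lie_linset K)).
  rewrite entD; apply: (wltD hX); rewrite entZ; apply: wltZ; rewrite entB -scaleN1r.
  by apply: (wltD hY); apply: wltZ.
exists (range h); split.
- by move=> _ [c _ <-].
- apply: irreducible_curve => i j; rewrite /h.
  have hl k : forall i j, is_uni (fun c => ((X + c *: (Y - X)) ^+ k) i j).
    elim: k => [|k IH] i' j'; first by apply: is_uni_ext (is_uni_cst (1%:M i' j')) => c; rewrite expr0.
    apply: is_uni_ext; first by move=> c; rewrite exprS [RHS]mxE; reflexivity.
    apply: is_uni_sum => l _; apply: is_uniM; last exact: IH.
    apply: (is_uni_ext (f := fun c => X i' l + c * (Y - X) i' l)) => [c|]; first by rewrite [RHS]mxE [X in _ = _ + X]mxE.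
    by apply: is_uniD; [exact: is_uni_cst | apply: is_uniM; [exact: is_uni_id | exact: is_uni_cst]].
  apply: is_uni_ext; first by move=> c; rewrite expmE summxE; reflexivity.
  apply: is_uni_sum => k _; apply: is_uni_ext; first by move=> c; rewrite [RHS]mxE; reflexivity.
  by apply: is_uniM; [exact: is_uni_cst | exact: hl].
- by exists 0; [exact: I | rewrite /h scale0r addr0].
by exists 1; [exact: I | rewrite /h scale1r addrC subrK].
Qed.

Lemma Ugrp_normal la x u : Pgrp la x -> Ugrp la u -> Ugrp la (x *m u *m invmx x).
Proof.
move=> hx hu; have xu := sg_unit sK hx.1; split; first exact: (sgJ sK hx.1 hu.1).
have E : x *m u *m invmx x - 1%:M = x *m (u - 1%:M) *m invmx x by rewrite mulmxBr mulmx1 mulmxBl mulmxV.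
rewrite /= E !entM //.
apply: wltMl; last by have [_ _ _ /(_ x hx)[_ ]] := Pgrp_subgroup la.
by apply: wltMr; [case: hx | case: hu].
Qed.

(** The opposite unipotent part is trivial, so [Pgrp la] contains the big cell, which is open in
    [K]. *)
Lemma conn_Pgrp la : connected_group K -> ratcochar g K la ->
  (forall X, lie K X -> wlt (negw la) (ent X) -> X = 0) -> Pgrp la = K.
Proof.
move=> cK hla h0.
have hU u : Ugrp (negw la) u -> u = 1%:M.
  by move=> /Ugrp_log[X [lX hX _ <-]]; rewrite (h0 X lX hX) expm0.
have L1 := sg1 (Lgrp_subgroup la).
have PK : Pgrp la `<=` K by move=> x [].
have pd := cell_den_poly g la.
apply: (@open_subgroup_conn _ _ K sK (Pgrp la) (cell_den g la) 1%:M cK (Pgrp_subgroup la) PK pd (sg1 sK)).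
  by have [h _] := cell_Lgrp gu aK L1; exact: h.
move=> y Ky /(cellP gu aK hla Ky)[hL [u [u' [/hU -> hu' ->]]]]; rewrite mul1mx.
apply: (sgM (Pgrp_subgroup la)); first by split; [exact: hL.1 | apply: weq_wle; exact: hL.2].
by split; [exact: hu'.1 | apply: wlt_unip_wle; exact: hu'.2].
Qed.

End Parts.
End GroupPieces.

(** * The additive Jordan decomposition *)

Section JordanDecomposition.
Variable F : closedFieldType.

Lemma crt_poly (s : seq F) k : uniq s ->
  exists q : {poly F}, forall r, r \in s -> ('X - r%:P) ^+ k %| q - r%:P.
Proof.
elim: s => [|r0 s IH] /=; first by exists 0.
move=> /andP[r0s /IH[q hq]].
pose A : {poly F} := \prod_(r <- s) ('X - r%:P) ^+ k; pose B : {poly F} := ('X - r0%:P) ^+ k.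
have cAB : coprimep A B.
  rewrite /A; elim: {IH hq A} s r0s => [|r s IH]; first by rewrite big_nil coprime1p.
  rewrite inE negb_or big_cons coprimepMl => /andP[r0r /IH ->]; rewrite andbT.
  apply/coprimep_expl/coprimep_expr; rewrite coprimep_XsubC root_XsubC; exact: r0r.
have [[u v] /= /eqpP[[c d] /andP[/= c0 d0] E]] := Bezout_coprimepP _ _ cAB.
have E' : u * A + v * B = (d / c)%:P.
  by rewrite -[LHS]scale1r -(mulVf c0) -scalerA E scalerA mulrC -alg_polyC.
pose e := (d / c)^-1; have e1 : e%:P * (u * A + v * B) = 1.
  by rewrite E' -polyCM mulVf ?mulf_neq0 ?invr_eq0.
exists (q + e%:P * u * A * (r0%:P - q)) => r; rewrite inE => /predU1P[->|rs].
  have -> : q + e%:P * u * A * (r0%:P - q) - r0%:P =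
    (q - r0%:P) * (e%:P * (u * A + v * B)) - (q - r0%:P) * (e%:P * (u * A)).
    by rewrite e1; ring.
  have -> : (q - r0%:P) * (e%:P * (u * A + v * B)) - (q - r0%:P) * (e%:P * (u * A))
    = ((q - r0%:P) * e%:P * v) * B by ring.
  exact: dvdp_mull.
have -> : q + e%:P * u * A * (r0%:P - q) - r%:P = (q - r%:P) + (e%:P * u * (r0%:P - q)) * A by ring.
apply: dvdp_add; first exact: hq.
by apply: dvdp_mull; rewrite /A (big_rem r rs) /=; apply: dvdp_mulr.
Qed.

(** The semisimple part is [q(X)] for a polynomial [q] congruent to each eigenvalue [r] modulo a
    high power of ['X - r]. Being a polynomial in [X], it commutes with whatever commutes with
    [X]. *)
Lemma jordan_decomposition n (X : 'M[F]_n) : exists g s N, [/\ g \in unitmx,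
  X = invmx g *m diag_mx s *m g + N, N ^+ n = 0,
  (forall Y, X *m Y = Y *m X -> (invmx g *m diag_mx s *m g) *m Y = Y *m (invmx g *m diag_mx s *m g)) &
  invmx g *m diag_mx s *m g *m N = N *m (invmx g *m diag_mx s *m g)].
Proof.
case: n X => [|n] X.
  by exists 1%:M, 0, 0; split; rewrite ?unitmx1 //; [apply/matrixP => -[] | apply/matrixP => -[]|
    move=> Y _; apply/matrixP => -[] | apply/matrixP => -[]].
have [rs hrs] := closed_field_poly_normal (char_poly X).
have := char_poly_monic X; rewrite monicE => /eqP lc; rewrite lc scale1r in hrs.
pose s := undup rs; have us : uniq s := undup_uniq _.
have [q hq] := crt_poly n.+1 us.
pose Q : {poly F} := \prod_(r <- s) ('X - r%:P) ^+ n.+1.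
have prod_dvd (f h : F -> {poly F}) (l : seq F) : (forall r, r \in l -> f r %| h r) ->
    \prod_(r <- l) f r %| \prod_(r <- l) h r.
  elim: l => [|r l IH] H; first by rewrite !big_nil dvdpp.
  by rewrite !big_cons; apply: dvdp_mul; [apply: H; rewrite mem_head | apply: IH => t tl; apply: H; rewrite inE tl orbT].
have char_dvd : char_poly X %| Q.
  have srs : size rs = n.+1.
    by have := size_char_poly X; rewrite hrs size_prod_XsubC => -[].
  rewrite hrs -[X in X %| _]big_undup_iterop_count /=.
  apply: prod_dvd => r _.
  have -> : iterop (count_mem r rs) *%R ('X - r%:P) 1 = ('X - r%:P) ^+ count_mem r rs by rewrite -[LHS]/(_ ^+ _).
  by apply: dvdp_exp2l; rewrite -srs count_size.
have hX p : Q %| p -> horner_mx X p = 0.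
  by move=> /(dvdp_trans char_dvd)/dvdpP[p' ->]; rewrite rmorphM /= Cayley_Hamilton mulr0.
pose S := horner_mx X q.
have SX : comm_mx S X by apply: comm_horner_mx.
have : exists2 P, P \in unitmx & diagonalizable_for P S.
  apply/mxpoly.diagonalizableP; exists s => //; apply: mxminpoly_min.
  have -> : horner_mx S (\prod_(x <- s) ('X - x%:P)) = horner_mx X (\prod_(x <- s) (q - x%:P)).
    rewrite !rmorph_prod; apply: eq_bigr => x _.
    by rewrite !rmorphB /= horner_mx_X !horner_mx_C.
  by apply: hX; apply: prod_dvd => r /hq.
move=> [P Pu /(diagonalizable_forLR Pu)[d SE]]; rewrite mxpoly.conjVmx // in SE.
exists P, d, (X - S); rewrite -SE; split=> //.
- by rewrite addrC subrK.
- have -> : X - S = horner_mx X ('X - q) by rewrite rmorphB /= horner_mx_X.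
  rewrite -rmorphXn; apply: hX; rewrite /Q prodrXl; apply: dvdp_exp2r.
  apply: uniq_roots_dvdp; last by rewrite uniq_rootsE.
  apply/allP => r rs'; rewrite /= -dvdp_XsubCl.
  have -> : 'X - q = ('X - r%:P) - (q - r%:P) by ring.
  by apply: dvdp_sub; rewrite ?dvdpp //; apply: dvdp_trans (hq r rs'); rewrite -[X in X %| _]expr1 dvdp_exp2l.
- by move=> Y /comm_mx_sym hY; apply/comm_mx_sym/comm_mx_horner.
by rewrite mulmxBr mulmxBl SX.
Qed.

End JordanDecomposition.

(** * Engel's theorem for Lie algebras of nilpotent matrices *)

Section Engel.
Variables (F : fieldType) (m : nat).
Local Notation M := 'M[F]_m.
Implicit Types (A X Y V W : M) (B : 'M[F]_(m * m)) (L : set M).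

Definition lie_subalgebra L := linset L /\ forall X Y, L X -> L Y -> L (X *m Y - Y *m X).
Lemma linset_basis L : linset L -> exists B : 'M[F]_(m * m), forall X, L X <-> (mxvec X <= B)%MS.
Proof.
move=> lL.
have [|B hB] := @linset_mx F (m * m) [set u | L (vec_mx u)].
  split=> [|a u v hu hv]; first by rewrite /= linear0; case: lL.
  by rewrite /= linearP; apply: lL.2.
by exists B => X; rewrite -hB /= mxvecK.
Qed.

(** [lflag B k] is the space generated by the products of [k] elements of the span of [B]; its
    vanishing for some [k] expresses simultaneous strict triangularity. *)
Definition lop B V : M := (\sum_i V *m vec_mx (row i B))%MS.
Definition lflag B k : M := iter k (lop B) 1%:M.

Lemma lop_sub B X V : (mxvec X <= B)%MS -> (V *m X <= lop B V)%MS.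
Proof.
move=> /submxP[D hD].
have -> : X = \sum_i D 0 i *: vec_mx (row i B).
  by rewrite -[LHS]mxvecK hD mulmx_sum_row linear_sum; apply: eq_bigr => i _; rewrite linearZ.
rewrite mulmx_sumr; apply: summx_sub => i _; rewrite -scalemxAr; apply: scalemx_sub.
exact: (sumsmx_sup i).
Qed.

Lemma lop_min B V W : (forall X, (mxvec X <= B)%MS -> (V *m X <= W)%MS) -> (lop B V <= W)%MS.
Proof. by move=> h; apply/sumsmx_subP => i _; apply: h; rewrite vec_mxK row_sub. Qed.

Lemma lop_mono B V W : (V <= W)%MS -> (lop B V <= lop B W)%MS.
Proof. by move=> VW; apply: lop_min => X hX; apply: submx_trans (submxMr _ VW) (lop_sub _ hX). Qed.

Lemma lop0 B : lop B 0 = 0.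
Proof. by rewrite /lop big1 // => i _; rewrite mul0mx. Qed.

Lemma lflag_dec B k : (lflag B k.+1 <= lflag B k)%MS.
Proof. by elim: k => [|k IH]; [exact: submx1 | exact: lop_mono]. Qed.

Lemma lflag0 B N k : lflag B N = 0 -> (N <= k)%N -> lflag B k = 0.
Proof. by move=> h /subnKC <-; elim: (k - N)%N => [|j IH]; rewrite ?addn0 // addnS /lflag iterS -/(lflag B _) IH lop0. Qed.

Lemma lflag_le B (W : nat -> M) : (1%:M <= W 0)%MS ->
  (forall i X, (mxvec X <= B)%MS -> (W i *m X <= W i.+1)%MS) -> forall k, (lflag B k <= W k)%MS.
Proof.
move=> W0 hW; elim=> [|k IH]; first exact: W0.
by apply: lop_min => X hX; apply: submx_trans (submxMr _ IH) (hW _ _ hX).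
Qed.

Lemma lflag_stable L B Y k : (forall X, L X <-> (mxvec X <= B)%MS) ->
  (forall X, L X -> L (X *m Y - Y *m X)) -> (lflag B k *m Y <= lflag B k)%MS.
Proof.
move=> hB hY; elim: k => [|k IH]; first exact: submx1.
rewrite {1}/lflag iterS -/(lflag B k) /lop sumsmxMr_gen; apply/sumsmx_subP => i _; rewrite genmxE.
set X := vec_mx _; have hX : L X by apply/hB; rewrite vec_mxK row_sub.
have -> : lflag B k *m X *m Y = lflag B k *m Y *m X + lflag B k *m (X *m Y - Y *m X).
  by rewrite mulmxBr !mulmxA addrCA subrr addr0.
apply: addmx_sub; last by apply/lop_sub/hB/hY.
by apply: submx_trans (submxMr _ IH) _; apply/lop_sub/hB.
Qed.

Lemma lie_extend (h : set M) B N X0 : lie_subalgebra h -> (forall X, h X <-> (mxvec X <= B)%MS) ->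
  lflag B N = 0 -> X0 ^+ m = 0 -> (forall X, h X -> h (X *m X0 - X0 *m X)) -> ~ h X0 ->
  exists h' B' N', [/\ lie_subalgebra h', (forall X, h' X <-> (mxvec X <= B')%MS), lflag B' N' = 0,
    (\rank B < \rank B')%N & forall Z, h' Z -> exists2 y, h y & exists c, Z = y + c *: X0].
Proof.
move=> [lh bh] hB BN X0n hX0 nX0.
pose h' : set M := [set Z | exists2 y, h y & exists c, Z = y + c *: X0].
have lh' : linset h'.
  split; first by exists 0; [case: lh | exists 0; rewrite scale0r addr0].
  move=> a _ _ [y hy [c ->]] [z hz [d ->]]; exists (a *: y + z); first exact: lh.2.
  by exists (a * c + d); rewrite scalerDl scalerDr scalerA addrACA.
have sub' : lie_subalgebra h'.
  split=> // _ _ [y hy [c ->]] [z hz [d ->]].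
  exists ((y *m z - z *m y) + d *: (y *m X0 - X0 *m y) - c *: (z *m X0 - X0 *m z)); last first.
    exists 0; rewrite scale0r addr0 !mulmxDl !mulmxDr -!scalemxAl -!scalemxAr !scalerA [d * c]mulrC.
    move: (y *m z) (z *m y) (y *m X0) (z *m X0) (X0 *m z) (X0 *m y) (X0 *m X0) => p1 p2 p3 p4 p5 p6 p7.
    by apply/matrixP => i j; rewrite !mxE; ring.
  apply: linsetB => //; last by apply: linsetZ => //; apply: hX0.
  by apply: linsetD => //; [apply: bh | apply: linsetZ => //; apply: hX0].
have [B' hB'] := linset_basis lh'.
pose V := lflag B; pose q := m.+1.
have X0q : X0 ^+ q = 0 by rewrite exprSr X0n mul0r.
(* Index [k q + l] stands for [V k] times [X0 ^+ l], modulo [V (k + 1)]. Since [X0 ^+ q = 0], both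
   [X0] and the elements of [h] move the index forward. *)
pose W j : M := (V (j %/ q).+1 + V (j %/ q)%N *m X0 ^+ (j %% q))%MS.
have stV k : (V k *m X0 <= V k)%MS by apply: (lflag_stable k hB).
have stVX k l : (V k *m X0 ^+ l <= V k)%MS.
  elim: l => [|l IH]; first by rewrite expr0 mulmx1.
  by rewrite exprSr mulmxA; apply: submx_trans (submxMr _ IH) (stV k).
have decV k : (V k.+1 <= V k)%MS by apply: lflag_dec.
have W0 : (1%:M <= W 0)%MS by rewrite /W div0n mod0n expr0 mulmx1 /V /lflag addsmxSr.
have hW i X : (mxvec X <= B')%MS -> (W i *m X <= W i.+1)%MS.
  move=> /hB'[y hy [c ->]]; rewrite /W addsmxMr.
  set k := (i %/ q)%N; set l := (i %% q)%N.
  have VyV Z : (Z <= V k)%MS -> (Z *m y <= V k.+1)%MS.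
    by move=> ZV; apply: submx_trans (submxMr _ ZV) _; apply/lop_sub/hB.
  have [E1 E2] : (V k.+1 <= W i.+1)%MS /\ (V k *m X0 ^+ l.+1 <= W i.+1)%MS.
    have [hl|hl] := ltnP l.+1 q.
      have -> : W i.+1 = (V k.+1 + V k *m X0 ^+ l.+1)%MS.
        have [Ed Em] : (i.+1 %/ q = k)%N /\ (i.+1 %% q = l.+1)%N.
          by rewrite (divn_eq i q) -/k -/l -addnS divnMDl // modnMDl divn_small // modn_small // addn0.
        by rewrite /W Ed Em.
      by split; [exact: addsmxSl | exact: addsmxSr].
    have ll : l.+1 = q by apply/eqP; rewrite eqn_leq hl andbT /l ltn_pmod.
    rewrite ll X0q mulmx0 sub0mx; split=> //.
    have -> : i.+1 = ((k.+1) * q)%N by rewrite {1}(divn_eq i q) -/k -/l -addnS ll mulSn addnC.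
    by rewrite /W mulnK // modnMl expr0 mulmx1 addsmxSr.
  rewrite -/(W i.+1) addsmx_sub; apply/andP; split.
    rewrite mulmxDr; apply: addmx_sub; first by apply: submx_trans E1; apply: VyV.
    by rewrite -scalemxAr; apply/scalemx_sub/(submx_trans (stV _)).
  rewrite mulmxDr; apply: addmx_sub; first by apply: submx_trans E1; apply: VyV.
  rewrite -scalemxAr -mulmxA; have <- : X0 ^+ l.+1 = X0 ^+ l *m X0 by rewrite exprSr.
  exact: scalemx_sub.
exists h', B', (N * q)%N; split=> //.
  have := lflag_le W0 hW (N * q)%N.
  have -> : W (N * q)%N = ((0 : M) + (0 : M))%MS.
    by rewrite /W mulnK // modnMl /V (lflag0 BN (leqnSn N)) BN mul0mx.
  by rewrite adds0mx submx0 => /eqP.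
have BB : (B <= B')%MS.
  apply/row_subP => i; rewrite -[row i B]vec_mxK; apply/hB'; exists (vec_mx (row i B)); last first.
    by exists 0; rewrite scale0r addr0.
  by apply/hB; rewrite vec_mxK row_sub.
rewrite rank_ltmx // /ltmx BB /=; apply/negP => B'B; apply: nX0; apply/hB/(submx_trans _ B'B)/hB'.
by exists 0; [case: lh | exists 1; rewrite add0r scale1r].
Qed.

(** Take a subalgebra [h] of largest dimension whose flag vanishes. Iterated brackets of an element
    of [L] with [h] end at zero; one of the last brackets outside [h] normalizes [h] and could be
    adjoined by [lie_extend]. *)
Lemma engel L : lie_subalgebra L -> (forall X, L X -> X ^+ m = 0) ->
  exists B N, (forall X, L X <-> (mxvec X <= B)%MS) /\ lflag B N = 0.
Proof.
move=> [lL bL] nL.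
pose P (r : nat) := exists h B N, [/\ lie_subalgebra h, h `<=` L,
  (forall X, h X <-> (mxvec X <= B)%MS), lflag B N = 0 & \rank B = r].
have [|r|r /asboolP[h [B [N [[lh bh] hL hB BN rB]]]] rmax] := @ex_maxnP (fun r => `[< P r >]) (m * m).
- exists 0%N; apply/asboolP; exists [set 0], 0, 1%N; split.
  + split; first by split=> // a u v -> ->; rewrite scaler0 addr0.
    by move=> _ _ -> ->; rewrite mul0mx subrr.
  + by move=> _ ->; case: lL.
  + move=> X; rewrite submx0 mxvec_eq0; split=> [->|/eqP->//]; exact: eqxx.
  + by rewrite /lflag /= /lop big1 // => i _; rewrite row0 linear0 mulmx0.
  + exact: mxrank0.
- by move=> /asboolP[h [B [N [_ _ _ _ <-]]]]; rewrite rank_leq_row.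
exists B, N; split=> // X; rewrite -hB; split; last exact: hL.
move=> LX; apply: contrapT => nX.
pose V := lflag B.
pose Dk k : set M := iter k (fun S : set M => [set Z | exists y Z', [/\ h y, S Z' & Z = Z' *m y - y *m Z']]) [set X].
have DL k Z : Dk k Z -> L Z.
  elim: k Z => [|k IH] Z /=; first by move=> ->.
  by move=> [y [Z' [hy /IH hZ' ->]]]; apply: bL => //; apply: hL.
(* Each bracket with [h] gains one step in the flag. The element at the start may lose at most [N]
   steps, so after [N + N] brackets it has become zero. *)
have filt k Z : Dk k Z -> forall i, (V i *m Z <= V (i + k - N)%N)%MS.
  elim: k Z => [|k IH] Z /=.
    move=> _ i; rewrite addn0; have [hi|/ltnW hi] := leqP N i; first by rewrite /V (lflag0 BN hi) mul0mx sub0mx.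
    by move: hi; rewrite -subn_eq0 => /eqP ->; exact: submx1.
  move=> [y [Z' [hy /IH hZ' ->]]] i; have Vy j : (V j *m y <= V j.+1)%MS by apply/lop_sub/hB.
  rewrite addnS mulmxBr !mulmxA; apply: addmx_sub.
    apply: submx_trans (submxMr _ (hZ' i)) _; apply: submx_trans (Vy _) _.
    have [hi|hi] := leqP N (i + k); first by rewrite subSn.
    have -> : ((i + k).+1 - N = 0)%N by lia.
    exact: submx1.
  rewrite -mulNmx -mulmxN; apply: submx_trans (submxMr _ _) (_ : _ <= _)%MS; first by rewrite mulmxN eqmx_opp; exact: Vy.
  by rewrite -addSn; exact: hZ'.
have D0 Z : Dk (N + N)%N Z -> Z = 0.
  move=> /filt/(_ 0%N); rewrite add0n addnK /V BN submx0 /= mul1mx => /eqP; exact.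
have ex : exists k, `[< Dk k `<=` h >] by exists (N + N)%N; apply/asboolP => Z /D0 ->; case: lh.
case: (ex_minnP ex) => -[/asboolP h0 _|k /asboolP hk kmin]; first by apply: nX; apply: h0.
have : ~ (Dk k `<=` h) by move=> /asboolP/kmin; rewrite ltnn.
move=> /existsNP[X0 /not_implyP[DX0 nX0]].
have [|h' [B' [N' [sub' hB' BN' rk h'E]]]] := lie_extend (conj lh bh) hB BN (nL _ (DL _ _ DX0)) _ nX0.
  move=> y hy; rewrite -opprB; apply: linsetN => //; apply: hk; exists y, X0; split=> //.
have : P (\rank B').
  exists h', B', N'; split=> // Z /h'E[y hy [c ->]].
  by apply: linsetD => //; [exact: hL | apply: linsetZ => //; exact: DL DX0].
by move=> /asboolP/rmax; rewrite -rB leqNgt rk.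
Qed.

(** The flag of [L] is stable under [Y] and moved down by [X], so [X Y] is nilpotent. *)
Lemma engel_trace L X Y : lie_subalgebra L -> (forall Z, L Z -> Z ^+ m = 0) ->
  (forall Z, L Z -> L (Z *m Y - Y *m Z)) -> L X -> \tr (X *m Y) = 0.
Proof.
move=> sL nL hY LX; have [B [N [hB BN]]] := engel sL nL.
suff : (X *m Y) ^+ N = 0 by move=> /nilpotent_facts[].
suff H k : ((X *m Y) ^+ k <= lflag B k)%MS.
  by have := H N; rewrite BN submx0 => /eqP.
elim: k => [|k IH]; first exact: submx1.
rewrite exprSr; apply: submx_trans (submxMr _ IH) _; rewrite mulmxA.
apply: submx_trans (submxMr Y (lop_sub (lflag B k) (proj1 (hB X) LX))) _.
exact: (lflag_stable k.+1 hB hY).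
Qed.

End Engel.

(** * Rational vectors with the standard dot product *)

Section RationalVectors.
Variable n : nat.
Implicit Types (u v w : 'rV[rat]_n) (X : set 'rV[rat]_n).

Definition dot u v : rat := \sum_j u 0 j * v 0 j.

Lemma dotE u v : dot u v = (u *m v^T) 0 0.
Proof. by rewrite mxE; apply: eq_bigr => j _; rewrite mxE. Qed.

Lemma dotC u v : dot u v = dot v u.
Proof. by apply: eq_bigr => j _; rewrite mulrC. Qed.

Lemma dotDl u v w : dot (u + v) w = dot u w + dot v w.
Proof. by rewrite !dotE mulmxDl mxE. Qed.

Lemma dotZl a u w : dot (a *: u) w = a * dot u w.
Proof. by rewrite !dotE -scalemxAl mxE. Qed.

Lemma dotNl u w : dot (- u) w = - dot u w.
Proof. by rewrite -scaleN1r dotZl mulN1r. Qed.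

Lemma dotBl u v w : dot (u - v) w = dot u w - dot v w.
Proof. by rewrite dotDl dotNl. Qed.

Lemma dotDr u v w : dot w (u + v) = dot w u + dot w v.
Proof. by rewrite dotC dotDl !(dotC w). Qed.

Lemma dotZr a u w : dot w (a *: u) = a * dot w u.
Proof. by rewrite dotC dotZl dotC. Qed.

Lemma dotNr u w : dot w (- u) = - dot w u.
Proof. by rewrite dotC dotNl dotC. Qed.

Lemma dotBr u v w : dot w (u - v) = dot w u - dot w v.
Proof. by rewrite dotDr dotNr. Qed.

Lemma dot0l w : dot 0 w = 0.
Proof. by rewrite -(scale0r 0) dotZl mul0r. Qed.

Lemma dot_suml (I : Type) (r : seq I) (P : pred I) (f : I -> 'rV_n) w :
  dot (\sum_(i <- r | P i) f i) w = \sum_(i <- r | P i) dot (f i) w.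
Proof. by elim/big_rec2: _ => [|i y z _ <-]; rewrite ?dot0l ?dotDl. Qed.

Lemma dot_ge0 u : 0 <= dot u u.
Proof. by apply: sumr_ge0 => j _; rewrite -expr2 sqr_ge0. Qed.

Lemma dot_eq0 u : (dot u u == 0) = (u == 0).
Proof.
apply/idP/eqP => [|->]; last by rewrite dot0l.
rewrite psumr_eq0 => [/allP h|j _]; last by rewrite -expr2 sqr_ge0.
apply/rowP => j; apply/eqP; rewrite mxE; have := h j; rewrite mem_index_enum => /(_ isT).
by rewrite /= mulf_eq0 orbb.
Qed.

Lemma dot_gt0 u : u != 0 -> 0 < dot u u.
Proof. by move=> u0; rewrite lt_def dot_ge0 dot_eq0 u0. Qed.

(** The orthogonal projection is rational, since the Gram matrix of a rational basis is invertible
    by positivity of the dot product. *)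
Lemma projection_mx X : linset X -> exists P : 'M[rat]_n,
  [/\ P^T = P, forall v, X (v *m P) & forall v, X v -> v *m P = v].
Proof.
move=> lX; have [B hB] := linset_mx lX.
pose A := row_base B; pose Gr := A *m A^T.
have Gu : Gr \in unitmx.
  rewrite -row_free_unit -kermx_eq0; apply/eqP/row_matrixP => i; rewrite row0.
  set k := row i _; have kG : k *m Gr = 0 by apply/sub_kermxP/row_sub.
  have : dot (k *m A) (k *m A) == 0.
    by rewrite dotE trmx_mul mulmxA -(mulmxA k) -/Gr kG mul0mx mxE.
  rewrite dot_eq0 => /eqP kA.
  have /row_freeP[D hD] := row_base_free B.
  by rewrite -[k]mulmx1 -hD mulmxA kA mul0mx.
exists (A^T *m invmx Gr *m A); split.
- have Gt : Gr^T = Gr by rewrite trmx_mul trmxK.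
  rewrite (trmx_mul (A^T *m invmx Gr) A) (trmx_mul A^T (invmx Gr)) (trmxK A) trmx_inv Gt; exact: mulmxA.
- by move=> v; apply/hB; rewrite mulmxA (submx_trans (submxMl _ _)) // eq_row_base.
move=> v /hB; rewrite -(eq_row_base B) => /submxP[D ->].
rewrite -/A; have -> : D *m A *m (A^T *m invmx Gr *m A) = D *m Gr *m invmx Gr *m A by rewrite /Gr !mulmxA.
by rewrite mulmxK.
Qed.

Lemma perturb (I : eqType) (s : seq I) (f h : I -> rat) :
  exists2 N : nat, (0 < N)%N & forall i, i \in s -> 0 < f i -> 0 < N%:R * f i + h i.
Proof.
elim: s => [|i s [N N0 hN]]; first by exists 1%N.
pose N1 := Num.truncn (`|h i| / f i); exists (N + N1.+1 + \sum_(j <- s) Num.truncn (`|h j| / f j))%N.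
  by rewrite !addn_gt0 N0.
have key (k : nat) j : 0 < f j -> (Num.truncn (`|h j| / f j) < k)%N -> 0 < k%:R * f j + h j.
  move=> fj hk.
  have h1 : `|h j| / f j < k%:R by apply: lt_le_trans (truncnS_gt _) _; rewrite ler_nat.
  have : `|h j| < k%:R * f j by rewrite -ltr_pdivrMr.
  have := ler_norm (- h j); rewrite normrN; lra.
move=> j; rewrite inE => /predU1P[->|js] fj; apply: key => //; first by rewrite -/N1; lia.
have : (Num.truncn (`|h j| / f j) <= \sum_(j <- s) Num.truncn (`|h j| / f j))%N.
  by rewrite (big_rem j js) /= leq_addr.
lia.
Qed.

(* The perturbation keeps every sign of [dot v] on [s] and separates the elements of [s]
   on which [X] does not vanish identically. *)
Lemma generic_vector X (s : seq 'rV[rat]_n) v0 : linset X -> X v0 ->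
  exists2 v, X v & forall r, r \in s -> (0 < dot v0 r -> 0 < dot v r) /\
    (dot v r = 0 -> forall x, X x -> dot x r = 0).
Proof.
move=> lX Xv0.
suff [v Xv [h1 h2]] : exists2 v, X v & (forall r, r \in s ++ map -%R s -> 0 < dot v0 r -> 0 < dot v r) /\
    forall r, r \in s -> dot v r = 0 -> forall x, X x -> dot x r = 0.
  by exists v => // r rs; split; [apply: h1; rewrite mem_cat rs | exact: h2].
set t := s ++ _; have : {subset s <= t} by move=> r rs; rewrite mem_cat rs.
have : forall r, r \in t -> - r \in t.
  move=> r; rewrite !mem_cat => /orP[rs|/mapP[r' rs ->]]; last by rewrite opprK rs.
  by apply/orP; right; apply: map_f.
clearbody t => tN; elim: s => [|r s' IH] st; first by exists v0.
have [|v Xv [h1 h2]] := IH; first by move=> x xs; apply: st; rewrite inE xs orbT.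
have [nz|] := pselect (dot v r = 0 -> forall x, X x -> dot x r = 0).
  by exists v => //; split=> // x; rewrite inE => /predU1P[->|]; [exact: nz | exact: h2].
move=> /not_implyP[vr /existsNP[x /not_implyP[Xx xr]]].
have [N N0 hN] := perturb t (dot v) (dot x).
exists (N%:R *: v + x); first exact: lX.2.
have pos y : y \in t -> 0 < dot v y -> 0 < dot (N%:R *: v + x) y.
  by move=> yt vy; rewrite dotDl dotZl; apply: hN.
have nzt y : y \in t -> dot v y != 0 -> dot (N%:R *: v + x) y != 0.
  move=> yt; rewrite neq_lt => /orP[vy|/(pos y yt)]; last by move=> h; rewrite gt_eqF.
  have : 0 < dot v (- y) by rewrite dotNr oppr_gt0.
  by move=> /(pos _ (tN _ yt)); rewrite dotNr oppr_gt0 => h; rewrite lt_eqF.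
split=> [y yt /(h1 y yt)|y]; first exact: pos.
rewrite inE => /predU1P[->|ys].
  by rewrite dotDl dotZl vr mulr0 add0r.
have yt : y \in t by apply: st; rewrite inE ys orbT.
by have [vy _|vy] := eqVneq (dot v y) 0; [exact: h2 | move=> E; have := nzt y yt vy; rewrite E eqxx].
Qed.

End RationalVectors.

Lemma rat_scale (I : finType) (v : I -> rat) : exists2 m : I -> int,
  exists2 N : nat, (0 < N)%N & forall j, (m j)%:~R = N%:R * v j & True.
Proof.
exists (fun j => numq (v j) * \prod_(i | i != j) denq (v i)) => //.
exists (absz (\prod_i denq (v i))).
  by rewrite absz_gt0; apply/prodf_neq0 => i _; rewrite denq_neq0.
move=> j; rewrite natr_absz gtr0_norm; last by apply: prodr_gt0 => i _; rewrite denq_gt0.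
rewrite [in RHS](bigD1 j) //= !rmorphM /= numqE; ring.
Qed.

Lemma prod_expz (F : fieldType) (I : Type) (r : seq I) (P : pred I) (f : I -> F) (k : int) :
  (\prod_(i <- r | P i) f i) ^ k = \prod_(i <- r | P i) f i ^ k.
Proof. by elim/big_rec2: _ => [|i y x _ <-]; rewrite ?exp1rz // expfzMl. Qed.

Lemma expz_sum (F : fieldType) (I : Type) (r : seq I) (P : pred I) (m : I -> int) (c : F) :
  c != 0 -> \prod_(i <- r | P i) c ^ m i = c ^ (\sum_(i <- r | P i) m i).
Proof. by move=> c0; elim/big_rec2: _ => [|i y x _ ->]; rewrite ?expr0z // expfzDr. Qed.

Lemma diag_conjM (F : fieldType) n (g : 'M[F]_n) (s t : 'rV[F]_n) : g \in unitmx ->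
  invmx g *m diag_mx s *m g *m (invmx g *m diag_mx t *m g) =
  invmx g *m diag_mx (\row_j (s 0 j * t 0 j)) *m g.
Proof.
move=> gu; rewrite !mulmxA mulmxK // -[_ *m diag_mx t]mulmxA; congr (_ *m _ *m _).
apply/matrixP => i j; rewrite mul_diag_mx !mxE; by case: (i == j); rewrite ?mulr1n ?mulr0n ?mulr0.
Qed.

Lemma diag_conjZ (F : fieldType) n (g : 'M[F]_n) a (s : 'rV[F]_n) :
  invmx g *m diag_mx (a *: s) *m g = a *: (invmx g *m diag_mx s *m g).
Proof. by rewrite linearZ /= -scalemxAr -scalemxAl. Qed.

(** * Rational cocharacters of a group and the replicas of a semisimple element *)

Section RationalCocharacters.
Variables (R : realType) (n : nat).
Local Notation C := R[i].
Local Notation M := 'M[C]_n.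
Variables (g : M) (gu : g \in unitmx).
Implicit Types (v w : 'rV[rat]_n).

Definition qrow v : 'rV[C]_n := map_mx ratr v.
Lemma qrowE v j : qrow v 0 j = ratr (v 0 j).
Proof. by rewrite mxE. Qed.

Definition qdiag v : M := tdiag g (qrow v).

Lemma tdiagM (s t : 'rV[C]_n) : tdiag g s *m tdiag g t = tdiag g (\row_j (s 0 j * t 0 j)).
Proof.
rewrite !tdiagE; exact: diag_conjM.
Qed.

Lemma tdiagD (s t : 'rV[C]_n) : tdiag g (s + t) = tdiag g s + tdiag g t.
Proof. by rewrite !tdiagE linearD /= mulmxDr mulmxDl. Qed.

Lemma tdiagZ a (s : 'rV[C]_n) : tdiag g (a *: s) = a *: tdiag g s.
Proof. rewrite !tdiagE; exact: diag_conjZ. Qed.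

Lemma qdiagD v w : qdiag (v + w) = qdiag v + qdiag w.
Proof. by rewrite /qdiag -tdiagD /qrow map_mxD. Qed.

Lemma qdiagZ a v : qdiag (a *: v) = ratr a *: qdiag v.
Proof. by rewrite /qdiag -tdiagZ /qrow map_mxZ. Qed.

Lemma cocharM (m m' : 'I_n -> int) (k k' : int) (c : C) : c != 0 ->
  cochar g (fun j => k * m j + k' * m' j) c = cochar g m (c ^ k) *m cochar g m' (c ^ k').
Proof.
move=> c0; rewrite !cocharE tdiagM; congr (tdiag g _); apply/rowP => j.
by rewrite !mxE !exprz_exp expfzDr.
Qed.

Variables (K : set M) (aK : algebraic_group K).
Let sK := alg_subgroup aK.
Definition cochars : set 'rV[rat]_n := [set v | ratcochar g K (v 0)].

Lemma cochars_linset : linset cochars.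
Proof.
split.
  exists (fun=> 0); first by exists 1%N => // j; rewrite mxE mulr0.
  move=> c c0; have -> : cochar g (fun=> 0) c = 1%:M; last exact: (sg1 sK).
  rewrite cocharE tdiagE; have -> : (\row_(j < n) c ^ 0%Z) = const_mx 1.
    by apply/rowP => j; rewrite !mxE expr0z.
  by rewrite diag_const_mx mulmx1 mulVmx.
move=> a u v [m [N N0 hm] hK] [m' [N' N'0 hm'] hK'].
exists (fun j => (N'%:Z * numq a) * m j + (N%:Z * denq a) * m' j).
  exists (N * N' * `|denq a|)%N; first by rewrite !muln_gt0 N0 N'0 absz_gt0 denq_neq0.
  move=> j; rewrite !mxE !natrM natr_absz gtr0_norm ?denq_gt0 // rmorphD /= !rmorphM /= hm hm'.
  rewrite -{4}[a]divq_num_den; set d := (denq a)%:~R; have d0 : d != 0 :> rat by rewrite intq_eq0 denq_neq0.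
  rewrite !pmulrn; field; exact: d0.
by move=> c c0; rewrite cocharM //; apply: (sgM sK); [apply: hK | apply: hK']; apply: expfz_neq0.
Qed.

Lemma cochars_lie v : cochars v -> lie K (qdiag v).
Proof.
move=> [m [N N0 hm] hK]; have := torus_lie gu hK.
have -> : \row_j (m j)%:~R = (N%:R : C) *: qrow v.
  apply/rowP => j; rewrite !mxE -(ratr_int C) hm rmorphM /= ratr_nat; congr (_ * ratr _).
rewrite tdiagZ => /(linsetZ (lie_linset K) N%:R^-1); rewrite scalerA mulVf ?scale1r //.
by rewrite pnatr_eq0 -lt0n.
Qed.

Section Rel.
Variables (s : 'rV[C]_n) (N : M).
Hypotheses (hX : lie K (tdiag g s + N)) (SN : tdiag g s *m N = N *m tdiag g s)
  (Nn : N ^+ n = 0).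

Definition relations : set 'rV[rat]_n := [set r | \sum_j qrow r 0 j * s 0 j = 0].

Lemma relations_linset : linset relations.
Proof.
split; first by apply: big1 => j _; rewrite !mxE rmorph0 mul0r.
move=> a u v hu hv; rewrite /relations /=.
rewrite (eq_bigr (fun j => ratr a * (qrow u 0 j * s 0 j) + qrow v 0 j * s 0 j)) => [|j _].
  by rewrite big_split /= -mulr_sumr hu hv mulr0 addr0.
rewrite !qrowE mxE mxE rmorphD rmorphM mulrDl -mulrA; reflexivity.
Qed.

(** Two integral combinations of the entries of [s] that agree differ by a relation, on which [v]
    vanishes; so [replica_mem] applies to the powers of [c] given by a multiple of [v]. *)
Lemma replica_cochars v : (forall r, relations r -> dot r v = 0) -> cochars v.
Proof.
move=> hv; have [m [D D0 hm] _] := rat_scale (v 0).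
exists m; first by exists D.
move=> c c0; rewrite cocharE; apply: (replica_mem aK gu hX SN Nn) => [j|w w' ww'].
  by rewrite mxE expfz_neq0.
have E (u : 'I_n -> nat) := @weight_row_cochar R n 1 (fun=> u) m c ord0 c0.
rewrite /weight_row in E; have := E w; rewrite mxE => ->; have := E w'; rewrite mxE => ->.
congr (c ^ _); apply: (@intr_inj rat).
pose r : 'rV[rat]_n := \row_j ((w j)%:R - (w' j)%:R).
have /hv/(congr1 ( *%R D%:R)) : relations r.
  rewrite /relations /= (eq_bigr (fun j => (w j)%:R * s 0 j - (w' j)%:R * s 0 j)) => [|j _].
    by rewrite sumrB ww' subrr.
  by rewrite !mxE rmorphB /= !ratr_nat mulrBl.
rewrite mulr0 /dot mulr_sumr => E0; apply/eqP; rewrite -subr_eq0 !rmorph_sum -sumrB -[X in _ == X]E0.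
apply/eqP; apply: eq_bigr => j _; rewrite !mxE !rmorphM /= hm -!pmulrn; ring.
Qed.

(** A rational vector orthogonal to all relations is a cocharacter and, by the hypothesis, itself a
    relation; being orthogonal to itself it is zero. Hence every rational vector is a relation. *)
Lemma replica_trace0 : (forall v, cochars v -> (forall r, relations r -> dot r v = 0) ->
  \sum_j s 0 j * qrow v 0 j = 0) -> s = 0.
Proof.
move=> h; have full : forall u, relations u.
  apply: (linset_full relations_linset) => A hA.
  have rA r : relations r -> dot r A^T = 0 by move=> hr; rewrite dotE trmxK hA // mxE.
  have AT := replica_cochars rA.
  have /hA : relations A^T.
    by rewrite /relations /= -[RHS](h _ AT rA); apply: eq_bigr => j _; rewrite mulrC.
  move=> /(congr1 (fun B : 'M_1 => B 0 0)); rewrite -[A in _ *m A]trmxK -dotE mxE => /eqP.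
  by rewrite dot_eq0 => /eqP/(congr1 trmx); rewrite trmxK trmx0.
apply/rowP => k; have := full (delta_mx 0 k); rewrite /relations /= (bigD1 k) //= big1 ?addr0.
  by rewrite !mxE !eqxx /= rmorph1 mul1r.
by move=> j jk; rewrite !mxE (negPf jk) andbF rmorph0 mul0r.
Qed.

(** The complex solutions of a rational linear system are spanned by its rational solutions, which
    here are cocharacters. *)
Lemma replica_span : exists (A : 'M[rat]_n) (u : 'rV[C]_n),
  (forall i, cochars (row i A)) /\ s = u *m map_mx ratr A.
Proof.
have [B hB] := linset_mx relations_linset.
have : (s <= kermx (map_mx ratr B^T : M))%MS.
  apply/sub_kermxP/rowP => i; rewrite !mxE.
  have /hB : (row i B <= B)%MS by apply: row_sub.
  rewrite /relations /= => E; rewrite -[RHS]E; apply: eq_bigr => j _.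
  by rewrite !mxE mulrC.
rewrite -map_kermx => /submxP[u uE]; exists (kermx B^T), u; split=> // i.
apply: replica_cochars => r /hB/submxP[w ->].
rewrite dotC dotE trmx_mul mulmxA.
have -> : row i (kermx B^T) *m B^T = 0 by apply/sub_kermxP/row_sub.
by rewrite mul0mx mxE.
Qed.

End Rel.

Lemma lie_cochars v : lie K (qdiag v) -> cochars v.
Proof.
move=> hv; have h0 : lie K (tdiag g (qrow v) + 0) by rewrite addr0.
apply: (replica_cochars h0); rewrite ?mulmx0 ?mul0mx //.
  by case: n => [|k]; [apply/matrixP => -[] | rewrite expr0n].
move=> r; rewrite /relations /= => E; apply: (@fmorph_inj _ C ratr); rewrite rmorph0 -[RHS]E rmorph_sum.
by apply: eq_bigr => j _; rewrite rmorphM /= !mxE.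
Qed.

End RationalCocharacters.

(** * Irreducibility of one-parameter subgroups *)

Section LaurentCurves.
Variables (R : realType) (n : nat).
Local Notation C := R[i].
Local Notation M := 'M[C]_n.

Definition is_laurent (h : C -> C) := exists B (q : {poly C}), forall c, c != 0 -> c ^+ B * h c = q.[c].

Lemma is_laurent_ext f h : (forall c, c != 0 -> f c = h c) -> is_laurent f -> is_laurent h.
Proof. by move=> E [B [q hq]]; exists B, q => c c0; rewrite -hq // E. Qed.

Lemma is_laurent_cst a : is_laurent (fun=> a).
Proof. by exists 0%N, a%:P => c _; rewrite expr0 mul1r hornerC. Qed.

Lemma is_laurentX (m : int) : is_laurent (fun c => c ^ m).
Proof.
case: m => k; first by exists 0%N, 'X^k => c _; rewrite expr0 mul1r hornerXn.
by exists k.+1, 1 => c c0; rewrite NegzE -exprnN mulfV ?expf_neq0 // hornerC.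
Qed.

Lemma is_laurentD f h : is_laurent f -> is_laurent h -> is_laurent (fun c => f c + h c).
Proof.
move=> [B [q hq]] [B' [q' hq']]; exists (B + B')%N, ('X^B' * q + 'X^B * q') => c c0.
rewrite hornerD !hornerM !hornerXn -hq // -hq' // exprD mulrDr.
by rewrite !mulrA [c ^+ B' * _]mulrC.
Qed.

Lemma is_laurentM f h : is_laurent f -> is_laurent h -> is_laurent (fun c => f c * h c).
Proof.
move=> [B [q hq]] [B' [q' hq']]; exists (B + B')%N, (q * q') => c c0.
by rewrite hornerM -hq // -hq' // exprD mulrACA.
Qed.

Lemma is_laurent_sum (I : Type) (r : seq I) (P : pred I) (F : I -> C -> C) :
  (forall i, P i -> is_laurent (F i)) -> is_laurent (fun x => \sum_(i <- r | P i) F i x).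
Proof.
move=> h; elim: r => [|i r IH].
  by apply: is_laurent_ext (is_laurent_cst 0) => c _; rewrite big_nil.
case Pi: (P i).
  by apply: is_laurent_ext (is_laurentD (h i Pi) IH) => c _; rewrite big_cons Pi.
by apply: is_laurent_ext IH => c _; rewrite big_cons Pi.
Qed.

Lemma irreducible_laurent (h : C -> M) : (forall i j, is_laurent (fun c => h c i j)) ->
  irreducible (h @` [set c | c != 0]).
Proof.
move=> hl; have lau f : is_poly f -> is_laurent (fun c => f (h c)).
  move: f; apply: is_poly_ind => [f f' E|c|i j|f f' _ _|f f' _ _].
  - by apply: is_laurent_ext => c _; rewrite E.
  - exact: is_laurent_cst.
  - exact: hl.
  - exact: is_laurentD.
  - exact: is_laurentM.
move=> f f' /lau[B [q hq]] /lau[B' [q' hq']] E.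
have : q * q' = 0.
  apply: poly_zero_except => c c0; rewrite hornerM -hq // -hq' // mulrACA E ?mulr0 //.
move=> /eqP; rewrite mulf_eq0 => /orP[/eqP q0|/eqP q0]; [left|right] => _ [c c0 <-].
  by have /eqP := hq c c0; rewrite q0 horner0 mulf_eq0 expf_eq0 (negPf c0) andbF /= => /eqP.
by have /eqP := hq' c c0; rewrite q0 horner0 mulf_eq0 expf_eq0 (negPf c0) andbF /= => /eqP.
Qed.

Lemma irreducible_cochar g (m : 'I_n -> int) : @irreducible R n (cochar g m @` [set c | c != 0]).
Proof.
apply: irreducible_laurent => i j.
apply: (@is_laurent_ext (fun c => \sum_k (invmx g i k * c ^ m k) * g k j)) => [c c0|].
  by rewrite cocharE tdiagE mxE; apply: eq_bigr => k _; rewrite mul_mx_diag !mxE.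
apply: is_laurent_sum => k _; apply: is_laurentM; last exact: is_laurent_cst.
by apply: is_laurentM; [exact: is_laurent_cst | exact: is_laurentX].
Qed.

End LaurentCurves.

Section BlockDeterminants.
Variables (F : numFieldType) (n : nat) (la : 'I_n -> rat).
Implicit Types y : 'M[F]_n.

(** Multiplicative on matrices of weight zero. Products of integral powers of such determinants
    supply enough characters on a group with diagonal Lie algebra. *)
Definition blockdet t y : F := \det (wproj F la t *m y + (1%:M - wproj F la t)).

Lemma wprojM t : wproj F la t *m wproj F la t = wproj F la t.
Proof.
apply/matrixP => i j; rewrite /wproj mul_diag_mx !mxE.
by case: (i == j); case: (la j == t); rewrite ?mulr1n ?mulr0n ?mulr0 ?mul0r ?mul1r ?mulr1 //; case: (la i == t); rewrite ?mulr0 ?mul1r.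
Qed.

Lemma blockdetM t y y' : weq la y -> blockdet t (y *m y') = blockdet t y * blockdet t y'.
Proof.
move=> hy; rewrite /blockdet -det_mulmx; congr (\det _); set p := wproj F la t.
have yp : y *m p = p *m y.
  apply/matrixP => i j; rewrite /p /wproj mul_mx_diag mul_diag_mx !mxE mulrC.
  by have [->|/hy ->//] := eqVneq (y i j) 0; rewrite !mulr0.
have pp := wprojM t; rewrite -/p in pp.
have E : p *m (y *m y') = p *m y *m (p *m y') by rewrite [RHS]mulmxA -(mulmxA p y p) yp !mulmxA pp.
have [pq qp qq] : [/\ p *m (1%:M - p) = 0, (1%:M - p) *m p = 0 & (1%:M - p) *m (1%:M - p) = 1%:M - p].
  have pq : p *m (1%:M - p) = 0 by rewrite mulmxBr mulmx1 pp subrr.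
  split=> //; first by rewrite mulmxBl mul1mx pp subrr.
  by rewrite mulmxBl mul1mx pq subr0.
rewrite E; move: (1%:M - p) pq qp qq => q pq qp qq.
rewrite mulmxDl !mulmxDr qq; have -> : p *m y *m q = 0 by rewrite -yp -mulmxA pq mulmx0.
by rewrite addr0 (mulmxA q) qp mul0mx add0r.
Qed.

Lemma blockdet_diag t (s : 'rV[F]_n) :
  blockdet t (diag_mx s) = \prod_(i | la i == t) s 0 i.
Proof.
rewrite /blockdet.
have -> : wproj F la t *m diag_mx s + (1%:M - wproj F la t) =
  diag_mx (\row_i (if la i == t then s 0 i else 1)).
  apply/matrixP => i j; rewrite /wproj mul_diag_mx !mxE; case: (i =P j) => [->|_]; last first.
    by rewrite !mulr0n mulr0 subr0 addr0.
  by rewrite !mulr1n; case: (la j == t); rewrite ?mul1r ?mul0r ?subrr ?addr0 ?subr0 ?add0r.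
rewrite det_diag [RHS]big_mkcond; apply: eq_bigr => i _; by rewrite mxE.
Qed.

Lemma blockdet1 t : blockdet t 1%:M = 1.
Proof. by rewrite /blockdet mulmx1 addrC subrK det1. Qed.

End BlockDeterminants.

(** * Groups with diagonal Lie algebra: a torus times a finite set *)

Section ToralCore.
Variables (R : realType) (n : nat).
Local Notation C := R[i].
Local Notation M := 'M[C]_n.
Variables (g : M) (gu : g \in unitmx).
Local Notation ent := (ent g).

Section TorusPoints.

Definition torus_pt k (b : 'I_k -> 'I_n -> int) (c : 'I_k -> C) : M :=
  tdiag g (\row_j \prod_l c l ^ b l j).
Definition torus_pts k (b : 'I_k -> 'I_n -> int) : set M :=
  torus_pt b @` [set c | forall l, c l != 0].

Lemma torus_ptM k (b : 'I_k -> 'I_n -> int) c c' :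
  torus_pt b c *m torus_pt b c' = torus_pt b (fun l => c l * c' l).
Proof.
rewrite /torus_pt (tdiagM gu); congr (tdiag g _); apply/rowP => j; rewrite !mxE -big_split.
by apply: eq_bigr => l _; rewrite expfzMl.
Qed.

Lemma torus_pt1 k (b : 'I_k -> 'I_n -> int) : torus_pt b (fun=> 1) = 1%:M.
Proof.
rewrite /torus_pt tdiagE; have -> : (\row_j \prod_(l < k) (1 : C) ^ b l j) = const_mx 1.
  by apply/rowP => j; rewrite !mxE big1 // => l _; rewrite exp1rz.
by rewrite diag_const_mx mulmx1 mulVmx.
Qed.

Lemma torus_ptV k (b : 'I_k -> 'I_n -> int) c : (forall l, c l != 0) ->
  invmx (torus_pt b c) = torus_pt b (fun l => (c l)^-1).
Proof.
move=> c0; have E : torus_pt b c *m torus_pt b (fun l => (c l)^-1) = 1%:M.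
  rewrite torus_ptM -[RHS](torus_pt1 b); congr (tdiag g _); apply/rowP => j; rewrite !mxE.
  by apply: eq_bigr => l _; rewrite mulfV.
have [u _] := mulmx1_unit E.
by rewrite -[LHS]mulmx1 -E mulKmx.
Qed.

Lemma torus_pts_irreducible k (b : 'I_k -> 'I_n -> int) : irreducible (torus_pts b).
Proof.
elim: k b => [|k IH] b.
  have -> : torus_pts b = [set 1%:M]; last exact: irreducible_set1.
  rewrite eqEsubset; split=> [_ [c _ <-]|_ ->].
    rewrite -(torus_pt1 b) /torus_pt /=; congr (tdiag g _).
    by apply/rowP => j; rewrite !mxE !big_ord0.
  by exists (fun=> 1); [case | exact: torus_pt1].
have -> : torus_pts b = mulset (cochar g (b ord0) @` [set c | c != 0]) (torus_pts (fun l => b (lift ord0 l))).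
  rewrite eqEsubset; split=> [_ [c c0 <-]|_ [_ [c c0 <-] [_ [d d0 <-] <-]]].
    exists (cochar g (b ord0) (c ord0)); first by exists (c ord0) => //; exact: c0.
    exists (torus_pt (fun l => b (lift ord0 l)) (fun l => c (lift ord0 l))).
      by exists (fun l => c (lift ord0 l)) => // l; exact: c0.
    rewrite cocharE /torus_pt (tdiagM gu); congr (tdiag g _); apply/rowP => j; rewrite !mxE.
    by rewrite big_ord_recl.
  exists (fun l => if unlift ord0 l is Some l' then d l' else c).
    by move=> l; case: unliftP => [l' _|_]; [exact: d0 | exact: c0].
  rewrite cocharE /torus_pt (tdiagM gu); congr (tdiag g _); apply/rowP => j; rewrite !mxE.
  rewrite big_ord_recl unlift_none; congr (_ * _); apply: eq_bigr => l _; by rewrite liftK.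
by apply: irreducible_mulset; [exact: irreducible_cochar | exact: IH].
Qed.

End TorusPoints.

Variables (L : set M) (aL : algebraic_group L) (la : 'I_n -> rat).
Let sL := alg_subgroup aL.
Hypotheses (gen : forall i j, la i = la j -> forall v, cochars g L v -> v 0 i = v 0 j)
  (wL : forall x, L x -> weq la (ent x))
  (lieL : forall Z, lie L Z -> exists s, Z = tdiag g s).

Lemma torus_pt_mem k (b : 'I_k -> 'I_n -> int) (K : set M) c : subgroup K ->
  (forall l c, c != 0 -> K (cochar g (b l) c)) -> (forall l, c l != 0) -> K (torus_pt b c).
Proof.
move=> sK hb; elim: k b hb c => [|k IH] b hb c c0.
  have -> : torus_pt b c = 1%:M; last exact: (sg1 sK).
  by rewrite -(torus_pt1 b); congr (tdiag g _); apply/rowP => j; rewrite !mxE !big_ord0.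
have -> : torus_pt b c = cochar g (b ord0) (c ord0) *m
    torus_pt (fun l => b (lift ord0 l)) (fun l => c (lift ord0 l)).
  rewrite cocharE /torus_pt (tdiagM gu); congr (tdiag g _); apply/rowP => j; rewrite !mxE.
  by rewrite big_ord_recl.
apply: (sgM sK); first exact: hb.
by apply: (IH (fun l => b (lift ord0 l))) => l; [exact: hb | exact: c0].
Qed.

(* The characters used to split off the torus are products of block determinants, with
   exponents dual to a basis of cocharacters. *)
Lemma torus_finite_index : exists k (b : 'I_k -> 'I_n -> int) (F : set M),
  [/\ (forall l, exists2 v, cochars g L v & exists2 N : nat, (0 < N)%N & forall j, (b l j)%:~R = N%:R * v 0 j),
      (forall l c, c != 0 -> L (cochar g (b l) c)), finite_set F, F `<=` L &
      forall x, L x -> exists2 y, torus_pts b y & exists2 f, F f & x = y *m f].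
Proof.
have lX := cochars_linset gu aL.
have [B0 hB0] := linset_mx lX.
pose d := \rank B0; pose B := row_base B0.
have hBrow l : cochars g L (row l B) by apply/hB0; rewrite -(eq_row_base B0) row_sub.
have rowE l i : row l B 0 i = B l i by rewrite mxE.
have hb (l : 'I_d) : exists bN : ('I_n -> int) * nat, [/\ (0 < bN.2)%N,
    (forall j, (bN.1 j)%:~R = bN.2%:R * B l j) & forall c, c != 0 -> L (cochar g bN.1 c)].
  by have [m [N N0 hm] hK] := hBrow l; exists (m, N); split=> // j; rewrite hm rowE.
have [bN hbN] := choice hb.
pose b l := (bN l).1.
have /row_freeP[D hD] := row_base_free B0; rewrite -/B in hD.
(* Cocharacters of [L] are constant on weight blocks, and a block determinant counts the common
   value once per index; [k] divides by the size of the block. *)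
pose k i : rat := \sum_(i' | la i' == la i) 1.
have k0 i : k i != 0.
  rewrite /k (bigD1 i) //=; apply: lt0r_neq0; apply: ltr_pwDl => //; exact: sumr_ge0.
have [A [N0 N0p hA] _] := rat_scale (fun ij : 'I_n * 'I_d => D ij.1 ij.2 / ((bN ij.2).2%:R * k ij.1)).
pose Psi j (x : M) : C := \prod_i blockdet la (la i) (ent x) ^ A (i, j).
have bdL x i : L x -> blockdet la (la i) (ent x) != 0.
  move=> Lx; have := blockdetM (la i) (ent (invmx x)) (wL Lx).
  rewrite -entM // mulmxV ?(sg_unit sL) // ent1 // blockdet1 => E.
  by apply: contra_eq_neq E => ->; rewrite mul0r oner_neq0.
have PsiM j x y : L x -> Psi j (x *m y) = Psi j x * Psi j y.
  move=> Lx; rewrite /Psi -big_split /=; apply: eq_bigr => i _.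
  by rewrite entM // blockdetM ?expfzMl //; apply: wL.
have Psi1 j : Psi j 1%:M = 1.
  by rewrite /Psi big1 // => i _; rewrite ent1 // blockdet1 exp1rz.
have Psi_diag j (s : 'rV[C]_n) : (forall i, s 0 i != 0) ->
    Psi j (tdiag g s) = \prod_i s 0 i ^ (\sum_(i' | la i' == la i) A (i', j)).
  move=> s0; rewrite /Psi (eq_bigr (fun i => \prod_(i' | la i' == la i) s 0 i' ^ A (i, j))) => [|i _].
    rewrite (exchange_big_dep predT) //=; apply: eq_bigr => i _.
    by rewrite expz_sum //; congr (_ ^ _); apply: eq_bigl => i'; rewrite eq_sym.
  by rewrite ent_tdiag // blockdet_diag prod_expz.
have sumA v j : cochars g L v -> \sum_i v 0 i * (\sum_(i' | la i' == la i) A (i', j))%:~R =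
    N0%:R / (bN j).2%:R * (v *m D) 0 j.
  move=> hv; rewrite mxE mulr_sumr.
  rewrite (eq_bigr (fun i => \sum_(i' | la i' == la i) v 0 i' * (A (i', j))%:~R)) => [|i _]; last first.
    rewrite rmorph_sum mulr_sumr; apply: eq_bigr => i' /eqP E.
    by rewrite (gen E hv).
  rewrite (exchange_big_dep predT) //=; apply: eq_bigr => i _.
  rewrite (eq_bigr (fun=> (v 0 i * (A (i, j))%:~R) * 1)) => [|i' _]; last by rewrite mulr1.
  rewrite -mulr_sumr (eq_bigl (fun i' => la i' == la i)) => [|i']; last by rewrite eq_sym.
  rewrite -/(k i) hA /=.
  have bj : (bN j).2%:R != 0 :> rat by rewrite pnatr_eq0 -lt0n; have [] := hbN j.
  by field; rewrite bj k0.
have Psi_pt j c : (forall l, c l != 0) -> Psi j (torus_pt b c) = c j ^+ N0.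
  move=> c0; rewrite /torus_pt Psi_diag => [|i]; last first.
    by rewrite mxE; apply/prodf_neq0 => l _; apply: expfz_neq0.
  rewrite (eq_bigr (fun i => \prod_l c l ^ (b l i * \sum_(i' | la i' == la i) A (i', j)))) => [|i _].
    rewrite exchange_big /= (bigD1 j) //= [X in _ * X]big1 ?mulr1 => [|l lj].
      rewrite expz_sum // exprnP; congr (_ ^ _); apply: (@intr_inj rat); rewrite rmorph_sum /=.
      have [bj0 hbj _] := hbN j; have bj : (bN j).2%:R != 0 :> rat by rewrite pnatr_eq0 -lt0n.
      rewrite (eq_bigr (fun i => (bN j).2%:R * (row j B 0 i * (\sum_(i' | la i' == la i) A (i', j))%:~R))) => [|i _].
        by rewrite -mulr_sumr sumA // -row_mul hD !mxE eqxx mulr1 mulrCA mulfV ?mulr1.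
      by rewrite rmorphM /= /b hbj rowE mulrA.
    rewrite expz_sum //; have -> : \sum_i b l i * \sum_(i' | la i' == la i) A (i', j) = 0; last by rewrite expr0z.
    apply: (@intr_inj rat); rewrite rmorph_sum /=; have [_ hbl _] := hbN l.
    rewrite (eq_bigr (fun i => (bN l).2%:R * (row l B 0 i * (\sum_(i' | la i' == la i) A (i', j))%:~R))) => [|i _].
      by rewrite -mulr_sumr sumA // -row_mul hD !mxE (negPf lj) !mulr0.
    by rewrite rmorphM /= /b hbl rowE mulrA.
  by rewrite mxE prod_expz; apply: eq_bigr => l _; rewrite exprz_exp.
(* Exponents may be negative, so the equation [Psi j x = 1] is written as the equality of two
   polynomials, over the nonnegative and over the negative exponents. *)
pose half j pos (x : M) := \prod_(i | (0 <= A (i, j))%R == pos) blockdet la (la i) (ent x) ^+ `|A (i, j)|%N.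
have polyN j pos : is_poly (half j pos).
  apply: is_poly_prod => i _; apply: is_polyX; apply: is_poly_det.
  apply: (is_polymxD (H := fun=> 1%:M - wproj C la (la i))); last exact: is_polymx_cst.
  by apply: is_polymxM; [exact: is_polymx_cst | exact: is_polymx_ent].
pose F : set M := [set x | L x /\ forall j, Psi j x = 1].
have PsiF j x : L x -> (Psi j x == 1) = (half j true x == half j false x).
  move=> Lx; rewrite /Psi (bigID (fun i => (0 <= A (i, j))%R)) /=.
  set P2 := half j false x.
  have P20 : P2 != 0 by apply/prodf_neq0 => i _; rewrite expf_neq0 // bdL.
  have -> : \prod_(i | ~~ (0 <= A (i, j))) blockdet la (la i) (ent x) ^ A (i, j) = P2^-1.
    rewrite /P2 /half -prodfV; apply: eq_big => [i|i]; first by rewrite eqbF_neg.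
    by case: (A (i, j)) => // q _; rewrite NegzE -exprnN.
  have -> : \prod_(i | 0 <= A (i, j)) blockdet la (la i) (ent x) ^ A (i, j) =
      half j true x.
    by apply: eq_big => [i|i]; [rewrite eqb_id | case: (A (i, j))].
  by rewrite -(inj_eq (mulIf P20)) mul1r mulfVK.
have sF : subgroup F.
  split=> [x [Lx _]||x y [Lx hx] [Ly hy]|x [Lx hx]].
  - exact: (sg_unit sL Lx).
  - by split; [exact: (sg1 sL) | exact: Psi1].
  - by split=> [|j]; [exact: (sgM sL) | rewrite PsiM // hx hy mulr1].
  split=> [|j]; first exact: (sgV sL).
  by have := PsiM j x (invmx x) Lx; rewrite mulmxV ?(sg_unit sL) // Psi1 hx mul1r.
have aF : algebraic_group F.
  apply: (alg_cut (F := [set f | exists j : 'I_d, f = fun x : M => half j true x - half j false x]) aL sF).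
    by move=> _ [j ->]; apply: is_polyB; apply: polyN.
  move=> x; split=> [[Lx hx]|[Lx hx]].
    split; first exact: Lx.
    move=> _ [j ->]; apply/eqP; rewrite subr_eq0 -(PsiF j x Lx); apply/eqP; exact: hx.
  split; first exact: Lx.
  move=> j; apply/eqP; rewrite (PsiF j x Lx) -subr_eq0; apply/eqP.
  by apply: (hx (fun x => half j true x - half j false x)); exists j.
(* A cocharacter with values in [F] is killed by all [Psi j], whose exponents are dual to a basis of
   cocharacters, so it is zero; then the Lie algebra of [F] is trivial. *)
have finF : finite_set F.
  apply: (lie0_finite aF) => Z hZ.
  have [s sE] := lieL (lie_mono (fun x (h : F x) => h.1) hZ).
  rewrite sE in hZ *; have hZ0 : lie F (tdiag g s + 0) by rewrite addr0.
  suff -> : s = 0 by rewrite tdiagE linear0 mulmx0 mul0mx.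
  apply: (replica_trace0 gu aF hZ0); rewrite ?mulmx0 ?mul0mx //.
    by case: (n) => [|q]; [apply/matrixP => -[] | rewrite expr0n].
  move=> v hv _.
  have Lv : cochars g L v by have [m hm hK] := hv; exists m => // c c0; have [] := hK c c0.
  have vD : v *m D = 0.
    apply/rowP => j; rewrite [RHS]mxE; have [m [N Np hm] hK] := hv.
    have [_ /(_ j)] := hK 2%:R (lt0r_neq0 (ltr0Sn _ _)).
    rewrite cocharE Psi_diag => [|i]; last by rewrite mxE expfz_neq0 // lt0r_neq0.
    rewrite (eq_bigr (fun i => 2%:R ^ (m i * \sum_(i' | la i' == la i) A (i', j)))) => [|i _]; last by rewrite mxE exprz_exp.
    rewrite expz_sum; last by rewrite lt0r_neq0.
    have two1 : (2%:R == 1 :> C) = false by apply: (eqr_nat C 2 1).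
    move=> /eqP; rewrite pexprz_eq1 ?ler0n // two1 orbF => /eqP E.
    have := sumA v j Lv; have bj : (bN j).2%:R != 0 :> rat by rewrite pnatr_eq0 -lt0n; have [] := hbN j.
    have Nq : N%:R != 0 :> rat by rewrite pnatr_eq0 -lt0n.
    have -> : \sum_i v 0 i * (\sum_(i' | la i' == la i) A (i', j))%:~R = 0.
      apply: (mulfI Nq); rewrite mulr0 mulr_sumr -[RHS](congr1 (intr : int -> rat) E) rmorph_sum /=.
      by apply: eq_bigr => i _; rewrite rmorphM /= hm mulrA.
    move=> /esym/eqP; rewrite !mulf_eq0 invr_eq0 (negPf bj) orbF pnatr_eq0 -[(N0 == 0)%N]negbK -lt0n N0p /=.
    by move=> /eqP.
  have /hB0 : cochars g L v by [].
  rewrite -(eq_row_base B0) -/B => /submxP[u uE].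
  have u0 : u = 0 by rewrite -[u]mulmx1 -hD mulmxA -uE vD.
  have v0 : v = 0 by rewrite uE u0 mul0mx.
  by apply: big1 => j _; rewrite qrowE v0 mxE rmorph0 mulr0.
exists d, b, F; split=> //.
- by move=> l; exists (row l B) => //; have [N1 hN1 _] := hbN l; exists (bN l).2 => // j; rewrite /b hN1 rowE.
- by move=> l; have [_ _ ] := hbN l.
- by move=> x [].
move=> x Lx.
(* On the torus [Psi j] is the [N0]-th power of the [j]-th parameter, so [x] is divided by the torus
   point whose parameters are [N0]-th roots of the values of [Psi]. *)
have root j : exists c, c ^+ N0 = Psi j x :> C.
  exists (N0.-root (Psi j x)); exact: rootCK.
have [c hc] := choice root.
have c0 j : c j != 0.
  have : c j ^+ N0 != 0 by rewrite hc; apply/prodf_neq0 => i _; apply/expfz_neq0/bdL.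
  by rewrite expf_eq0 N0p.
have Ly : L (torus_pt b c) by apply: torus_pt_mem => // l; have [_ _ ] := hbN l.
exists (torus_pt b c); first by exists c.
exists (invmx (torus_pt b c) *m x); last by rewrite mulKVmx // (sg_unit sL).
split=> [|j]; first by apply: (sgM sL) => //; apply: (sgV sL).
have := PsiM j (torus_pt b c) (invmx (torus_pt b c) *m x) Ly.
rewrite mulKVmx ?(sg_unit sL) // Psi_pt // -hc => E.
have cN : c j ^+ N0 != 0 by rewrite expf_neq0.
by apply: (mulfI cN); rewrite mulr1 -E.
Qed.

End ToralCore.

Section CocharMore.
Variables (R : realType) (n : nat).
Local Notation C := R[i].
Local Notation M := 'M[C]_n.
Variables (g : M) (gu : g \in unitmx).
Local Notation ent := (ent g).

Lemma cochars_int (K : set M) (v : 'rV[rat]_n) (m : 'I_n -> int) (N : nat) c : cochars g K v ->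
  (forall j, (m j)%:~R = N%:R * v 0 j) -> c != 0 -> K (cochar g m c).
Proof.
move=> [m' [N' N'0 hm'] hK] hm c0; pose d := N'.-root c.
have dN : d ^+ N' = c by apply: rootCK.
have d0 : d != 0 by have := c0; rewrite -dN expf_eq0 N'0.
have -> : cochar g m c = cochar g m' (d ^+ N).
  rewrite !cocharE; congr (tdiag g _); apply/rowP => j; rewrite !mxE -dN !exprnP !exprz_exp.
  congr (d ^ _); apply: (@intr_inj rat); rewrite !rmorphM /= hm hm' -!pmulrn; ring.
by apply: hK; rewrite expf_neq0.
Qed.

Lemma cochars_mono (K K' : set M) v : K `<=` K' -> cochars g K v -> cochars g K' v.
Proof. by move=> KK [m hm hK]; exists m => // c c0; apply/KK/hK. Qed.

Lemma tdiag_ent Z : (forall i j, i != j -> ent Z i j = 0) -> exists s, Z = tdiag g s.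
Proof.
move=> h; exists (\row_j ent Z j j); apply: (ent_inj gu); rewrite ent_tdiag //.
apply/matrixP => i j; rewrite !mxE; have [->|ij] := eqVneq i j; rewrite ?mulr1n // mulr0n.
exact: h.
Qed.

Section Core.
Variables (L : set M) (aL : algebraic_group L) (la : 'I_n -> rat).
Let sL := alg_subgroup aL.
Hypotheses (gen : forall i j, la i = la j -> forall v, cochars g L v -> v 0 i = v 0 j)
  (wL : forall x, L x -> weq la (ent x))
  (lieL : forall Z, lie L Z -> exists s, Z = tdiag g s).

(** [Q] is the closure of the torus points in [L]. For each [f] in [F] outside [Q], a translate of
    an equation of [Q] vanishes on the coset of [f] but not at 1, and [h] is the product of these.
    The last clause holds because the torus points are generated by cocharacters of [L]. *)
Lemma toral_core : exists Q (h : M -> C),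
  [/\ algebraic_group Q, irreducible Q, Q `<=` L, is_poly h /\ h 1%:M != 0 &
      (forall x, L x -> h x != 0 -> Q x) /\
      forall T, algebraic_group T -> (forall v, cochars g L v -> cochars g T v) -> Q `<=` T].
Proof.
have [k [b [F [hb hbL finF FL LE]]]] := torus_finite_index gu aL gen wL lieL.
pose A := torus_pts g b.
have AL : A `<=` L by move=> _ [c c0 <-]; apply: torus_pt_mem.
have AM x y : A x -> A y -> A (x *m y).
  move=> [c c0 <-] [d d0 <-]; rewrite torus_ptM //; exists (fun l => c l * d l) => // l.
  exact: mulf_neq0 (c0 l) (d0 l).
have AV x : A x -> A (invmx x).
  move=> [c c0 <-]; rewrite torus_ptV //; exists (fun l => (c l)^-1) => // l.
  by rewrite invr_eq0; exact: c0.
have A1 : A 1%:M by exists (fun=> 1); [move=> l; exact: oner_neq0 | exact: torus_pt1].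
pose Q : set M := [set x | L x /\ forall f, is_poly f -> (forall y, A y -> f y = 0) -> f x = 0].
have AQ : A `<=` Q by move=> x Ax; split=> [|f _]; [exact: AL | exact].
have QL : Q `<=` L by move=> x [].
have QM x y : Q x -> Q y -> Q (x *m y).
  move=> [Lx hx] [Ly hy]; split; first exact: (sgM sL).
  move=> f pf hf; apply: (hx (fun z => f (z *m y))).
    by apply: (is_poly_ext (f := fun z => f (1%:M *m z *m y))) => [z|]; [rewrite mul1mx | exact: is_poly_mulr].
  move=> a Aa; apply: (hy (fun z => f (a *m z))).
    by apply: (is_poly_ext (f := fun z => f (a *m z *m 1%:M))) => [z|]; [rewrite mulmx1 | exact: is_poly_mulr].
  by move=> z Az; apply/hf/AM.
have QV x : Q x -> Q (invmx x).
  move=> [Lx hx]; split; first exact: (sgV sL).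
  move=> f pf hf.
  have pdet : is_poly (fun x : M => \det x) by apply/is_poly_det/is_polymx_id.
  have hinv : ratmx (fun x : M => \det x) (fun x : M => invmx x).
    by apply: (ratmx_inv (rest := fun=> 1)) => [||z]; [exact: is_polymx_id | exact: is_poly_cst | rewrite mulr1].
  have [N [p [pp Ep]]] := ratmx_comp pdet pf hinv.
  have d0 y : L y -> \det y != 0 by move=> Ly; rewrite -unitfE -unitmxE (sg_unit sL).
  have px : p x = 0.
    by apply: hx => // y Ay; rewrite -Ep ?d0 ?hf ?mulr0 //; [exact: AV | exact: AL].
  have /eqP := Ep x (d0 x Lx); rewrite px mulf_eq0 expf_eq0 (negPf (d0 x Lx)) andbF /=.
  by move=> /eqP.
have sQ : subgroup Q.
  split=> [x /QL/(sg_unit sL)//|||]; [exact: AQ | exact: QM | exact: QV].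
have aQ : algebraic_group Q.
  apply: (alg_cut (F := [set f | is_poly f /\ forall y, A y -> f y = 0]) aL sQ); first by move=> f [].
  by move=> x; split=> [[Lx hx]|[Lx hx]]; split=> // f; [case; exact: hx | move=> pf hf; exact: hx].
have iQ : irreducible Q.
  have iA : irreducible A by apply: (torus_pts_irreducible gu).
  by apply: (irreducible_dense AQ iA) => f pf hf x [_]; apply.
have [h [ph h1 hQ]] : exists h, [/\ is_poly h, h 1%:M != 0 &
    forall x f, F f -> ~ Q f -> Q (x *m invmx f) -> h x = 0].
  move: finF => /finite_seqP[s sF].
  have : {subset s <= [pred x | `[< L x >]]} by move=> x xs; apply/asboolP/FL; rewrite sF.
  suff H : {subset s <= [pred x | `[< L x >]]} -> exists h, [/\ is_poly h, h 1%:M != 0 &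
      forall x f, f \in s -> ~ Q f -> Q (x *m invmx f) -> h x = 0].
    move=> /H[h [ph h1 hs]]; exists h; split=> // x f Ff; apply: hs.
    by move: Ff; rewrite sF.
  elim: s {sF} => [|f s IH] sLx; first by exists (fun=> 1); split=> //; [exact: is_poly_cst | exact: oner_neq0].
  have [|h [ph h1 hs]] := IH; first by move=> x xs; apply: sLx; rewrite inE xs orbT.
  have Lf : L f by apply/asboolP; apply: (sLx f); rewrite mem_head.
  have [Qf|nQf] := pselect (Q f).
    by exists h; split=> // x f'; rewrite inE => /predU1P[->|f's]; [move=> /(_ Qf) | exact: hs].
  have nQf' : ~ Q (invmx f) by move=> /QV; rewrite invmxK.
  have [phi [pphi phiA phif]] : exists phi, [/\ is_poly phi, (forall y, A y -> phi y = 0) & phi (invmx f) != 0].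
    apply: contrapT => nex; apply: nQf'; split; first exact: (sgV sL).
    move=> phi pphi phiA; apply/eqP; apply: contrapT => /negP ne; apply: nex.
    by exists phi.
  exists (fun x => h x * phi (x *m invmx f)); split.
  - apply: is_polyM => //.
    by apply: (is_poly_ext (f := fun z => phi (1%:M *m z *m invmx f))) => [z|]; [rewrite mul1mx | exact: is_poly_mulr].
  - by rewrite mul1mx mulf_neq0.
  move=> x f'; rewrite inE => /predU1P[->|f's] nf' [Lx hx]; first by rewrite hx ?mulr0.
  by rewrite (hs x f') ?mul0r.
exists Q, h; split=> //; split.
  move=> x Lx hx; have [y Ay [f Ff xE]] := LE x Lx.
  have [Qf|nQf] := pselect (Q f); first by rewrite xE; apply: QM => //; apply: AQ.
  move: hx; rewrite (hQ x f) ?eqxx // xE mulmxK ?(sg_unit sL) //; first exact: AQ.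
  exact: FL.
move=> T aT hT x [Lx hx]; apply: (alg_mem aT); first exact: (sg_unit sL).
move=> f pf hf; apply: hx => // _ [c c0 <-]; apply: hf.
apply: (torus_pt_mem gu (alg_subgroup aT)) => // l d d0.
have [v hv [N N0 hm]] := hb l.
exact: cochars_int (hT v hv) hm d0.
Qed.

End Core.

Lemma sep_connected K T (h : M -> C) : subgroup K -> connected_group K -> subgroup T ->
  is_poly h -> h 1%:M != 0 -> (forall x, K x -> h x != 0 -> T x) -> K `<=` T.
Proof.
move=> sK cK sT ph h1 hT x Kx.
have s' : subgroup (K `&` T).
  split=> [y []|||].
  - by move=> /(sg_unit sK).
  - by split; [exact: (sg1 sK) | exact: (sg1 sT)].
  - by move=> y z [Ky Ty] [Kz Tz]; split; [exact: (sgM sK) | exact: (sgM sT)].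
  - by move=> y [Ky Ty]; split; [exact: (sgV sK) | exact: (sgV sT)].
have KT : K `&` T = K.
  apply: (@open_subgroup_conn _ _ K sK (K `&` T) h 1%:M cK s' (fun y (q : (K `&` T) y) => q.1) ph (sg1 sK) h1).
  by move=> y Ky hy; split=> //; apply: hT.
by move: Kx; rewrite -KT => -[].
Qed.

Section Torus.
Variables (T : set M) (aT : algebraic_group T) (cT : connected_group T).
Let sT := alg_subgroup aT.
Hypothesis dT : forall t, T t -> is_diag_mx (ent t).
Local Notation X := (cochars g T).

(** [la] separates every pair of coordinates that some cocharacter of [T] separates, so commuting
    with [la] amounts to commuting with [T]. *)
Definition generic (la : 'rV[rat]_n) := X la /\
  forall i j, la 0 i = la 0 j -> forall v, X v -> v 0 i = v 0 j.

Lemma torus_ent t i j : T t -> i != j -> ent t i j = 0.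
Proof. by move=> /dT/is_diag_mxP h ij; apply: h. Qed.

Lemma torus_lie_diag Z : lie T Z -> exists s, Z = tdiag g s.
Proof.
move=> hZ; apply: tdiag_ent => i j; apply: contraNeq; move: i j.
apply: (lie_cut (p := fun i j => i == j)) hZ => t Tt i j ij.
by rewrite entB ent1 // mxBE torus_ent // mxE (negPf ij) subr0.
Qed.

Lemma torus_weq (la : 'I_n -> rat) t : T t -> weq la (ent t).
Proof. by move=> Tt i j; have [->//|ij] := eqVneq i j; rewrite torus_ent ?eqxx. Qed.

Lemma torus_core la : generic la -> irreducible T /\
  forall T', algebraic_group T' -> (forall v, X v -> cochars g T' v) -> T `<=` T'.
Proof.
move=> [Xla gla]; have [Q [h [aQ iQ QT [ph h1] [hQ hT']]]] :=
  toral_core aT gla (fun t => @torus_weq (la 0) t) torus_lie_diag.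
have TQ := sep_connected sT cT (alg_subgroup aQ) ph h1 hQ.
have E : T = Q by rewrite eqEsubset.
by split=> [|T' aT' hT]; rewrite E //; apply: hT'.
Qed.

(** The points of [T] where the two monomials agree form an algebraic subgroup containing all
    cocharacters, and [T] lies in every such group by [torus_core]. *)
Lemma torus_monomial la (w w' : 'I_n -> nat) : generic la ->
  (forall v, X v -> \sum_i (w i)%:R * v 0 i = \sum_i (w' i)%:R * v 0 i) ->
  forall t, T t -> \prod_i ent t i i ^+ w i = \prod_i ent t i i ^+ w' i.
Proof.
move=> gla hw.
pose mon (u : 'I_n -> nat) (t : M) := \prod_i ent t i i ^+ u i.
have monM u s t : T s -> T t -> mon u (s *m t) = mon u s * mon u t.
  move=> Ts Tt; rewrite /mon -big_split /=; apply: eq_bigr => i _; rewrite -exprMn; congr (_ ^+ _).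
  by rewrite entM // mxE (bigD1 i) //= big1 ?addr0 // => j ji; rewrite torus_ent ?mul0r // eq_sym.
have mon1 u : mon u 1%:M = 1.
  by rewrite /mon big1 // => i _; rewrite ent1 // mxE eqxx expr1n.
have pmon u : is_poly (mon u).
  by apply: is_poly_prod => i _; apply: is_polyX; apply: is_polymx_ent.
pose T' : set M := [set t | T t /\ mon w t = mon w' t].
have sT' : subgroup T'.
  split=> [x [Tx _]||x y [Tx hx] [Ty hy]|x [Tx hx]].
  - exact: (sg_unit sT Tx).
  - by split; [exact: (sg1 sT) | rewrite !mon1].
  - by split; [exact: (sgM sT) | rewrite !monM // hx hy].
  have TVx := sgV sT Tx; split=> //.
  have E u : mon u (invmx x) * mon u x = 1 by rewrite -monM // mulVmx ?mon1 // (sg_unit sT).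
  have n0 : mon w x != 0 by apply/eqP => E0; have /eqP := E w; rewrite E0 mulr0 eq_sym oner_eq0.
  by apply: (mulIf n0); rewrite E hx E.
have aT' : algebraic_group T'.
  apply: (alg_cut (F := [set f | f = fun x => mon w x - mon w' x]) aT sT').
    by move=> _ ->; apply: is_polyB.
  move=> x; split=> -[Tx hx]; split=> //; first by move=> _ ->; rewrite hx subrr.
  by apply/eqP; rewrite -subr_eq0; apply/eqP; apply: (hx (fun x => mon w x - mon w' x)).
have [_ /(_ T' aT') TT'] := torus_core gla.
suff h : T `<=` T' by move=> t /h[].
apply: TT' => v Xv; have [m [N N0 hm] hK] := Xv; exists m; first by exists N.
move=> c c0; split; first exact: hK.
have E u : mon u (cochar g m c) = c ^ (\sum_i (u i)%:Z * m i).
  rewrite -expz_sum //; apply: eq_bigr => i _; rewrite ent_cochar // !mxE eqxx mulr1n exprnP exprz_exp.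
  by rewrite mulrC.
rewrite !E; congr (c ^ _); apply: (@intr_inj rat); rewrite !rmorph_sum /=.
have E' u : \sum_i ((u i)%:Z * m i)%:~R = N%:R * \sum_i (u i)%:R * v 0 i :> rat.
  by rewrite mulr_sumr; apply: eq_bigr => i _; rewrite rmorphM /= hm -pmulrn mulrCA.
by rewrite !E' hw.
Qed.

Lemma torus_char la i j : generic la -> la 0 i = la 0 j -> forall t, T t -> ent t i i = ent t j j.
Proof.
move=> gla ij t Tt; have E (k : 'I_n) (F : fieldType) (f : 'I_n -> F) :
    \prod_i f i ^+ (i == k) = f k.
  rewrite (bigD1 k) //= eqxx expr1 big1 ?mulr1 // => l /negPf ->; exact: expr0.
rewrite -(E i _ (fun k => ent t k k)) -(E j _ (fun k => ent t k k)).
apply: (torus_monomial gla) Tt => v Xv.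
have S k : \sum_i ((i == k) : nat)%:R * v 0 i = v 0 k.
  by rewrite (bigD1 k) //= eqxx mul1r big1 ?addr0 // => l /negPf ->; rewrite mul0r.
by rewrite !S; exact: gla.2.
Qed.

Lemma torus_commute la Z t : generic la -> weq (la 0) (ent Z) -> T t -> t *m Z = Z *m t.
Proof.
move=> gla hZ Tt; apply: (ent_inj gu); rewrite !entM //.
have [s tE] : exists s, t = tdiag g s by apply: tdiag_ent => i j ij; apply: torus_ent.
rewrite tE ent_tdiag //; apply/matrixP => i j; rewrite mul_diag_mx mul_mx_diag !mxE mulrC.
have [->|/hZ E] := eqVneq (ent Z i j) 0; first by rewrite !mul0r.
have := torus_char gla E Tt; rewrite tE ent_tdiag // !mxE !eqxx !mulr1n => ->; reflexivity.
Qed.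

Lemma generic_exists (s : seq 'rV[rat]_n) v0 : X v0 -> exists2 la, generic la & forall r, r \in s ->
  (0 < dot v0 r -> 0 < dot la r) /\ (dot la r = 0 -> forall x, X x -> dot x r = 0).
Proof.
move=> Xv0; pose s' := s ++ [seq delta_mx 0 ij.1 - delta_mx 0 ij.2 | ij : 'I_n * 'I_n].
have [la Xla hla] := generic_vector s' (cochars_linset gu aT) Xv0.
exists la; last by move=> r rs; apply: hla; rewrite mem_cat rs.
split=> // i j ij v Xv.
have dd (u : 'rV[rat]_n) (k : 'I_n) : dot u (delta_mx 0 k) = u 0 k.
  rewrite /dot (bigD1 k) //= mxE !eqxx mulr1 big1 ?addr0 // => l lk.
  by rewrite mxE (negPf lk) andbF mulr0.
have [|_ h] := hla (delta_mx 0 i - delta_mx 0 j).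
  by rewrite mem_cat; apply/orP; right; apply/mapP; exists (i, j); rewrite ?mem_enum.
have := h _ v Xv; rewrite !dotBr !dd ij subrr => /(_ erefl) /eqP; rewrite subr_eq0 => /eqP; exact.
Qed.

End Torus.
End CocharMore.

(** * Weight components of matrices and of Lie algebras *)

Section WeightComponents.
Variables (F : numFieldType) (n : nat) (V : zmodType) (v : 'I_n -> V).
Implicit Types (A B : 'M[F]_n) (r t : V).

(** Weights take values in any additive group: rational numbers for a single cocharacter, vectors
    for a whole torus. *)
Definition haswt r A := forall i j, A i j != 0 -> v i - v j = r.
Definition wcomp r A : 'M[F]_n := \matrix_(i, j) (if v i - v j == r then A i j else 0).
Definition wdiffs : seq V := undup [seq v ij.1 - v ij.2 | ij : 'I_n * 'I_n].

Lemma wcomp_haswt r A : haswt r (wcomp r A).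
Proof. by move=> i j; rewrite mxE; case: (v i - v j =P r) => // _; rewrite eqxx. Qed.

Lemma wcomp_sum A : A = \sum_(r <- wdiffs) wcomp r A.
Proof.
apply/matrixP => i j; rewrite summxE (bigD1_seq (v i - v j)) ?undup_uniq //=; last first.
  by rewrite mem_undup; apply/mapP; exists (i, j); rewrite ?mem_enum.
rewrite mxE eqxx big1 ?addr0 // => r rij; rewrite mxE eq_sym (negPf rij) //.
Qed.

Lemma haswtM r t A B : haswt r A -> haswt t B -> haswt (r + t) (A *m B).
Proof. by move=> hA hB i j /mulmx_neq0[k [/hA <- /hB <-]]; rewrite addrA subrK. Qed.

Lemma haswtD r A B : haswt r A -> haswt r B -> haswt r (A + B).
Proof. by move=> hA hB i j /addmx_neq0[/hA|/hB]. Qed.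

Lemma haswtZ r a A : haswt r A -> haswt r (a *: A).
Proof. by move=> hA i j; rewrite mxE mulf_eq0 negb_or => /andP[_ /hA]. Qed.

Lemma haswtN r A : haswt r A -> haswt r (- A).
Proof. by rewrite -scaleN1r; apply: haswtZ. Qed.

Lemma haswt_bracket r t A B : haswt r A -> haswt t B -> haswt (r + t) (A *m B - B *m A).
Proof.
move=> hA hB; apply: haswtD; first exact: haswtM.
by rewrite addrC; apply/haswtN/haswtM.
Qed.

Lemma haswt_tr r A : haswt r A -> r != 0 -> \tr A = 0.
Proof.
move=> hA r0; apply: big1 => i _; apply/eqP; apply: contraNT r0 => /hA.
by rewrite subrr => <-.
Qed.

Lemma haswt_trM r t A B : haswt r A -> haswt t B -> r + t != 0 -> \tr (A *m B) = 0.
Proof. by move=> hA hB; apply/haswt_tr/haswtM. Qed.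

Lemma wcomp_tr r A B : haswt r A -> \tr (A *m B) = \tr (A *m wcomp (- r) B).
Proof.
move=> hA; rewrite {1}(wcomp_sum B) mulmx_sumr raddf_sum /=.
have [h|h] := boolP (- r \in wdiffs).
  rewrite (bigD1_seq (- r)) ?undup_uniq //= big1 ?addr0 // => t tr.
  apply: (haswt_trM hA (@wcomp_haswt t B)); apply: contraNneq tr => /eqP; rewrite addr_eq0 => /eqP ->.
  by rewrite opprK.
rewrite big1_seq => [|t /andP[_ ht]]; last first.
  apply: (haswt_trM hA (@wcomp_haswt t B)); apply: contraNneq h => /eqP; rewrite addr_eq0 => /eqP ->.
  by rewrite opprK.
have -> : wcomp (- r) B = 0; last by rewrite mulmx0 linear0.
apply/matrixP => i j; rewrite !mxE; case: eqP => // E; case/negP: h; rewrite -E mem_undup.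
by apply/mapP; exists (i, j); rewrite ?mem_enum.
Qed.

End WeightComponents.

Section WeightSplit.
Variables (F : numFieldType) (n : nat) (v : 'I_n -> rat).

Lemma haswt_wmx r (A : 'M[F]_n) : haswt v r A -> wmx F v *m A - A *m wmx F v = ratr r *: A.
Proof.
move=> h; apply/matrixP => i j; rewrite /wmx mxBE mul_diag_mx mul_mx_diag !mxE.
have [->|/h <-] := eqVneq (A i j) 0; first by rewrite !mulr0 mul0r subrr.
by rewrite rmorphB /= mulrBl; congr (_ - _); rewrite mulrC.
Qed.

Lemma weight_split (I : set 'M[F]_n) Z r : linset I ->
  (forall Z, I Z -> I (wmx F v *m Z - Z *m wmx F v)) -> I Z -> I (wcomp v r Z).
Proof.
move=> lI hI IZ; have [h|h] := boolP (r \in wdiffs v); last first.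
  have -> : wcomp v r Z = 0; last by case: lI.
  apply/matrixP => i j; rewrite !mxE; case: eqP => // E; case/negP: h; rewrite -E mem_undup.
  by apply/mapP; exists (i, j); rewrite ?mem_enum.
pose D := wmx F v; pose A := mulmx D \- mulmxr D.
have ri : injective (ratr : rat -> F) by apply: fmorph_inj.
pose s := map ratr (wdiffs v) : seq F.
pose w (t : F) : 'M[F]_n := \sum_(r <- wdiffs v | ratr r == t) wcomp v r Z.
have wE q : q \in wdiffs v -> w (ratr q) = wcomp v q Z.
  move=> qs; rewrite /w -big_filter (_ : [seq _ <- _ | _] = [:: q]) ?big_seq1 //.
  rewrite (eq_filter (a2 := pred1 q)) ?filter_pred1_uniq ?undup_uniq // => x.
  by rewrite /= (inj_eq ri).
rewrite -wE //; apply: (@spectral_split F _ A I lI.2 _ s (fun=> 1%N)) => [Y IY||||].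
- exact: hI.
- by rewrite map_inj_uniq // undup_uniq.
- move=> _ /mapP[q qs ->] /=; rewrite wE // (haswt_wmx (@wcomp_haswt _ _ _ v q Z)) subrr; by case: lI.
- rewrite big_map (eq_big_seq (fun q => wcomp v q Z)) => [|q /wE //].
  by rewrite -wcomp_sum.
by apply: map_f.
Qed.

End WeightSplit.

Lemma tr_diag_conj (F : fieldType) n (g : 'M[F]_n) (s t : 'rV[F]_n) : g \in unitmx ->
  \tr (invmx g *m diag_mx s *m g *m (invmx g *m diag_mx t *m g)) = \sum_j s 0 j * t 0 j.
Proof.
move=> gu; rewrite diag_conjM // -mulmxA mxtrace_mulC mulmxK // mxtrace_diag.
by apply: eq_bigr => j _; rewrite mxE.
Qed.

Lemma expm_sub1 (R : realType) n (a : 'M[R[i]]_n) :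
  exists c : nat -> R[i], expm a - 1%:M = \sum_(i < n.-1) c i *: a ^+ i.+1.
Proof.
exists (fun i => (i.+1`!%:R)^-1); case: n a => [|m] a; first by apply/matrixP => -[].
by rewrite expmE big_ord_recl fact0 invr1 scale1r expr0 addrAC subrr add0r.
Qed.

(** * Nondegeneracy of the trace form for a reductive group *)

Section ReductiveLie.
Variables (R : realType) (n : nat).
Local Notation C := R[i].
Local Notation M := 'M[C]_n.

Implicit Types (g X Y Z : M) (K G : set M).

Lemma tr_ent g Z : g \in unitmx -> \tr (ent g Z) = \tr Z.
Proof. by move=> gu; rewrite entE -mulmxA mxtrace_mulC mulmxKV. Qed.

Lemma ent_qdiag g (v : 'rV[rat]_n) : g \in unitmx -> ent g (qdiag g v) = wmx C (v 0).
Proof.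
move=> gu; rewrite /qdiag (ent_tdiag gu) /wmx; congr diag_mx; apply/rowP => j.
by rewrite [LHS]mxE [RHS]mxE.
Qed.

Lemma lie_wcomp g K (v : 'rV[rat]_n) Z r : g \in unitmx -> algebraic_group K -> cochars g K v ->
  lie K Z -> lie K (unent g (wcomp (v 0) r (ent g Z))).
Proof.
move=> gu aK hv hZ.
pose I : set M := [set A | lie K (unent g A)].
have lI : linset I.
  split; first by rewrite /I /= unentE mulmx0 mul0mx; case: (lie_linset K).
  move=> a A B hA hB; rewrite /I /=; have -> : unent g (a *: A + B) = a *: unent g A + unent g B.
    by rewrite !unentE mulmxDr mulmxDl -scalemxAr -scalemxAl.
  exact: (proj2 (lie_linset K) a _ _ hA hB).
have hI A : I A -> I (wmx C (v 0) *m A - A *m wmx C (v 0)).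
  move=> hA; have := lie_bracket aK (cochars_lie gu hv) hA; rewrite /I /=.
  congr (lie K _); apply: (ent_inj gu).
  by rewrite entB (entM gu) (entM gu) (unentK gu) (unentK gu) (ent_qdiag _ gu).
have IZ : I (ent g Z) by rewrite /I /= (entK gu).
exact: (weight_split r lI hI IZ).
Qed.

Lemma nilpotent_tr_comm (A B : M) : A ^+ n = 0 -> A *m B = B *m A -> \tr (A *m B) = 0.
Proof.
case: n A B => [|m] A B An AB; first by rewrite /mxtrace big_ord0.
have : (A *m B) ^+ m.+1 = 0 by rewrite exprMn_comm ?An ?mul0r.
by move=> /nilpotent_facts[].
Qed.

Lemma exp_uni X i j : is_uni (fun c : C => expm (c *: X) i j).
Proof. by exists (exp_curve X i j) => c; rewrite -exp_curveE mxE. Qed.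

Lemma expm_id X : X ^+ n = 0 -> (forall c : C, expm (c *: X) = 1%:M) -> X = 0.
Proof.
move=> Xn h; have := exp_dcurve 0 Xn; rewrite scale0r expm0 mul1mx => <-.
have -> : exp_curve X = map_mx polyC 1%:M.
  apply/matrixP => i j; apply: poly_nat_inj => k.
  by have /matrixP/(_ i j) := h k%:R; rewrite -exp_curveE !mxE hornerC.
exact: mxdcurve_cst.
Qed.

Definition nondegenerate (L : set M) := forall Z, L Z -> (forall Y, L Y -> \tr (Z *m Y) = 0) -> Z = 0.

(** Cartan's criterion through replicas. If [v] is orthogonal to the relations of [s], then
    [qdiag g v] lies in the Lie algebra and commutes with [N], so the orthogonality of [Z] says that
    the sum of the products of the entries of [s] and [v] is zero; [replica_trace0] gives
    [s = 0]. *)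
Lemma null_nilpotent K Z : algebraic_group K -> lie K Z -> (forall Y, lie K Y -> \tr (Z *m Y) = 0) ->
  Z ^+ n = 0.
Proof.
move=> aK hZ h; have [g [s [N [gu ZE Nn _ SN]]]] := jordan_decomposition Z.
rewrite -tdiagE in ZE SN.
have hZ' : lie K (tdiag g s + N) by rewrite -ZE.
suff s0 : s = 0.
  by rewrite ZE s0 tdiagE linear0 mulmx0 mul0mx add0r.
apply: (replica_trace0 gu aK hZ' SN Nn) => v hv rv.
have tN : \tr (N *m qdiag g v) = 0.
  apply: nilpotent_tr_comm; first exact: Nn.
  apply: (ent_inj gu); rewrite (entM gu) (entM gu) (ent_qdiag _ gu).
  have := congr1 (ent g) SN; rewrite (entM gu) (entM gu) (ent_tdiag gu) => E.
  apply/matrixP => i j; rewrite mul_diag_mx mul_mx_diag mxE [RHS]mxE [in LHS]mxE [in RHS]mxE mulrC.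
  have [->|Nij] := eqVneq (ent g N i j) 0; first by rewrite !mulr0.
  congr (ratr _ * _); have /matrixP/(_ i j) := E; rewrite mul_diag_mx mul_mx_diag mxE [RHS]mxE mulrC => /(mulfI Nij) sij.
  have : relations s (delta_mx 0 i - delta_mx 0 j).
    rewrite /relations /= (eq_bigr (fun k => (k == i)%:R * s 0 k - (k == j)%:R * s 0 k)) => [|k _]; last first.
      by rewrite -mulrBl !mxE !eqxx rmorphB /= !ratr_nat.
    rewrite sumrB (bigD1 i) //= [X in _ - X](bigD1 j) //= !eqxx !mul1r.
    by rewrite !big1 ?addr0 ?sij ?subrr // => k /negPf ->; rewrite mul0r.
  move=> /rv; rewrite /dot (eq_bigr (fun k => (k == i)%:R * v 0 k - (k == j)%:R * v 0 k)) => [|k _]; last first.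
    by rewrite -mulrBl !mxE !eqxx.
  rewrite sumrB (bigD1 i) //= [X in _ - X](bigD1 j) //= !eqxx !mul1r.
  rewrite !big1 ?addr0 => [/eqP|k /negPf ->|k /negPf ->]; rewrite ?mul0r // subr_eq0 => /eqP.
  by move=> ->.
have := h _ (cochars_lie gu hv); rewrite ZE mulmxDl linearD /= tN addr0 => E0; rewrite -[RHS]E0.
rewrite /qdiag !tdiagE; symmetry; exact: tr_diag_conj.
Qed.

(** The kernel of the trace form is an ideal of nilpotent matrices. Engel's theorem gives a flag
    that it moves down and that [G] preserves. The elements of [G] acting trivially on the
    successive quotients form a connected normal unipotent group, which contains the exponentials of
    the kernel and is trivial by reductivity. *)
Lemma reductive_nondegenerate G : connected_reductive G -> nondegenerate (lie G).
Proof.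
move=> [aG cG rG]; have sG := alg_subgroup aG.
pose rad : set M := [set Z | lie G Z /\ forall Y, lie G Y -> \tr (Z *m Y) = 0].
have radAd x Z : G x -> rad Z -> rad (x *m Z *m invmx x).
  move=> Gx [hZ h]; split; first exact: lie_Ad.
  move=> Y hY; have xu := sg_unit sG Gx.
  have := h _ (lie_Ad aG (sgV sG Gx) hY); rewrite invmxK.
  by rewrite !mulmxA mxtrace_mulC !mulmxA.
have rad_lin : linset rad.
  split; first by split=> [|Y _]; [case: (lie_linset G) | rewrite mul0mx linear0].
  move=> a u w [hu tu] [hw tw]; split; first exact: (lie_linset G).2.
  by move=> Y hY; rewrite mulmxDl -scalemxAl linearD linearZ /= tu // tw // mulr0 addr0.
have rad_lie : lie_subalgebra rad.
  split=> // X Y [hX tX] [hY tY]; split; first exact: lie_bracket.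
  move=> Z hZ; have := tX _ (lie_bracket aG hY hZ).
  rewrite mulmxBr mulmxBl !linearB /= !mulmxA => <-; congr (_ - _).
  by rewrite [RHS]mxtrace_mulC !mulmxA.
have rad_nil Z : rad Z -> Z ^+ n = 0 by move=> [hZ h]; apply: null_nilpotent h.
have [B [N [hB BN]]] := engel rad_lie rad_nil.
pose V := lflag B.
have VG x k : G x -> (V k *m x <= V k)%MS.
  move=> Gx; have xu := sg_unit sG Gx; elim: k => [|k IH]; first exact: submx1.
  rewrite {1}/V /lflag iterS -/(lflag B k) -/(V k) /lop sumsmxMr_gen; apply/sumsmx_subP => i _; rewrite genmxE.
  set Z := vec_mx _; have hZ : rad Z by apply/hB; rewrite vec_mxK row_sub.
  have -> : V k *m Z *m x = V k *m x *m (invmx x *m Z *m x).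
    by rewrite !mulmxA mulmxK.
  apply: submx_trans (submxMr _ IH) _; apply: lop_sub; apply/hB.
  by have := radAd _ _ (sgV sG Gx) hZ; rewrite invmxK.
(* The matrices moving the flag one step down are nilpotent, and the products of such a matrix with
   one preserving the flag are again of this kind. *)
pose st (a : M) := forall k, (V k *m a <= V k.+1)%MS.
have stZ c a : st a -> st (c *: a) by move=> ha k; rewrite -scalemxAr; apply/scalemx_sub/ha.
have stD a b : st a -> st b -> st (a + b) by move=> ha hb k; rewrite mulmxDr; apply: addmx_sub.
have stMr a b : st a -> (forall k, (V k *m b <= V k)%MS) -> st (a *m b).
  by move=> ha hb k; rewrite mulmxA; apply: submx_trans (submxMr _ (ha k)) (hb _).
have stMl a b : (forall k, (V k *m b <= V k)%MS) -> st a -> st (b *m a).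
  by move=> hb ha k; rewrite mulmxA; apply: submx_trans (submxMr _ (hb k)) (ha _).
have st_w a : st a -> forall k, (V k *m a <= V k)%MS.
  by move=> ha k; apply: submx_trans (ha k) (lflag_dec _ _).
have st0 : st 0 by move=> k; rewrite mulmx0 sub0mx.
have st_sum (I : Type) (r : seq I) (P : pred I) (f : I -> M) :
    (forall i, P i -> st (f i)) -> st (\sum_(i <- r | P i) f i).
  by move=> h; elim/big_ind: _.
have stX a k : st a -> st (a ^+ k.+1).
  move=> ha; elim: k => [|k IH]; first by rewrite expr1.
  by rewrite exprS; apply: stMr => //; apply: st_w.
have st_nil a : st a -> a ^+ n = 0.
  move=> ha; suff : a ^+ N = 0 by move=> /nilpotent_facts[].
  suff H k : (a ^+ k <= V k)%MS by have := H N; rewrite /V BN submx0 => /eqP.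
  elim: k => [|k IH]; first exact: submx1.
  by rewrite exprSr; apply: submx_trans (submxMr _ IH) (ha k).
have st_exp a : st a -> st (expm a - 1%:M).
  move=> ha; have [c ->] := expm_sub1 a.
  by apply: st_sum => i _; apply: stZ; apply: stX.
pose U : set M := [set x | G x /\ st (x - 1%:M)].
have sU : subgroup U.
  split=> [x [Gx _]||x y [Gx hx] [Gy hy]|x [Gx hx]].
  - exact: (sg_unit sG Gx).
  - by split; [exact: (sg1 sG) | rewrite subrr].
  - split; first exact: (sgM sG).
    have -> : x *m y - 1%:M = (x - 1%:M) *m y + (y - 1%:M) by rewrite mulmxBl mul1mx addrA subrK.
    by apply: stD => //; apply: stMr => // k; apply: VG.
  split; first exact: (sgV sG).
  have -> : invmx x - 1%:M = (-1) *: (invmx x *m (x - 1%:M)).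
    by rewrite mulmxBr mulVmx ?(sg_unit sG Gx) // mulmx1 scaleN1r opprB.
  by apply/stZ/stMl => // k; apply/VG/(sgV sG).
have aU : algebraic_group U.
  apply: (alg_cut (F := [set f | exists k i j, f = fun x : M => (V k *m (x - 1%:M) *m cokermx (V k.+1)) i j]) aG sU).
    move=> _ [k [i [j ->]]].
    have p1 : is_polymx (fun x : M => x - 1%:M).
      move=> a b; apply: (is_poly_ext (f := fun x => x a b - (1%:M : M) a b)) => [x|]; first by rewrite mxBE.
      by apply: is_polyB; [exact: is_poly_entry | exact: is_poly_cst].
    have p2 : is_polymx (fun x : M => V k *m (x - 1%:M)).
      by apply: is_polymxM; [exact: is_polymx_cst | exact: p1].
    have p3 : is_polymx (fun x : M => V k *m (x - 1%:M) *m cokermx (V k.+1)).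
      by apply: is_polymxM; [exact: p2 | exact: is_polymx_cst].
    exact: p3.
  move=> x; split=> -[Gx hx]; split=> //.
    by move=> _ [k [i [j ->]]]; have := hx k; rewrite submxE => /eqP ->; rewrite mxE.
  move=> k; rewrite submxE; apply/eqP/matrixP => i j; rewrite [RHS]mxE.
  by apply: (hx (fun x : M => (V k *m (x - 1%:M) *m cokermx (V k.+1)) i j)); exists k, i, j.
have U_exp Z : lie G Z -> Z ^+ n = 0 -> st Z -> forall c, U (expm (c *: Z)).
  move=> hZ Zn sZ c; split; first exact: lie_exp.
  by apply/st_exp/stZ.
have cU : connected_group U.
  suff -> : U = identity_component U by apply: idcomp_connected.
  rewrite eqEsubset; split; last exact: idcomp_sub.
  move=> x [Gx hx]; have [X Xn [eX [a a0 XE]]] := unipotent_log (st_nil _ hx).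
  have sX : st X.
    rewrite XE; apply: st_sum => -[k kn] _; case: k kn => [|k] kn /=; first by rewrite a0 scale0r.
    by apply/stZ/stX.
  pose h c := expm (c *: X).
  have hU c : U (h c) by split; [exact: (unipotent_curve aG Gx Xn eX) | exact/st_exp/stZ].
  have : range h `<=` identity_component U.
    apply: idcomp_max.
    - by apply/irreducible_connected/irreducible_curve; apply: exp_uni.
    - by exists 0; [exact: I | rewrite /h scale0r expm0].
    - by move=> _ [c _ <-].
  by apply; exists 1; [exact: I | rewrite /h scale1r].
move=> Z hZ h; have rZ : rad Z by split.
have Zn := rad_nil _ rZ.
have sZ : st Z by move=> k; apply/lop_sub/hB.
apply: (expm_id Zn) => c.
have : unipotent_radical G (expm (c *: Z)).
  exists U; last exact: U_exp.
  split=> //; last by move=> x [_ /st_nil hx]; exists n.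
  split; first by move=> x [].
  move=> x u Gx [Gu hu]; split; first exact: (sgJ sG).
  have xu := sg_unit sG Gx.
  have -> : x *m u *m invmx x - 1%:M = x *m (u - 1%:M) *m invmx x by rewrite mulmxBr mulmx1 mulmxBl mulmxV.
  by apply: stMr => [|k]; [apply: stMl => // k; apply: VG | apply/VG/(sgV sG)].
by rewrite rG.
Qed.

End ReductiveLie.

Section BlockTraces.
Variables (F : numFieldType) (n : nat) (la : 'I_n -> rat).
Implicit Types A N : 'M[F]_n.

Definition blocktr i A : F := \sum_(j | la j == la i) A j j.

Lemma blocktr_nilpotent i N : weq la N -> N ^+ n = 0 -> blocktr i N = 0.
Proof.
move=> wN Nn; pose p := wproj F la (la i).
have Np : N *m p = p *m N.
  apply/matrixP => k l; rewrite /p /wproj mul_mx_diag mul_diag_mx !mxE mulrC.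
  by have [->|/wN ->//] := eqVneq (N k l) 0; rewrite !mulr0.
have -> : blocktr i N = \tr (p *m N).
  rewrite /blocktr big_mkcond; apply: eq_bigr => j _; rewrite mul_diag_mx !mxE.
  by case: (la j == la i); rewrite ?mul1r ?mul0r.
rewrite -Np; case: n la N wN Nn i p Np => [|m] la' N wN Nn i p Np; first by case: (i).
have : (N *m p) ^+ m.+1 = 0 by rewrite exprMn_comm ?Nn ?mul0r.
by move=> /nilpotent_facts[].
Qed.

Lemma blocktrD i A B : blocktr i (A + B) = blocktr i A + blocktr i B.
Proof. by rewrite /blocktr -big_split; apply: eq_bigr => j _; rewrite mxE. Qed.

Lemma blocktr_diag i (s : 'rV[F]_n) : (forall j, la j = la i -> s 0 j = s 0 i) ->
  blocktr i (diag_mx s) = s 0 i * (\sum_(j | la j == la i) 1).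
Proof.
move=> hs; rewrite mulr_sumr; apply: eq_bigr => j /eqP /hs E.
by rewrite mxE eqxx mulr1n E mulr1.
Qed.

Lemma block_size_neq0 i : \sum_(j | la j == la i) (1 : F) != 0.
Proof. by rewrite (bigD1 i) //=; apply: lt0r_neq0; apply: ltr_pwDl => //; exact: sumr_ge0. Qed.

End BlockTraces.

(** The value of the cocharacter at 2 is enough, because distinct integral powers of 2 are
    distinct. *)
Lemma commute_weq (R : realType) n (g : 'M[R[i]]_n) (T : set 'M[R[i]]_n) (la : 'rV[rat]_n) Y :
  g \in unitmx -> cochars g T la -> (forall t, T t -> t *m Y = Y *m t) -> weq (la 0) (ent g Y).
Proof.
move=> gu [m [N N0 hm] hK] cY.
have := cY _ (hK 2%:R (lt0r_neq0 (ltr0Sn _ _))).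
move=> /(congr1 (ent g)); rewrite (entM gu) (entM gu) (ent_cochar gu) => E i j Yij.
have /matrixP/(_ i j) := E; rewrite mul_diag_mx mul_mx_diag mxE [RHS]mxE [in LHS]mxE [in RHS]mxE mulrC.
move=> /(mulfI Yij) E2.
have : (2%:R : R[i]) ^ (m i - m j) = 1.
  by rewrite expfzDr ?lt0r_neq0 // E2 -expfzDr ?lt0r_neq0 // subrr expr0z.
have two1 : (2%:R == 1 :> R[i]) = false by apply: (eqr_nat R[i] 2 1).
move=> /eqP; rewrite pexprz_eq1 ?ler0n // two1 orbF subr_eq0 => /eqP mij.
have Nq : N%:R != 0 :> rat by rewrite pnatr_eq0 -lt0n.
by apply: (mulfI Nq); rewrite -!hm mij.
Qed.

(** * The centralizer of a maximal torus in the Lie algebra *)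

Section MaximalTorus.
Variables (R : realType) (n : nat).
Local Notation C := R[i].
Local Notation M := 'M[C]_n.
Variables (G T : set M).
Hypotheses (rG : connected_reductive G) (mT : maximal_torus G T).
Let aG : algebraic_group G. Proof. by case: rG. Qed.
Let aT : algebraic_group T. Proof. by case: mT => -[]. Qed.
Let sT := alg_subgroup aT.
Let cT : connected_group T. Proof. by case: mT => -[]. Qed.
Let TG : T `<=` G. Proof. by case: mT. Qed.
Variables (g : M) (gu : g \in unitmx).
Hypothesis dT : forall t, T t -> is_diag_mx (ent g t).

(* A semisimple element of the Lie algebra that commutes with [T] is diagonal, together with [T],
   in a suitable basis, and its replicas generate with [T] a torus. *)
Lemma semisimple_lie_torus p s : p \in unitmx -> lie G (tdiag p s) ->
  (forall t, T t -> t *m tdiag p s = tdiag p s *m t) -> lie T (tdiag p s).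
Proof.
move=> pu hS cS.
have [v0 Xv0] : exists v, cochars g T v by exists 0; case: (cochars_linset gu aT).
have [la gla _] := generic_exists gu aT [::] Xv0.
have qS : comm_mx (qdiag g la) (tdiag p s).
  rewrite /comm_mx; have /weqP E := commute_weq gu gla.1 cS.
  by apply: (ent_inj gu); rewrite (entM gu) (entM gu) (ent_qdiag _ gu) E.
have diagble (q : M) (u : 'rV[C]_n) : q \in unitmx ->
    exists2 P, P \in unitmx & diagonalizable_for P (tdiag q u).
  move=> qu; exists q => //; apply/(diagonalizable_forLR qu); exists u.
  by rewrite (mxpoly.conjVmx _ qu) tdiagE.
have [P Pu /= /and3P[dla dS _]] : exists2 P, P \in unitmx &
    all [pred A | diagonalizable_for P A] [:: qdiag g la; tdiag p s].
  apply/mxpoly.codiagonalizableP; split.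
    move=> A B; rewrite !inE => /orP[]/eqP-> /orP[]/eqP->;
      [reflexivity | exact: qS | exact: (esym qS) | reflexivity].
  by move=> A; rewrite !inE => /orP[/eqP->|/eqP->]; apply: diagble.
have [d dE] := diagonalizable_forLR Pu dla; rewrite (mxpoly.conjVmx _ Pu) in dE.
have [s' s'E] := diagonalizable_forLR Pu dS; rewrite (mxpoly.conjVmx _ Pu) in s'E.
(* [P] diagonalizes [qdiag g la]. As [la] is generic, each eigenspace of that matrix is contained in
   an eigenspace of every element of [T]. *)
have diagT t : T t -> is_diag_mx (ent P t).
  move=> Tt; have [h [hu hg]] : exists h, h \in unitmx /\ P = h *m g.
    by exists (P *m invmx g); rewrite unitmx_mul Pu unitmx_inv mulmxKV.
  have hE : diag_mx d *m h = h *m wmx C (la 0).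
    have E1 : diag_mx d *m h *m g = h *m wmx C (la 0) *m g.
      have E2 : diag_mx d *m P = P *m qdiag g la by rewrite dE !mulmxA mulmxV // mul1mx.
      rewrite -(mulmxA (diag_mx d)) -hg E2 hg -(ent_qdiag la gu) entE.
      by rewrite !mulmxA (mulmxKV gu).
    by rewrite -[LHS](mulmxK gu) E1 (mulmxK gu).
  have [u tE] : exists u, t = tdiag g u by apply: (tdiag_ent gu) => i j ij; apply: (torus_ent dT).
  have ut i j : la 0 i = la 0 j -> u 0 i = u 0 j.
    move=> ij; have := torus_char gu aT cT dT gla ij Tt; rewrite tE (ent_tdiag gu).
    by rewrite mxE [RHS]mxE !eqxx !mulr1n.
  have hk i : exists k, h i k != 0.
    apply: contrapT => nk; have : row i h = 0.
      apply/rowP => k; rewrite [LHS]mxE [RHS]mxE; apply/eqP; apply: contrapT => /negP hik; apply: nk.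
      by exists k.
    move=> /(congr1 (mulmx^~ (invmx h))); rewrite -row_mul mulmxV // mul0mx => /rowP/(_ i).
    by rewrite !mxE eqxx => /eqP; rewrite oner_eq0.
  have [k hkk] := choice hk.
  have E : h *m diag_mx u = diag_mx (\row_i u 0 (k i)) *m h.
    apply/matrixP => i j; rewrite mul_mx_diag mul_diag_mx mxE [RHS]mxE [in RHS]mxE mulrC.
    have [->|hij] := eqVneq (h i j) 0; first by rewrite !mulr0.
    congr (_ * _); apply: ut; apply: (@fmorph_inj _ C ratr).
    have L l : h i l != 0 -> d 0 i = ratr (la 0 l).
      move=> hil; have /matrixP/(_ i l) := hE; rewrite mul_diag_mx mul_mx_diag mxE [RHS]mxE [in RHS]mxE mulrC.
      by move=> /(mulfI hil).
    have := L _ hij; rewrite (L _ (hkk i)) => E3; exact: (esym E3).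
  have -> : ent P t = diag_mx (\row_i u 0 (k i)).
    have E1 : P *m t = diag_mx (\row_i u 0 (k i)) *m P.
      by rewrite {1}hg tE tdiagE !mulmxA (mulmxK gu) E hg !mulmxA.
    by rewrite entE E1 (mulmxK Pu).
  exact: diag_mx_is_diag.
(* The weights 0, 1, 2 and so on are pairwise distinct, so weight zero means diagonal in the basis
   [P]. *)
pose D := Lgrp P G (fun j : 'I_n => (j : nat)%:R).
have aD : algebraic_group D := Lgrp_algebraic Pu aG _.
have diagD x : weq (fun j : 'I_n => (j : nat)%:R) (ent P x) <-> is_diag_mx (ent P x).
  split=> [h|/is_diag_mxP h i j]; last by move=> hij; congr (_%:R); apply/eqP; apply: contraNT hij => ij; rewrite h // eq_sym.
  apply/is_diag_mxP => i j ij; apply/eqP; apply: contraNT ij => /h/eqP.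
  by rewrite eqr_nat eq_sym.
pose T' := identity_component D.
have tT' : torus T'.
  split; [exact: idcomp_algebraic | exact: idcomp_connected |].
  exists P => // t /idcomp_sub[_ /diagD]; by rewrite entE.
have TT' : T `<=` T'.
  apply: idcomp_max => //; first exact: (sg1 sT).
  by move=> t Tt; split; [exact: TG | apply/diagD; exact: diagT].
have T'E : T' = T.
  case: mT => _ _ hm; apply: hm => // t /idcomp_sub[]; by [].
have S0 : lie G (tdiag P s' + 0) by rewrite addr0 tdiagE -s'E.
have [A [u [hA s'A]]] : exists (A : 'M[rat]_n) (u : 'rV[C]_n),
    (forall i, cochars P G (row i A)) /\ s' = u *m map_mx ratr A.
  apply: (replica_span Pu aG S0); rewrite ?mulmx0 ?mul0mx //.
  by case: (n) => [|q]; [apply/matrixP => -[] | rewrite expr0n].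
have hAT i : cochars P T (row i A).
  have [m hm hK] := hA i; exists m => // c c0; rewrite -T'E.
  have cc1 : cochar P m 1 = 1%:M.
    rewrite cocharE tdiagE; have -> : (\row_(j < n) (1 : C) ^ m j) = const_mx 1.
      by apply/rowP => j; rewrite !mxE exp1rz.
    by rewrite diag_const_mx mulmx1 mulVmx.
  have : cochar P m @` [set c | c != 0] `<=` T'.
    apply: idcomp_max.
    - by apply/irreducible_connected/irreducible_cochar.
    - by exists 1; [exact: oner_neq0 | exact: cc1].
    - move=> _ [c' c'0 <-]; split; first exact: hK.
      by apply/diagD; rewrite (ent_cochar Pu); apply: diag_mx_is_diag.
  by apply; exists c.
have -> : tdiag p s = \sum_i u 0 i *: qdiag P (row i A).
  rewrite s'E -tdiagE s'A mulmx_sum_row.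
  have lin : forall (r : seq 'I_n), tdiag P (\sum_(i <- r) u 0 i *: row i (map_mx ratr A)) =
      \sum_(i <- r) u 0 i *: qdiag P (row i A).
    elim=> [|i r IH]; first by rewrite !big_nil tdiagE linear0 mulmx0 mul0mx.
    by rewrite !big_cons tdiagD tdiagZ IH /qdiag /qrow map_row.
  exact: lin.
apply: (linset_sum (lie_linset T)) => i _; apply: (linsetZ (lie_linset T)).
exact: (cochars_lie Pu (hAT i)).
Qed.

(* In the centralizer of [T] the nilpotent elements are those with vanishing block traces, so they form
   a linear space, on which the trace form vanishes. *)
Lemma centralizer_lie_torus Z : lie G Z -> (forall t, T t -> t *m Z = Z *m t) -> lie T Z.
Proof.
have [v0 Xv0] : exists v, cochars g T v by exists 0; case: (cochars_linset gu aT).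
have [la gla _] := generic_exists gu aT [::] Xv0.
have wT Y : (forall t, T t -> t *m Y = Y *m t) -> weq (la 0) (ent g Y).
  by move=> cY; apply: (commute_weq gu gla.1 cY).
have jd Y : lie G Y -> (forall t, T t -> t *m Y = Y *m t) -> exists s N,
    [/\ Y = tdiag g s + N, lie T (tdiag g s), lie G N, N ^+ n = 0 &
      (forall t, T t -> t *m N = N *m t) /\ forall i j, la 0 j = la 0 i -> s 0 j = s 0 i].
  move=> hY cY; have [p [s [N [pu YE Nn cS SN]]]] := jordan_decomposition Y.
  rewrite -tdiagE in YE cS SN.
  have hS : lie G (tdiag p s) by apply: (lie_semisimple aG pu _ SN Nn); rewrite -YE.
  have cSt t : T t -> t *m tdiag p s = tdiag p s *m t by move=> Tt; rewrite cS // cY.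
  have hST := semisimple_lie_torus pu hS cSt.
  have [u uE] := torus_lie_diag gu dT hST.
  have NE : N = Y - tdiag p s by rewrite YE addrC addKr.
  exists u, N; rewrite -uE; split=> //.
    by rewrite NE; apply: (linsetB (lie_linset G)).
  split; first by move=> t Tt; rewrite NE mulmxBr mulmxBl cY // cSt.
  move=> i j ij; apply/eqP; rewrite -subr_eq0; apply/eqP.
  have := @lie_linear_eq _ _ T (tdiag p s) (fun x => ent g x j j - ent g x i i).
  rewrite uE (ent_tdiag gu) !mxE !eqxx !mulr1n; apply.
  - by apply: is_polyB; apply: is_polymx_ent.
  - by move=> a x y; rewrite !entD !entZ !mxE; ring.
  - move=> x Tx; rewrite (torus_char gu aT cT dT gla ij Tx) (ent1 gu) !mxE !eqxx !subrr; by [].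
  - by rewrite -uE.
have nil Y : lie G Y -> (forall t, T t -> t *m Y = Y *m t) ->
    (Y ^+ n = 0 <-> forall i, blocktr (la 0) i (ent g Y) = 0).
  move=> hY cY; split=> [Yn i|h].
    by apply: (blocktr_nilpotent _ (wT _ cY)); rewrite -entX // Yn ent0.
  have [s [N [YE hS hN Nn [cN hs]]]] := jd Y hY cY.
  suff s0 : s = 0 by rewrite YE s0 tdiagE linear0 mulmx0 mul0mx add0r.
  apply/rowP => i; have := h i; rewrite YE entD blocktrD (ent_tdiag gu) blocktr_diag; last by move=> j; apply: hs.
  rewrite (blocktr_nilpotent _ (wT _ cN)) ?addr0; last by rewrite -entX // Nn ent0.
  by move=> /eqP; rewrite mulf_eq0 (negPf (block_size_neq0 _ _ _)) orbF mxE => /eqP.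
have lc a Y Y' : (forall t, T t -> t *m Y = Y *m t) -> (forall t, T t -> t *m Y' = Y' *m t) ->
    forall t, T t -> t *m (a *: Y + Y') = (a *: Y + Y') *m t.
  by move=> h h' t Tt; rewrite mulmxDr mulmxDl -scalemxAr -scalemxAl h // h'.
have trNN N N' : lie G N -> (forall t, T t -> t *m N = N *m t) -> N ^+ n = 0 ->
    lie G N' -> (forall t, T t -> t *m N' = N' *m t) -> N' ^+ n = 0 -> \tr (N *m N') = 0.
  move=> hN cN Nn hN' cN' N'n.
  have hS : lie G (1 *: N + N') := proj2 (lie_linset G) 1 _ _ hN hN'.
  have Sn : (1 *: N + N') ^+ n = 0.
    apply/(nil _ hS (lc 1 _ _ cN cN')) => i; rewrite scale1r entD blocktrD.
    by have [/(_ Nn i) -> _] := nil N hN cN; have [/(_ N'n i) -> _] := nil N' hN' cN'; rewrite addr0.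
  have tS (A : M) : A ^+ n = 0 -> \tr (A *m A) = 0 by move=> An; apply: nilpotent_tr_comm.
  have := tS _ Sn; rewrite scale1r mulmxDl !mulmxDr !linearD /= (tS _ Nn) (tS _ N'n) addr0 add0r.
  rewrite [\tr (N' *m N)]mxtrace_mulC => /eqP; rewrite -mulr2n mulrn_eq0 => /eqP; exact.
move=> hZ cZ; have [s [N [ZE hS hN Nn [cN hs]]]] := jd Z hZ cZ.
suff N0 : N = 0 by rewrite ZE N0 addr0.
apply: (reductive_nondegenerate rG hN) => Y hY.
have hN0 : haswt (la 0) 0 (ent g N) by move=> i j /(wT _ cN) ->; rewrite subrr.
(* Only the weight-zero component of [Y] contributes to the trace against [N], and this component
   commutes with [T]. *)
pose Y0 := unent g (wcomp (la 0) 0 (ent g Y)).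
have hY0 : lie G Y0.
  by apply: (lie_wcomp _ gu aG _ hY); apply: (cochars_mono TG); exact: gla.1.
have -> : \tr (N *m Y) = \tr (N *m Y0).
  rewrite -(tr_ent (N *m Y) gu) -(tr_ent (N *m Y0) gu) !(entM gu) /Y0 (unentK gu).
  by rewrite (wcomp_tr _ hN0) oppr0.
have wY0 : weq (la 0) (ent g Y0).
  rewrite /Y0 (unentK gu) => i j /wcomp_haswt/eqP; by rewrite subr_eq0 => /eqP ->.
have cY0 t : T t -> t *m Y0 = Y0 *m t by move=> Tt; apply: (torus_commute gu aT cT dT gla wY0 Tt).
have [s' [N' [YE hS' hN' N'n [cN' hs']]]] := jd Y0 hY0 cY0.
have t2 := trNN _ _ hN cN Nn hN' cN' N'n.
rewrite YE mulmxDr linearD /= t2 addr0; apply: nilpotent_tr_comm; first exact: Nn.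
apply: (ent_inj gu); rewrite (entM gu) (entM gu).
rewrite (ent_tdiag gu); apply/matrixP => i j; rewrite mul_diag_mx mul_mx_diag mxE [RHS]mxE mulrC.
have [->|/(wT _ cN) /hs' ->] := eqVneq (ent g N i j) 0; by rewrite ?mulr0.
Qed.

End MaximalTorus.

(** * Root vectors, triples of sl2 type and reflections *)

Lemma haswt_ad_zero (F : numFieldType) n (w : 'I_n -> rat) (c : rat) : 0 < c ->
  exists k : nat, forall (d : rat) (A : 'M[F]_n), 0 < d -> haswt w (d + k%:R * c) A -> A = 0.
Proof.
move=> c0; pose B := \sum_(ij : 'I_n * 'I_n) `|w ij.1 - w ij.2|.
exists (Num.truncn (B / c)).+1 => d A d0 hA; apply/matrixP => i j; rewrite [RHS]mxE.
apply/eqP; apply: contraT => /hA E.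
have hB : B < (Num.truncn (B / c)).+1%:R * c by rewrite -ltr_pdivrMr // truncnS_gt.
have : w i - w j <= B.
  apply: le_trans (ler_norm _) _; rewrite /B (bigD1 (i, j)) //= lerDl.
  by apply: sumr_ge0 => ij _; apply: normr_ge0.
rewrite E => h; have : d + (Num.truncn (B / c)).+1%:R * c < (Num.truncn (B / c)).+1%:R * c by apply: le_lt_trans h hB.
by rewrite -subr_lt0 addrK ltNge (ltW d0).
Qed.

Lemma mx_jacobi (F : fieldType) n (A B D : 'M[F]_n) :
  A *m (B *m D - D *m B) - (B *m D - D *m B) *m A =
  ((A *m B - B *m A) *m D - D *m (A *m B - B *m A)) + (B *m (A *m D - D *m A) - (A *m D - D *m A) *m B).
Proof.
rewrite !(mulmxBr, mulmxBl) !mulmxA.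
move: (A *m B *m D) (A *m D *m B) (B *m D *m A) (D *m B *m A) (B *m A *m D) (D *m A *m B) => a b c d e f.
by apply/matrixP => i j; rewrite !mxE; ring.
Qed.

Lemma mxtraceB (F : fieldType) n (A B : 'M[F]_n) : \tr (A - B) = \tr A - \tr B.
Proof. exact: linearB. Qed.

Lemma tr_shuffle (F : fieldType) n (e f q : 'M[F]_n) :
  \tr ((e *m f - f *m e) *m q) = - \tr (e *m (q *m f - f *m q)).
Proof.
rewrite mulmxBl mulmxBr !mxtraceB opprB !mulmxA; congr (_ - _).
by rewrite -(mulmxA f e q) mxtrace_mulC.
Qed.

(* Otherwise [Y] would generate an infinite-dimensional module under [E]. *)
Lemma sl2_lowest (F : numFieldType) n (w : 'I_n -> rat) (E G Y : 'M[F]_n) (c d : rat) (kappa : F) :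
  kappa != 0 -> 0 < c -> 0 < d -> haswt w c E -> haswt w d Y ->
  E *m G - G *m E = kappa *: wmx F w -> G *m Y = Y *m G -> Y = 0.
Proof.
move=> k0 c0 d0 hE hY EG GY.
pose ad Z := E *m Z - Z *m E; pose y k := iter k ad Y.
have hy k : haswt w (d + k%:R * c) (y k).
  elim: k => [|k IH]; first by rewrite mul0r addr0.
  rewrite /y iterS -/(y k); have -> : d + k.+1%:R * c = c + (d + k%:R * c) by rewrite -[k.+1%:R]natr1; ring.
  exact: haswt_bracket.
pose b k : rat := \sum_(i < k) (d + i%:R * c).
have GE : G *m E - E *m G = - kappa *: wmx F w by rewrite scaleNr -EG opprB.
have GyS k : G *m y k.+1 - y k.+1 *m G = - (kappa * ratr (b k.+1)) *: y k.
  elim: k => [|k IH].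
    rewrite /y /= /ad mx_jacobi GY subrr mulmx0 mul0mx subrr addr0 GE -scalemxAl -scalemxAr -scalerBr.
    by rewrite (haswt_wmx hY) scalerA /b big_ord1 mul0r addr0 mulNr.
  rewrite {1 2}/y iterS -/(y k.+1) /ad mx_jacobi IH GE -scalemxAl -scalemxAr -scalerBr.
  rewrite (haswt_wmx (hy k.+1)) -scalemxAr -scalemxAl -scalerBr.
  rewrite -/(ad (y k)) -[ad (y k)]/(y k.+1) scalerA -scalerDl; congr (_ *: _).
  by rewrite /b [in RHS]big_ord_recr /= rmorphD /=; ring.
have b0 k : 0 < b k.+1.
  rewrite /b big_ord_recl mul0r addr0; apply: ltr_pwDl => //.
  by apply: sumr_ge0 => i _; apply: addr_ge0; [exact: ltW | apply: mulr_ge0; [exact: ler0n | exact: ltW]].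
have [k hk] := haswt_ad_zero F w c0.
have : y k = 0 by apply: hk d0 (hy k).
elim: k {hk} => [//|k IH] yk; apply: IH.
have := GyS k; rewrite yk mulmx0 mul0mx subrr => /esym/eqP.
by rewrite scaler_eq0 oppr_eq0 mulf_eq0 (negPf k0) fmorph_eq0 (gt_eqF (b0 k)) /= => /eqP.
Qed.

Lemma intertwine3 (F : fieldType) n (a b d x0 x1 x2 x3 : 'M[F]_n) :
  d *m x0 = x1 *m d -> b *m x1 = x2 *m b -> a *m x2 = x3 *m a ->
  (a *m b *m d) *m x0 = x3 *m (a *m b *m d).
Proof. by move=> h1 h2 h3; rewrite -!mulmxA h1 (mulmxA b) h2 -mulmxA (mulmxA a) h3 !mulmxA. Qed.

(** The product of three exponentials is the usual lift of a reflection from SL2. Each exponential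
    is moved past the toral element by [expm_ad], where the series of iterated brackets stops. *)
Lemma sl2_reflection (R : realType) n (E F Q H : 'M[R[i]]_n) (c : R[i]) : E ^+ n = 0 -> F ^+ n = 0 ->
  Q *m E - E *m Q = c *: E -> Q *m F - F *m Q = - (c *: F) -> E *m F - F *m E = H ->
  H *m E - E *m H = 2%:R *: E -> H *m F - F *m H = - (2%:R *: F) ->
  (expm E *m expm (- F) *m expm E) *m Q = (Q - c *: H) *m (expm E *m expm (- F) *m expm E).
Proof.
move=> En Fn QE QF EF HE HF.
have sw (A B D : 'M[R[i]]_n) : A *m B - B *m A = D -> B *m A = A *m B - D by move=> <-; rewrite opprB addrC subrK.
have Fn' : (- F) ^+ n = 0 by rewrite -scaleN1r; apply: nilpotentZ.
have s1 : expm E *m Q = (Q - c *: E) *m expm E.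
  have -> : Q - c *: E = Q + (- (c *: E)) + 2%:R^-1 *: 0 by rewrite scaler0 addr0.
  apply: (expm_ad En).
  - exact: sw QE.
  - by rewrite addr0 mulmxN mulNmx -scalemxAl -scalemxAr.
  - by rewrite mulmx0 mul0mx.
have s2 : expm (- F) *m (Q - c *: E) = (Q - c *: E - c *: H) *m expm (- F).
  have -> : Q - c *: E - c *: H = (Q - c *: E) + (- (c *: F) - c *: H) + 2%:R^-1 *: (2%:R *: (c *: F)).
    rewrite [2%:R^-1 *: _]scalerA mulVf ?pnatr_eq0 // scale1r.
    by move: (c *: E) (c *: F) (c *: H) => A B D; apply/matrixP => i j; rewrite !mxE; ring.
  apply: (expm_ad Fn').
  - rewrite !(mulmxBr, mulmxBl, mulNmx, mulmxN) -!scalemxAl -!scalemxAr (sw _ _ _ QF) -EF.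
    by move: (Q *m F) (E *m F) (F *m E) => A B D; apply/matrixP => i j; rewrite !mxE; ring.
  - rewrite !(mulmxBr, mulmxBl, mulNmx, mulmxN) -!scalemxAl -!scalemxAr (sw _ _ _ HF).
    by move: (F *m F) (H *m F) => A B; apply/matrixP => i j; rewrite !mxE; ring.
  - by rewrite mulNmx mulmxN -!scalemxAl -!scalemxAr.
have s3 : expm E *m (Q - c *: E - c *: H) = (Q - c *: H) *m expm E.
  have -> : Q - c *: H = (Q - c *: E - c *: H) + c *: E + 2%:R^-1 *: 0.
    by rewrite scaler0 addr0 addrAC subrK.
  apply: (expm_ad En).
  - rewrite !(mulmxBr, mulmxBl) -!scalemxAl -!scalemxAr (sw _ _ _ QE) (sw _ _ _ HE).
    by move: (Q *m E) (E *m E) (H *m E) => A B D; apply/matrixP => i j; rewrite !mxE; ring.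
  - by rewrite addr0 -scalemxAl -scalemxAr.
  - by rewrite mulmx0 mul0mx.
exact: intertwine3 s1 s2 s3.
Qed.

(* [g] diagonalizes the torus [T], and [P] is the matrix of the orthogonal projection onto the
   rational span of the cocharacters of [T]. *)
Record torus_frame (R : realType) n (g : 'M[R[i]]_n) (T : set 'M[R[i]]_n) (P : 'M[rat]_n) : Prop := TorusFrame {
  fr_gu : g \in unitmx;
  fr_aT : algebraic_group T;
  fr_cT : connected_group T;
  fr_dT : forall t, T t -> is_diag_mx (ent g t);
  fr_Ps : P^T = P;
  fr_PX : forall v, cochars g T (v *m P);
  fr_Pid : forall v, cochars g T v -> v *m P = v }.

(** All that the theory of roots below takes from reductivity and maximality of the torus. It is
    established for [G] and then for the identity component of the fixed group of [S], so that both
    are treated alike. *)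
Record torus_pair (R : realType) n (T K : set 'M[R[i]]_n) : Prop := TorusPair {
  pr_aK : algebraic_group K;
  pr_cK : connected_group K;
  pr_TK : T `<=` K;
  pr_hz : forall Z, lie K Z -> (forall t, T t -> t *m Z = Z *m t) -> lie T Z;
  pr_nd : nondegenerate (lie K) }.

Section Pair.
Variables (R : realType) (n : nat).
Local Notation C := R[i].
Local Notation M := 'M[C]_n.
Variables (g : M) (T : set M) (P : 'M[rat]_n) (fr : torus_frame g T P).
Let gu := fr_gu fr.
Let aT := fr_aT fr.
Let cT := fr_cT fr.
Let dT := fr_dT fr.
Let Ps := fr_Ps fr.
Let PX := fr_PX fr.
Let Pid := fr_Pid fr.
Local Notation ent := (ent g).
Local Notation unent := (unent g).
Local Notation qdiag := (qdiag g).
Local Notation X := (cochars g T).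

(** The [i]-th coordinate function on cocharacters, represented by a vector of [X] through the dot
    product; weights of [T] are differences of these. *)
Definition eps i : 'rV[rat]_n := row i P.

Lemma X_lin : linset X. Proof. exact: cochars_linset. Qed.

Lemma eps_X i : X (eps i).
Proof. by rewrite /eps rowE; apply: PX. Qed.

Lemma dot_eps v i : X v -> dot v (eps i) = v 0 i.
Proof.
move=> Xv; rewrite -{2}(Pid Xv) mxE; apply: eq_bigr => j _.
by rewrite mxE -{2}Ps mxE.
Qed.

Lemma dot_epsB v i j : X v -> dot v (eps i - eps j) = v 0 i - v 0 j.
Proof. by move=> Xv; rewrite dotBr !dot_eps. Qed.

Definition rwt r (Z : M) := haswt eps r (ent Z).

Lemma rwt_haswt v r Z : X v -> rwt r Z -> haswt (v 0) (dot v r) (ent Z).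
Proof. by move=> Xv h i j /h <-; rewrite dot_epsB. Qed.

Lemma rwt_nz r Z : rwt r Z -> Z != 0 -> exists i j, eps i - eps j = r.
Proof.
move=> h Z0; apply: contrapT => ne; move/negP: Z0; apply; apply/eqP; apply: (ent_inj gu); rewrite ent0.
apply/matrixP => i j; rewrite [RHS]mxE; apply/eqP; apply: contrapT => /negP/h E; apply: ne.
by exists i, j.
Qed.

Lemma rwtX r Z : rwt r Z -> Z != 0 -> X r.
Proof.
move=> h Z0; have [i [j <-]] := rwt_nz h Z0; apply: (linsetB X_lin); exact: eps_X.
Qed.

Lemma rwt_bracket r s A B : rwt r A -> rwt s B -> rwt (r + s) (A *m B - B *m A).
Proof. by rewrite /rwt entB !(entM gu); apply: haswt_bracket. Qed.

Lemma rwtZ r a A : rwt r A -> rwt r (a *: A).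
Proof. by rewrite /rwt entZ; apply: haswtZ. Qed.

Lemma rwtD r A B : rwt r A -> rwt r B -> rwt r (A + B).
Proof. by rewrite /rwt entD; apply: haswtD. Qed.

Lemma rwt_qdiag v : rwt 0 (qdiag v).
Proof.
rewrite /rwt (ent_qdiag _ gu) => i j; rewrite mxE; have [->|ij] := eqVneq i j; first by rewrite subrr.
by rewrite mulr0n eqxx.
Qed.

Lemma rwt_nilpotent r Z : rwt r Z -> r != 0 -> Z ^+ n = 0.
Proof.
move=> h r0; have [->|Z0] := eqVneq Z 0.
  by case: (n) => [|k]; [apply/matrixP => -[] | rewrite expr0n].
apply: (@ent_expm_wlt _ _ g gu (r 0)) => i j /(rwt_haswt (rwtX h Z0) h) E.
by rewrite -subr_gt0 E dot_gt0.
Qed.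

Lemma qdiag_bracket v r Z : X v -> rwt r Z -> qdiag v *m Z - Z *m qdiag v = ratr (dot v r) *: Z.
Proof.
move=> Xv h; apply: (ent_inj gu); rewrite entB !(entM gu) entZ (ent_qdiag _ gu).
exact: haswt_wmx (rwt_haswt Xv h).
Qed.

Lemma qdiag_tr u v : \tr (qdiag u *m qdiag v) = ratr (dot u v).
Proof.
rewrite /qdiag !tdiagE tr_diag_conj // rmorph_sum; apply: eq_bigr => j _.
by rewrite !qrowE rmorphM.
Qed.

Lemma qdiag_sum (r : seq 'rV[rat]_n) : qdiag (\sum_(v <- r) v) = \sum_(v <- r) qdiag v.
Proof.
elim: r => [|v r IH]; last by rewrite !big_cons qdiagD IH.
by rewrite !big_nil -(scale0r 0) qdiagZ rmorph0 scale0r.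
Qed.

(** Besides being generic, [la] takes distinct values on distinct weights, so that a weight
    component for [T] is a weight component for the single cocharacter [la]. *)
Definition regular la := generic g T la /\
  forall r s, r \in wdiffs eps -> s \in wdiffs eps -> dot la r = dot la s -> r = s.

Lemma regular_exists (s : seq 'rV[rat]_n) v0 : X v0 -> (forall r, r \in s -> X r) -> exists2 la, regular la & forall r, r \in s ->
  (0 < dot v0 r -> 0 < dot la r) /\ (dot la r = 0 -> r = 0).
Proof.
move=> Xv0 sX.
have [la gla hla] := generic_exists gu aT (s ++ [seq x.1 - x.2 | x <- allpairs pair (wdiffs eps) (wdiffs eps)]) Xv0.
have nz r : r \in s ++ [seq x.1 - x.2 | x <- allpairs pair (wdiffs eps) (wdiffs eps)] -> X r -> dot la r = 0 -> r = 0.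
  move=> /hla[_ h] Xr /h /(_ _ Xr)/eqP; rewrite dot_eq0 => /eqP; exact.
have dX r : r \in wdiffs eps -> X r.
  rewrite mem_undup => /mapP[[i j] _ ->] /=; apply: (linsetB X_lin); exact: eps_X.
exists la; last by move=> r rs; split=> [h|]; [apply: (hla r _).1 => //; rewrite mem_cat rs | apply: nz; [rewrite mem_cat rs | exact: sX]].
split=> // r q hr hq /eqP; rewrite -subr_eq0 -dotBr => /eqP E; apply/eqP; rewrite -subr_eq0; apply/eqP.
apply: nz E; last by apply: (linsetB X_lin); exact: dX.
rewrite mem_cat; apply/orP; right; apply/mapP; exists (r, q) => //.
by apply/allpairsP; exists (r, q).
Qed.

Lemma regular_ex : exists la, regular la.
Proof. by have [|la h _] := @regular_exists [::] 0 (proj1 X_lin); [|exists la]. Qed.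

Section Group.
Variables (K : set M) (pr : torus_pair T K).
Let aK := pr_aK pr.
Let TK := pr_TK pr.
Let hz := pr_hz pr.
Let hnd := pr_nd pr.
Let sK := alg_subgroup aK.
Local Notation k := (lie K).
Let lk := lie_linset K.

Definition rcomp r (Z : M) := unent (wcomp eps r (ent Z)).

Lemma rcomp_rwt r Z : rwt r (rcomp r Z).
Proof. by rewrite /rwt /rcomp (unentK gu); apply: wcomp_haswt. Qed.

Lemma rcomp_sum Z : Z = \sum_(r <- wdiffs eps) rcomp r Z.
Proof.
apply: (ent_inj gu); rewrite ent_sum {1}(wcomp_sum eps (ent Z)); apply: eq_bigr => r _.
by rewrite /rcomp (unentK gu).
Qed.

Lemma rcomp0 r Z : r \notin wdiffs eps -> rcomp r Z = 0.
Proof.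
move=> h; apply: (ent_inj gu); rewrite ent0 /rcomp (unentK gu); apply/matrixP => i j; rewrite !mxE.
case: eqP => // E; case/negP: h; rewrite -E mem_undup.
by apply/mapP; exists (i, j); rewrite ?mem_enum.
Qed.

Lemma X_k v : X v -> k (qdiag v).
Proof. by move=> Xv; apply: (lie_mono TK); apply: cochars_lie. Qed.

Lemma rcomp_k (L : set M) r Z : algebraic_group L -> T `<=` L -> lie L Z -> lie L (rcomp r Z).
Proof.
move=> aL TL hZ; have [|/rcomp0 ->] := boolP (r \in wdiffs eps); last by case: (lie_linset L).
move=> hr; have [la [gla sla]] := regular_ex.
rewrite /rcomp; have -> : wcomp eps r (ent Z) = wcomp (la 0) (dot la r) (ent Z).
  apply/matrixP => i j; rewrite [LHS]mxE [RHS]mxE -(dot_epsB i j gla.1); case: (eqVneq (eps i - eps j) r) => [->|ne].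
    by rewrite eqxx.
  case: eqP => // E; case/eqP: ne; apply: sla => //; rewrite mem_undup.
  by apply/mapP; exists (i, j); rewrite ?mem_enum.
by apply: (lie_wcomp _ gu aL _ hZ); apply: (cochars_mono TL); exact: gla.1.
Qed.

Lemma rwt0_torus Z : k Z -> rwt 0 Z -> lie T Z.
Proof.
move=> hZ h; apply: hz => // t Tt.
have [la [gla sla]] := regular_ex.
apply: (torus_commute gu aT cT dT gla _ Tt) => i j /h /eqP; rewrite subr_eq0 => /eqP E.
by rewrite -(dot_eps i gla.1) -(dot_eps j gla.1) E.
Qed.

Definition is_root r := r != 0 /\ exists e, [/\ k e, e != 0 & rwt r e].

Lemma is_rootX r : is_root r -> X r.
Proof. by move=> [_ [e [_ e0 he]]]; apply: rwtX he e0. Qed.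

Lemma tr_rcomp r e Y : rwt r e -> \tr (e *m Y) = \tr (e *m rcomp (- r) Y).
Proof. by move=> h; rewrite -!(tr_ent (e *m _) gu) !(entM gu) (wcomp_tr _ h) /rcomp (unentK gu). Qed.

(** Nondegeneracy gives an element pairing nontrivially with [e], and only its component of weight
    [- r] takes part in the pairing. *)
Lemma dual_vector r e : k e -> e != 0 -> rwt r e -> exists f, [/\ k f, rwt (- r) f & \tr (e *m f) = 1].
Proof.
move=> he e0 we.
have [Y hY nY] : exists2 Y, k Y & \tr (e *m Y) != 0.
  apply: contrapT => ne; move/eqP: e0; apply; apply: hnd => // Y hY; apply/eqP; apply: contrapT => /negP h.
  by apply: ne; exists Y.
pose f := rcomp (- r) Y; exists ((\tr (e *m Y))^-1 *: f); split.
- by apply: (linsetZ lk); apply: rcomp_k.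
- by apply: rwtZ; apply: rcomp_rwt.
by rewrite -scalemxAr linearZ /= -tr_rcomp // mulVf.
Qed.

Lemma root_opp r : is_root r -> is_root (- r).
Proof.
move=> [r0 [e [he e0 we]]]; have [f [hf wf tf]] := dual_vector he e0 we.
split; first by rewrite oppr_eq0.
exists f; split=> //; apply: contra_eq_neq tf => ->; rewrite mulmx0 linear0 eq_sym; exact: oner_neq0.
Qed.

(** The difference of the two sides has weight zero, hence is toral; by invariance of the trace it
    is orthogonal to all cocharacters. *)
Lemma root_bracket r e f : X r -> k e -> k f -> rwt r e -> rwt (- r) f ->
  e *m f - f *m e = \tr (e *m f) *: qdiag r.
Proof.
move=> Xr he hf we wf; set D := e *m f - f *m e; set t := \tr _.
have hD : lie T (D - t *: qdiag r).
  apply: rwt0_torus.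
    by apply: (linsetB lk); [exact: lie_bracket | apply/(linsetZ lk)/X_k].
  rewrite -scaleNr; apply: rwtD; last by apply/rwtZ/rwt_qdiag.
  by have := rwt_bracket we wf; rewrite subrr.
have [s sE] := torus_lie_diag gu dT hD.
apply/eqP; rewrite -subr_eq0 sE; apply/eqP; rewrite sE in hD.
suff -> : s = 0 by rewrite tdiagE linear0 mulmx0 mul0mx.
have hD0 : lie T (tdiag g s + 0) by rewrite addr0.
apply: (replica_trace0 gu aT hD0); rewrite ?mulmx0 ?mul0mx //.
  by case: (n) => [|q]; [apply/matrixP => -[] | rewrite expr0n].
move=> v Xv _.
have <- : \tr (tdiag g s *m qdiag v) = \sum_j s 0 j * qrow R v 0 j.
  by rewrite /qdiag !tdiagE tr_diag_conj.
rewrite -sE mulmxBl mxtraceB /D tr_shuffle (qdiag_bracket Xv wf) -scalemxAl -scalemxAr !mxtraceZ qdiag_tr.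
by rewrite -/t dotNr rmorphN mulNr opprK dotC mulrC subrr.
Qed.

Lemma sl2_kills r d e f Y (kap : C) : X r -> kap != 0 -> r != 0 -> rwt r e -> e *m f - f *m e = kap *: qdiag r ->
  rwt d Y -> 0 < dot r d -> f *m Y = Y *m f -> Y = 0.
Proof.
move=> Xr k0 r0 we ef wY rd fY; apply: (ent_inj gu); rewrite ent0.
apply: (@sl2_lowest C n (r 0) (ent e) (ent f) (ent Y) (dot r r) (dot r d) kap k0 (dot_gt0 r0) rd).
- exact: (rwt_haswt Xr we).
- exact: (rwt_haswt Xr wY).
- by rewrite -!(entM gu) -entB ef entZ (ent_qdiag _ gu).
by rewrite -!(entM gu) fY.
Qed.

(** The combination of [e'] and [e] with trace zero against [f] commutes with [f], while its weight
    pairs positively with [r]; [sl2_kills] makes it zero. *)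
Lemma root_dim1 r e e' : r != 0 -> k e -> k e' -> e != 0 -> rwt r e -> rwt r e' -> exists c, e' = c *: e.
Proof.
move=> r0 he he' e0 we we'; have Xr := rwtX we e0.
have [f [hf wf tf]] := dual_vector he e0 we.
exists (\tr (e' *m f)); apply/eqP; rewrite -subr_eq0; apply/eqP; set Y := e' - _.
have kY : k Y by apply: (linsetB lk) => //; apply: (linsetZ lk).
have wY : rwt r Y by rewrite /Y -scaleNr; apply: rwtD => //; apply: rwtZ.
have ef := root_bracket Xr he hf we wf; rewrite tf in ef.
apply: (sl2_kills Xr (oner_neq0 _) r0 we ef wY (dot_gt0 r0)).
have := root_bracket Xr kY hf wY wf.
have -> : \tr (Y *m f) = 0 by rewrite mulmxBl linearB /= -scalemxAl linearZ /= tf mulr1 subrr.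
by rewrite scale0r => /eqP; rewrite subr_eq0 => /eqP.
Qed.

(** The bracket of [f] with a vector [Y] of weight [r + r] is a multiple of [e]. The coefficient is
    the trace of [f] times a bracket with [f], that is zero, so [Y] commutes with [f] and is
    killed. *)
Lemma root_double r : is_root r -> ~ is_root (r + r).
Proof.
move=> [r0 [e [he e0 we]]] [_ [Y [hY Y0 wY]]]; have Xr := rwtX we e0.
have [f [hf wf tf]] := dual_vector he e0 we.
have ef := root_bracket Xr he hf we wf; rewrite tf in ef.
move/eqP: Y0; apply; apply: (sl2_kills Xr (oner_neq0 _) r0 we ef wY); first by rewrite dotDr addr_gt0 // dot_gt0.
have wfY : rwt r (f *m Y - Y *m f) by have := rwt_bracket wf wY; rewrite addKr.
have [c cE] := root_dim1 r0 he (lie_bracket aK hf hY) e0 we wfY.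
have : \tr (f *m (f *m Y - Y *m f)) = 0.
  by rewrite mulmxBr mxtraceB [\tr (f *m (Y *m f))](_ : _ = \tr (f *m (f *m Y))) ?subrr // mulmxA mxtrace_mulC.
rewrite cE -scalemxAr linearZ /= mxtrace_mulC tf mulr1 => c0.
by apply/eqP; rewrite -subr_eq0 cE c0 scale0r.
Qed.

Lemma root_string a b : is_root a -> is_root b -> 0 < dot a b -> b != a -> is_root (b - a).
Proof.
move=> [a0 [e [he e0 we]]] [b0 [Y [hY Y0 wY]]] ab ba; have Xa := rwtX we e0.
have [f [hf wf tf]] := dual_vector he e0 we.
have ef := root_bracket Xa he hf we wf; rewrite tf in ef.
split; first by rewrite subr_eq0.
exists (f *m Y - Y *m f); split; [exact: lie_bracket | | by rewrite addrC; apply: rwt_bracket].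
apply: contraNneq Y0 => /eqP; rewrite subr_eq0 => /eqP fY.
by apply/eqP; apply: (sl2_kills Xa (oner_neq0 _) a0 we ef wY ab).
Qed.

Definition refl a v : 'rV[rat]_n := v - (2%:R * dot v a / dot a a) *: a.

Lemma reflection_element a e f : is_root a -> k e -> k f -> rwt a e -> rwt (- a) f ->
  \tr (e *m f) = 2%:R / ratr (dot a a) ->
  let w := expm e *m expm (- f) *m expm e in
  K w /\ forall v, X v -> w *m qdiag v = qdiag (refl a v) *m w.
Proof.
move=> ra he hf we wf tf w; have Xa := is_rootX ra; have a0 : a != 0 by case: ra.
have en := rwt_nilpotent we a0; have fn : f ^+ n = 0 by apply: (rwt_nilpotent wf); rewrite oppr_eq0.
split.
  have Ke : K (expm e) by have := lie_exp aK 1 he en; rewrite scale1r.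
  have Kf : K (expm (- f)) by have := lie_exp aK (-1) hf fn; rewrite scaleN1r.
  by apply: (sgM sK) => //; apply: (sgM sK).
move=> v Xv; have aa0 : ratr (dot a a) != 0 :> C by rewrite fmorph_eq0 dot_eq0.
have ef := root_bracket Xa he hf we wf; rewrite tf in ef.
have -> : qdiag (refl a v) = qdiag v - ratr (dot v a) *: ((2%:R / ratr (dot a a)) *: qdiag a).
  rewrite /refl -scaleNr qdiagD qdiagZ rmorphN /= scaleNr scalerA; congr (_ - _ *: _).
  by rewrite !rmorphM /= fmorphV ratr_nat; ring.
apply: sl2_reflection en fn _ _ ef _ _.
- exact: qdiag_bracket.
- by rewrite (qdiag_bracket Xv wf) dotNr rmorphN scaleNr.
- by rewrite -scalemxAl -scalemxAr -scalerBr (qdiag_bracket Xa we) scalerA mulfVK.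
- by rewrite -scalemxAl -scalemxAr -scalerBr (qdiag_bracket Xa wf) scalerA dotNr rmorphN mulrN mulfVK // scaleNr.
Qed.

End Group.
End Pair.

Lemma invmxM (F : fieldType) n (A B : 'M[F]_n) : A \in unitmx -> B \in unitmx ->
  invmx (A *m B) = invmx B *m invmx A.
Proof.
move=> Au Bu; have E : A *m B *m (invmx B *m invmx A) = 1%:M by rewrite mulmxA mulmxK // mulmxV.
by rewrite -[LHS]mulmx1 -E mulKmx // unitmx_mul Au.
Qed.

Lemma intertwine2 (F : fieldType) n (a b x0 x1 x2 : 'M[F]_n) :
  b *m x0 = x1 *m b -> a *m x1 = x2 *m a -> (a *m b) *m x0 = x2 *m (a *m b).
Proof. by move=> h1 h2; rewrite -!mulmxA h1 (mulmxA a) h2 !mulmxA. Qed.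

Lemma intertwine_inv (F : fieldType) n (a x0 x1 : 'M[F]_n) : a \in unitmx ->
  a *m x0 = x1 *m a -> invmx a *m x1 = x0 *m invmx a.
Proof. by move=> au h; rewrite -[x1](mulmxK au) -h !mulmxA mulVmx // mul1mx. Qed.

Lemma conj_bracket (F : fieldType) n (a x0 x1 z : 'M[F]_n) : a \in unitmx -> a *m x0 = x1 *m a ->
  x1 *m (a *m z *m invmx a) - (a *m z *m invmx a) *m x1 = a *m (x0 *m z - z *m x0) *m invmx a.
Proof.
move=> au h; have h' := intertwine_inv au h.
by rewrite mulmxBr mulmxBl !mulmxA -h -[a *m z *m _ *m x1]mulmxA h' !mulmxA.
Qed.

Lemma conjmx_eq0 (F : fieldType) n (a z : 'M[F]_n) : a \in unitmx -> a *m z *m invmx a = 0 -> z = 0.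
Proof. by move=> au E; rewrite -[z](mulKmx au) -[a *m z](mulmxKV au) E mul0mx mulmx0. Qed.

(** * The normalizer of the torus and its action on cocharacters *)

Section PairGroup.
Variables (R : realType) (n : nat).
Local Notation C := R[i].
Local Notation M := 'M[C]_n.
Variables (g : M) (T : set M) (P : 'M[rat]_n) (fr : torus_frame g T P).
Let gu := fr_gu fr.
Let aT := fr_aT fr.
Let cT := fr_cT fr.
Let dT := fr_dT fr.
Let sT := alg_subgroup aT.
Variables (K : set M) (pr : torus_pair T K).
Let aK := pr_aK pr.
Let cK := pr_cK pr.
Let TK := pr_TK pr.
Let hz := pr_hz pr.
Let sK := alg_subgroup aK.
Local Notation ent := (ent g).
Local Notation qdiag := (qdiag g).
Local Notation X := (cochars g T).

Lemma X_ratcochar v : X v -> ratcochar g K (v 0).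
Proof. exact: cochars_mono TK. Qed.

Lemma centralizer_sep la : generic g T la -> exists h : M -> C,
  [/\ is_poly h, h 1%:M != 0 & forall x, Lgrp g K (la 0) x -> h x != 0 -> T x].
Proof.
move=> gla; pose L := Lgrp g K (la 0).
have aL : algebraic_group L by apply: Lgrp_algebraic.
have LK : L `<=` K by move=> x [].
have lieLT Z : lie L Z -> lie T Z.
  move=> hZ; apply: hz => [|t Tt]; first exact: (lie_mono LK).
  by apply: (torus_commute gu aT cT dT gla _ Tt); exact: lie_Lgrp hZ.
have LT v : cochars g L v -> X v by move=> hv; apply: (lie_cochars gu aT); apply/lieLT/cochars_lie.
have gen i j : la 0 i = la 0 j -> forall v, cochars g L v -> v 0 i = v 0 j.
  by move=> ij v /LT; apply: gla.2.
have wL x : L x -> weq (la 0) (ent x) by case.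
have lL Z : lie L Z -> exists s, Z = tdiag g s by move=> /lieLT; apply: torus_lie_diag.
have [Q [h [aQ iQ QL [ph h1] [hQ hT]]]] := toral_core gu aL gen wL lL.
exists h; split=> // x Lx hx; apply: (hT T aT LT); exact: hQ.
Qed.

(** Finite products of [T] and the two opposite unipotent parts are irreducible sets containing 1.
    Their union is an irreducible subgroup, and it contains an open part of [K] by the big cell. *)
Lemma pair_irreducible : irreducible K.
Proof.
have [la [gla _]] := regular_ex fr.
have [h [ph h1 hT]] := centralizer_sep gla.
have hla := X_ratcochar gla.1.
have iT : irreducible T by have [] := torus_core gu aT cT dT gla.
have pd := cell_den_poly g (la 0).
have [N [p [pp Ep]]] := ratmx_comp pd ph (@cell_levi_rat _ _ g (la 0)).
pose U := Ugrp g K (la 0); pose V := Ugrp g K (negw (la 0)).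
have iU : irreducible U by apply: Ugrp_irreducible.
have iV : irreducible V by apply: Ugrp_irreducible.
have sU : subgroup U by apply: Ugrp_subgroup.
have sV : subgroup V by apply: Ugrp_subgroup.
have UK : U `<=` K by move=> x [].
have VK : V `<=` K by move=> x [].
pose A := mulset (mulset V T) U; pose B := mulset (mulset U T) V.
have iA : irreducible A by apply: irreducible_mulset => //; apply: irreducible_mulset.
have iB : irreducible B by apply: irreducible_mulset => //; apply: irreducible_mulset.
have mem3 (S1 S2 S3 : set M) a b c : S1 a -> S2 b -> S3 c -> mulset (mulset S1 S2) S3 (a *m b *m c).
  by move=> h1' h2 h3; exists (a *m b); [exists a => //; exists b | exists c].
have inv3 (S1 S2 S3 : set M) x : subgroup S1 -> subgroup S2 -> subgroup S3 ->
    mulset (mulset S1 S2) S3 x -> mulset (mulset S3 S2) S1 (invmx x).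
  move=> s1 s2 s3 [_ [a h1' [b h2 <-]] [c h3 <-]].
  have au := sg_unit s1 h1'; have bu := sg_unit s2 h2; have cu := sg_unit s3 h3.
  rewrite !invmxM ?unitmx_mul ?au ?bu ?cu // mulmxA; apply: mem3; exact: sgV.
have sub3 (S1 S2 S3 : set M) : S1 `<=` K -> S2 `<=` K -> S3 `<=` K -> mulset (mulset S1 S2) S3 `<=` K.
  by move=> h1' h2 h3 _ [_ [a /h1' ha [b /h2 hb <-]] [c /h3 hc <-]]; apply: (sgM sK) => //; apply: (sgM sK).
have AK : A `<=` K by apply: sub3.
have BK : B `<=` K by apply: sub3.
have A1 : A 1%:M by have := mem3 V T U _ _ _ (sg1 sV) (sg1 sT) (sg1 sU); rewrite !mulmx1.
have B1 : B 1%:M by have := mem3 U T V _ _ _ (sg1 sU) (sg1 sT) (sg1 sV); rewrite !mulmx1.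
pose E := mulset A B.
have iE : irreducible E by apply: irreducible_mulset.
have E1 : E 1%:M by exists 1%:M => //; exists 1%:M => //; rewrite mulmx1.
have EV x : E x -> E (invmx x).
  move=> [a Aa [b Bb <-]]; exists (invmx b); first exact: (inv3 U T V).
  exists (invmx a); first exact: (inv3 V T U).
  by rewrite (invmxM (sg_unit sK (AK _ Aa)) (sg_unit sK (BK _ Bb))).
pose Ek := fix Ek (k : nat) : set M := if k is k'.+1 then mulset E (Ek k') else [set 1%:M].
have iEk k : irreducible (Ek k) by elim: k => [|k IH]; [exact: irreducible_set1 | exact: irreducible_mulset].
have EkS k : Ek k `<=` Ek k.+1 by move=> x hx; exists 1%:M => //; exists x => //; rewrite mul1mx.
have EkD i j x y : Ek i x -> Ek j y -> Ek (i + j)%N (x *m y).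
  elim: i x => [|i IH] x; first by move=> -> hy; rewrite mul1mx.
  by move=> [a Ea [b hb <-]] hy; exists a => //; exists (b *m y); [exact: IH | rewrite mulmxA].
have EkK k : Ek k `<=` K.
  elim: k => [|k IH] x; first by move=> ->; exact: (sg1 sK).
  by move=> [_ [a /AK ha [b /BK hb <-]] [c /IH hc <-]]; apply: (sgM sK) => //; apply: (sgM sK).
pose Q := \bigcup_k Ek k.
have iQ : irreducible Q.
  apply: irreducible_chain => // i j /subnKC <-; elim: (j - i)%N => [|k IH]; first by rewrite addn0.
  by rewrite addnS; apply: (subset_trans IH); exact: EkS.
have sQ : subgroup Q.
  split.
  - by move=> x [k _ /EkK]; exact: (sg_unit sK).
  - by exists 0%N.
  - by move=> x y [i _ hx] [j _ hy]; exists (i + j)%N => //; exact: EkD.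
  move=> x [k _ hx]; exists k => //; elim: k x hx => [|k IH] x; first by move=> ->; rewrite /= invmx1.
  move=> [a Ea [b hb <-]].
  have bu := sg_unit sK (EkK _ _ hb).
  have au : a \in unitmx by case: Ea => a1 /AK ha1 [a2 /BK ha2 <-]; rewrite unitmx_mul (sg_unit sK ha1) (sg_unit sK ha2).
  rewrite invmxM ?unitmx_mul ?au // -addn1; apply: EkD; first exact: IH.
  by exists (invmx a); [exact: EV | exists 1%:M => //; rewrite mulmx1].
suff -> : K = Q by [].
apply: esym; have QK : Q `<=` K by move=> x [k _ /EkK].
have L1 : Lgrp g K (la 0) 1%:M := sg1 (Lgrp_subgroup gu aK _).
have [d1 e1] := cell_Lgrp gu aK L1.
apply: (@open_subgroup_conn _ _ K sK Q (fun x => cell_den g (la 0) x * p x) 1%:M cK sQ QK (is_polyM pd pp) (sg1 sK)).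
  rewrite -(Ep _ d1) e1; exact: (mulf_neq0 d1 (mulf_neq0 (expf_neq0 N d1) h1)).
move=> y Ky; rewrite mulf_eq0 negb_or => /andP[dy].
rewrite -(Ep _ dy) mulf_eq0 negb_or => /andP[_ hy].
have [hL [u [u' [hu hu' yE]]]] := cellP gu aK hla Ky dy.
exists 1%N => //; exists y; last by exists 1%:M => //; rewrite mulmx1.
exists y; last by exists 1%:M => //; rewrite mulmx1.
by rewrite yE; apply: mem3 => //; exact: hT.
Qed.

(** The centralizer is irreducible, hence connected, and [centralizer_sep] places a neighbourhood of
    its identity inside [T]. *)
Lemma centralizer_torus la : generic g T la -> Lgrp g K (la 0) = T.
Proof.
move=> gla; have aL := Lgrp_algebraic gu aK (la 0).
rewrite eqEsubset; split; last by move=> t Tt; split; [exact: TK | exact: (torus_weq dT)].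
have [h [ph h1 hT]] := centralizer_sep gla.
apply: (sep_connected (alg_subgroup aL) _ sT ph h1 hT).
by apply: irreducible_connected; apply: Lgrp_irreducible; [exact: gu | exact: aK | exact: pair_irreducible | exact: X_ratcochar gla.1].
Qed.

Lemma commute_torus la x : generic g T la -> K x -> x *m qdiag la = qdiag la *m x -> T x.
Proof.
move=> gla Kx /(congr1 ent); rewrite (entM gu) (entM gu) (ent_qdiag _ gu) => E.
by rewrite -(centralizer_torus gla); split=> //; apply/weqP.
Qed.

Lemma torus_qdiag t v : T t -> t *m qdiag v = qdiag v *m t.
Proof.
move=> Tt; apply: (ent_inj gu); rewrite (entM gu) (entM gu) (ent_qdiag _ gu).
by apply/weqP; exact: (torus_weq dT).
Qed.

Lemma normalizerP x : normalizer K T x <->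
  K x /\ forall t, T t -> T (x *m t *m invmx x) /\ T (invmx x *m t *m x).
Proof.
split=> [[Kx /seteqP[h1 h2]]|[Kx h]]; split=> //.
  move=> t Tt; split.
    apply: h1; exists (x *m t); first by exists x => //; exists t.
    by exists (invmx x) => //; exists x.
  have [_ [_ -> [s Ts <-]] [_ [_ -> <-] E]] := h2 t Tt.
  by rewrite -E !mulmxA mulVmx ?(sg_unit sK Kx) // mul1mx mulmxKV ?(sg_unit sK Kx).
apply/seteqP; split=> [_ [_ [_ -> [s Ts <-]] [_ [_ -> <-] <-]]|t Tt]; first exact: (h s Ts).1.
have xu := sg_unit sK Kx.
exists (x *m (invmx x *m t *m x)); first by exists x => //; exists (invmx x *m t *m x) => //; exact: (h t Tt).2.
by exists (invmx x); [exists x | rewrite !mulmxA mulmxV // mul1mx mulmxK].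
Qed.

(** Some permutation meets only nonzero entries because the determinant is nonzero. On cocharacters
    the action of a normalizing [x] does not depend on this choice, by [act_unique]; acting by
    permutations of coordinates makes it isometric. *)
Definition wperm (x : M) : 'S_n := odflt 1%g [pick s : 'S_n | \prod_i ent x i (s i) != 0].
Definition act (x : M) (v : 'rV[rat]_n) : 'rV[rat]_n := \row_i v 0 (wperm x i).

Lemma wperm_neq0 x i : x \in unitmx -> ent x i (wperm x i) != 0.
Proof.
move=> xu; rewrite /wperm; case: pickP => [s /prodf_neq0 h|h]; first exact: h.
have : \det (ent x) != 0 by rewrite det_ent // -unitfE -unitmxE.
rewrite /determinant big1 ?eqxx // => s _; have := h s => /negbFE/eqP ->; exact: mulr0.
Qed.

Lemma act_unique x u v : x \in unitmx -> x *m qdiag v = qdiag u *m x -> u = act x v.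
Proof.
move=> xu /(congr1 ent); rewrite (entM gu) (entM gu) !(ent_qdiag _ gu) => /matrixP E.
apply/rowP => i; rewrite mxE; apply: (@fmorph_inj _ C ratr); apply: (mulfI (wperm_neq0 i xu)).
have := E i (wperm x i); rewrite mul_mx_diag mul_diag_mx mxE [RHS]mxE [in LHS]mxE [in RHS]mxE mulrC => E2.
exact: etrans (mulrC _ _) (esym E2).
Qed.

Lemma act_dot x u v : dot (act x u) (act x v) = dot u v.
Proof.
rewrite /dot [RHS](reindex_inj (@perm_inj _ (wperm x))) /=.
by apply: eq_bigr => i _; rewrite !mxE.
Qed.

Lemma actD x u v : act x (u + v) = act x u + act x v.
Proof. by apply/rowP => i; rewrite !mxE. Qed.

Lemma actZ x a v : act x (a *: v) = a *: act x v.
Proof. by apply/rowP => i; rewrite !mxE. Qed.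

Lemma actN x v : act x (- v) = - act x v.
Proof. by apply/rowP => i; rewrite !mxE. Qed.

Lemma act0 x : act x 0 = 0.
Proof. by apply/rowP => i; rewrite !mxE. Qed.

Lemma act_sum x (I : Type) (r : seq I) (Q : pred I) (f : I -> 'rV_n) :
  act x (\sum_(i <- r | Q i) f i) = \sum_(i <- r | Q i) act x (f i).
Proof. by elim/big_rec2: _ => [|i y z _ <-]; rewrite ?act0 ?actD. Qed.

Lemma act_inj x : injective (act x).
Proof. by move=> u v E; apply/rowP => i; have /rowP/(_ ((wperm x)^-1%g i)) := E; rewrite !mxE permKV. Qed.

Lemma norm_act x v : normalizer K T x -> X v -> X (act x v) /\ x *m qdiag v = qdiag (act x v) *m x.
Proof.
move=> /normalizerP[Kx hT] [m [N N0 hm] hK]; have xu := sg_unit sK Kx.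
pose m' i := m (wperm x i).
have E c : c != 0 -> x *m cochar g m c = cochar g m' c *m x.
  move=> c0; have [Tc _] := hT _ (hK c c0).
  have [s sE] : exists s, x *m cochar g m c *m invmx x = tdiag g s.
    by apply: (tdiag_ent gu) => i j ij; apply: (torus_ent dT).
  have E : x *m cochar g m c = tdiag g s *m x by rewrite -sE mulmxKV.
  have -> : cochar g m' c = tdiag g s; last exact: E.
  rewrite cocharE; congr (tdiag g _); apply/rowP => i; rewrite [LHS]mxE /m'.
  have := congr1 ent E; rewrite (entM gu) (entM gu) (ent_cochar gu) (ent_tdiag gu) => /matrixP/(_ i (wperm x i)).
  rewrite mul_mx_diag mul_diag_mx mxE [RHS]mxE [in LHS]mxE mulrC.
  by move=> /(mulIf (wperm_neq0 i xu)).
have hm' i : (m' i)%:~R = N%:R * act x v 0 i by rewrite /m' hm mxE.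
split.
  exists m'; first by exists N.
  move=> c c0; have := (hT _ (hK c c0)).1; rewrite (E c c0) mulmxK //.
(* Evaluation at 2 turns equality of characters into equality of integral exponents. *)
have two0 : (2%:R : C) != 0 by rewrite pnatr_eq0.
have := congr1 ent (E 2%:R two0); rewrite (entM gu) (entM gu) !(ent_cochar gu) => /matrixP E2.
apply: (ent_inj gu); rewrite (entM gu) (entM gu) !(ent_qdiag _ gu); apply/matrixP => i j.
have := E2 i j; rewrite !mul_mx_diag !mul_diag_mx mxE [RHS]mxE [in LHS]mxE [in RHS]mxE.
move=> E3; rewrite mxE [RHS]mxE [in LHS]mxE [in RHS]mxE mulrC.
have [->|xij] := eqVneq (ent x i j) 0; first by rewrite !mulr0.
congr (ratr _ * _); move: E3; rewrite mulrC => /(mulIf xij) E4.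
have : (2%:R : C) ^ (m j - m' i) = 1 by rewrite expfzDr // E4 -expfzDr // subrr expr0z.
have two1 : (2%:R == 1 :> C) = false by apply: (eqr_nat C 2 1).
move=> /eqP; rewrite pexprz_eq1 ?ler0n // two1 orbF subr_eq0 => /eqP mij.
have Nq : N%:R != 0 :> rat by rewrite pnatr_eq0 -lt0n.
by apply: (mulfI Nq); rewrite -hm -hm' mij.
Qed.

Lemma normalizer_subgroup : subgroup (normalizer K T).
Proof.
split=> [x [Kx _]||x y /normalizerP[Kx hx] /normalizerP[Ky hy]|x /normalizerP[Kx hx]].
- exact: (sg_unit sK Kx).
- apply/normalizerP; split; first exact: (sg1 sK).
  by move=> t Tt; rewrite invmx1 !mulmx1 !mul1mx.
- apply/normalizerP; split; first exact: (sgM sK).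
  move=> t Tt; rewrite invmxM ?unitmx_mul ?(sg_unit sK Kx) ?(sg_unit sK Ky) //; split.
    by have := (hx _ (hy t Tt).1).1; rewrite !mulmxA.
  by have := (hy _ (hx t Tt).2).2; rewrite !mulmxA.
apply/normalizerP; split; first exact: (sgV sK).
by move=> t Tt; rewrite invmxK; have [h1 h2] := hx t Tt.
Qed.

Lemma torus_normalizer : T `<=` normalizer K T.
Proof.
move=> t Tt; apply/normalizerP; split; first exact: TK.
by move=> s Ts; split; [exact: (sgJ sT) | apply: (sgM sT) => //; apply: (sgM sT) => //; exact: (sgV sT)].
Qed.

Lemma act_mul x y v : normalizer K T x -> normalizer K T y -> X v -> act (x *m y) v = act x (act y v).
Proof.
move=> nx ny Xv; have [X1 E1] := norm_act ny Xv; have [X2 E2] := norm_act nx X1.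
apply: esym; apply: act_unique.
  by rewrite unitmx_mul (sg_unit normalizer_subgroup nx) (sg_unit normalizer_subgroup ny).
exact: (intertwine2 E1 E2).
Qed.

Lemma act_torus t v : T t -> act t v = v.
Proof. by move=> Tt; apply: esym; apply: act_unique; [exact: (sg_unit sT) | exact: torus_qdiag]. Qed.

Lemma act1 v : act 1%:M v = v.
Proof. by apply: act_torus; exact: (sg1 sT). Qed.

Lemma act_invK x v : normalizer K T x -> X v -> act (invmx x) (act x v) = v.
Proof.
move=> nx Xv; rewrite -act_mul //; last exact: (sgV normalizer_subgroup).
by rewrite mulVmx ?act1 // (sg_unit normalizer_subgroup nx).
Qed.

Lemma act_Kinv x v : normalizer K T x -> X v -> act x (act (invmx x) v) = v.
Proof.
move=> nx Xv; rewrite -act_mul //; last exact: (sgV normalizer_subgroup).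
by rewrite mulmxV ?act1 // (sg_unit normalizer_subgroup nx).
Qed.

Lemma act_X x v : normalizer K T x -> X v -> X (act x v).
Proof. by move=> nx Xv; have [] := norm_act nx Xv. Qed.

Lemma act_fix_generic x la : normalizer K T x -> generic g T la -> act x la = la -> T x.
Proof.
move=> nx gla E; have [_] := norm_act nx gla.1; rewrite E => h.
by apply: (commute_torus gla) => //; case: nx.
Qed.

Lemma act_eq_torus x y : normalizer K T x -> normalizer K T y -> (forall v, X v -> act x v = act y v) ->
  exists2 t, T t & x = y *m t.
Proof.
move=> nx ny h; have [la [gla _]] := regular_ex fr.
have yu := sg_unit normalizer_subgroup ny; have nyV := sgV normalizer_subgroup ny.
exists (invmx y *m x); last by rewrite mulKVmx.
apply: (act_fix_generic (la := la)) => //; first exact: (sgM normalizer_subgroup).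
by rewrite act_mul ?h ?act_invK //; exact: gla.1.
Qed.

(** A conjugate of an element of [T] commutes with a generic cocharacter, whose centralizer is
    [T]. *)
Lemma normalizer_intro x (s s' : 'rV[rat]_n -> 'rV[rat]_n) : K x ->
  (forall v, X v -> x *m qdiag v = qdiag (s v) *m x) ->
  (forall v, X v -> x *m qdiag (s' v) = qdiag v *m x) -> normalizer K T x.
Proof.
move=> Kx hs hs'; have [la [gla _]] := regular_ex fr; have xu := sg_unit sK Kx.
apply/normalizerP; split=> // t Tt; split; apply: (commute_torus gla).
- by apply: (sgJ sK) => //; exact: TK.
- exact: (intertwine3 (intertwine_inv xu (hs' _ gla.1)) (torus_qdiag _ Tt) (hs' _ gla.1)).
- by apply: (sgM sK) => //; apply: (sgM sK); [exact: (sgV sK) | exact: TK].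
exact: (intertwine3 (hs _ gla.1) (torus_qdiag _ Tt) (intertwine_inv xu (hs _ gla.1))).
Qed.

(** The bracket identity is tested on the cocharacter [d], the weight of a nonzero entry minus [r];
    it shows that [d] is orthogonal to itself. *)
Lemma rwt_intro r Z : X r -> (forall v, X v -> qdiag v *m Z - Z *m qdiag v = ratr (dot v r) *: Z) ->
  rwt g P r Z.
Proof.
move=> Xr h i j Zij; apply/eqP; rewrite -subr_eq0 -dot_eq0; apply/eqP.
set d := _ - r; have Xd : X d.
  by apply: (linsetB (X_lin fr)) => //; apply: (linsetB (X_lin fr)); apply: (eps_X fr).
have := congr1 ent (h d Xd); rewrite entB !(entM gu) entZ (ent_qdiag _ gu) => /matrixP/(_ i j).
rewrite mxBE mul_mx_diag mul_diag_mx mxE [X in _ - X]mxE [RHS]mxE [in LHS]mxE [X in _ - _ * X]mxE.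
rewrite [X in _ - X]mulrC -mulrBl -rmorphB => /(mulIf Zij)/(fmorph_inj (ratr : {rmorphism rat -> C})).
by rewrite -(dot_epsB fr i j Xd) => /eqP; rewrite -subr_eq0 -dotBr => /eqP.
Qed.

Lemma rwt_act x r Z : normalizer K T x -> X r -> rwt g P r Z -> rwt g P (act x r) (x *m Z *m invmx x).
Proof.
move=> nx Xr hZ; have xu := sg_unit normalizer_subgroup nx.
apply: rwt_intro => [|v Xv]; first exact: act_X.
have Xv' := act_X (sgV normalizer_subgroup nx) Xv.
have [_ E] := norm_act nx Xv'; rewrite act_Kinv // in E.
rewrite (conj_bracket Z xu E).
rewrite (qdiag_bracket fr Xv' hZ) -scalemxAr -scalemxAl; congr (ratr _ *: _).
by rewrite -[in RHS](act_Kinv nx Xv) act_dot.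
Qed.

Lemma root_act x r : normalizer K T x -> is_root g P K r -> is_root g P K (act x r).
Proof.
move=> nx hr; have Xr := is_rootX fr hr; have [r0 [e [he e0 we]]] := hr.
have xu := sg_unit normalizer_subgroup nx; have [Kx _] := nx.
split; first by apply: contraNneq r0 => E; apply/eqP/(act_inj (x := x)); rewrite act0.
exists (x *m e *m invmx x); split; [exact: lie_Ad | | exact: rwt_act].
by apply: contraNneq e0 => /(conjmx_eq0 xu) ->.
Qed.

Lemma root_reflection a : is_root g P K a -> exists e f,
  [/\ lie K e, lie K f, rwt g P a e, rwt g P (- a) f &
   [/\ e != 0, f != 0, normalizer K T (expm e *m expm (- f) *m expm e) &
      forall v, X v -> act (expm e *m expm (- f) *m expm e) v = refl a v]].
Proof.
move=> ra; have Xa := is_rootX fr ra; have [a0 [e [he e0 we]]] := ra.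
have [f0 [hf0 wf0 tf0]] := dual_vector fr pr he e0 we.
have aa0 : ratr (dot a a) != 0 :> C by rewrite fmorph_eq0 dot_eq0.
have two0 : (2%:R : C) != 0 by rewrite pnatr_eq0.
(* This scaling makes the bracket of [e] and [f] the coroot of [a]. *)
pose f := (2%:R / ratr (dot a a)) *: f0; exists e, f.
have hf : lie K f by apply: (linsetZ (lie_linset K)).
have wf : rwt g P (- a) f by apply: rwtZ.
have tf : \tr (e *m f) = 2%:R / ratr (dot a a) by rewrite -scalemxAr mxtraceZ tf0 mulr1.
have [Kw hw] := reflection_element fr pr ra he hf we wf tf.
have rX v : X v -> X (refl a v).
  by move=> Xv; rewrite /refl -scaleNr; apply: (linsetD (X_lin fr)) => //; apply: (linsetZ (X_lin fr)).
have rr v : refl a (refl a v) = v.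
  rewrite /refl dotBl dotZl mulfVK ?dot_eq0 // -addrA -opprD -scalerDl -mulrDl.
  have -> : 2%:R * dot v a + 2%:R * (dot v a - 2%:R * dot v a) = 0 by ring.
  by rewrite mul0r scale0r subr0.
have nw : normalizer K T (expm e *m expm (- f) *m expm e).
  apply: (normalizer_intro (s := refl a) (s' := refl a) Kw hw) => v Xv.
  have := hw _ (rX _ Xv); rewrite rr; exact.
split=> //; split=> //.
  by apply: contra_eq_neq tf => ->; rewrite mulmx0 linear0 eq_sym mulf_neq0 ?invr_eq0.
by move=> v Xv; apply: esym; apply: act_unique; [exact: (sg_unit sK) | exact: hw].
Qed.

End PairGroup.

(** * Combinatorics of finite root systems: inversions, dominance, closed subsets *)

Section RootSystems.
Variables (n : nat) (Phi : seq 'rV[rat]_n).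
Implicit Types a b c v : 'rV[rat]_n.
Hypotheses (Phi_uniq : uniq Phi) (Phi0 : forall a, a \in Phi -> a != 0)
  (PhiN : forall a, a \in Phi -> - a \in Phi)
  (Phi_dbl : forall a, a \in Phi -> a + a \notin Phi)
  (Phi_str : forall a b, a \in Phi -> b \in Phi -> 0 < dot a b -> b != a -> b - a \in Phi)
  (Phi_refl : forall a b, a \in Phi -> b \in Phi -> refl a b \in Phi).
Variables (la : 'rV[rat]_n) (la_reg : forall a, a \in Phi -> dot la a != 0).

Definition pos b := (b \in Phi) && (0 < dot la b).
Definition posroots := [seq b <- Phi | 0 < dot la b].
Definition simple a := pos a /\ forall b c, pos b -> pos c -> a <> b + c.

Lemma mem_posroots b : (b \in posroots) = pos b.
Proof. by rewrite mem_filter andbC. Qed.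

Lemma posN b : b \in Phi -> pos (- b) = ~~ pos b.
Proof.
move=> hb; rewrite /pos hb PhiN //= dotNr oppr_gt0 -leNgt le_eqVlt (negPf (la_reg hb)) //.
Qed.

Lemma pos_Phi b : pos b -> b \in Phi. Proof. by case/andP. Qed.

Lemma pos_gt0 b : pos b -> 0 < dot la b. Proof. by case/andP. Qed.

Lemma refl_a a : a != 0 -> refl a a = - a.
Proof.
by move=> a0; rewrite /refl mulfK ?dot_eq0 // scaler_nat mulr2n opprD addrA subrr sub0r.
Qed.

Lemma reflK a : a != 0 -> involutive (refl a).
Proof.
move=> a0 v; rewrite /refl dotBl dotZl mulfVK ?dot_eq0 // -addrA -opprD -scalerDl -mulrDl.
have -> : 2%:R * dot v a + 2%:R * (dot v a - 2%:R * dot v a) = 0 by ring.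
by rewrite mul0r scale0r subr0.
Qed.

Lemma refl_dot a u v : a != 0 -> dot (refl a u) (refl a v) = dot u v.
Proof.
move=> a0; rewrite /refl !(dotBl, dotBr, dotZl, dotZr) [dot a v]dotC.
by field; rewrite dot_eq0.
Qed.

Lemma refl_fix a v : dot v a = 0 -> refl a v = v.
Proof. by move=> h; rewrite /refl h mulr0 mul0r scale0r subr0. Qed.

Lemma reflN a v : refl a (- v) = - refl a v.
Proof. by rewrite /refl dotNl mulrN mulNr scaleNr opprB opprK addrC. Qed.

Lemma reflD a u v : refl a (u + v) = refl a u + refl a v.
Proof. by rewrite /refl dotDl mulrDr mulrDl scalerDl opprD addrACA. Qed.

Lemma refl_sum a (I : Type) (r : seq I) (Q : pred I) (f : I -> 'rV_n) :
  refl a (\sum_(i <- r | Q i) f i) = \sum_(i <- r | Q i) refl a (f i).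
Proof.
elim/big_rec2: _ => [|i y z _ <-]; last by rewrite reflD.
by rewrite /refl dot0l mulr0 mul0r scale0r subr0.
Qed.

Lemma simple_string_pos a b : simple a -> pos b -> b != a -> 0 < dot b a -> pos (b - a).
Proof.
move=> [pa sa] pb ba h.
have hba : b - a \in Phi by apply: Phi_str; rewrite ?pos_Phi // dotC.
apply: contraT => np; have pab : pos (a - b) by rewrite -opprB posN.
by case: (sa b (a - b)) => //; rewrite addrC subrK.
Qed.

(* If [refl a b] were negative, [b] and [c = - refl a b] would sum to a multiple of [a]; subtracting [a] from
   both of them preserves this situation, and it can be repeated. *)
Lemma simple_reflection_pos a b : simple a -> pos b -> b != a -> pos (refl a b).
Proof.
move=> sa pb ba; have pa := sa.1; have a0 := Phi0 (pos_Phi pa).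
apply: contraT => np; have hr := Phi_refl (pos_Phi pa) (pos_Phi pb).
pose c := - refl a b; have pc : pos c by rewrite posN.
have ca : c != a.
  apply: contraNneq ba => E; apply/eqP/(inv_inj (reflK a0)).
  by rewrite refl_a // -[refl a b]opprK -/c E.
pose k := 2%:R * dot b a / dot a a.
have bc : b + c = k *: a by rewrite /c /refl opprB addrC subrK.
have dbc : dot b a = dot c a.
  by have := refl_dot b a a0; rewrite refl_a // dotNr => <-; rewrite /c dotNl.
have desc (N : nat) : forall b c k, pos b -> pos c -> b != a -> c != a -> b + c = k *: a -> dot b a = dot c a -> k < N%:R -> False.
  elim: N => [|N IH] b' c' k' pb' pc' b'a c'a E d kN.
    have : 0 < dot la (b' + c') by rewrite dotDr addr_gt0 ?pos_gt0.
    rewrite E dotZr => h; have : 0 < k' by rewrite -(pmulr_lgt0 _ (pos_gt0 pa)).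
    by rewrite ltNge ltW.
  have k0 : 0 < k'.
    have : 0 < dot la (b' + c') by rewrite dotDr addr_gt0 ?pos_gt0.
    by rewrite E dotZr (pmulr_lgt0 _ (pos_gt0 pa)).
  have db : 0 < dot b' a.
    have : dot (b' + c') a = k' * dot a a by rewrite E dotZl.
    rewrite dotDl -d => E2; have : 0 < dot b' a + dot b' a by rewrite E2 mulr_gt0 // dot_gt0.
    by rewrite -mulr2n pmulrn_lgt0.
  have dc : 0 < dot c' a by rewrite -d.
  have nd b1 : pos b1 -> b1 - a != a.
    move=> p1; apply/eqP => E1; have := Phi_dbl (pos_Phi pa).
    by rewrite -{1}E1 subrK pos_Phi.
  apply: (IH (b' - a) (c' - a) (k' - 2%:R)).
  - exact: simple_string_pos.
  - exact: simple_string_pos.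
  - exact: nd.
  - exact: nd.
  - by rewrite addrACA E -opprD scalerBl; congr (_ - _); rewrite -mulr2n scaler_nat.
  - by rewrite !dotBl d.
  by rewrite ltrBlDr; apply: lt_trans kN _; rewrite -natrD ltr_nat addn2.
have [N _ hN] := perturb [:: tt] (fun=> 1 : rat) (fun=> - k).
by case: (desc N b c k pb pc ba ca bc dbc); have := hN tt (mem_head _ _) ltr01; rewrite mulr1 subr_gt0.
Qed.

(** Induction on the number of positive roots of smaller product with [la]. *)
Lemma pos_ind (Q : 'rV[rat]_n -> Prop) : (forall a, simple a -> Q a) ->
  (forall b c, pos b -> pos c -> pos (b + c) -> Q b -> Q c -> Q (b + c)) -> forall b, pos b -> Q b.
Proof.
move=> hs hD b pb; pose mu b := count (fun r => dot la r < dot la b) posroots.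
have [N] := ubnP (mu b); elim: N b pb => // N IH b pb hN.
have [sb|] := pselect (simple b); first exact: hs.
move=> /not_andP[//|/existsNP[c /existsNP[d /not_implyP[pc /not_implyP[pd /contrapT E]]]]].
have lt e : pos e -> dot la e < dot la b -> (mu e < N)%N.
  move=> pe eb; apply: (@leq_trans (mu b)); last by rewrite -ltnS.
  rewrite /mu.
  have -> : count (fun r => dot la r < dot la b) posroots =
     (count (fun r => (dot la r < dot la e)%R) posroots +
      count (fun r => (dot la e <= dot la r < dot la b)%R) posroots)%N.
    rewrite -count_predUI [X in (_ + X)%N](_ : _ = 0%N) ?addn0.
      apply: eq_count => r /=; case: (ltP (dot la r) (dot la e)) => //= h; by rewrite (lt_trans h eb).
    apply/eqP; rewrite -leqn0 leqNgt -has_count; apply/hasPn => r _ /=.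
    by case: (ltP (dot la r) (dot la e)).
  rewrite -addn1 leq_add2l -has_count; apply/hasP; exists e; rewrite ?mem_posroots //.
  by rewrite lexx.
rewrite E; apply: hD => //; first (by rewrite -E); apply: IH => //; apply: lt => //; rewrite E dotDr.
  by rewrite ltrDl pos_gt0.
by rewrite ltrDr pos_gt0.
Qed.

(** The inversion number, which is later identified with the word length [weyl_length]. *)
Definition ninv (w : 'rV[rat]_n -> 'rV[rat]_n) : nat := count (fun b => ~~ pos (w b)) posroots.

Lemma posroots_uniq : uniq posroots. Proof. exact: filter_uniq. Qed.

Lemma refl_permutes a : simple a -> perm_eq (map (refl a) (rem a posroots)) (rem a posroots).
Proof.
move=> sa; have a0 := Phi0 (pos_Phi sa.1); have inj := inv_inj (reflK a0).
have u : uniq (rem a posroots) by rewrite rem_uniq // posroots_uniq.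
apply: uniq_perm => //; first by rewrite map_inj_uniq.
suff sub : {subset map (refl a) (rem a posroots) <= rem a posroots}.
  by have [] := uniq_min_size _ sub _; rewrite ?map_inj_uniq ?size_map.
move=> _ /mapP[b hb ->]; move: hb; rewrite !mem_rem_uniq ?posroots_uniq // !inE !mem_posroots => /andP[ba pb].
rewrite simple_reflection_pos // andbT; apply/eqP => E.
by have := pos_gt0 pb; rewrite -[b](reflK a0) E refl_a // dotNr oppr_gt0 ltNge (ltW (pos_gt0 sa.1)).
Qed.

(** A simple reflection permutes the positive roots other than [a], so the count changes only by the
    contribution of [a]. *)
Lemma ninv_refl (w : 'rV[rat]_n -> 'rV[rat]_n) a : (forall b, b \in Phi -> w b \in Phi) ->
  (forall v, w (- v) = - w v) -> simple a ->
  if pos (w a) then ninv (w \o refl a) = (ninv w).+1 else ninv w = (ninv (w \o refl a)).+1.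
Proof.
move=> wP wN sa; have a0 := Phi0 (pos_Phi sa.1).
have E (f : pred 'rV_n) : count f posroots = (f a + count f (rem a posroots))%N.
  have h : a \in posroots by rewrite mem_posroots; exact: sa.1.
  by have := seq.permP (perm_to_rem h) f.
rewrite /ninv !E /= refl_a // wN posN ?wP ?pos_Phi //; last exact: sa.1.
have -> : count (fun b => ~~ pos (w (refl a b))) (rem a posroots) = count (fun b => ~~ pos (w b)) (rem a posroots).
  by rewrite -[RHS](seq.permP (refl_permutes sa)) count_map.
by case: (pos (w a)).
Qed.

Lemma ninv0 (w : 'rV[rat]_n -> 'rV[rat]_n) : (forall u v, w (u + v) = w u + w v) ->
  (forall b, b \in Phi -> w b \in Phi) -> ninv w != 0%N -> exists2 a, simple a & ~~ pos (w a).
Proof.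
move=> wD wP; rewrite -lt0n -has_count => /hasP[b]; rewrite mem_posroots => pb npb.
apply: contrapT => ne; move/negP: npb; apply; move: b pb; apply: pos_ind.
  by move=> a sa; apply: contrapT => /negP np; apply: ne; exists a.
move=> b c pb pc pbc h1 h2; rewrite /pos wP ?pos_Phi // wD dotDr addr_gt0 //; exact: pos_gt0.
Qed.

(** Twice the half-sum of positive roots: it is regular and fixed by every transformation without
    inversions, and so detects the identity. *)
Definition rho2 := \sum_(b <- posroots) b.

Lemma rho2_simple a : simple a -> 0 < dot rho2 a.
Proof.
move=> sa; have a0 := Phi0 (pos_Phi sa.1).
have E : rho2 = a + \sum_(b <- rem a posroots) b.
  by rewrite /rho2 (perm_big _ (perm_to_rem (_ : a \in posroots))) ?big_cons // mem_posroots; exact: sa.1.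
have F : refl a (\sum_(b <- rem a posroots) b) = \sum_(b <- rem a posroots) b.
  by rewrite refl_sum -(big_map (refl a) xpredT id) (perm_big _ (refl_permutes sa)).
have : dot (refl a rho2) (refl a a) = dot rho2 a by apply: refl_dot.
rewrite refl_a // E reflD refl_a // F dotNr dotDl dotNl opprD opprK [RHS]dotDl.
have := dot_gt0 a0; rewrite dotDl; lra.
Qed.

Lemma rho2_pos b : pos b -> 0 < dot rho2 b.
Proof.
move: b; apply: pos_ind => [a|b c _ _ _ h1 h2]; first exact: rho2_simple.
by rewrite dotDr addr_gt0.
Qed.

Lemma rho2_reg b : b \in Phi -> dot rho2 b != 0.
Proof.
move=> hb; have [/rho2_pos h|] := boolP (pos b); first by rewrite gt_eqF.
by rewrite -posN // => /rho2_pos; rewrite dotNr oppr_gt0 => h; rewrite lt_eqF.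
Qed.

Lemma rho2_fix (w : 'rV[rat]_n -> 'rV[rat]_n) : injective w ->
  (forall r (s : seq 'rV[rat]_n), w (\sum_(b <- r) b) = \sum_(b <- r) w b) ->
  (forall b, b \in Phi -> w b \in Phi) -> ninv w = 0%N -> w rho2 = rho2.
Proof.
move=> winj wsum wP /eqP; rewrite -leqn0 leqNgt -has_count => /hasPn h.
rewrite /rho2 wsum //; rewrite -(big_map w xpredT id); apply: perm_big.
have sub : {subset map w posroots <= posroots}.
  by move=> _ /mapP[b hb ->]; rewrite mem_posroots; have := h b hb; rewrite negbK.
apply: uniq_perm; rewrite ?map_inj_uniq ?posroots_uniq //.
by have [] := uniq_min_size _ sub _; rewrite ?map_inj_uniq ?posroots_uniq ?size_map.
Qed.

Definition dominant v := forall b, pos b -> 0 <= dot v b.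

Lemma ler_sum_sub (s t : seq 'rV[rat]_n) (f : 'rV[rat]_n -> rat) : uniq s -> uniq t ->
  {subset t <= s} -> (forall c, c \in s -> 0 <= f c) -> \sum_(c <- t) f c <= \sum_(c <- s) f c.
Proof.
move=> us ut ts f0; rewrite [leRHS](bigID (mem t)) /= -[X in _ <= X + _]big_filter.
have E : perm_eq [seq c <- s | c \in t] t.
  apply: uniq_perm => // [|c]; first exact: filter_uniq.
  by rewrite mem_filter andb_idr // => /ts.
by rewrite (perm_big _ E) /= lerDl big_seq_cond sumr_ge0 // => c /andP[/f0].
Qed.

Section ClosedRootSets.
Hypothesis Phi_int : forall a b, a \in Phi -> b \in Phi -> exists m : int, refl a b = b + m%:~R *: a.
Variable Psi : pred 'rV[rat]_n.
Hypotheses (Psi_Phi : forall a, Psi a -> a \in Phi)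
  (Psi_add : forall a b, Psi a -> Psi b -> a + b \in Phi -> Psi (a + b)).

(** The string [c], [c + r], [c + 2 r] and so on leads to the reflection of [c]. If at least three
    steps are needed, the reflection of [c + r] lies one step before that of [c], and the induction
    applies to [c + r]. *)
Lemma closed_refl c r : Psi c -> Psi r -> dot c r < 0 -> c != - r -> Psi (refl r c).
Proof.
move=> pc pr; have hr := Psi_Phi pr; have r0 := dot_gt0 (Phi0 hr).
have [m] := Phi_int hr (Psi_Phi pc).
case: m => [m|m] mE neg; last first.
  have := congr1 (fun v => dot v r) mE; rewrite /refl dotBl dotDl !dotZl mulfVK ?gt_eqF // => E.
  have : 0 < - (2%:R * dot c r) by rewrite -mulrN mulr_gt0 // oppr_gt0.
  have -> : - (2%:R * dot c r) = (Negz m)%:~R * dot r r by apply: (addrI (dot c r)).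
  by rewrite pmulr_lgt0 // ltr0z.
have {mE} : refl r c = c + m%:R *: r by rewrite mE.
have [k] := ubnP m; elim: k c m pc neg => // k IH c m pc neg hm mE cr.
case: m hm mE => [|[|[|m]]] hm mE.
- have := congr1 (fun v => dot v r) mE; rewrite /refl scale0r addr0 dotBl dotZl mulfVK ?gt_eqF // => E.
  by move: neg; have -> : dot c r = 0; [lra | rewrite ltxx].
- by rewrite mE scale1r; apply: Psi_add => //; rewrite -[r]scale1r -mE; apply: Phi_refl (Psi_Phi pc).
all: have hc' : c + r \in Phi by rewrite -[r]opprK; apply: Phi_str => //; [exact: PhiN | exact: Psi_Phi | rewrite dotNl dotC oppr_gt0].
all: have pc' := Psi_add pc pr hc'.
all: have hrc := Phi_refl hr (Psi_Phi pc).
- have E : refl r c = (c + r) + r by rewrite mE scaler_nat mulr2n addrA.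
  by rewrite E; apply: Psi_add => //; rewrite -E.
have E : refl r c = refl r (c + r) + r by rewrite reflD (refl_a (Phi0 hr)) subrK.
have mE' : refl r (c + r) = (c + r) + m.+1%:R *: r.
  apply: (addIr r); rewrite -E mE -!addrA; congr (_ + _).
  by rewrite addrCA -mulr2n -scaler_nat -scalerDl -natrD addn2.
have neg' : dot (c + r) r < 0.
  have := congr1 (fun v => dot v r) mE'; rewrite /refl dotBl !(dotDl, dotZl) mulfVK ?gt_eqF //.
  have : (0 : rat) < m.+1%:R * dot r r by rewrite mulr_gt0 // ltr0Sn.
  by move: (m.+1%:R * dot r r) => z; lra.
rewrite E; apply: Psi_add => //; last by rewrite -E.
apply: (IH _ m.+1 pc' neg' _ mE').
  by move: hm; rewrite !ltnS => /ltnW.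
apply: contraTneq (Psi_Phi pc) => h; have -> : c = - r + - r by apply: (addIr r); rewrite h subrK.
exact: Phi_dbl (PhiN hr).
Qed.

(** For the roots of a parabolic these are the roots of its unipotent radical, and [closed_weight]
    is the weight of the determinant of the adjoint action on the radical. *)
Definition unpaired c := Psi c && ~~ Psi (- c).
Definition closed_weight := \sum_(b <- Phi | unpaired b) b.

Lemma unpaired_refl c r : unpaired c -> Psi r -> dot c r < 0 -> unpaired (refl r c).
Proof.
move=> /andP[pc npc] pr neg; have r0 := Phi0 (Psi_Phi pr).
have cr : c != - r by apply: contraNneq npc => ->; rewrite opprK.
rewrite /unpaired closed_refl //=; apply: contra npc => h.
have E : refl r (- refl r c) = - c by rewrite reflN reflK.
rewrite -E; apply: closed_refl => //.
  by rewrite dotNl -[X in dot _ X](reflK r0) refl_dot // refl_a // dotNr opprK.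
by apply: contraNneq cr => /oppr_inj/(congr1 (refl r)); rewrite reflK // refl_a // => ->.
Qed.

(** The terms with negative product against [r] cancel with those of their reflections. The
    remaining terms are nonnegative, and [r] itself is among them when it is unpaired. *)
Lemma closed_weight_ge r : Psi r -> (unpaired r)%:R * dot r r <= dot closed_weight r.
Proof.
move=> pr; have hr := Psi_Phi pr; have r0 := Phi0 hr; have rr := dot_gt0 r0.
pose s := [seq b <- Phi | unpaired b]; have us : uniq s by apply: filter_uniq.
have sE b : (b \in s) = unpaired b.
  by rewrite mem_filter andb_idr // => /andP[/Psi_Phi].
rewrite /closed_weight dot_suml -big_filter -/s (bigID (fun b => dot b r < 0)) /=.
pose t := [seq refl r b | b <- s & dot b r < 0].
have fr_ b : dot (refl r b) r = - dot b r.
  by rewrite -[in RHS](refl_dot b r r0) refl_a // dotNr opprK.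
have -> : \sum_(b <- s | dot b r < 0) dot b r = - \sum_(b <- t) dot b r.
  rewrite big_map big_filter -sumrN; apply: eq_bigr => b _; by rewrite fr_ opprK.
have ut : uniq t by rewrite map_inj_uniq; [exact: filter_uniq | exact: can_inj (reflK r0)].
have tP c : c \in t -> unpaired c /\ 0 < dot c r.
  move=> /mapP[b]; rewrite mem_filter sE => /andP[neg ub] ->; split; first exact: unpaired_refl.
  by rewrite fr_ oppr_gt0.
pose t' := if unpaired r then r :: t else t.
have -> : (unpaired r)%:R * dot r r = - (\sum_(b <- t) dot b r) + \sum_(b <- t') dot b r.
  by rewrite /t'; case: unpaired; rewrite ?big_cons ?mul1r ?mul0r ?addNr // addrCA addNr addr0.
rewrite lerD2l -[leRHS]big_filter; apply: ler_sum_sub => [| |c|c].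
- exact: filter_uniq.
- rewrite /t'; case: ifP => //= ur; rewrite ut andbT; apply/negP => /mapP[b].
  rewrite mem_filter sE => /andP[_ /andP[_ nb]] E; case/negP: nb.
  by rewrite -[b](reflK r0) -E refl_a // opprK.
- rewrite mem_filter sE -leNgt /t'; case: ifP => ur; rewrite ?inE.
    by move=> /predU1P[->|/tP[-> /ltW ->]] //; rewrite ur ltW.
  by move=> /tP[-> /ltW ->].
- by rewrite mem_filter -leNgt => /andP[].
Qed.

End ClosedRootSets.

End RootSystems.

Lemma irreducible_finite_union (R : realType) n (A : set 'M[R[i]]_n) (I : eqType) (s : seq I)
  (F : I -> set ('M[R[i]]_n -> R[i])) : irreducible A -> A !=set0 ->
  (forall i f, F i f -> is_poly f) ->
  (forall x, A x -> exists2 i, i \in s & forall f, F i f -> f x = 0) ->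
  exists2 i, i \in s & forall x f, A x -> F i f -> f x = 0.
Proof.
move=> iA [x0 Ax0] pF cov; apply: contrapT => ne.
suff [h [ph h0 [x Ax hx]]] : exists h, [/\ is_poly h, (forall x i, i \in s -> A x -> (forall f, F i f -> f x = 0) -> h x = 0) & exists2 x, A x & h x != 0].
  by have [i hi Fi] := cov x Ax; move: hx; rewrite (h0 x i) ?eqxx.
have bad i : i \in s -> exists2 f, F i f & exists2 x, A x & f x != 0.
  move=> hi; apply: contrapT => ne'; apply: ne; exists i => // x f Ax Ff; apply/eqP; apply: contrapT => /negP nz.
  by apply: ne'; exists f => //; exists x.
elim: s bad {cov ne} => [|i s IH] bad.
  by exists (fun=> 1); split=> //; [exact: is_poly_cst | exists x0; rewrite ?oner_neq0].
have [|h [ph h0 [x Ax hx]]] := IH; first by move=> j js; apply: bad; rewrite inE js orbT.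
have [|f Ff [y Ay fy]] := bad i; first by rewrite mem_head.
exists (fun x => f x * h x); split.
- by apply: is_polyM => //; apply: pF Ff.
- move=> z j; rewrite inE => /predU1P[->|js] Az hz; first by rewrite hz ?mul0r.
  by rewrite (h0 z j) ?mulr0.
by have [z Az hz] := irreducibleP iA (pF _ _ Ff) ph Ay Ax fy hx; exists z.
Qed.

Lemma mulf_sub0 (F : idomainType) (x a b : F) : x != 0 -> x * (a - b) = 0 -> a = b.
Proof. by move=> x0 /eqP; rewrite mulf_eq0 (negPf x0) subr_eq0 => /eqP. Qed.

(** * Centralizers of root-regular cocharacters *)

Section RegularCentralizer.
Variables (R : realType) (n : nat).
Local Notation C := R[i].
Local Notation M := 'M[C]_n.
Variables (g : M) (T : set M) (P : 'M[rat]_n) (fr : torus_frame g T P).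
Let gu := fr_gu fr.
Let dT := fr_dT fr.
Variables (K : set M) (pr : torus_pair T K).
Let aK := pr_aK pr.
Let TK := pr_TK pr.
Local Notation ent := (ent g).
Local Notation qdiag := (qdiag g).
Local Notation X := (cochars g T).

(* The centralizer of a root-regular cocharacter is irreducible with Lie algebra that of [T]; it permutes the finitely many diagonal
   conjugates of a generic cocharacter, hence fixes it. *)
Lemma centralizer_regular v : X v -> (forall r, is_root g P K r -> dot v r != 0) ->
  Lgrp g K (v 0) = T.
Proof.
move=> Xv vreg; pose L := Lgrp g K (v 0).
have aL : algebraic_group L by apply: Lgrp_algebraic.
have sL := alg_subgroup aL.
have LK : L `<=` K by move=> x [].
have TL : T `<=` L by move=> t Tt; split; [exact: TK | exact: (torus_weq dT)].
have [la [gla _]] := regular_ex fr.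
rewrite eqEsubset; split => //.
have lieL Z : lie L Z -> lie T Z.
  move=> hZ; rewrite (rcomp_sum fr Z); apply: (linset_sum (lie_linset T)) => r _.
  have hr := rcomp_k fr r aL TL hZ.
  have hw : rwt g P r (rcomp g P r Z) by apply: (rcomp_rwt fr).
  have [r0|r0] := eqVneq r 0.
    by apply: (rwt0_torus fr pr); [exact: (lie_mono LK) | rewrite -r0].
  have [->|c0] := eqVneq (rcomp g P r Z) 0; first by case: (lie_linset T).
  have rt : is_root g P K r by split=> //; exists (rcomp g P r Z); split=> //; exact: (lie_mono LK).
  have := vreg r rt; have [i [j cij]] := ent_neq0 gu c0.
  by rewrite -(rwt_haswt fr Xv hw cij) (lie_Lgrp gu hr cij) subrr eqxx.
have iL : irreducible L.
  by apply: Lgrp_irreducible; [exact: gu | exact: aK | exact: (pair_irreducible fr pr) | exact: (X_ratcochar pr Xv)].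
(* The equations on [x] saying that conjugation by [x] sends [la] to its image under the permutation
   [s]. *)
pose F (s : 'S_n) : set (M -> C) := [set f | exists ij : 'I_n * 'I_n, f = fun x : M =>
  ent x ij.1 ij.2 * (ratr (la 0 ij.2) - ratr (la 0 (s ij.1)))].
have pF s f : F s f -> is_poly f.
  by move=> [ij ->]; apply: is_polyM; [exact: is_polymx_ent | exact: is_poly_cst].
have cov x : L x -> exists2 s : 'S_n, s \in enum 'S_n & forall f, F s f -> f x = 0.
  move=> Lx; have Kx := LK _ Lx; have xu := sg_unit sL Lx.
  have [s sE] : exists s, x *m qdiag la *m invmx x = tdiag g s.
    apply: (torus_lie_diag gu dT); apply: lieL; apply: (lie_Ad aL Lx); apply: (lie_mono TL).
    exact: (cochars_lie gu gla.1).
  exists (wperm g x); first by rewrite mem_enum.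
  move=> _ [[i j] ->] /=.
  have E : x *m qdiag la = tdiag g s *m x by rewrite -sE mulmxKV.
  have := congr1 ent E; rewrite (entM gu x (qdiag la)) (entM gu (tdiag g s) x) (ent_qdiag _ gu) (ent_tdiag gu) => /matrixP E2.
  have E3 k : ent x i k != 0 -> ratr (la 0 k) = s 0 i.
    move=> xk; have := E2 i k; rewrite mul_mx_diag mul_diag_mx mxE [RHS]mxE [in LHS]mxE mulrC => /(mulIf xk); exact.
  have [->|xij] := eqVneq (ent x i j) 0; first by rewrite mul0r.
  by rewrite (E3 _ xij) (E3 _ (wperm_neq0 fr i xu)) subrr mulr0.
have [|s _ hs] := irreducible_finite_union iL _ pF cov; first by exists 1%:M; exact: (sg1 sL).
move=> x Lx; apply: (commute_torus fr pr gla (LK _ Lx)).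
apply: (ent_inj gu); rewrite (entM gu) (entM gu) (ent_qdiag _ gu); apply/weqP => i j xij.
have fix_ i' : (ratr (la 0 i') : C) = ratr (la 0 (s i')).
  have := hs 1%:M _ (sg1 sL) (ex_intro _ (i', i') erefl); rewrite /= ent1 // mxE eqxx mul1r => /eqP.
  by rewrite subr_eq0 => /eqP.
apply: (@fmorph_inj _ C ratr); exact: etrans (mulf_sub0 xij (hs x _ Lx (ex_intro _ (i, j) erefl))) (esym (fix_ i)).
Qed.

Lemma act_fix_regular x v : normalizer K T x -> X v -> (forall r, is_root g P K r -> dot v r != 0) ->
  act g x v = v -> T x.
Proof.
move=> nx Xv vreg E; have [_] := norm_act fr pr nx Xv; rewrite E => /(congr1 ent).
rewrite (entM gu) (entM gu) (ent_qdiag _ gu) => h.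
by rewrite -(centralizer_regular Xv vreg); split; [case: nx | apply/weqP].
Qed.

End RegularCentralizer.

Opaque mulmx invmx.

(** * Lengths, dominant cocharacters and minimal representatives *)

Section WeylGroup.
Variables (R : realType) (n : nat).
Local Notation C := R[i].
Local Notation M := 'M[C]_n.
Variables (g : M) (T : set M) (P : 'M[rat]_n) (fr : torus_frame g T P).
Variables (K : set M) (pr : torus_pair T K).
Local Notation X := (cochars g T).
Local Notation N := (normalizer K T).
Let sN := normalizer_subgroup pr.

Definition rootsq : seq 'rV[rat]_n := [seq r <- wdiffs (eps P) | `[< is_root g P K r >]].

Lemma mem_rootsq r : (r \in rootsq) = `[< is_root g P K r >].
Proof.
rewrite mem_filter andb_idr // => /asboolP[r0 [e [he e0 we]]].
have [i [j <-]] := rwt_nz fr we e0; rewrite mem_undup.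
by apply/mapP; exists (i, j); rewrite ?mem_enum.
Qed.

Lemma rootsqP r : reflect (is_root g P K r) (r \in rootsq).
Proof. by rewrite mem_rootsq; apply: asboolP. Qed.

Lemma rootsq_uniq : uniq rootsq. Proof. exact/filter_uniq/undup_uniq. Qed.
Lemma rootsq0 a : a \in rootsq -> a != 0. Proof. by move=> /rootsqP[]. Qed.
Lemma rootsqN a : a \in rootsq -> - a \in rootsq.
Proof. by move=> /rootsqP h; apply/rootsqP; apply: (root_opp fr pr). Qed.
Lemma rootsq_dbl a : a \in rootsq -> a + a \notin rootsq.
Proof. by move=> /rootsqP h; apply/negP => /rootsqP; apply: (root_double fr pr). Qed.
Lemma rootsq_str a b : a \in rootsq -> b \in rootsq -> 0 < dot a b -> b != a -> b - a \in rootsq.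
Proof. by move=> /rootsqP ha /rootsqP hb h ne; apply/rootsqP; apply: (root_string fr pr). Qed.
Lemma rootsqX a : a \in rootsq -> X a. Proof. by move=> /rootsqP h; apply: (is_rootX fr h). Qed.
Lemma rootsq_act x a : N x -> a \in rootsq -> act g x a \in rootsq.
Proof. by move=> nx /rootsqP h; apply/rootsqP; apply: (root_act fr pr). Qed.

Lemma reflection_exists a : a \in rootsq -> exists2 s, N s & forall v, X v -> act g s v = refl a v.
Proof.
move=> /rootsqP ra; have [e [f [_ _ _ _ [_ _ ns hs]]]] := root_reflection fr pr ra.
by exists (expm e *m expm (- f) *m expm e).
Qed.

Lemma rootsq_refl a b : a \in rootsq -> b \in rootsq -> refl a b \in rootsq.
Proof.
move=> ha hb; have [s ns hs] := reflection_exists ha.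
by rewrite -hs; [exact: rootsq_act | exact: rootsqX].
Qed.

Lemma rootsq_nz r e : lie K e -> rwt g P r e -> e != 0 -> r != 0 -> r \in rootsq.
Proof. by move=> he we e0 r0; apply/rootsqP; split=> //; exists e. Qed.

Section Positive.
Variable la : 'rV[rat]_n.
Hypothesis la_reg : forall a, a \in rootsq -> dot la a != 0.
Local Notation pos := (pos rootsq la).
Local Notation simple := (simple rootsq la).
Local Notation dominant := (dominant rootsq la).
Let U := rootsq_uniq.

Definition wlen (x : M) : nat := ninv rootsq la (act g x).

Lemma wlen_eq x y : (forall v, X v -> act g x v = act g y v) -> wlen x = wlen y.
Proof.
move=> h; apply: eq_in_count => b; rewrite mem_posroots => pb.
by rewrite h //; apply: rootsqX; apply: pos_Phi pb.
Qed.

Lemma wlen_torus x t : N x -> T t -> wlen (x *m t) = wlen x.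
Proof.
move=> nx Tt; apply: wlen_eq => v Xv.
by rewrite (act_mul fr pr nx (torus_normalizer fr pr Tt) Xv) (act_torus fr v Tt).
Qed.

(** Without inversions [x] fixes [rho2], a root-regular cocharacter, and so lies in its centralizer
    [T]. *)
Lemma wlen0 x : N x -> wlen x = 0%N -> T x.
Proof.
move=> nx h.
have Xrho : X (rho2 rootsq la).
  rewrite /rho2 big_seq; apply: (linset_sum (X_lin fr)) => b; rewrite mem_posroots => pb.
  by apply: rootsqX; apply: pos_Phi pb.
apply: (act_fix_regular fr pr nx Xrho) => [r /rootsqP hr|].
  exact: (rho2_reg U rootsq0 rootsqN rootsq_dbl rootsq_str rootsq_refl la_reg).
apply: (rho2_fix U (@act_inj _ _ g x) _ (fun b => @rootsq_act x b nx) h) => r _.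
exact: act_sum.
Qed.

Lemma wlen1 : wlen 1%:M = 0%N.
Proof.
apply/eqP; rewrite -leqn0 leqNgt -has_count; apply/hasPn => b; rewrite mem_posroots => pb.
by rewrite negbK (act1 fr).
Qed.

Lemma wlen_refl x s a : N x -> N s -> simple a -> (forall v, X v -> act g s v = refl a v) ->
  if pos (act g x a) then wlen (x *m s) = (wlen x).+1 else wlen x = (wlen (x *m s)).+1.
Proof.
move=> nx ns sa hs.
have E : wlen (x *m s) = ninv rootsq la (act g x \o refl a).
  apply: eq_in_count => b; rewrite mem_posroots => pb /=.
  have Xb : X b by apply: rootsqX; apply: pos_Phi pb.
  by rewrite (act_mul fr pr nx ns Xb) hs.
rewrite E.
exact: (ninv_refl U rootsq0 rootsqN rootsq_dbl rootsq_str rootsq_refl la_reg (fun b => @rootsq_act x b nx) (actN g x) sa).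
Qed.

Lemma wlen_descent x : N x -> wlen x != 0%N -> exists a s, [/\ simple a, N s,
  (forall v, X v -> act g s v = refl a v), ~~ pos (act g x a) & wlen x = (wlen (x *m s)).+1].
Proof.
move=> nx h; have [a sa npa] := ninv0 (actD g x) (fun b => @rootsq_act x b nx) h.
have [s ns hs] := reflection_exists (pos_Phi sa.1).
exists a, s; split=> //; have := wlen_refl nx ns sa hs; by rewrite (negPf npa).
Qed.

Lemma posN_act x a : N x -> a \in rootsq -> ~~ pos (act g x a) -> pos (- act g x a).
Proof. by move=> nx ha npa; rewrite posN //; [exact: rootsqN | exact: rootsq_act]. Qed.

(** Induction on the length: by dominance on both sides a descent [a] of [x] is orthogonal to [v],
    so the simple reflection can be removed without changing the image of [v]. *)
Lemma dominant_unique x v : N x -> X v -> dominant v -> dominant (act g x v) -> act g x v = v.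
Proof.
move=> nx Xv dv; have [m] := ubnP (wlen x); elim: m x nx => // m IH x nx hm dxv.
have [h|h] := eqVneq (wlen x) 0%N; first by apply: (act_torus fr); apply: wlen0.
have [a [s [sa ns hs npa E]]] := wlen_descent nx h.
have pa := posN_act nx (pos_Phi sa.1) npa.
have va : dot v a = 0.
  apply/eqP; rewrite eq_le (dv _ sa.1) andbT.
  by have := dxv _ pa; rewrite dotNr act_dot oppr_ge0.
have sv : act g s v = v by rewrite hs // refl_fix.
have nxs : N (x *m s) by apply: (sgM sN).
have xsv : act g (x *m s) v = act g x v by rewrite (act_mul fr pr) // sv.
by rewrite -xsv; apply: (IH _ nxs); [rewrite -ltnS -E | rewrite xsv].
Qed.

(** Among the finitely many images of [v], one with the largest product with [la] is dominant, since
    reflecting in a violated positive root would increase that product. *)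
Lemma dominant_exists v : X v -> exists2 x, N x & dominant (act g x v).
Proof.
move=> Xv.
pose Q (s : 'S_n) := `[< exists2 x, N x & wperm g x = s >].
have Q1 : Q (wperm g 1%:M) by apply/asboolP; exists 1%:M => //; exact: (sg1 sN).
case: (@Order.TotalTheory.arg_maxP _ _ _ (wperm g 1%:M) Q (fun s : 'S_n => dot la (\row_i v 0 (s i))) Q1) => s /asboolP[x nx xs] smax.
exists x => // b pb; rewrite leNgt; apply/negP => h.
have hb := pos_Phi pb.
have [t nt ht] := reflection_exists hb.
have Q2 : Q (wperm g (t *m x)) by apply/asboolP; exists (t *m x) => //; apply: (sgM sN).
have := smax _ Q2; rewrite -/(act g (t *m x) v) -xs -/(act g x v) (act_mul fr pr) // ht; last exact: (act_X fr pr).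
rewrite /refl dotBr dotZr => h2.
have b0 := dot_gt0 (rootsq0 hb).
have : 0 < - (2%:R * dot (act g x v) b / dot b b) * dot la b.
  by rewrite mulr_gt0 ?(pos_gt0 pb) // -mulNr -mulrN divr_gt0 // mulr_gt0 // oppr_gt0.
rewrite mulNr => h3; suff: dot la (act g x v) < dot la (act g x v) by rewrite ltxx.
by apply: (lt_le_trans _ h2); rewrite ltrDl.
Qed.

Section Stabilizer.
Variable mu : 'rV[rat]_n.
Hypotheses (Xmu : X mu) (dmu : dominant mu).

Definition stab : set M := [set u | N u /\ act g u mu = mu].
(** The form in roots of minimal length in the coset of [x] modulo the stabilizer of [mu]. *)
Definition posl x := forall b, pos b -> dot mu b = 0 -> pos (act g x b).

(** By dominance an inversion of [u] is orthogonal to [mu]; the conditions on [x] and on [x u] then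
    prescribe opposite signs for its image. *)
Lemma posl_unique x u : N x -> stab u -> posl x -> posl (x *m u) -> T u.
Proof.
move=> nx [nu umu] px pxu.
have nux : N (x *m u) by apply: (sgM sN).
apply: wlen0 => //; apply/eqP; rewrite -leqn0 leqNgt -has_count; apply/hasPn => b; rewrite mem_posroots negbK => pb.
have hb := pos_Phi pb; have Xb := rootsqX hb; have hub := rootsq_act nu hb.
have E : dot mu (act g u b) = dot mu b by rewrite -{1}umu act_dot.
apply: contraT => npub; have pN := posN_act nu hb npub.
have h0 : 0 <= dot mu (- act g u b) by apply: dmu.
have h1 : 0 <= dot mu b by apply: dmu.
have mb : dot mu b = 0 by move: h0; rewrite dotNr E; lra.
have := px _ pN; rewrite dotNr E mb oppr0 => /(_ erefl).
have := pxu b pb mb; rewrite (act_mul fr pr nx nu Xb) actN (posN rootsqN la_reg (rootsq_act nx hub)).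
by move=> ->.
Qed.

(** A positive root orthogonal to the dominant [mu] decomposes only into such roots, so simple roots
    suffice; one made negative by [x] would give a shorter element of the coset. *)
Lemma posl_min x : N x -> (forall u, stab u -> (wlen x <= wlen (x *m u))%N) -> posl x.
Proof.
move=> nx hmin b pb mb.
have sub a : pos a -> dot mu a = 0 -> forall c d, pos c -> pos d -> a = c + d -> dot mu c = 0 /\ dot mu d = 0.
  move=> pa ma c d pc pd E; have := dmu pc; have := dmu pd; move: ma; rewrite E dotDr; lra.
move: b pb mb; apply: (pos_ind (la := la)) => [a sa ma|b c pb pc pbc hb hc mbc].
  apply: contraT => npa; have [s ns hs] := reflection_exists (pos_Phi sa.1).
  have ss : stab s by split=> //; rewrite hs // refl_fix.
  have := wlen_refl nx ns sa hs; rewrite (negPf npa) => E.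
  by have := hmin s ss; rewrite E ltnn.
have [mb mc] := sub _ pbc mbc _ _ pb pc erefl.
have h := rootsq_act nx (pos_Phi pbc).
by apply/andP; split=> //; rewrite actD dotDr addr_gt0 ?(pos_gt0 (hb mb)) ?(pos_gt0 (hc mc)).
Qed.

Lemma posl_exists x : N x -> exists2 u, stab u & posl (x *m u) /\
  forall u', stab u' -> (wlen (x *m u) <= wlen (x *m u'))%N.
Proof.
move=> nx; have s1 : stab 1%:M by split; [exact: (sg1 sN) | rewrite (act1 fr)].
have ex : exists k, `[< exists2 u, stab u & wlen (x *m u) = k >].
  by exists (wlen (x *m 1%:M)); apply/asboolP; exists 1%:M.
case: (ex_minnP ex) => k /asboolP[u su uk] kmin; exists u; first exact: su.
have hmin u' : stab u' -> (wlen (x *m u) <= wlen (x *m u'))%N.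
  by move=> su'; rewrite uk; apply: kmin; apply/asboolP; exists u'.
split; last exact: hmin.
apply: posl_min (sgM sN nx su.1) _ => v [nv vmu]; rewrite -mulmxA; apply: hmin; case: su => nu umu.
split; first exact: (sgM sN nu nv).
by rewrite (act_mul fr pr nu nv Xmu) vmu.
Qed.

Lemma posl_minP x : N x -> posl x <-> forall u, stab u -> (wlen x <= wlen (x *m u))%N.
Proof.
move=> nx; split; last exact: posl_min.
move=> px u su; have [v sv [pv hmin]] := posl_exists nx.
have Tv := posl_unique nx sv px pv.
by rewrite -(wlen_torus nx Tv); apply: hmin.
Qed.

End Stabilizer.
End Positive.
End WeylGroup.

(** * Integrality of root strings and nonvanishing of brackets *)

Section RootSubsystems.
Variables (R : realType) (n : nat).
Local Notation C := R[i].
Local Notation M := 'M[C]_n.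
Variables (g : M) (T : set M) (P : 'M[rat]_n) (fr : torus_frame g T P).
Let gu := fr_gu fr.
Local Notation ent := (ent g).
Local Notation rwt := (rwt g P).
Variables (K : set M) (pr : torus_pair T K).
Let aK := pr_aK pr.
Let sK := alg_subgroup aK.
Local Notation X := (cochars g T).

Definition latt (a c : 'rV[rat]_n) (Z : M) :=
  forall i j, ent Z i j != 0 -> exists m : int, eps P i - eps P j = c + m%:~R *: a.

Lemma lattM a b c Y Z : latt a b Y -> latt a c Z -> latt a (b + c) (Y *m Z).
Proof.
move=> hY hZ i j; rewrite (entM gu) => /mulmx_neq0[k [/hY[m hm] /hZ[m' hm']]].
exists (m + m'); rewrite intrD scalerDl addrACA -hm -hm' addrA subrK //.
Qed.

Lemma lattM0 a Y Z : latt a 0 Y -> latt a 0 Z -> latt a 0 (Y *m Z).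
Proof. by move=> hY hZ i j ij; have := lattM hY hZ ij; rewrite addr0. Qed.

Lemma latt1 a : latt a 0 1%:M.
Proof.
move=> i j; rewrite (ent1 gu) mxE; case: (i =P j) => [-> _|_]; last by rewrite eqxx.
by exists 0; rewrite subrr scale0r addr0.
Qed.

Lemma latt_expm a e : latt a 0 e -> latt a 0 (expm e).
Proof.
move=> he i j; rewrite expmE (ent_sum) summxE => h.
have [k hk] : exists k : 'I_n, ent (e ^+ k) i j != 0.
  apply: contrapT => ne; move/eqP: h; apply; apply: big1 => k _; rewrite (entZ) mxE.
  have [->|hk] := eqVneq (ent (e ^+ k) i j) 0; [exact: mulr0 | by case: ne; exists k].
have hX : latt a 0 (e ^+ k).
  elim: (nat_of_ord k) => [|m IH]; first by rewrite expr0; exact: latt1.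
  by rewrite exprS -mulmxE; apply: lattM0.
exact: hX hk.
Qed.

Lemma latt_rwt a c (m : int) Z : rwt (c + m%:~R *: a) Z -> latt a c Z.
Proof. by move=> h i j /h ->; exists m. Qed.

(** The lift [w] of the reflection is built from exponentials of weights [a] and [- a]. The weights
    of [w Y] therefore lie in [b] plus integral multiples of [a]; read as [w Y w^-1] times [w], the
    same matrix has its weights in [refl a b] plus such multiples. *)
Lemma root_integral a b : is_root g P K a -> is_root g P K b ->
  exists m : int, refl a b = b + m%:~R *: a.
Proof.
move=> ra rb; have [e [f [he hf we wf [e0 f0 nw hw]]]] := root_reflection fr pr ra.
have [_ [Y [hY Y0 wY]]] := rb; have Xb := is_rootX fr rb.
set w := (expm e *m _ *m _) in nw hw; have wu : w \in unitmx := sg_unit sK nw.1.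
have wtW := rwt_act fr pr nw Xb wY; rewrite hw // in wtW.
have lw : latt a 0 w.
  have le : latt a 0 (expm e) by apply: latt_expm; apply: (@latt_rwt a 0 1); rewrite add0r scale1r.
  have lf : latt a 0 (expm (- f)).
    apply: latt_expm; apply: (@latt_rwt a 0 (- 1)); rewrite add0r rmorphN /= scaleN1r.
    by have := rwtZ (a := -1) wf; rewrite scaleN1r.
  exact: (lattM0 (lattM0 le lf) le).
have wY0 : w *m Y != 0 by apply: contraNneq Y0 => h; rewrite -[Y](mulKmx wu) h mulmx0.
have [i [j ij]] := ent_neq0 gu wY0.
have [m1 E1] : exists m : int, eps P i - eps P j = b + m%:~R *: a.
  have lY : latt a b Y by apply: (@latt_rwt a b 0); rewrite scale0r addr0.
  by have := lattM lw lY ij; rewrite add0r.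
have [m2 E2] : exists m : int, eps P i - eps P j = refl a b + m%:~R *: a.
  have ij' : ent ((w *m Y *m invmx w) *m w) i j != 0 by rewrite mulmxKV.
  have lW : latt a (refl a b) (w *m Y *m invmx w) by apply: (@latt_rwt a _ 0); rewrite scale0r addr0.
  by have := lattM lW lw ij'; rewrite addr0.
exists (m1 - m2); rewrite rmorphB /= scalerBl addrA -E1 E2 addrK //.
Qed.

Lemma root_add_lt a r Y e : lie K Y -> lie K e -> rwt a Y -> rwt r e -> Y != 0 -> e != 0 ->
  r != 0 -> dot a r < 0 -> e *m Y - Y *m e != 0.
Proof.
move=> hY he wY we Y0 e0 r0 ar; have Xr := rwtX fr we e0.
have [f [hf wf tf]] := dual_vector fr pr he e0 we.
have we' : rwt (- - r) e by rewrite opprK.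
have Xr' : X (- r) by apply: (linsetN (X_lin fr)).
have fe := root_bracket fr pr Xr' hf he wf we'; rewrite mxtrace_mulC tf in fe.
apply: contraNneq Y0 => /eqP; rewrite subr_eq0 => /eqP eY.
apply/eqP; apply: (sl2_kills fr Xr' (oner_neq0 _) _ wf fe wY _ eY); first by rewrite oppr_eq0.
by rewrite dotNl oppr_gt0 dotC.
Qed.

(** When [a] and [r] have a nonnegative product, the bracket is tested by the trace on a root vector
    of weight opposite to [a + r], whose product with [r] is negative. *)
Lemma root_add_neq0 a r Y e : lie K Y -> lie K e -> rwt a Y -> rwt r e -> Y != 0 -> e != 0 ->
  a != 0 -> r != 0 -> is_root g P K (a + r) -> e *m Y - Y *m e != 0.
Proof.
move=> hY he wY we Y0 e0 a0 r0 rar; have [ar|ar] := ltP (dot a r) 0; first exact: (root_add_lt hY he wY we Y0 e0 r0 ar).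
have [_ [Z [hZ Z0 wZ]]] := rar; have [Z' [hZ' wZ' tZ]] := dual_vector fr pr hZ Z0 wZ.
have Z'0 : Z' != 0 by apply/eqP => E; move: tZ; rewrite E mulmx0 mxtrace0 => /esym/eqP; rewrite oner_eq0.
have neg : dot (- (a + r)) r < 0 by rewrite dotNl oppr_lt0 dotDl ltr_wpDl // dot_gt0.
have eZ0 := root_add_lt hZ' he wZ' we Z'0 e0 r0 neg.
have weZ : rwt (- a) (e *m Z' - Z' *m e) by have := rwt_bracket fr we wZ'; rewrite opprD addrCA subrr addr0.
have [Y' [hY' wY' tY]] := dual_vector fr pr hY Y0 wY.
have Na0 : - a != 0 by rewrite oppr_eq0.
have [c cE] := root_dim1 fr pr Na0 (lie_bracket aK he hZ') hY' eZ0 weZ wY'.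
apply/eqP => E.
have : \tr ((e *m Y - Y *m e) *m Z') = - \tr (Y *m (e *m Z' - Z' *m e)).
  by rewrite mulmxBl mulmxBr !mxtraceB opprB -mulmxA mxtrace_mulC !mulmxA.
rewrite E mul0mx mxtrace0 => /esym/eqP; rewrite oppr_eq0 => /eqP t0.
by move: tY; rewrite cE -scalemxAr linearZ /= t0 mulr0 => /esym/eqP; rewrite oner_eq0.
Qed.

End RootSubsystems.

Section Derived.
Variables (R : realType) (n : nat).
Local Notation M := 'M[R[i]]_n.
Implicit Types G Q D : set M.

Lemma derived_comm G x y : G x -> G y -> derived_subgroup G (x *m y *m invmx x *m invmx y).
Proof. by move=> Gx Gy D [_]; apply; exists x => //; exists y. Qed.

Lemma derived_sub G D : subgroup D -> (forall x y, G x -> G y -> D (x *m y *m invmx x *m invmx y)) ->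
  derived_subgroup G `<=` D.
Proof. by move=> sD h; apply: smallest_sub => // _ [x Gx [y Gy <-]]; apply: h. Qed.

Lemma derived_subgroup_sg G : subgroup G -> subgroup (derived_subgroup G) /\ derived_subgroup G `<=` G.
Proof.
move=> sG; have sub : derived_subgroup G `<=` G.
  by apply: derived_sub => // x y Gx Gy; apply: (sgM sG); [apply: (sgJ sG) | apply: (sgV sG)].
split=> //; split.
- by move=> x /sub; apply: sg_unit.
- by move=> D [sD _]; apply: (sg1 sD).
- by move=> x y hx hy D hD; apply: (sgM hD.1); [apply: hx | apply: hy].
- by move=> x hx D hD; apply: (sgV hD.1); apply: hx.
Qed.

Lemma iter_derived_sg G k : subgroup G -> subgroup (iter k (@derived_subgroup R n) G) /\
  iter k (@derived_subgroup R n) G `<=` G.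
Proof.
move=> sG; elim: k => [|k [sk IH]]; first by split.
by have [s1 s2] := derived_subgroup_sg sk; split=> // x /s2/IH.
Qed.

End Derived.

Section Twisted.
Variables (F : fieldType) (n : nat).
Implicit Types (x y a b d : 'M[F]_n) (c : F).

Definition twisted x a b c := x *m a = c *: (b *m x).

Lemma twistedM x y a b d c c' : twisted y a b c -> twisted x b d c' -> twisted (x *m y) a d (c * c').
Proof.
by rewrite /twisted => h h'; rewrite -mulmxA h -scalemxAr [x *m (b *m y)]mulmxA h' -scalemxAl scalerA -[d *m x *m y]mulmxA.
Qed.

Lemma twistedV x a b c : x \in unitmx -> c != 0 -> twisted x a b c -> twisted (invmx x) b a c^-1.
Proof.
rewrite /twisted => xu c0 h.
have -> : b = c^-1 *: (x *m a *m invmx x) by rewrite h -scalemxAl mulmxK // scalerA mulVf // scale1r.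
by rewrite -scalemxAr !mulmxA mulVmx // mul1mx.
Qed.

Lemma twisted_conj x a c (y : F) : x \in unitmx -> twisted x a a c -> x *m (y *: a) *m invmx x = (y * c) *: a.
Proof. by move=> xu h; rewrite -scalemxAr h -!scalemxAl mulmxK // scalerA. Qed.

Lemma twisted_diag (d : 'rV[F]_n) a c : (forall i j, a i j != 0 -> d 0 i = c * d 0 j) ->
  twisted (diag_mx d) a a c.
Proof.
move=> h; apply/matrixP => i j; rewrite mul_diag_mx mul_mx_diag mxE [RHS]mxE [in RHS]mxE.
have [->|/h ->] := eqVneq (a i j) 0; first by rewrite mulr0 mul0r mulr0.
by rewrite -mulrA [d 0 j * _]mulrC.
Qed.

End Twisted.

Lemma commutator_scale (F : fieldType) (k d c : F) : k != 0 -> k^-1 * (d * (k * c)) = d * c.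
Proof. by move=> k0; rewrite mulrCA mulKf. Qed.

Lemma sqr_pow2_neq1 (F : numFieldType) (z : int) : 0 < z -> ((2%:R : F) ^ z) ^+ 2 != 1.
Proof.
case: z => // k; rewrite ltz_nat => k0; rewrite -exprnP -exprM.
by rewrite gt_eqF // exprn_egt1 ?ltr1n // muln_eq0 orbF -lt0n.
Qed.

(** * Algebraic subgroups containing the torus and their roots *)

Section ClosedSubgroups.
Variables (R : realType) (n : nat).
Local Notation C := R[i].
Local Notation M := 'M[C]_n.
Variables (g : M) (T : set M) (P : 'M[rat]_n) (fr : torus_frame g T P).
Let gu := fr_gu fr.
Local Notation ent := (ent g).
Local Notation rwt := (rwt g P).
Local Notation rcomp := (rcomp g P).

Lemma rcomp_ent r Z i j : eps P i - eps P j = r -> ent (rcomp r Z) i j = ent Z i j.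
Proof. by move=> <-; rewrite [ent (rcomp _ _)](unentK gu) mxE eqxx. Qed.

Lemma rcomp_entry r Z : rcomp r Z != 0 -> exists i j, eps P i - eps P j = r /\ ent Z i j != 0.
Proof.
move=> h; have [i [j ij]] := ent_neq0 gu h.
have E := rcomp_rwt fr ij; exists i, j; split=> //; by rewrite -(rcomp_ent _ E).
Qed.

Lemma lie_entry Q Z i j : algebraic_group Q -> T `<=` Q -> lie Q Z -> ent Z i j != 0 ->
  eps P i - eps P j = 0 \/ eps P i - eps P j \in rootsq g P Q.
Proof.
move=> aQ TQ hZ ij; case: (eqVneq (eps P i - eps P j) 0) => h; [by left | right].
apply/(rootsqP fr); split=> //; exists (rcomp (eps P i - eps P j) Z); split.
- exact: (rcomp_k fr _ aQ TQ).
- by apply/eqP => E; move: ij; rewrite -(rcomp_ent _ erefl) E ent0 mxE eqxx.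
- exact: (rcomp_rwt fr).
Qed.

Variables (K : set M) (pr : torus_pair T K).
Let aK := pr_aK pr.
Let sK := alg_subgroup aK.
Let TK := pr_TK pr.
Local Notation Phi := (rootsq g P K).

Let rtP Q r : r \in rootsq g P Q -> is_root g P Q r := elimT (rootsqP fr Q r).

Section Subgroup.
Variables (Q : set M) (aQ : algebraic_group Q) (TQ : T `<=` Q) (QK : Q `<=` K).
Let sQ := alg_subgroup aQ.
Let lQ := lie_linset Q.
Local Notation Psi := (rootsq g P Q).

Lemma rootsq_sub r : r \in Psi -> r \in Phi.
Proof.
by move=> /(rootsqP fr)[r0 [e [he e0 we]]]; apply/(rootsqP fr); split=> //; exists e; split=> //; apply: (lie_mono QK).
Qed.

Lemma root_lie r e : r \in Psi -> lie K e -> rwt r e -> lie Q e.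
Proof.
move=> /(rootsqP fr)[r0 [e' [he' e'0 we']]] he we.
have [c ->] := root_dim1 fr pr r0 (lie_mono QK he') he e'0 we' we.
exact: (linsetZ lQ).
Qed.

Lemma lie_sub Z : lie K Z -> (forall r, r != 0 -> rcomp r Z != 0 -> r \in Psi) -> lie Q Z.
Proof.
move=> hZ h; rewrite (rcomp_sum fr Z); apply: (linset_sum lQ) => r _.
have hr := rcomp_k fr r aK TK hZ.
have [r0|r0] := eqVneq r 0.
  by apply: (lie_mono TQ); apply: (rwt0_torus fr pr hr); rewrite r0; exact: (rcomp_rwt fr).
have [->|z0] := eqVneq (rcomp r Z) 0; first by case: lQ.
apply: (root_lie (h r r0 z0) hr); exact: (rcomp_rwt fr).
Qed.

Lemma rootsq_add a b : a \in Psi -> b \in Psi -> a + b \in Phi -> a + b \in Psi.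
Proof.
move=> ha hb /(rootsqP fr) hab; have [a0 [Y [hY Y0 wY]]] := rtP ha.
have [b0 [e [he e0 we]]] := rtP hb; apply/(rootsqP fr); split; first by case: hab.
exists (e *m Y - Y *m e); split; first exact: (lie_bracket aQ).
  exact: (root_add_neq0 fr pr (lie_mono QK hY) (lie_mono QK he) wY we).
by rewrite addrC; apply: (rwt_bracket fr).
Qed.

(** On the big cell of [L] the unipotent factors are exponentials and the middle factor lies in [T],
    so an equation of [Q] vanishes there; irreducibility extends this to [L]. *)
Lemma conn_lie_sub L : algebraic_group L -> irreducible L -> T `<=` L -> L `<=` K ->
  lie L `<=` lie Q -> L `<=` Q.
Proof.
move=> aL iL TL LK sub x Lx; have sL := alg_subgroup aL.
have [la [gla _]] := regular_ex fr; have Xla := gla.1.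
have rla : ratcochar g L (la 0) by exact: (cochars_mono TL Xla).
apply: (alg_mem aQ (sg_unit sL Lx)) => f pf fQ.
have unip mu u : Ugrp g L mu u -> Q u.
  move=> /(Ugrp_log gu aL)[Z [hZ _ Zn <-]].
  by have := lie_exp aQ 1 (sub _ hZ) Zn; rewrite scale1r.
have zero y : L y -> cell_den g (la 0) y * f y = 0.
  move=> Ly; have [->|d0] := eqVneq (cell_den g (la 0) y) 0; first exact: mul0r.
  have [hl [u [u' [hu hu' ->]]]] := cellP gu aL rla Ly d0.
  rewrite fQ ?mulr0 //; apply: (sgM sQ (sgM sQ (unip _ _ hu) _) (unip _ _ hu')).
  by apply: TQ; rewrite -(centralizer_torus fr pr gla); split; [exact: (LK _ hl.1) | exact: hl.2].
have [h|h] := iL _ _ (cell_den_poly g (la 0)) pf zero; last exact: h.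
have L1 : Lgrp g L (la 0) 1%:M by exact: (sg1 (Lgrp_subgroup gu aL (la 0))).
by have [/eqP[]] := cell_Lgrp gu aL L1; rewrite h //; exact: (sg1 sL).
Qed.

Section Solvable.
Variables (e f t : M).
Hypotheses (he : lie Q e) (hf : lie Q f) (en : e ^+ n = 0) (fn : f ^+ n = 0).
Let w := expm e *m expm (- f) *m expm e.
Variable c : C.
Hypotheses (c0 : c != 0) (c2 : c ^+ 2 != 1) (Tt : T t) (te : twisted t e e c) (tf : twisted t f f c^-1)
  (kap : C) (k0 : kap != 0).
Hypotheses (wf : twisted w f e kap) (kap' : C) (k0' : kap' != 0) (we : twisted w e f kap').

Let tu : t \in unitmx. Proof. exact: (sg_unit sQ (TQ Tt)). Qed.
Let wu : w \in unitmx.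
Proof.
have := lie_exp aQ (-1) hf fn; rewrite scaleN1r => Qf; have := lie_exp aQ 1 he en; rewrite scale1r => Qe.
exact: (sg_unit sQ (sgM sQ (sgM sQ Qe Qf) Qe)).
Qed.

(** The element [z], the commutator of [t] and [w], is a product of elements of root groups, so it
    stays in every derived subgroup. It scales [e] and [f] by the square of [c] and by its inverse,
    and commutators with [z] recover both root groups. *)
Lemma sl2_derived k x : iter k (@derived_subgroup R n) Q (expm (x *: e)) /\
  iter k (@derived_subgroup R n) Q (expm (x *: f)).
Proof.
elim: k x => [|k IH] x; first by split; apply: (lie_exp aQ).
have [sD _] := iter_derived_sg k sQ; set D := iter k _ Q in IH sD; rewrite iterS -/D.
have nX (y : C) (Z : M) : Z ^+ n = 0 -> (y *: Z) ^+ n = 0 by move=> Zn; rewrite expmxZ Zn scaler0.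
have Dw : D w.
  have [D1 _] := IH 1; have [_ D2] := IH (-1); rewrite scale1r in D1; rewrite scaleN1r in D2.
  exact: (sgM sD (sgM sD D1 D2) D1).
have conjE y Z c' : twisted t Z Z c' -> t *m expm (y *: Z) *m invmx t = expm ((y * c') *: Z).
  by move=> h; rewrite (expm_conj _ tu) (twisted_conj y tu h).
have Dtw : D (t *m w *m invmx t).
  have -> : t *m w *m invmx t = expm ((1 * c) *: e) *m expm ((-1 * c^-1) *: f) *m expm ((1 * c) *: e).
    rewrite -!(conjE _ _ _ te) -(conjE _ _ _ tf) scale1r scaleN1r /w !mulmxA.
    by rewrite !(mulmxKV tu).
  have [D1 _] := IH (1 * c); have [_ D2] := IH (-1 * c^-1).
  exact: (sgM sD (sgM sD D1 D2) D1).
pose z := t *m w *m invmx t *m invmx w.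
have Dz : D z by apply: (sgM sD Dtw); apply: (sgV sD).
have zu : z \in unitmx := sg_unit sD Dz.
have ti := twistedV tu.
have ze : twisted z e e (c ^+ 2).
  have := twistedM (twistedV wu k0 wf) (twistedM (ti _ _ _ (invr_neq0 c0) tf) (twistedM wf te)).
  by rewrite invrK (commutator_scale c c k0).
have zf : twisted z f f (c^-1 ^+ 2).
  have := twistedM (twistedV wu k0' we) (twistedM (ti _ _ _ c0 te) (twistedM we tf)).
  by rewrite (commutator_scale c^-1 c^-1 k0').
have comm Z d y : twisted z Z Z d -> Z ^+ n = 0 -> (forall y, D (expm (y *: Z))) -> d != 1 ->
    derived_subgroup D (expm (y *: Z)).
  move=> zZ Zn DZ d1; pose u : C := y / (d - 1).
  have := derived_comm Dz (DZ u); rewrite (expm_conj _ zu) (expm_inv (nX _ _ Zn)).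
  have -> : z *m (u *: Z) *m invmx z = (u * d) *: Z.
    exact: (twisted_conj u zu zZ).
  have -> : u * d = y + u by apply/eqP; rewrite -subr_eq -{2}[u]mulr1 -mulrBr /u mulfVK // subr_eq0.
  by rewrite -scaleNr -(expmZD _ _ Zn) addrK.
have c2' : c^-1 ^+ 2 != 1 by rewrite exprVn invr_eq1.
split; first exact: (comm _ _ _ ze en (fun y => (IH y).1) c2).
exact: (comm _ _ _ zf fn (fun y => (IH y).2) c2').
Qed.

End Solvable.

(** A pair of opposite roots would give root groups that survive in every derived subgroup, by
    [sl2_derived]. *)
Lemma solvable_unpaired a : solvable_group Q -> a \in Psi -> - a \notin Psi.
Proof.
move=> [k hk] ha; apply/negP => hNa; have ra := rtP (rootsq_sub ha); have Xa := is_rootX fr ra.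
have [e [f [he hf we wf [e0 f0 nw hw]]]] := root_reflection fr pr ra.
have a0 : a != 0 by case: ra. have Na0 : - a != 0 by rewrite oppr_eq0.
have en := rwt_nilpotent fr we a0; have fn := rwt_nilpotent fr wf Na0.
have he' := root_lie ha he we; have hf' := root_lie hNa hf wf.
set w := expm e *m _ *m _ in nw hw; have wu : w \in unitmx := sg_unit sK nw.1.
have twist b Y b' Y' : is_root g P K b -> lie K Y -> rwt b Y -> lie K Y' -> Y' != 0 -> b' != 0 -> rwt b' Y' -> act g w b = b' ->
    Y != 0 -> exists2 q, q != 0 & twisted w Y Y' q.
  move=> rb hY wY hY' Y'0 b'0 wY' E Y0.
  have wJ := rwt_act fr pr nw (is_rootX fr rb) wY; rewrite E in wJ.
  have [q qE] := root_dim1 fr pr b'0 hY' (lie_Ad aK nw.1 hY) Y'0 wY' wJ.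
  have qE' : w *m Y = q *: (Y' *m w) by rewrite scalemxAl -qE mulmxKV.
  exists q => //; apply: contraNneq Y0 => q0; rewrite -[Y](mulKmx wu) qE' q0 scale0r mulmx0 //.
have [|kap' k0' hwe] := twist a e (- a) f ra he we hf f0 Na0 wf _ e0.
  by rewrite hw // refl_a.
have [|kap k0 hwf] := twist (- a) f a e (root_opp fr pr ra) hf wf he e0 a0 we _ f0.
  by rewrite hw; [rewrite reflN refl_a // opprK | apply: (linsetN (X_lin fr))].
have [m [N N0 hm] hT] := Xa.
have two0 : (2%:R : C) != 0 by rewrite pnatr_eq0.
have [i0 [j0 eij]] := ent_neq0 gu e0.
(* The weight of [e] under the integral multiple [m] of [a]. It equals [N] times the square of [a],
   hence is positive, so the square of [2 ^ z] is not 1. *)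
pose z := m i0 - m j0.
have zE : z%:~R = N%:R * dot a a :> rat.
  by rewrite rmorphB /= !hm -mulrBr; congr (_ * _); apply: (rwt_haswt fr Xa we).
have z0 : 0 < z by rewrite -(ltr0z rat) zE mulr_gt0 ?ltr0n ?dot_gt0.
have mE i j q : dot a q = a 0 i - a 0 j -> (m i - m j)%:~R = N%:R * dot a q :> rat.
  by move=> ->; rewrite rmorphB /= !hm -mulrBr.
have tw Y q : (forall i j, ent Y i j != 0 -> m i = q + m j) -> twisted (cochar g m 2%:R) Y Y (2%:R ^ q).
  move=> h; apply: (ent_inj gu); rewrite (entM gu) entZ (entM gu) (ent_cochar gu).
  apply: twisted_diag => i j /h; rewrite !mxE => ->; exact: expfzDr.
have te : twisted (cochar g m 2%:R) e e (2%:R ^ z).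
  apply: tw => i j /(rwt_haswt fr Xa we)/esym/(mE i j a); rewrite -zE => /intr_inj <-; by rewrite subrK.
have tf : twisted (cochar g m 2%:R) f f (2%:R ^ z)^-1.
  rewrite invr_expz; apply: tw => i j /(rwt_haswt fr Xa wf)/esym/(mE i j (- a)).
  rewrite dotNr mulrN -zE -rmorphN /= => /intr_inj <-; by rewrite subrK.
have := sl2_derived he' hf' en fn (expfz_neq0 _ two0) (sqr_pow2_neq1 C z0) (hT _ two0) te tf k0 hwf k0' hwe k.
rewrite hk => h; move/eqP: e0; apply; apply: (expm_id en) => x; exact: (h x).1.
Qed.

End Subgroup.
End ClosedSubgroups.

Lemma wltB (F : numFieldType) n (la : 'I_n -> rat) (A B : 'M[F]_n) : wlt la A -> wlt la B -> wlt la (A - B).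
Proof. by move=> hA hB; rewrite -scaleN1r; apply: wltD => //; apply: wltZ. Qed.

(** In each column, a nonzero entry in a row of least weight receives no contribution from [N], so
    that row has the weight of the column. *)
Lemma intertwine_wle (F : numFieldType) n (la : 'I_n -> rat) (A N : 'M[F]_n) : wlt la N ->
  A *m wmx F la = (wmx F la + N) *m A -> wle la A.
Proof.
move=> hN E i j ij.
case: (@Order.TotalTheory.arg_minP _ _ _ i (fun k => A k j != 0) la ij) => k kj kmin.
suff <- : la k = la j by apply: kmin.
have := congr1 (fun B : 'M_n => B k j) E.
rewrite /= mulmxDl mul_mx_diag mul_diag_mx mxE [RHS]mxE [in X in _ = X + _]mxE [X in _ = _ + X]mxE.
rewrite big1 ?addr0 => [|l _]; last first.
  have [->|Nkl] := eqVneq (N k l) 0; first exact: mul0r.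
  have [->|lj] := eqVneq (A l j) 0; first exact: mulr0.
  by have := hN _ _ Nkl; rewrite ltNge kmin.
by rewrite !mxE mulrC => /(mulIf kj)/fmorph_inj.
Qed.

Lemma trace_bracket (F : fieldType) n (Y e f : 'M[F]_n) :
  \tr ((Y *m e - e *m Y) *m f) = \tr (Y *m (e *m f - f *m e)).
Proof. by rewrite mulmxBl mulmxBr !mxtraceB !mulmxA -(mulmxA e Y f) (mxtrace_mulC e). Qed.

Section TraceInvariance.
Variables (F : fieldType) (n : nat) (I : Type) (s : seq I) (e f : I -> 'M[F]_n) (u : set 'M[F]_n).
Hypothesis expand : forall Z, u Z -> Z = \sum_(r <- s) \tr (Z *m f r) *: e r.
Variables (x Y : 'M[F]_n).
Hypotheses (xu : x \in unitmx) (ue : forall r, u (e r)) (uJ : forall Z, u Z -> u (x *m Z *m invmx x))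
  (uV : forall Z, u Z -> u (invmx x *m Z *m x)) (uY : forall Z, u Z -> u (Y *m Z - Z *m Y)).

(** For dual families [e] and [f] on [u] both sums are traces on [u], of the brackets with
    [x Y x^-1] and with [Y]. The equality is invariance of the trace under the change of basis by
    [x]. *)
Lemma trace_conj : \sum_(r <- s) \tr ((x *m Y *m invmx x *m e r - e r *m (x *m Y *m invmx x)) *m f r)
  = \sum_(r <- s) \tr ((Y *m e r - e r *m Y) *m f r).
Proof.
pose e' r := invmx x *m e r *m x; pose f' r := invmx x *m f r *m x.
have trJ (Z W : 'M[F]_n) : \tr (Z *m (invmx x *m W *m x)) = \tr (x *m Z *m invmx x *m W).
  by rewrite mulmxA mxtrace_mulC !mulmxA.
have E r : \tr ((x *m Y *m invmx x *m e r - e r *m (x *m Y *m invmx x)) *m f r) =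
    \sum_(t <- s) \tr (e' r *m f t) * \tr ((Y *m e t - e t *m Y) *m f' r).
  have -> : (x *m Y *m invmx x *m e r - e r *m (x *m Y *m invmx x)) = x *m (Y *m e' r - e' r *m Y) *m invmx x.
    by rewrite mulmxBr mulmxBl /e' !mulmxA mulmxV // mul1mx -!mulmxA mulmxV // mulmx1.
  have eE : e' r = \sum_(t <- s) \tr (e' r *m f t) *: e t := expand (uV (ue r)).
  rewrite -trJ -/(f' r); rewrite {1 2}eE.
  rewrite mulmx_sumr mulmx_suml -sumrB mulmx_suml raddf_sum /=; apply: eq_bigr => t _.
  by rewrite -scalemxAr -scalemxAl -scalerBr -scalemxAl mxtraceZ.
rewrite (eq_bigr _ (fun r _ => E r)) exchange_big /=; apply: eq_bigr => t _.
set Z := Y *m e t - e t *m Y; have uZ : u Z by apply: uY.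
have EZ : Z = \sum_(r <- s) \tr (Z *m f' r) *: e' r.
  have h := expand (uJ uZ).
  have -> : Z = invmx x *m (x *m Z *m invmx x) *m x by rewrite !mulmxA mulVmx // mul1mx mulmxKV.
  rewrite {1}h mulmx_sumr mulmx_suml; apply: eq_bigr => r _.
  rewrite -scalemxAr -scalemxAl; congr (_ *: _).
  by rewrite /f' trJ !mulmxA mulmxV // mul1mx -!mulmxA mulKmx // mulmxA.
rewrite [in RHS]EZ mulmx_suml raddf_sum /=; apply: eq_bigr => r _.
by rewrite -scalemxAl mxtraceZ mulrC.
Qed.

End TraceInvariance.

Lemma comm_shift (F : fieldType) n (x y : 'M[F]_n) :
  x *m y - y *m x = (x - 1%:M) *m (y - 1%:M) - (y - 1%:M) *m (x - 1%:M).
Proof.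
rewrite !(mulmxBl, mulmxBr) !mul1mx !mulmx1; move: (x *m y) (y *m x) => a b.
by apply/matrixP => i j; rewrite !mxE; ring.
Qed.

Lemma comm_split (F : fieldType) n (x y t s : 'M[F]_n) : t *m s = s *m t ->
  x *m y - y *m x = ((x - t) *m y + t *m (y - s)) - ((y - s) *m x + s *m (x - t)).
Proof.
rewrite !(mulmxBl, mulmxBr) => ->; move: (x *m y) (y *m x) (t *m y) (s *m t) (s *m x) => a b c d e.
by apply/matrixP => i j; rewrite !mxE; ring.
Qed.

(** * Depth of triangular matrices and solvability *)

Section Filtration.
Variables (R : realType) (n : nat).
Local Notation C := R[i].
Local Notation M := 'M[C]_n.
Variables (g : M) (gu : g \in unitmx) (la : 'I_n -> rat).
Local Notation ent := (ent g).

(** Counting the smaller weights replaces rational weights by naturals bounded by [n], so that depth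
    can be measured in unit steps. *)
Definition rk i := #|[pred j | la j < la i]|.

Lemma rk_le i j : la j <= la i -> (rk j <= rk i)%N.
Proof. by move=> h; apply: subset_leq_card; apply/fintype.subsetP => k; rewrite !inE => /lt_le_trans; apply. Qed.

Lemma rk_lt i j : la j < la i -> (rk j < rk i)%N.
Proof.
move=> h; apply: proper_card; apply/properP; split.
  by apply/fintype.subsetP => k; rewrite !inE => /lt_trans; apply.
by exists j; rewrite !inE ?h // ltxx.
Qed.

Definition deep k (Z : M) := forall i j, ent Z i j != 0 -> (rk j + k <= rk i)%N.

Lemma deepM k l Y Z : deep k Y -> deep l Z -> deep (k + l) (Y *m Z).
Proof.
move=> hY hZ i j; rewrite (entM gu) => /mulmx_neq0[m [/hY h1 /hZ h2]].
by apply: leq_trans h1; rewrite [(k + l)%N]addnC addnA leq_add2r.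
Qed.

Lemma deepD k Y Z : deep k Y -> deep k Z -> deep k (Y + Z).
Proof. by move=> hY hZ i j; rewrite entD => /addmx_neq0[/hY|/hZ]. Qed.

Lemma deepB k Y Z : deep k Y -> deep k Z -> deep k (Y - Z).
Proof.
move=> hY hZ; apply: deepD => // i j; rewrite -scaleN1r entZ mxE => h; apply: hZ.
by apply: contraNneq h => ->; rewrite mulr0.
Qed.

Lemma deep_le k l Z : (l <= k)%N -> deep k Z -> deep l Z.
Proof. by move=> lk h i j /h; apply: leq_trans; rewrite leq_add2l. Qed.

Lemma deep_wle Z : wle la (ent Z) -> deep 0 Z.
Proof. by move=> h i j /h; rewrite addn0; apply: rk_le. Qed.

Lemma deep_wlt Z : wlt la (ent Z) -> deep 1 Z.
Proof. by move=> h i j /h; rewrite addn1; apply: rk_lt. Qed.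

Lemma deep_eq0 Z : deep n.+1 Z -> Z = 0.
Proof.
move=> h; apply: (ent_inj gu); rewrite ent0; apply/matrixP => i j; rewrite [RHS]mxE.
apply: contrapT => /eqP/h; rewrite leqNgt; case/negP; rewrite addnS ltnS.
by apply: leq_trans (max_card _) _; rewrite card_ord leq_addl.
Qed.

Variables (K : set M) (aK : algebraic_group K).
Local Notation U := (Ugrp g K la).
Let sU := Ugrp_subgroup gu aK la.

Definition deep_group k : set M := [set x | U x /\ deep k (x - 1%:M)].

Lemma U_deep x : U x -> deep 0 x.
Proof. by move=> [_ h]; apply/deep_wle/(wlt_unip_wle gu). Qed.

Lemma deep_group_subgroup k : subgroup (deep_group k).
Proof.
split.
- by move=> x [/(sg_unit sU)].
- split; first exact: (sg1 sU).
  by rewrite subrr => i j; rewrite ent0 mxE eqxx.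
- move=> x y [Ux dx] [Uy dy]; split; first exact: (sgM sU).
  have -> : x *m y - 1%:M = (x - 1%:M) *m y + (y - 1%:M) by rewrite mulmxBl mul1mx addrA subrK.
  by apply: (deepD _ dy); rewrite -[k]addn0; apply: (deepM dx (U_deep Uy)).
move=> x [Ux dx]; have Uv := sgV sU Ux; split; first exact: Uv.
have -> : invmx x - 1%:M = 0 - (x - 1%:M) *m invmx x.
  by rewrite mulmxBl mul1mx mulmxV ?(sg_unit sU Ux) // opprB add0r.
apply: deepB; first by move=> i j; rewrite ent0 mxE eqxx.
by rewrite -[k]addn0; apply: (deepM dx (U_deep Uv)).
Qed.

Lemma comm_sub1 (x y : M) : x \in unitmx -> y \in unitmx ->
  x *m y *m invmx x *m invmx y - 1%:M = (x *m y - y *m x) *m invmx x *m invmx y.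
Proof. by move=> xu yu; rewrite !mulmxBl mulmxK // mulmxV. Qed.

Lemma deep_comm k x y : (0 < k)%N -> deep_group k x -> deep_group k y ->
  deep_group k.+1 (x *m y *m invmx x *m invmx y).
Proof.
move=> k0 [Ux dx] [Uy dy]; have Uxi := sgV sU Ux; have Uyi := sgV sU Uy; split.
  by apply: (sgM sU _ Uyi); apply: (sgJ sU).
rewrite (comm_sub1 (sg_unit sU Ux) (sg_unit sU Uy)) -[k.+1]addn0; apply: deepM (U_deep Uyi).
rewrite -[k.+1]addn0; apply: deepM (U_deep Uxi).
rewrite comm_shift.
have kk : (k.+1 <= k + k)%N by rewrite -addn1 leq_add2l.
by apply: deepB; apply: (deep_le kk); [apply: (deepM dx dy) | apply: (deepM dy dx)].
Qed.

(** From the first derived subgroup on, each commutator gains one step of depth, and depth above [n]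
    forces the identity. *)
Lemma solvable_Pgrp : subgroup (Pgrp g K la) ->
  (forall x y, Pgrp g K la x -> Pgrp g K la y -> U (x *m y *m invmx x *m invmx y)) ->
  solvable_group (Pgrp g K la).
Proof.
move=> sP hP; exists n.+1; have [sD _] := iter_derived_sg n.+1 sP.
have sub k : iter k.+1 (@derived_subgroup R n) (Pgrp g K la) `<=` deep_group k.+1.
  elim: k => [|k IH]; apply: derived_sub; try exact: deep_group_subgroup.
    move=> x y Px Py; have h := hP x y Px Py; split; first exact: h.
    by apply: deep_wlt; case: h.
  by move=> x y /IH dx /IH dy; apply: deep_comm.
apply/seteqP; split=> [x /sub[_ /deep_eq0/eqP]|x ->]; last exact: (sg1 sD).
by rewrite subr_eq0 => /eqP.
Qed.

End Filtration.

(** * Borel and parabolic subgroups as groups of a cocharacter *)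

Section Structure.
Variables (R : realType) (n : nat).
Local Notation C := R[i].
Local Notation M := 'M[C]_n.
Variables (g : M) (T : set M) (P : 'M[rat]_n) (fr : torus_frame g T P).
Let gu := fr_gu fr.
Let aT := fr_aT fr.
Local Notation ent := (ent g).
Local Notation X := (cochars g T).
Variables (K : set M) (pr : torus_pair T K).
Let aK := pr_aK pr.
Let sK := alg_subgroup aK.
Let TK := pr_TK pr.
Local Notation rwt := (rwt g P).
Local Notation rcomp := (rcomp g P).
Let lK := lie_linset K.
Let rtP Q r : r \in rootsq g P Q -> is_root g P Q r := elimT (rootsqP fr Q r).
Local Notation Phi := (rootsq g P K).

Lemma torus_comm t s : T t -> T s -> t *m s = s *m t.
Proof.
move=> Tt Ts; have [la gla] := regular_ex fr.
apply: (torus_commute gu aT (fr_cT fr) (fr_dT fr) gla.1 _ Tt); exact: (@torus_weq _ _ g T (fr_dT fr) (la 0) s Ts).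
Qed.

Lemma torus_sub_Pgrp v : T `<=` Pgrp g K v.
Proof.
move=> t Tt; split; first exact: TK.
exact/weq_wle/(@torus_weq _ _ g T (fr_dT fr) v t Tt).
Qed.

Lemma Pgrp_irreducible v : X v -> irreducible (Pgrp g K (v 0)).
Proof.
move=> Xv; have rv := X_ratcochar pr Xv.
have -> : Pgrp g K (v 0) = mulset (Lgrp g K (v 0)) (Ugrp g K (v 0)).
  apply/seteqP; split=> [b hb|_ [l hl [u hu <-]]].
    have [u hu E] := levi_decomp gu aK rv hb; exists (levi_proj g (v 0) b); first exact: (levi_part gu aK rv hb).
    by exists u.
  apply: (sgM (Pgrp_subgroup gu aK (v 0))).
    by case: hl => h1 h2; split=> //; apply: weq_wle.
  by case: hu => h1 h2; split; [exact: h1 | apply: (wlt_unip_wle gu)].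
apply: irreducible_mulset; last exact: (Ugrp_irreducible gu aK).
exact: (Lgrp_irreducible gu aK (pair_irreducible fr pr) rv).
Qed.

Lemma lie_Pgrp_wlt v Z : lie K Z -> wlt v (ent Z) -> lie (Pgrp g K v) Z.
Proof.
move=> hZ wZ; apply: unipotent_lie; first exact: (ent_expm_wlt gu wZ).
move=> c; have hc : Ugrp g K v (expm (c *: Z)).
  by apply: (Ugrp_exp gu aK); [apply: (linsetZ (lie_linset K)) | rewrite entZ; apply: wltZ].
by case: hc => h1 h2; split; [exact: h1 | apply: (wlt_unip_wle gu)].
Qed.

(** For a regular [v] the Levi part is [T], which is commutative, so commutators have only positive
    weights apart from the identity. *)
Lemma regular_Pgrp_solvable v : X v -> (forall r, r \in Phi -> dot v r != 0) ->
  connected_solvable (Pgrp g K (v 0)).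
Proof.
move=> Xv vreg; have rv := X_ratcochar pr Xv; have sP := Pgrp_subgroup gu aK (v 0).
split; [exact: (Pgrp_algebraic gu aK) | exact/irreducible_connected/Pgrp_irreducible|].
apply: (solvable_Pgrp gu aK sP) => x y Px Py.
have LT : Lgrp g K (v 0) = T.
  by apply: (centralizer_regular fr pr Xv) => r /(introT (rootsqP fr K r)); apply: vreg.
have split_ z : Pgrp g K (v 0) z -> exists2 t, T t & wlt (v 0) (ent (z - t)).
  move=> hz; exists (levi_proj g (v 0) z); first by rewrite -LT; apply: (levi_part gu aK rv hz).
  by rewrite entB /levi_proj (unentK gu); apply: wdiag_wlt; case: hz.
have [t Tt wx] := split_ x Px; have [s Ts wy] := split_ y Py.
have wT z : T z -> wle (v 0) (ent z) by move=> Tz; exact: (@torus_sub_Pgrp (v 0) z Tz).2.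
have cts := torus_comm Tt Ts.
have [Kx wlx] := Px; have [Ky wly] := Py; have [Kxi wxi] := sgV sP Px; have [Kyi wyi] := sgV sP Py.
split; first by apply: (sgM sK _ Kyi); apply: (sgJ sK).
rewrite /= (comm_sub1 (sg_unit sK Kx) (sg_unit sK Ky)) (entM gu) (entM gu); apply: (wltMl _ wyi); apply: (wltMl _ wxi).
rewrite (comm_split _ _ cts) entB entD entD (entM gu) (entM gu) (entM gu) (entM gu).
by apply: wltB; apply: wltD; [exact: (wltMl wx wly) | exact: (wltMr (wT _ Tt) wy) | exact: (wltMl wy wlx) | exact: (wltMr (wT _ Ts) wx)].
Qed.

Let rcw r Z : rwt r (rcomp r Z).
Proof. exact: (rcomp_rwt fr). Qed.
Arguments rcw : clear implicits.

Definition root_weight Q := closed_weight Phi (fun r => r \in rootsq g P Q).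

Lemma root_weight_X Q : X (root_weight Q).
Proof.
rewrite /root_weight /closed_weight big_seq_cond; apply: (linset_sum (X_lin fr)) => b /andP[hb _].
exact: (rootsqX fr hb).
Qed.

Section Closed.
Variables (Q : set M) (aQ : algebraic_group Q) (TQ : T `<=` Q) (QK : Q `<=` K).
Local Notation Psi := (rootsq g P Q).
Let sQ := alg_subgroup aQ.

Lemma root_weight_ge r : r \in Psi -> (- r \notin Psi)%:R * dot r r <= dot (root_weight Q) r.
Proof.
move=> hr.
have := closed_weight_ge (rootsq_uniq g P K) (rootsq0 fr (K := K)) (rootsqN fr pr) (rootsq_dbl fr pr)
  (rootsq_str fr pr) (rootsq_refl fr pr)
  (fun a b ha hb => root_integral fr pr (rtP ha) (rtP hb)) (Psi := fun r => r \in Psi)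
  (rootsq_sub fr QK) (rootsq_add fr pr aQ QK) hr.
by rewrite /unpaired hr.
Qed.

Lemma root_weight_gt r : r \in Psi -> - r \notin Psi -> 0 < dot (root_weight Q) r.
Proof.
move=> hr nr; apply: lt_le_trans (root_weight_ge hr).
by rewrite nr mul1r dot_gt0 // (rootsq0 fr hr).
Qed.

Lemma root_weight_ge0 r : r \in Psi -> 0 <= dot (root_weight Q) r.
Proof. by move=> hr; apply: le_trans (root_weight_ge hr); rewrite mulr_ge0 ?ler0n ?dot_ge0. Qed.

Hypothesis total : forall r, r \in Phi -> r \in Psi \/ - r \in Psi.

Let lam := root_weight Q.
(** The orthogonal of the Lie algebra of [Q]; it is spanned by the root spaces of the unpaired roots
    and plays the role of the nilradical. *)
Let q_perp : set M := [set Z | lie K Z /\ forall Y, lie Q Y -> \tr (Z *m Y) = 0].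
Let s := [seq r <- Phi | unpaired (fun r => r \in Psi) r].

Lemma mem_psi_dot r : r \in Phi -> (r \in Psi) = (0 <= dot lam r).
Proof.
move=> hr; apply/idP/idP => [|h]; first exact: root_weight_ge0.
have [//|hN] := total hr; apply: contraT => nr; have := root_weight_gt hN; rewrite opprK => /(_ nr).
by rewrite dotNr oppr_gt0 ltNge h.
Qed.

Lemma perp_comp Z r : q_perp Z -> rcomp r Z != 0 -> r \in s.
Proof.
move=> [hZ hp] c0; have hc := rcomp_k fr r aK TK hZ.
have [f [hf wf tf]] := dual_vector fr pr hc c0 (rcw _ _).
suff nQ : ~ lie Q f.
  have r0 : r != 0.
    apply: contra_notN nQ => /eqP r0; apply: (lie_mono TQ); apply: (rwt0_torus fr pr hf).
    by move: wf; rewrite r0 oppr0.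
  have hr : r \in Phi := rootsq_nz fr hc (rcw _ _) c0 r0.
  have nr : - r \notin Psi by apply: contra_notN nQ => h; apply: (root_lie fr pr QK h hf wf).
  by rewrite mem_filter hr andbT /unpaired nr andbT; have [//|h] := total hr; rewrite h in nr.
move=> hQ; have := hp f hQ; rewrite mxtrace_mulC (tr_rcomp fr Z wf) opprK mxtrace_mulC tf => /eqP.
by rewrite oner_eq0.
Qed.

Lemma perp_wlt Z : q_perp Z -> wlt (lam 0) (ent Z).
Proof.
move=> hZ i j ij.
have c0 : rcomp (eps P i - eps P j) Z != 0.
  by apply/eqP => E; move: ij; rewrite -(rcomp_ent fr Z erefl) E ent0 mxE eqxx.
have := perp_comp hZ c0; rewrite mem_filter => /andP[/andP[h1 h2] _].
by have := root_weight_gt h1 h2; rewrite (dot_epsB fr _ _ (root_weight_X Q)) subr_gt0.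
Qed.

Lemma perp_conj x Z : Q x -> q_perp Z -> q_perp (x *m Z *m invmx x).
Proof.
move=> Qx [hZ hp]; split; first exact: (lie_Ad aK (QK Qx)).
move=> Y hY; have xu := sg_unit sQ Qx.
have -> : \tr (x *m Z *m invmx x *m Y) = \tr (Z *m (invmx x *m Y *m x)).
  by rewrite -(mulmxA _ (invmx x)) -(mulmxA x) mxtrace_mulC -!mulmxA.
by apply: hp; have := lie_Ad aQ (sgV sQ Qx) hY; rewrite invmxK.
Qed.

(** The trace of the bracket with [Y] on [q_perp] is the trace of [Y] against [qdiag g lam], and it
    is invariant under conjugation by [Q]. Hence the conjugate of [qdiag g lam] by an element [x] of
    [Q] differs from it by an element of [q_perp], which has positive weights only, and
    [intertwine_wle] makes [x] triangular. This treats all components of [Q] at once. *)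
Lemma parabolic_sub_Pgrp : Q `<=` Pgrp g K (lam 0).
Proof.
have /choice[ef efP] : forall r : 'rV[rat]_n, exists ef : M * M, r \in Phi ->
    [/\ lie K ef.1, lie K ef.2, rwt r ef.1, rwt (- r) ef.2 & \tr (ef.1 *m ef.2) = 1].
  move=> r.
  have [hr|hr] := boolP (r \in Phi); last by exists (0, 0).
  have [_ [e [he e0 we]]] := rtP hr; have [f [hf wf tf]] := dual_vector fr pr he e0 we.
  by exists (e, f).
pose e r := if r \in s then (ef r).1 else 0; pose f r := (ef r).2.
have sPhi r : r \in s -> r \in Phi by rewrite mem_filter => /andP[].
have expand Z : q_perp Z -> Z = \sum_(r <- s) \tr (Z *m f r) *: e r.
  move=> hZ; have E r : rcomp r Z = if r \in s then \tr (Z *m f r) *: e r else 0.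
    case: ifP => hr; last by apply/eqP; apply: contraFT hr; apply: perp_comp.
    have [he hf we wf tf] := efP r (sPhi r hr); have r0 := rootsq0 fr (sPhi r hr).
    have e0 : (ef r).1 != 0 by apply/eqP => E; move: tf; rewrite E mul0mx mxtrace0 => /esym/eqP; rewrite oner_eq0.
    have [c cE] := root_dim1 fr pr r0 he (rcomp_k fr r aK TK hZ.1) e0 we (rcw _ _).
    by rewrite /e hr mxtrace_mulC (tr_rcomp fr Z wf) opprK cE -scalemxAr mxtraceZ mxtrace_mulC tf mulr1.
  rewrite {1}(rcomp_sum fr Z) (eq_bigr _ (fun r _ => E r)) -big_mkcond /= -big_filter.
  apply: perm_big; apply: uniq_perm; [exact/filter_uniq/undup_uniq | exact/filter_uniq/rootsq_uniq|].
  move=> r; rewrite mem_filter andb_idr // => /sPhi; by rewrite mem_filter => /andP[].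
have ue r : q_perp (e r).
  rewrite /e; case: ifP => hr; last by split=> [|Y _]; [case: lK | rewrite mul0mx mxtrace0].
  have [he _ we _ _] := efP r (sPhi r hr); split=> // Y hY.
  rewrite (tr_rcomp fr Y we).
  have [->|c0] := eqVneq (rcomp (- r) Y) 0; first by rewrite mulmx0 mxtrace0.
  have Nr0 : - r != 0 by rewrite oppr_eq0 (rootsq0 fr (sPhi r hr)).
  have := rootsq_nz fr (rcomp_k fr (- r) aQ TQ hY) (rcw _ _) c0 Nr0.
  by move: hr; rewrite mem_filter => /andP[/andP[_ /negP]].
have phiE Y : \sum_(r <- s) \tr ((Y *m e r - e r *m Y) *m f r) = \tr (Y *m qdiag g lam).
  have -> : qdiag g lam = \sum_(r <- s) qdiag g r.
    by rewrite -(qdiag_sum g s); congr (qdiag g _); rewrite big_filter.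
  rewrite mulmx_sumr raddf_sum /=.
  apply: eq_big_seq => r hr; have [he hf we wf tf] := efP r (sPhi r hr).
  have Xr := rootsqX fr (sPhi r hr).
  have := root_bracket fr pr Xr he hf we wf; rewrite tf scale1r => <-.
  by rewrite /e hr trace_bracket.
have uY Y Z : lie Q Y -> q_perp Z -> q_perp (Y *m Z - Z *m Y).
  move=> hY [hZ hp]; split; first exact: (lie_bracket aK (lie_mono QK hY) hZ).
  move=> Y' hY'; rewrite -[Y *m Z - _]opprB mulNmx raddfN /= tr_shuffle opprK; apply: hp; exact: (lie_bracket aQ).
move=> x Qx; split; first exact: QK.
have xu := sg_unit sQ Qx; have Qv := sgV sQ Qx; have Xl := root_weight_X Q.
pose W := x *m qdiag g lam *m invmx x - qdiag g lam.
have hL := X_k fr pr Xl.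
have hW : q_perp W.
  split; first exact: (linsetB lK (lie_Ad aK (QK Qx) hL) hL).
  move=> Y hY; rewrite mulmxBl mxtraceB.
  have h : \tr (invmx x *m Y *m x *m qdiag g lam) = \tr (Y *m qdiag g lam).
    rewrite -!phiE; have := @trace_conj _ _ _ s e f q_perp expand (invmx x) Y; rewrite unitmx_inv invmxK.
    apply=> // [Z /(perp_conj Qv)|Z /(perp_conj Qx)|Z]; rewrite ?invmxK //.
    exact: uY.
  have -> : \tr (x *m qdiag g lam *m invmx x *m Y) = \tr (invmx x *m Y *m x *m qdiag g lam).
    by rewrite -mulmxA mxtrace_mulC !mulmxA.
  by rewrite h [\tr (qdiag g lam *m Y)]mxtrace_mulC subrr.
apply: (intertwine_wle (perp_wlt hW)).
rewrite -(ent_qdiag _ gu) -entD -(entM gu) -(entM gu) /W addrC subrK mulmxKV //.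
Qed.

Lemma parabolic_Pgrp : Q = Pgrp g K (lam 0).
Proof.
apply/seteqP; split; first exact: parabolic_sub_Pgrp.
have Xl := root_weight_X Q.
apply: (conn_lie_sub fr pr aQ TQ) => [| | |x []//|Z hZ].
- exact: (Pgrp_algebraic gu aK).
- exact: (Pgrp_irreducible Xl).
- exact: torus_sub_Pgrp.
have hK : lie K Z by apply: lie_mono hZ => x [].
apply: (lie_sub fr pr TQ QK hK) => r r0 c0.
have hr := rootsq_nz fr (rcomp_k fr r aK TK hK) (rcw _ _) c0 r0.
rewrite (mem_psi_dot hr); have [i [j [<- ij]]] := rcomp_entry fr c0.
by rewrite (dot_epsB fr _ _ Xl) subr_ge0; apply: (lie_Pgrp gu hZ).
Qed.

End Closed.

(** Solvability excludes opposite pairs, so [root_weight B] is positive on the roots of [B], and a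
    perturbation [la] of it is also regular. The group of [la] in [K] is connected solvable and
    contains [B]; maximality of [B] gives equality. *)
Lemma borel_structure B : borel_subgroup K B -> T `<=` B -> exists la,
  [/\ X la, forall r, r \in Phi -> dot la r != 0,
      forall r, r \in Phi -> (r \in rootsq g P B) = (0 < dot la r) & B = Pgrp g K (la 0)].
Proof.
move=> [[aB cB solB] BK maxB] TB.
have nB r : r \in rootsq g P B -> - r \notin rootsq g P B := solvable_unpaired fr pr aB TB BK solB.
have [|la [gla _] hla] := regular_exists fr (s := Phi) (root_weight_X B).
  by move=> r; apply: (rootsqX fr).
have Xl := gla.1.
have pos r : r \in rootsq g P B -> 0 < dot la r.
  move=> hr; apply: (hla r (rootsq_sub fr BK hr)).1.
  exact: (root_weight_gt aB BK hr (nB r hr)).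
have reg r : r \in Phi -> dot la r != 0.
  by move=> hr; apply: contra (rootsq0 fr hr) => /eqP /(hla r hr).2 ->.
have rB : ratcochar g B (la 0) by exact: (cochars_mono TB Xl).
have EB : Pgrp g B (la 0) = B.
  apply: (conn_Pgrp gu aB cB rB) => Z hZ wZ; apply: (ent_inj gu); rewrite ent0.
  apply/matrixP => i j; rewrite [RHS]mxE; apply: contrapT => /eqP ij.
  have := wZ i j ij; rewrite /negw ltrN2 -subr_lt0 -(dot_epsB fr _ _ Xl).
  by have [->|/pos/ltW h] := lie_entry fr aB TB hZ ij; [rewrite dotC dot0l ltxx | rewrite ltNge h].
have BP : B `<=` Pgrp g K (la 0) by rewrite -EB => x [Bx wx]; split=> //; apply: BK.
have EP := maxB _ (regular_Pgrp_solvable Xl reg) (fun x h => h.1) BP.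
exists la; split=> // r hr; apply/idP/idP => [|h]; first exact: pos.
have [r0 [e [he e0 we]]] := rtP hr.
apply: (rootsq_nz fr _ we e0 r0); rewrite -EP; apply: (lie_Pgrp_wlt he) => i j ij.
by rewrite -subr_gt0 -(dot_epsB fr _ _ Xl) (we _ _ ij).
Qed.

End Structure.

(** * Lie algebras of unipotent groups *)

Section UnipotentLie.
Variables (R : realType) (n : nat).
Local Notation C := R[i].
Local Notation M := 'M[C]_n.

Lemma unipotent_diag (F : fieldType) m (d : 'rV[F]_m) k j : (diag_mx d - 1%:M) ^+ k = 0 -> d 0 j = 1.
Proof.
move=> h; have E (l : nat) : delta_mx 0 j *m (diag_mx d - 1%:M) ^+ l = (d 0 j - 1) ^+ l *: delta_mx 0 j :> 'rV_m.
  elim: l => [|l IH]; first by rewrite !expr0 scale1r mulmx1.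
  rewrite exprSr mulmxA IH -scalemxAl exprSr -scalerA; congr (_ *: _).
  rewrite mulmxBr mulmx1 mul_mx_diag; apply/rowP => i; rewrite !mxE eqxx /=.
  by case: (i =P j) => [->|_]; rewrite ?mul1r ?mulr1 // mul0r mulr0 subrr.
have := congr1 (fun B : 'rV_m => B 0 j) (E k); rewrite h mulmx0 !mxE !eqxx mulr1.
by move=> /esym/eqP; rewrite expf_eq0 subr_eq0 => /andP[_ /eqP].
Qed.

(** A cocharacter with unipotent values is trivial, so [replica_trace0] makes the semisimple part of
    [Z] vanish. *)
Lemma unipotent_lie_nilpotent (U : set M) Z : algebraic_group U -> unipotent_group U -> lie U Z -> Z ^+ n = 0.
Proof.
move=> aU uU hZ; have [g [s [N [gu ZE Nn _ SN]]]] := jordan_decomposition Z.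
rewrite -tdiagE in ZE SN.
have hZ' : lie U (tdiag g s + N) by rewrite -ZE.
suff s0 : s = 0 by rewrite ZE s0 tdiagE linear0 mulmx0 mul0mx add0r.
apply: (replica_trace0 gu aU hZ' SN Nn) => v [m [N0 N0p hm] hU] _.
have two0 : (2%:R : C) != 0 by rewrite pnatr_eq0.
apply: big1 => j _; have [k hk] := uU _ (hU _ two0).
have m0 : m j = 0.
  have := congr1 (ent g) hk; rewrite entX // entB ent0 (ent1 gu) (ent_cochar gu) => /(@unipotent_diag _ _ _ _ j).
  rewrite mxE => h2; case: (ltgtP (m j) 0) => // mj.
    have := sqr_pow2_neq1 C (z := - m j); rewrite oppr_gt0 -invr_expz h2 invr1 expr1n eqxx => /(_ mj) //.
  by have := sqr_pow2_neq1 C mj; rewrite h2 expr1n eqxx.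
have v0 : v 0 j = 0 by apply/eqP; have := hm j; rewrite m0 => /esym/eqP; rewrite mulf_eq0 pnatr_eq0 -leqn0 leqNgt N0p.
by rewrite qrowE v0 rmorph0 mulr0.
Qed.

Lemma is_polymx_comm (s : M) : is_polymx (fun x : M => s *m x - x *m s).
Proof.
apply: is_polymxD; last apply: is_polymxN; apply: is_polymxM;
  by [exact: is_polymx_cst | exact: is_polymx_id].
Qed.

Lemma wle_expm (g : M) (la : 'I_n -> rat) Y : g \in unitmx -> wle la (ent g Y) -> wle la (ent g (expm Y)).
Proof.
move=> gu wY i j; rewrite (expm_ent gu) expmE summxE => ij.
have [k hk] : exists k : 'I_n, (ent g Y ^+ k) i j != 0.
  apply: contrapT => ne; move/eqP: ij; apply; apply: big1 => k _; rewrite mxE.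
  have [->|hk] := eqVneq ((ent g Y ^+ k) i j) 0; [exact: mulr0 | by case: ne; exists k].
suff w : wle la (ent g Y ^+ k) by exact: w hk.
elim: (nat_of_ord k) => [|m IH]; first by rewrite expr0; exact: wle1.
by rewrite exprS -mulmxE; apply: wleM.
Qed.

End UnipotentLie.

Lemma conj_eq1 (F : fieldType) m (l w : 'M[F]_m) : l \in unitmx -> l *m w *m invmx l = 1%:M -> w = 1%:M.
Proof.
by move=> lu /(congr1 (fun x => invmx l *m x *m l)); rewrite mulmx1 mulVmx // !mulmxA mulVmx // mul1mx mulmxKV.
Qed.

(** * Levi components and their Weyl groups *)

Section Levi.
Variables (R : realType) (n : nat).
Local Notation C := R[i].
Local Notation M := 'M[C]_n.
Variables (g : M) (T : set M) (P : 'M[rat]_n) (fr : torus_frame g T P).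
Let gu := fr_gu fr.
Let aT := fr_aT fr.
Local Notation ent := (ent g).
Local Notation X := (cochars g T).
Variables (K : set M) (pr : torus_pair T K).
Let aK := pr_aK pr.
Let sK := alg_subgroup aK.
Let TK := pr_TK pr.
Local Notation N := (normalizer K T).
Let sN := normalizer_subgroup pr.

Lemma centralizer_of_torus x : K x -> (forall t, T t -> t *m x = x *m t) -> T x.
Proof.
move=> Kx h; have [la [gla _]] := regular_ex fr; apply: (commute_torus fr pr gla Kx).
apply/eqP; rewrite -subr_eq0; apply/eqP/matrixP => i j; rewrite [RHS]mxE.
apply: (@lie_linear_eq _ _ T (qdiag g la) (fun t => (x *m t - t *m x) i j)).
- exact: (is_polymx_comm x).
- by move=> a u v; rewrite mulmxDr mulmxDl -scalemxAr -scalemxAl !mxE; ring.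
- by move=> t Tt; rewrite (h t Tt) mulmx1 mul1mx !subrr.
exact: (cochars_lie gu gla.1).
Qed.

Lemma norm_ent x v i j : N x -> X v -> ent x i j != 0 -> act g x v 0 i = v 0 j.
Proof.
move=> nx Xv ij; have [_] := norm_act fr pr nx Xv => /(congr1 ent).
rewrite (entM gu) (entM gu) (ent_qdiag _ gu) (ent_qdiag _ gu) => /matrixP/(_ i j).
rewrite mul_mx_diag mul_diag_mx mxE [RHS]mxE [in LHS]mxE [in RHS]mxE mulrC.
by move=> /(mulIf ij)/fmorph_inj.
Qed.

Lemma norm_entV x v i j : N x -> X v -> ent (invmx x) j i != 0 -> v 0 j = act g x v 0 i.
Proof.
move=> nx Xv; have nv := sgV sN nx; have Xa := act_X fr pr nx Xv.
by move=> /(norm_ent nv Xa); rewrite (act_invK fr pr nx Xv).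
Qed.

Lemma wle_conj x v Y : N x -> X v -> wle (v 0) (ent Y) -> wle (act g x v 0) (ent (x *m Y *m invmx x)).
Proof.
move=> nx Xv wY i k; rewrite (entM gu) (entM gu) => /mulmx_neq0[l [/mulmx_neq0[j [ij jl]] lk]].
by rewrite (norm_ent nx Xv ij) -(norm_entV nx Xv lk); apply: wY.
Qed.

Lemma conj_Pgrp x v : N x -> X v ->
  conjset (mulset [set x] T) (Pgrp g K (v 0)) = Pgrp g K (act g x v 0).
Proof.
move=> nx Xv; have sP := Pgrp_subgroup gu aK (v 0); have Kx := nx.1; have xu := sg_unit sK Kx.
have TP := @torus_sub_Pgrp _ _ _ _ _ fr _ pr (v 0).
have sT := alg_subgroup aT.
apply/seteqP; split.
  move=> _ [_ [_ [_ -> [t Tt <-]] [p Pp <-]] [_ [_ [_ -> [t' Tt' <-]] <-] <-]].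
  have tu := sg_unit sT Tt'; rewrite (invmxM xu tu).
  have -> : x *m t *m p *m (invmx t' *m invmx x) = x *m (t *m p *m invmx t') *m invmx x by rewrite !mulmxA.
  have hp : Pgrp g K (v 0) (t *m p *m invmx t').
    by apply: (sgM sP (sgM sP (TP _ Tt) Pp)); apply: (sgV sP); apply: TP.
  by split; [exact: (sgJ sK Kx hp.1) | exact: (wle_conj nx Xv hp.2)].
move=> y [Ky wy].
have hy : Pgrp g K (v 0) (invmx x *m y *m x).
  have nv := sgV sN nx; split; first by have := sgJ sK nv.1 Ky; rewrite invmxK.
  by have := wle_conj nv (act_X fr pr nx Xv) wy; rewrite (act_invK fr pr nx Xv) invmxK.
exists (x *m (invmx x *m y *m x)).
  by exists x; [exists x; [|exists 1%:M; [exact: (sg1 sT) | exact: mulmx1]] | exists (invmx x *m y *m x)].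
exists (invmx x); last by rewrite !mulmxA mulmxV // mul1mx mulmxK.
by exists x => //; exists x; [|exists 1%:M; [exact: (sg1 sT) | exact: mulmx1]].
Qed.

Variables (v : 'rV[rat]_n) (Xv : X v).
Local Notation Q := (Pgrp g K (v 0)).
Local Notation L := (Lgrp g K (v 0)).
Let aQ := Pgrp_algebraic gu aK (v 0).
Let sQ := Pgrp_subgroup gu aK (v 0).
Let TQ : T `<=` Q := @torus_sub_Pgrp _ _ _ _ _ fr _ pr (v 0).

Lemma lie_Pgrp_rwt r Y : lie K Y -> rwt g P r Y -> r != 0 -> 0 <= dot v r -> lie Q Y.
Proof.
move=> hY wY r0 h; have Yn := rwt_nilpotent fr wY r0.
apply: (unipotent_lie Yn) => c; split; first exact: (lie_exp aK c hY Yn).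
have wc : wle (v 0) (ent (c *: Y)).
  move=> i j; rewrite entZ mxE => ij; rewrite -subr_ge0 -(dot_epsB fr _ _ Xv) (wY i j) //.
  by apply: contraNneq ij => ->; rewrite mulr0.
exact: (wle_expm gu wc).
Qed.

Lemma Ugrp_radical : Ugrp g K (v 0) `<=` unipotent_radical Q.
Proof.
move=> u Uu; exists (Ugrp g K (v 0)); [split|exact: Uu].
- exact: (Ugrp_algebraic gu aK).
- exact/irreducible_connected/(Ugrp_irreducible gu aK).
- split=> [x [Kx wx]|x y Qx Uy]; first by split; [exact: Kx | exact: (wlt_unip_wle gu)].
  exact: (Ugrp_normal gu aK Qx Uy).
- by move=> x Ux; exists n; exact: (Ugrp_unipotent gu Ux).
Qed.

(** The logarithm [Z] of such an element is orthogonal to the Lie algebra of [Q], by Engel's theorem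
    applied to a normal unipotent group. It is orthogonal to the other root spaces because its
    weights for [v] are zero. Nondegeneracy gives [Z = 0]. *)
Lemma levi_radical : L `&` unipotent_radical Q = [set 1%:M].
Proof.
apply/seteqP; split=> [x [Lx [U [aU cU [UQ nU] uU] Ux]]|x ->]; last first.
  split; first exact: (sg1 (Lgrp_subgroup gu aK (v 0))).
  by apply: Ugrp_radical; exact: (sg1 (Ugrp_subgroup gu aK (v 0))).
have aA : algebraic_group (L `&` U) := alg_setI (Lgrp_algebraic gu aK (v 0)) aU.
have [k xk] := uU _ Ux; have [xn _] := nilpotent_facts xk.
have [Z Zn [Zx _]] := unipotent_log xn.
have hZ := unipotent_lie Zn (unipotent_curve aA (conj Lx Ux) Zn Zx).
have hU : lie U Z by apply: lie_mono hZ => y [_ h].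
have hL : lie L Z by apply: lie_mono hZ => y [h _].
have wZ := lie_Lgrp gu hL.
have hK : lie K Z by apply: lie_mono hL => y [h _].
have sub : lie_subalgebra (lie U) by split; [exact: lie_linset | move=> A B; apply: (lie_bracket aU)].
have tr0 Y : lie Q Y -> \tr (Z *m Y) = 0.
  move=> hY; apply: (engel_trace sub (fun W => unipotent_lie_nilpotent aU uU) _ hU) => W hW.
  rewrite -opprB; apply: (linsetN (lie_linset U)); apply: (lie_ideal aQ _ hY) => y Qy.
  by apply: lie_Ad_norm hW; [exact: (sg_unit sQ Qy) | move=> z; apply: nU].
suff -> : x = 1%:M by [].
rewrite -Zx; suff -> : Z = 0 by rewrite expm0.
apply: (pr_nd pr hK) => Y hY; rewrite (rcomp_sum fr Y) mulmx_sumr raddf_sum /=; apply: big1 => r _.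
have hr := rcomp_k fr r aK TK hY; have wr := @rcomp_rwt _ _ _ _ _ fr r Y.
have [h|h] := lerP 0 (dot v r).
  apply: tr0; have [r0|r0] := eqVneq r 0; last exact: lie_Pgrp_rwt hr wr r0 h.
  by apply: (lie_mono TQ); apply: (rwt0_torus fr pr hr); rewrite -r0.
rewrite mxtrace_mulC (tr_rcomp fr Z wr).
have [->|c0] := eqVneq (rcomp g P (- r) Z) 0; first by rewrite mulmx0 mxtrace0.
have [i [j [E ij]]] := rcomp_entry fr c0; move: h; rewrite -[r]opprK -E dotNr (dot_epsB fr _ _ Xv) (wZ _ _ ij).
by rewrite subrr oppr0 ltxx.
Qed.

(** The definition of [levi] selects some complement by [xget], and this makes the choice harmless
    for Weyl groups. Write a normalizing [x] as [l u]: the commutator of [u] with an element of [T]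
    is conjugate into the intersection of [L'] with the radical, so [u] centralizes [T], lies in
    [T], and is trivial. *)
Lemma levi_normalizer L' : [/\ algebraic_group L', T `<=` L', mulset L' (unipotent_radical Q) = Q &
  L' `&` unipotent_radical Q = [set 1%:M]] -> normalizer L' T = normalizer Q T.
Proof.
move=> [aL TL LQ LU]; have sL := alg_subgroup aL.
have L1 x : L' x -> unipotent_radical Q x -> x = 1%:M.
  by move=> hx ux; have : (L' `&` unipotent_radical Q) x by []; rewrite LU.
have U1 : unipotent_radical Q 1%:M by have : [set 1%:M : M] 1%:M by []; rewrite -LU => -[].
have sub x : L' x -> Q x by move=> hx; rewrite -LQ; exists x => //; exists 1%:M => //; exact: mulmx1.
apply/seteqP; split=> x [hx nx]; split=> //; first exact: sub.
have Qx := hx; rewrite -LQ in hx; have [l Ll [u [U [aU cU [UQ nU] uU] Uu] E]] := hx.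
have sU := alg_subgroup aU; have Ux := sg_unit sQ Qx.
have lu := sg_unit sL Ll; have uu := sg_unit sU Uu.
have [_ hT] : K x /\ (forall t, T t -> T (x *m t *m invmx x) /\ T (invmx x *m t *m x)).
  by apply/(normalizerP pr); split; [case: Qx | ].
suff -> : x = l by [].
rewrite -E; suff -> : u = 1%:M by rewrite mulmx1.
suff uT t : T t -> t *m u = u *m t.
  apply: L1; last by exists U.
  by apply: TL; apply: centralizer_of_torus uT; case: (UQ _ Uu).
move=> Tt; have tu := sg_unit sL (TL _ Tt).
pose w := u *m (t *m invmx u *m invmx t).
have Uw : U w by apply: (sgM sU Uu); apply: nU; [exact: TQ | exact: (sgV sU)].
have wE : w *m t = u *m t *m invmx u by rewrite /w !mulmxA mulmxKV.
have E2 : x *m t *m invmx x = (l *m w *m invmx l) *m (l *m t *m invmx l).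
  have -> : l *m w *m invmx l *m (l *m t *m invmx l) = l *m (w *m t) *m invmx l by rewrite !mulmxA mulmxKV.
  by rewrite wE -E (invmxM lu uu) !mulmxA.
have Lw : L' (l *m w *m invmx l).
  have Llt : L' (l *m t *m invmx l) by apply: (sgJ sL Ll); apply: TL.
  by apply: (sgMr sL Llt); rewrite -E2; apply: TL; case: (hT t Tt).
have w1 : l *m w *m invmx l = 1%:M.
  by apply: (L1 _ Lw); exists U => //; apply: nU => //; apply: sub.
have {}w1 : w = 1%:M.
  by apply: (conj_eq1 lu).
by move: wE; rewrite w1 mul1mx => /(congr1 (mulmx^~ u)); rewrite /= mulmxKV.
Qed.

Lemma levi_exists : exists L', [/\ algebraic_group L', T `<=` L', mulset L' (unipotent_radical Q) = Q &
  L' `&` unipotent_radical Q = [set 1%:M]].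
Proof.
exists L; split; [exact: (Lgrp_algebraic gu aK) | | | exact: levi_radical].
  move=> t Tt; split; first exact: TK.
  exact: (@torus_weq _ _ g T (fr_dT fr) (v 0) t Tt).
apply/seteqP; split=> [_ [l [Kl wl] [u [U [aU cU [UQ nU] uU] Uu] <-]]|b Qb].
  by apply: (sgM sQ); [split; [exact: Kl | exact: weq_wle] | exact: UQ].
have rv := X_ratcochar pr Xv; have [u Uu bE] := levi_decomp gu aK rv Qb.
exists (levi_proj g (v 0) b); first exact: (levi_part gu aK rv Qb).
by exists u => //; apply: Ugrp_radical.
Qed.

(** An element of [Q] normalizing [T] can only lower the coordinates of [v]; as it permutes them,
    their sum is unchanged and none is lowered. *)
Lemma normalizer_Pgrp : normalizer Q T = [set x | N x /\ act g x v = v].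
Proof.
apply/seteqP; split=> [x [[Kx wx] nx]|x [[Kx nx] xv]].
  split; first by split.
  have nx' : N x by split.
  have xu := sg_unit sK Kx.
  have le i : act g x v 0 i <= v 0 i.
    by rewrite mxE; apply: wx; apply: (wperm_neq0 fr i xu).
  have E : \sum_i (v 0 i - act g x v 0 i) = 0.
    rewrite sumrB (reindex_inj (@perm_inj _ (wperm g x))) /= -sumrB.
    by apply: big1 => i _; rewrite mxE subrr.
  apply/rowP => i; apply/eqP; rewrite eq_sym -subr_eq0.
  have ge0 k : true -> 0 <= v 0 k - act g x v 0 k by move=> _; rewrite subr_ge0.
  by rewrite (psumr_eq0P ge0 E).
split=> //; split=> // i j ij.
have nx' : N x by split.
by rewrite -(norm_ent nx' Xv ij) xv.
Qed.

Lemma weyl_parabolic_Pgrp :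
  weyl_parabolic Q T = [set mulset [set x] T | x in [set x | N x /\ act g x v = v]].
Proof.
have h := xgetPex set0 levi_exists.
by rewrite /weyl_parabolic /weyl (levi_normalizer h) normalizer_Pgrp.
Qed.

End Levi.

Lemma comm_pow (F : fieldType) n (s a : 'M[F]_n) k : s *m a = a *m s -> s *m a ^+ k = a ^+ k *m s.
Proof.
move=> h; elim: k => [|k IH]; first by rewrite expr0 mulmx1 mul1mx.
by rewrite exprS -mulmxE mulmxA h -mulmxA IH mulmxA.
Qed.

(** * The identity component of the fixed group of S *)

Section FixedGroup.
Variables (R : realType) (n : nat).
Local Notation C := R[i].
Local Notation M := 'M[C]_n.
Variables (g : M) (T : set M) (P : 'M[rat]_n) (fr : torus_frame g T P).
Let gu := fr_gu fr.
Let aT := fr_aT fr.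
Let sT := alg_subgroup aT.
Local Notation ent := (ent g).
Local Notation rcomp := (rcomp g P).
Local Notation X := (cochars g T).
Variables (G : set M) (pr : torus_pair T G).
Let aG := pr_aK pr.
Let sG := alg_subgroup aG.
Let TG := pr_TK pr.
Variables (S : set M) (sS : subgroup S) (ST : S `<=` T).

Lemma fixedP (Q : set M) x : fixed Q S x <-> Q x /\ forall s, S s -> s *m x = x *m s.
Proof.
split=> -[Qx h]; split=> // s Ss; have su := sg_unit sS Ss.
  by rewrite -{2}(h s Ss) mulmxKV.
by rewrite (h s Ss) mulmxK.
Qed.

Lemma fixed_subgroup (Q : set M) : subgroup Q -> subgroup (fixed Q S).
Proof.
move=> sQ; split.
- by move=> x [/(sg_unit sQ)].
- by apply/fixedP; split; [exact: (sg1 sQ) | move=> s _; rewrite mulmx1 mul1mx].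
- move=> x y /fixedP[Qx hx] /fixedP[Qy hy]; apply/fixedP; split; first exact: (sgM sQ).
  by move=> s Ss; rewrite mulmxA hx // -mulmxA hy // mulmxA.
move=> x /fixedP[Qx hx]; apply/fixedP; split; first exact: (sgV sQ).
move=> s Ss; have xu := sg_unit sQ Qx; symmetry; apply: (intertwine_inv xu); symmetry; exact: hx.
Qed.

Lemma fixed_algebraic : algebraic_group (fixed G S).
Proof.
pose F : set (M -> C) := [set f | exists s i j, S s /\ f = fun x : M => (s *m x - x *m s) i j].
apply: (@alg_cut _ _ G _ F aG (fixed_subgroup sG)).
- move=> _ [s [i [j [_ ->]]]].
  exact: (is_polymx_comm s).
move=> x; split.
  move=> /fixedP[Gx hx]; split=> // _ [s [i [j [Ss ->]]]]; by rewrite hx // subrr mxE.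
move=> [Gx h]; apply/fixedP; split=> // s Ss; apply/eqP; rewrite -subr_eq0; apply/eqP/matrixP => i j.
have -> : (s *m x - x *m s) i j = 0 by apply: (h (fun x : M => (s *m x - x *m s) i j)); exists s, i, j.
by rewrite mxE.
Qed.

Local Notation H := (identity_component (fixed G S)).
Let aH : algebraic_group H := idcomp_algebraic fixed_algebraic.
Let lH := lie_linset H.

Lemma idcomp_fixed_sub : H `<=` fixed G S.
Proof. exact: idcomp_sub. Qed.

Lemma idcomp_fixed_subG : H `<=` G.
Proof. by move=> x /idcomp_fixed_sub[]. Qed.

Lemma torus_sub_fixed : T `<=` H.
Proof.
apply: (idcomp_max (fr_cT fr) (sg1 sT)) => t Tt; apply/fixedP; split; first exact: TG.
by move=> s /ST Ts; apply: (torus_comm fr).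
Qed.

Lemma lie_fixed Z s : lie H Z -> S s -> s *m Z = Z *m s.
Proof.
move=> hZ Ss; apply/eqP; rewrite -subr_eq0; apply/eqP/matrixP => i j; rewrite [RHS]mxE.
apply: (@lie_linear_eq _ _ H Z (fun t => (s *m t - t *m s) i j)) hZ.
- exact: (is_polymx_comm s).
- by move=> a u v; rewrite mulmxDr mulmxDl -scalemxAr -scalemxAl !mxE; ring.
by move=> x /idcomp_fixed_sub/fixedP[_ h]; rewrite h // mulmx1 mul1mx !subrr.
Qed.

Lemma commute_rcomp s r Z : T s -> s *m Z = Z *m s -> s *m rcomp r Z = rcomp r Z *m s.
Proof.
move=> Ts /(congr1 ent) E; apply: (ent_inj gu); rewrite (entM gu) (entM gu).
rewrite (entM gu) (entM gu) in E.
have sE : ent s = diag_mx (\row_i ent s i i).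
  apply/matrixP => i j; rewrite !mxE; case: (i =P j) => [->|/eqP ij]; first by rewrite mulr1n.
  by rewrite (torus_ent (fr_dT fr) Ts ij).
rewrite sE in E *; apply/matrixP => i j; move/matrixP/(_ i j): E.
rewrite !mul_diag_mx !mul_mx_diag mxE [RHS]mxE => E; rewrite mxE [RHS]mxE.
have [d|d] := eqVneq (eps P i - eps P j) r; first by rewrite !(rcomp_ent fr Z d).
have -> : ent (rcomp r Z) i j = 0.
  by apply/eqP; apply: contraNT d => /(@rcomp_rwt _ _ _ _ _ fr r Z i j)/eqP.
by rewrite mulr0 mul0r.
Qed.

(** The weight components of [Z] commute with [S] as well. Those of nonzero weight exponentiate to
    connected curves of fixed points through the identity; the one of weight zero is toral. *)
Lemma fixed_lie Z : lie G Z -> (forall s, S s -> s *m Z = Z *m s) -> lie H Z.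
Proof.
move=> hZ h; rewrite (rcomp_sum fr Z); apply: (linset_sum lH) => r _.
have hr := rcomp_k fr r aG TG hZ; have wr := @rcomp_rwt _ _ _ _ _ fr r Z.
have cr s : S s -> s *m rcomp r Z = rcomp r Z *m s by move=> Ss; apply: commute_rcomp; [exact: ST | exact: h].
have [r0|r0] := eqVneq r 0.
  by apply: (lie_mono torus_sub_fixed); apply: (rwt0_torus fr pr hr); rewrite -r0.
have En := rwt_nilpotent fr wr r0; apply: (unipotent_lie En) => c.
have cv : connected_group (range (fun c : C => expm (c *: rcomp r Z))).
  by apply/irreducible_connected/irreducible_curve => i j; apply: exp_uni.
apply: (idcomp_max cv); [|move=> _ [d _ <-]|by exists c].
  by exists 0 => //; rewrite scale0r expm0.
apply/fixedP; split; first exact: (lie_exp aG d hr En).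
by move=> s Ss; apply: expm_comm; rewrite -scalemxAr -scalemxAl cr.
Qed.

Lemma root_conj s r Y : T s -> r != 0 -> lie G Y -> rwt g P r Y -> exists c, s *m Y *m invmx s = c *: Y.
Proof.
move=> Ts r0 hY wY; have [->|Y0] := eqVneq Y 0; first by exists 1; rewrite mulmx0 mul0mx scaler0.
have wJ := rwt_act fr pr (torus_normalizer fr pr Ts) (rwtX fr wY Y0) wY.
rewrite (act_torus fr r Ts) in wJ.
exact: (root_dim1 fr pr r0 hY (lie_Ad aG (TG Ts) hY) Y0 wY wJ).
Qed.

Lemma tr_conj_eq0 (F : fieldType) m (s Z Y : 'M[F]_m) c : s \in unitmx -> s *m Z = Z *m s ->
  s *m Y *m invmx s = c *: Y -> c != 1 -> \tr (Z *m Y) = 0.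
Proof.
move=> su sZ sY c1; have E : \tr (Z *m Y) = c * \tr (Z *m Y).
  have -> : c * \tr (Z *m Y) = \tr (s *m (Z *m Y) *m invmx s) by rewrite -mxtraceZ scalemxAr -sY !mulmxA sZ.
  by rewrite [RHS]mxtrace_mulC mulKmx.
by apply/eqP; move/eqP: E; rewrite -subr_eq0 -{1}[\tr _]mul1r -mulrBl mulf_eq0 subr_eq0 eq_sym (negPf c1).
Qed.

(** For nondegeneracy, a root component on which some element of [S] acts by a scalar other than 1
    is orthogonal to everything fixed by [S], and the other components lie in the Lie algebra of
    [H]. *)
Lemma fixed_pair : torus_pair T H.
Proof.
split.
- exact: aH.
- exact: idcomp_connected.
- exact: torus_sub_fixed.
- by move=> Z hZ; apply: (pr_hz pr); apply: (lie_mono idcomp_fixed_subG).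
move=> Z hZ h; apply: (pr_nd pr (lie_mono idcomp_fixed_subG hZ)) => Y hY.
rewrite (rcomp_sum fr Y) mulmx_sumr raddf_sum /=; apply: big1 => r _.
have hr := rcomp_k fr r aG TG hY; have wr := @rcomp_rwt _ _ _ _ _ fr r Y.
have [r0|r0] := eqVneq r 0.
  by apply: h; apply: (lie_mono torus_sub_fixed); apply: (rwt0_torus fr pr hr); rewrite -r0.
have [[s Ss sY]|nex] := pselect (exists2 s, S s & s *m rcomp r Y <> rcomp r Y *m s).
  have su := sg_unit sS Ss; have [c cE] := root_conj (ST Ss) r0 hr wr.
  apply: (tr_conj_eq0 su (lie_fixed hZ Ss) cE); apply/eqP => c1; apply: sY.
  by rewrite -[LHS](mulmxKV su) cE c1 scale1r.
apply: h; apply: (fixed_lie hr) => s Ss; apply: contrapT => ns; by apply: nex; exists s.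
Qed.

(** In one direction, root vectors of [H] are exponentiated. In the other, a fixed element is [t u]
    with [t] in [T] and [u] unipotent and fixed by [S]; the logarithm of [u] lies in the Lie algebra
    of [H] and has only roots positive for [la]. *)
Lemma fixed_sub_Pgrp la v : X la -> (forall r, r \in rootsq g P G -> dot la r != 0) -> X v ->
  fixed (Pgrp g G (la 0)) S `<=` Pgrp g G (v 0) <->
  (forall r, r \in rootsq g P H -> 0 < dot la r -> 0 <= dot v r).
Proof.
move=> Xl lreg Xv; have rl := X_ratcochar pr Xl; have sP := Pgrp_subgroup gu aG (la 0).
split=> [sub r /(elimT (rootsqP fr H r))[r0 [e [he e0 we]]] lr|dom b /fixedP[Pb cb]].
  have hG := lie_mono idcomp_fixed_subG he; have en := rwt_nilpotent fr we r0.
  have wl : lie (Pgrp g G (la 0)) e.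
    by apply: (lie_Pgrp_wlt fr pr hG) => i j ij; rewrite -subr_gt0 -(dot_epsB fr _ _ Xl) (we _ _ ij).
  have hv : lie (Pgrp g G (v 0)) e.
    apply: (unipotent_lie en) => c; apply: sub; apply/fixedP; split.
      exact: (lie_exp (Pgrp_algebraic gu aG (la 0)) c wl en).
    by move=> s Ss; apply: expm_comm; rewrite -scalemxAr -scalemxAl (lie_fixed he Ss).
  have [i [j ij]] := ent_neq0 gu e0.
  by rewrite -(we _ _ ij) (dot_epsB fr _ _ Xv) subr_ge0; apply: (lie_Pgrp gu hv).
have sV := Pgrp_subgroup gu aG (v 0).
have [u Uu bE] := levi_decomp gu aG rl Pb; set t := levi_proj _ _ _ in bE.
have Tt : T t.
  rewrite -(centralizer_regular fr pr Xl) => [|r /(introT (rootsqP fr G r))]; last exact: lreg.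
  exact: (levi_part gu aG rl Pb).
have tu := sg_unit sT Tt; have Gu : G u by case: Uu.
have cu s : S s -> s *m u = u *m s.
  move=> Ss; apply: (can_inj (mulKmx tu)); rewrite mulmxA -(torus_comm fr (ST Ss) Tt) -mulmxA -bE [t *m (u *m s)]mulmxA -bE.
  exact: cb.
have un := Ugrp_unipotent gu Uu; have [Z Zn [Zu [a a0 ZE]]] := unipotent_log un.
have cZ s : S s -> s *m Z = Z *m s.
  move=> Ss; rewrite ZE mulmx_sumr mulmx_suml; apply: eq_bigr => k _; rewrite -scalemxAr -scalemxAl; congr (_ *: _).
  by apply: comm_pow; rewrite mulmxBr mulmxBl mulmx1 mul1mx cu.
have aU := Ugrp_algebraic gu aG (la 0).
have hU := unipotent_lie Zn (unipotent_curve aU Uu Zn Zu).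
have hG : lie G Z by apply: lie_mono hU => y [].
have wl := lie_Ugrp hU.
have hH := fixed_lie hG cZ.
rewrite bE; apply: (sgM sV); first exact: (@torus_sub_Pgrp _ _ _ _ _ fr _ pr (v 0)).
split=> //; rewrite -Zu; apply: (wle_expm gu) => i j ij.
have := wl i j ij; rewrite -subr_gt0 -(dot_epsB fr _ _ Xl) -subr_ge0 -(dot_epsB fr _ _ Xv).
by have [->|hr] := lie_entry fr aH torus_sub_fixed hH ij; [rewrite !(dotC _ 0) !dot0l | exact: dom].
Qed.

End FixedGroup.

Lemma pow2_inj (F : numFieldType) : injective (fun z : int => (2%:R : F) ^ z).
Proof.
move=> a b E; have two0 : (2%:R : F) != 0 by rewrite pnatr_eq0.
have h (z : int) : (2%:R : F) ^ z = 1 -> z = 0.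
  move=> zE; case: (ltgtP z 0) => // z0.
    by have := sqr_pow2_neq1 F (z := - z); rewrite oppr_gt0 -invr_expz zE invr1 expr1n eqxx => /(_ z0).
  by have := sqr_pow2_neq1 F z0; rewrite zE expr1n eqxx.
by apply/eqP; rewrite -subr_eq0; apply/eqP/h; rewrite expfzDr // E -expfzDr // subrr expr0z.
Qed.

(** * Translation between root vectors and characters of the torus *)

Section Characters.
Variables (R : realType) (n : nat).
Local Notation C := R[i].
Local Notation M := 'M[C]_n.
Variables (g : M) (T : set M) (P : 'M[rat]_n) (fr : torus_frame g T P).
Let gu := fr_gu fr.
Let aT := fr_aT fr.
Let sT := alg_subgroup aT.
Local Notation ent := (ent g).
Local Notation X := (cochars g T).
Local Notation eps := (eps P).
Local Notation diffs := (wdiffs eps).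

Definition chr (a : 'rV[rat]_n) (t : M) : C :=
  if `[< T t >] then
    if [pick ij : 'I_n * 'I_n | eps ij.1 - eps ij.2 == a] is Some ij
    then ent t ij.1 ij.1 / ent t ij.2 ij.2 else 1
  else 0.

Lemma torus_diagE t : T t -> ent t = diag_mx (\row_i ent t i i).
Proof.
move=> Tt; apply/matrixP => k j; rewrite !mxE; case: (k =P j) => [->|/eqP kj]; first by rewrite mulr1n.
by rewrite (torus_ent (fr_dT fr) Tt kj).
Qed.

Lemma ent_diag_neq0 t i : T t -> ent t i i != 0.
Proof.
move=> Tt; have := sg_unit sT Tt; rewrite -(ent_unit gu) unitmxE unitfE (torus_diagE Tt) det_diag.
by move=> /prodf_neq0/(_ i isT); rewrite mxE [X in _ -> X != 0]mxE eqxx mulr1n mxE.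
Qed.

Lemma torus_seq (s s' : seq 'I_n) : (forall v, X v -> \sum_(i <- s) v 0 i = \sum_(i <- s') v 0 i) ->
  forall t, T t -> \prod_(i <- s) ent t i i = \prod_(i <- s') ent t i i.
Proof.
move=> h t Tt; have [la [gla _]] := regular_ex fr.
have prodE (r : seq 'I_n) (f : 'I_n -> C) : \prod_(i <- r) f i = \prod_i f i ^+ count_mem i r.
  elim: r => [|k r IH]; first by rewrite big_nil big1.
  rewrite big_cons IH [RHS](eq_bigr (fun i => f i ^+ (k == i) * f i ^+ count_mem i r)) => [|i _]; last by rewrite -exprD.
  rewrite big_split /=; congr (_ * _); rewrite (bigD1 k) //= eqxx expr1 big1 ?mulr1 // => i /negPf.
  by rewrite eq_sym => ->; rewrite expr0.
have sumE (r : seq 'I_n) (f : 'I_n -> rat) : \sum_(i <- r) f i = \sum_i (count_mem i r)%:R * f i.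
  elim: r => [|k r IH]; first by rewrite big_nil big1 // => i _; rewrite mul0r.
  rewrite big_cons IH [RHS](eq_bigr (fun i => (k == i)%:R * f i + (count_mem i r)%:R * f i)) => [|i _]; last by rewrite -mulrDl -natrD.
  rewrite big_split /=; congr (_ + _); rewrite (bigD1 k) //= eqxx mul1r big1 ?addr0 // => i /negPf.
  by rewrite eq_sym => ->; rewrite mul0r.
rewrite (prodE s) (prodE s'); apply: (torus_monomial gu aT (fr_cT fr) (fr_dT fr) gla _ Tt) => v Xv.
by rewrite -(sumE s) -(sumE s'); apply: h.
Qed.

Lemma chrE a i j t : eps i - eps j = a -> T t -> chr a t = ent t i i / ent t j j.
Proof.
move=> E Tt; rewrite /chr asboolT //; case: pickP => [[k l] /= /eqP E2|/(_ (i, j))/eqP]; last by [].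
have := @torus_seq [:: k; j] [:: i; l] _ t Tt; rewrite !big_cons !big_nil !mulr1 => h.
have nz := fun i => ent_diag_neq0 i Tt.
apply: (mulIf (nz l)); rewrite mulfVK //; apply: (mulIf (nz j)); rewrite h; last first.
  move=> v Xv; rewrite !big_cons !big_nil !addr0.
  have := dot_epsB fr k l Xv; rewrite E2 -E (dot_epsB fr _ _ Xv); lra.
by rewrite mulrAC mulfVK.
Qed.

Lemma chr_out a t : ~ T t -> chr a t = 0.
Proof. by move=> nT; rewrite /chr asboolF. Qed.

Lemma chrD a b t : a \in diffs -> b \in diffs -> a + b \in diffs -> T t -> chr (a + b) t = chr a t * chr b t.
Proof.
rewrite !mem_undup => /mapP[[i j] _ /= aE] /mapP[[k l] _ /= bE] /mapP[[p q] _ /= abE] Tt.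
rewrite (chrE (esym abE) Tt) (chrE (esym aE) Tt) (chrE (esym bE) Tt).
have := @torus_seq [:: p; j; l] [:: i; k; q] _ t Tt; rewrite !big_cons !big_nil !mulr1 => h.
have nz := fun i => ent_diag_neq0 i Tt.
apply: (mulIf (nz q)); rewrite mulfVK //; apply: (mulIf (nz l)); apply: (mulIf (nz j)).
have -> : ent t i i / ent t j j * (ent t k k / ent t l l) * ent t q q * ent t l l * ent t j j = ent t i i * (ent t k k * ent t q q).
  by field; rewrite !nz.
rewrite -h => [|v Xv]; first by rewrite -mulrA [X in _ * X]mulrC.
 rewrite !big_cons !big_nil !addr0.
have := dot_epsB fr p q Xv; rewrite -abE dotDr aE bE !(dot_epsB fr _ _ Xv); lra.
Qed.

Lemma chr_cochar a (m : 'I_n -> int) c N (v : 'rV[rat]_n) : (forall j, (m j)%:~R = N%:R * v 0 j) -> X v -> c != 0 -> T (cochar g m c) ->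
  a \in diffs -> exists2 z : int, z%:~R = N%:R * dot v a & chr a (cochar g m c) = c ^ z.
Proof.
move=> hm Xv c0 Tc; rewrite mem_undup => /mapP[[i j] _ /= aE]; exists (m i - m j).
  by rewrite aE (dot_epsB fr _ _ Xv) rmorphB /= !hm mulrBr.
rewrite (chrE (esym aE) Tc) (ent_cochar gu) !mxE !eqxx !mulr1n expfzDr // invr_expz //.
Qed.

(** Evaluation at 2 of the cocharacter proportional to [v = a - (b + c)] shows that [v] is
    orthogonal to itself. *)
Lemma chr_linear a b c : a \in diffs -> b \in diffs -> c \in diffs -> X a -> X b -> X c ->
  (forall t, T t -> chr a t = chr b t * chr c t) -> a = b + c.
Proof.
move=> ha hb hc Xa Xb Xc h; apply/eqP; rewrite -subr_eq0 -dot_eq0; apply/eqP.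
have Xv : X (a - (b + c)) by apply: (linsetB (X_lin fr)) => //; apply: (linsetD (X_lin fr)).
set v := a - _ in Xv *; have [m [N N0 hm] hT] := Xv.
have two0 : (2%:R : C) != 0 by rewrite pnatr_eq0.
have [za ha1 ha2] := chr_cochar hm Xv two0 (hT _ two0) ha.
have [zb hb1 hb2] := chr_cochar hm Xv two0 (hT _ two0) hb.
have [zc hc1 hc2] := chr_cochar hm Xv two0 (hT _ two0) hc.
have := h _ (hT _ two0); rewrite ha2 hb2 hc2 -expfzDr // => /pow2_inj E.
have : N%:R * dot v a = N%:R * dot v b + N%:R * dot v c by rewrite -ha1 -hb1 -hc1 E rmorphD.
have N0' : (N%:R : rat) != 0 by rewrite pnatr_eq0 -lt0n.
rewrite -mulrDr => /(mulfI N0'); rewrite {2}/v dotBr dotDr => ->; exact: subrr.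
Qed.

Lemma chr_rwt a Y t : T t -> rwt g P a Y -> twisted t Y Y (chr a t).
Proof.
move=> Tt wY; apply: (ent_inj gu); rewrite (entM gu) entZ (entM gu).
rewrite (torus_diagE Tt); apply: twisted_diag => i j /wY E; rewrite !mxE (chrE E Tt) mulfVK //; exact: ent_diag_neq0.
Qed.

Lemma rootsq_diffs Q a : a \in rootsq g P Q -> a \in diffs.
Proof. by rewrite mem_filter => /andP[]. Qed.

Variables (G : set M) (pr : torus_pair T G).

Lemma roots_chr B : algebraic_group B -> T `<=` B -> B `<=` G ->
  Defs.roots B T = [set chr a | a in [set a | a \in rootsq g P B]].
Proof.
move=> aB TB BG; apply/seteqP; split=> [ch [out [t0 Tt0 ch0] [A [hA A0 chA]]]|_ [a /= ha <-]]; last first.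
  have [a0 [e [he e0 we]]] := elimT (rootsqP fr B a) ha; split.
  - exact: chr_out.
  - apply: contrapT => ne; case/negP: a0; apply/eqP.
    have Te : lie T e.
      apply: (pr_hz pr (lie_mono BG he)) => t Tt; rewrite (chr_rwt Tt we).
      have -> : chr a t = 1 by apply: contrapT => /eqP h; apply: ne; exists t.
      by rewrite scale1r.
    have [s sE] := torus_lie_diag gu (fr_dT fr) Te.
    have [i [j ij]] := ent_neq0 gu e0.
    rewrite -(we _ _ ij); case: (i =P j) => [->|/eqP nij]; first exact: subrr.
    by move: ij; rewrite sE (ent_tdiag gu) mxE (negPf nij) mulr0n eqxx.
  - exists e; split=> // t Tt; rewrite (chr_rwt Tt we) -scalemxAl mulmxK //; exact: (sg_unit sT Tt).
have [i [j ij]] := ent_neq0 gu A0.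
have chE t : T t -> ch t = chr (eps i - eps j) t.
  move=> Tt; rewrite (chrE erefl Tt); have nz := ent_diag_neq0 j Tt.
  have : t *m A = ch t *: (A *m t) by rewrite -[LHS](mulmxKV (sg_unit sT Tt)) chA // scalemxAl.
  move=> /(congr1 ent)/matrixP/(_ i j); rewrite (entM gu) entZ (entM gu) {1 2}(torus_diagE Tt).
  rewrite mul_diag_mx mul_mx_diag mxE [in X in X = _]mxE [RHS]mxE [in RHS]mxE [in X in _ = _ * (_ * X)]mxE => E.
  apply: (mulIf nz); rewrite mulfVK //; apply: (mulIf ij).
  by rewrite [RHS]E mulrAC mulrA.
exists (eps i - eps j); last first.
  apply/funext => t; have [Tt|nT] := pselect (T t); first by rewrite chE.
  by rewrite out // chr_out.
have [E|//] := lie_entry fr aB TB hA ij.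
case/negP: ch0; rewrite chE // (chrE erefl Tt0).
have -> : ent t0 i i = ent t0 j j.
  have := @torus_seq [:: i] [:: j] _ t0 Tt0; rewrite !big_cons !big_nil !mulr1; apply.
  move=> v Xv; rewrite !big_cons !big_nil !addr0; apply/eqP; rewrite -subr_eq0 -(dot_epsB fr _ _ Xv) E.
  by rewrite dotC dot0l.
by rewrite divff // ent_diag_neq0.
Qed.

Lemma simple_roots_chr B la : algebraic_group B -> T `<=` B -> B `<=` G ->
  (forall r, r \in rootsq g P G -> (r \in rootsq g P B) = (0 < dot la r)) ->
  simple_roots B T = [set chr a | a in [set a | simple (rootsq g P G) la a]].
Proof.
move=> aB TB BG hla.
have posE a : pos (rootsq g P G) la a = (a \in rootsq g P B).
  apply/andP/idP => [[h1 h2]|h]; first by rewrite hla.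
  by have h' := rootsq_sub fr BG h; rewrite -hla.
have RB a : Defs.roots B T (chr a) <-> exists2 b, b \in rootsq g P B & chr b = chr a by rewrite (roots_chr aB TB BG).
apply/seteqP; split=> [ch []|_ [a [pa sa] <-]].
  rewrite {1}(roots_chr aB TB BG) => -[a /= ha <-] h; exists a => //; split; first by rewrite posE.
  move=> b c; rewrite !posE => hb hc E.
  apply: (h (chr b) (chr c)); [by apply/RB; exists b | by apply/RB; exists c|].
  apply/funext => t; have [Tt|nT] := pselect (T t); last by rewrite !chr_out // mul0r.
  by rewrite E chrD ?(rootsq_diffs hb) ?(rootsq_diffs hc) // -E (rootsq_diffs ha).
rewrite posE in pa; split; first by apply/RB; exists a.
rewrite (roots_chr aB TB BG) => _ _ [b /= hb <-] [c /= hc <-] E.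
apply: (sa b c); rewrite ?posE //.
have Xr d : d \in rootsq g P B -> X d by apply: (rootsqX fr).
apply: (chr_linear (rootsq_diffs pa) (rootsq_diffs hb) (rootsq_diffs hc) (Xr _ pa) (Xr _ hb) (Xr _ hc)) => t Tt.
by rewrite E.
Qed.

End Characters.

(** * Weyl group elements as cosets of the torus *)

Section Cosets.
Variables (R : realType) (n : nat).
Local Notation C := R[i].
Local Notation M := 'M[C]_n.
Variables (g : M) (T : set M) (P : 'M[rat]_n) (fr : torus_frame g T P).
Let aT := fr_aT fr.
Let sT := alg_subgroup aT.
Local Notation X := (cochars g T).
Local Notation cos x := (mulset [set x] T).
Variables (K : set M) (pr : torus_pair T K).
Local Notation N := (normalizer K T).
Let sN := normalizer_subgroup pr.

Lemma mulsetA (A B D : set M) : mulset A (mulset B D) = mulset (mulset A B) D.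
Proof.
apply/seteqP; split.
  move=> _ [a Aa [_ [b Bb [d Dd <-]] <-]]; exists (a *m b); first by exists a => //; exists b.
  by exists d => //; rewrite mulmxA.
move=> _ [_ [a Aa [b Bb <-]] [d Dd <-]]; exists a => //; exists (b *m d); first by exists b => //; exists d.
by rewrite mulmxA.
Qed.

Lemma mulset1 (x y : M) : mulset [set x] [set y] = [set x *m y].
Proof.
apply/seteqP; split; first by move=> _ [_ -> [_ -> <-]].
by move=> _ ->; exists x => //; exists y.
Qed.

Lemma mulsetTT : mulset T T = T.
Proof.
apply/seteqP; split; first by move=> _ [a Ta [b Tb <-]]; apply: (sgM sT).
by move=> t Tt; exists t => //; exists 1%:M; [exact: (sg1 sT) | exact: mulmx1].
Qed.

Lemma coset_torus t : T t -> cos t = T.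
Proof.
move=> Tt; apply/seteqP; split; first by move=> _ [_ -> [s Ts <-]]; apply: (sgM sT).
move=> s Ts; exists t => //; exists (invmx t *m s); first by apply: (sgM sT) => //; apply: (sgV sT).
by rewrite mulKVmx // (sg_unit sT Tt).
Qed.

Lemma coset_comm x : N x -> mulset T [set x] = cos x.
Proof.
move=> nx; have xu := sg_unit sN nx; have [_ h] := iffLR (normalizerP pr x) nx.
apply/seteqP; split.
  move=> _ [t Tt [_ -> <-]]; exists x => //; exists (invmx x *m t *m x); first exact: (h t Tt).2.
  by rewrite !mulmxA mulmxV // mul1mx.
move=> _ [_ -> [t Tt <-]]; exists (x *m t *m invmx x); first exact: (h t Tt).1.
by exists x => //; rewrite mulmxKV.
Qed.

Lemma coset_mul x y : N y -> mulset (cos x) (cos y) = cos (x *m y).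
Proof.
move=> ny; rewrite mulsetA -(mulsetA [set x]) (coset_comm ny) (mulsetA [set x]) mulset1 -mulsetA mulsetTT //.
Qed.

Lemma coset_eqP x y : N x -> N y -> cos x = cos y <-> forall v, X v -> act g x v = act g y v.
Proof.
move=> nx ny; split=> [E v Xv|h].
  have : cos y x by rewrite -E; exists x => //; exists 1%:M; [exact: (sg1 sT) | exact: mulmx1].
  move=> [_ -> [t Tt <-]].
  by rewrite (act_mul fr pr ny (torus_normalizer fr pr Tt) Xv) (act_torus fr v Tt).
have [t Tt ->] := act_eq_torus fr pr nx ny h.
by rewrite -mulset1 -mulsetA (coset_torus Tt).
Qed.

Lemma coset_eq_regular x y v : N x -> N y -> X v -> (forall r, r \in rootsq g P K -> dot v r != 0) ->
  act g x v = act g y v -> cos x = cos y.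
Proof.
move=> nx ny Xv vreg E; have nxi := sgV sN nx; have nz := sgM sN nxi ny.
have Tz : T (invmx x *m y).
  apply: (act_fix_regular fr pr nz Xv) => [r /(introT (rootsqP fr K r))|]; first exact: vreg.
  by rewrite (act_mul fr pr nxi ny Xv) -E (act_invK fr pr nx Xv).
rewrite -[y](mulKVmx (sg_unit sN nx)).
by rewrite -[RHS]/(mulset [set x *m (invmx x *m y)] T) -mulset1 -mulsetA (coset_torus Tz).
Qed.

End Cosets.

(** * Simple reflections, word length and minimal coset representatives *)

Section Lengths.
Variables (R : realType) (n : nat).
Local Notation C := R[i].
Local Notation M := 'M[C]_n.
Variables (g : M) (T : set M) (P : 'M[rat]_n) (fr : torus_frame g T P).
Let gu := fr_gu fr.
Let aT := fr_aT fr.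
Let sT := alg_subgroup aT.
Local Notation ent := (ent g).
Local Notation X := (cochars g T).
Local Notation cos x := (mulset [set x] T).
Variables (G : set M) (pr : torus_pair T G).
Let sG := alg_subgroup (pr_aK pr).
Local Notation N := (normalizer G T).
Let sN := normalizer_subgroup pr.
Local Notation Phi := (rootsq g P G).
Variables (B : set M) (la : 'rV[rat]_n).
Hypotheses (aB : algebraic_group B) (TB : T `<=` B) (BG : B `<=` G) (Xl : X la)
  (lreg : forall r, r \in Phi -> dot la r != 0)
  (hla : forall r, r \in Phi -> (r \in rootsq g P B) = (0 < dot la r)).
Local Notation ker a := (identity_component [set t | T t /\ chr g T P a t = 1]).

Lemma ker_sub a : ker a `<=` [set t | T t /\ chr g T P a t = 1].
Proof. exact: idcomp_sub. Qed.

Lemma cochar_fixed m x (v : 'rV[rat]_n) N0 : (0 < N0)%N -> (forall j, (m j)%:~R = N0%:R * v 0 j) ->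
  x \in unitmx -> cochar g m 2%:R *m x = x *m cochar g m 2%:R -> act g x v = v.
Proof.
move=> N00 hm xu E; symmetry; apply: (act_unique fr xu); apply: (ent_inj gu).
rewrite (entM gu) (entM gu) (ent_qdiag _ gu); apply/weqP => i j ij.
have := congr1 ent E; rewrite (entM gu) (entM gu) (ent_cochar gu) => /matrixP/(_ i j).
rewrite mul_diag_mx mul_mx_diag mxE [RHS]mxE [in LHS]mxE [in RHS]mxE mulrC => /(mulfI ij)/pow2_inj mij.
have N0' : (N0%:R : rat) != 0 by rewrite pnatr_eq0 -lt0n.
by apply: (mulfI N0'); rewrite -!hm mij.
Qed.

(** A cocharacter orthogonal to [a] has its values in the kernel of the character, and its image is
    connected, so it lies in the identity component that [x] centralizes. *)
Lemma root_centralizer_fix a x v : a \in Phi -> fixed G (ker a) x -> X v -> dot v a = 0 -> act g x v = v.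
Proof.
move=> ha [Gx hx] Xv va; have xu := sg_unit sG Gx; have [m [N0 N00 hm] hT] := Xv.
have two0 : (2%:R : C) != 0 by rewrite pnatr_eq0.
suff kc : ker a (cochar g m 2%:R).
  apply: (cochar_fixed N00 hm xu); have cu := cochar_unit gu m two0.
  by rewrite -{2}(hx _ kc) mulmxKV.
have cc : connected_group [set cochar g m c | c in [set c : C | c != 0]].
  exact/irreducible_connected/irreducible_cochar.
apply: (idcomp_max cc); last by exists 2%:R.
  exists 1; first exact: oner_neq0.
  apply: (ent_inj gu); rewrite (ent_cochar gu) (ent1 gu); apply/matrixP => i j; rewrite !mxE.
  by rewrite exp1rz.
move=> _ [c /= c0 <-]; split; first exact: hT.
have [z hz ->] := chr_cochar fr hm Xv c0 (hT c c0) (rootsq_diffs ha).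
by move: hz; rewrite va mulr0 => /eqP; rewrite intr_eq0 => /eqP ->; rewrite expr0z.
Qed.

Lemma orth_dichotomy (a b : 'rV[rat]_n) : X a -> X b -> a != 0 -> dot b b = dot a a ->
  (forall v, X v -> dot v a = 0 -> dot b v = 0) -> b = a \/ b = - a.
Proof.
move=> Xa Xb a0 bb h; have aa := dot_gt0 a0; pose k := dot b a / dot a a.
have Xp : X (b - k *: a) by apply: (linsetB (X_lin fr)) => //; apply: (linsetZ (X_lin fr)).
have pa : dot (b - k *: a) a = 0 by rewrite dotBl dotZl /k mulfVK ?subrr // gt_eqF.
have bk : b = k *: a.
  apply/eqP; rewrite -subr_eq0 -dot_eq0 {1}dotBl dotZl (h _ Xp pa) [dot a _]dotC pa mulr0 subrr //.
have : k ^+ 2 == 1.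
  by move: bb; rewrite {1 2}bk dotZl dotZr mulrA -expr2 -{2}[dot a a]mul1r => /(mulIf (lt0r_neq0 aa)) ->.
by rewrite sqrf_eq1 => /orP[]/eqP E; [left | right]; rewrite bk E ?scale1r ?scaleN1r.
Qed.

(** An element centralizing that component fixes the cocharacters orthogonal to [a] and is
    isometric, so it acts as the identity or as the reflection. Conversely the lift built from
    exponentials commutes with the kernel of the character. *)
Lemma root_reflectionsP a w : a \in Phi ->
  root_reflections G T (chr g T P a) w <-> exists s, [/\ N s, w = cos s & forall v, X v -> act g s v = refl a v].
Proof.
move=> ha; have Xa := rootsqX fr ha; have a0 := rootsq0 fr ha.
split=> [[[x [Zx nx] <-] xT]|[s [ns -> hs]]].
  have Nx : N x by split; [case: Zx | ].
  exists x; split=> // v Xv.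
  have fixv u : X u -> dot u a = 0 -> act g x u = u by move=> Xu; apply: root_centralizer_fix ha Zx Xu.
  have vE : v = (v - (dot v a / dot a a) *: a) + (dot v a / dot a a) *: a by rewrite subrK.
  have Xp : X (v - (dot v a / dot a a) *: a).
    by apply: (linsetB (X_lin fr)) => //; apply: (linsetZ (X_lin fr)).
  have pa : dot (v - (dot v a / dot a a) *: a) a = 0.
    by rewrite dotBl dotZl mulfVK ?subrr // dot_eq0.
  have [] := @orth_dichotomy a (act g x a) Xa (act_X fr pr Nx Xa) a0 (act_dot g x a a).
  - by move=> u Xu ua; rewrite -(fixv u Xu ua) act_dot dotC.
  - move=> E; case: xT; apply: (etrans _ (coset_torus fr (sg1 sT))).
    apply/(coset_eqP fr pr Nx (sg1 sN)) => u Xu; rewrite (act1 fr).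
    have uE : u = (u - (dot u a / dot a a) *: a) + (dot u a / dot a a) *: a by rewrite subrK.
    have Xq : X (u - (dot u a / dot a a) *: a).
      by apply: (linsetB (X_lin fr)) => //; apply: (linsetZ (X_lin fr)).
    have qa : dot (u - (dot u a / dot a a) *: a) a = 0 by rewrite dotBl dotZl mulfVK ?subrr // dot_eq0.
    by rewrite {1}uE actD actZ E (fixv _ Xq qa) -uE.
  move=> E; rewrite {1}vE actD actZ E (fixv _ Xp pa) -addrA scalerN -opprD -scalerDl /refl.
  by congr (_ - _ *: _); rewrite -mulrDl -mulr2n mulr_natl.
have [e [f [he hf we wf [e0 f0 nw hw]]]] := root_reflection fr pr (elimT (rootsqP fr G a) ha).
set q := expm e *m _ *m _ in nw hw.
have -> : cos s = cos q by apply/(coset_eqP fr pr ns nw) => v Xv; rewrite hs // hw.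
split; last first.
  move=> E; have := iffLR (coset_eqP fr pr nw (sg1 sN)) (etrans E (esym (coset_torus fr (sg1 sT)))) a Xa.
  rewrite hw // (act1 fr) refl_a // => /eqP; rewrite eq_sym -addr_eq0 -mulr2n -scaler_nat scaler_eq0 pnatr_eq0 /=.
  by rewrite (negPf a0).
exists q => //; split; last by case: nw.
split; first exact: nw.1.
move=> t /ker_sub[Tt ct].
have te : t *m e = e *m t by rewrite (chr_rwt fr Tt we) ct scale1r.
have tf : t *m f = f *m t.
  have dN : - a \in wdiffs (eps P) by apply: rootsq_diffs (rootsqN fr pr ha).
  have d0 : a + - a \in wdiffs (eps P).
    by move: (rootsq_diffs ha); rewrite subrr !mem_undup => /mapP[[i j] _ _]; apply/mapP; exists (i, i); rewrite ?mem_enum ?subrr.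
  have := chrD fr (rootsq_diffs ha) dN d0 Tt; rewrite ct mul1r subrr => cN.
  have c0 : chr g T P 0 t = 1.
    move: d0; rewrite subrr mem_undup => /mapP[[i j] _ /= E].
    have /eqP := esym E; rewrite subr_eq0 => /eqP Eij.
    have E' : eps P i - eps P i = 0 by rewrite subrr.
    by rewrite (chrE fr E' Tt) divff // (ent_diag_neq0 fr).
  by rewrite (chr_rwt fr Tt wf) -cN c0 scale1r.
have tu := sg_unit sT Tt.
suff tw : t *m q = q *m t by rewrite tw mulmxK.
have tE := expm_comm te; have tF : t *m expm (- f) = expm (- f) *m t.
  by apply: expm_comm; rewrite mulmxN tf mulNmx.
exact: esym (intertwine3 (esym tE) (esym tF) (esym tE)).
Qed.

Lemma simple_reflectionsP w : simple_reflections G B T w <->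
  exists a s, [/\ simple Phi la a, N s, w = cos s & forall v, X v -> act g s v = refl a v].
Proof.
rewrite /simple_reflections (simple_roots_chr fr pr aB TB BG hla); split.
  move=> [_ [a sa <-]] /(root_reflectionsP _ (pos_Phi sa.1))[s [ns -> hs]].
  by exists a, s.
move=> [a [s [sa ns -> hs]]]; exists (chr g T P a); first by exists a.
by apply/(root_reflectionsP _ (pos_Phi sa.1)); exists s.
Qed.

Local Notation wlen := (wlen g P G la).

Lemma word_wlen (s : seq (set M)) : (forall r, r \in s -> simple_reflections G B T r) ->
  exists x, [/\ N x, foldr (@mulset R n) T s = cos x & (wlen x <= size s)%N].
Proof.
elim/last_ind: s => [|s r IH] h.
  exists 1%:M; split; [exact: (sg1 sN) | by rewrite (coset_torus fr (sg1 sT)) |].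
  by rewrite (wlen1 fr).
have [|x [nx xE xl]] := IH; first by move=> q qs; apply: h; rewrite mem_rcons inE qs orbT.
have [|a [y [sa ny rE hy]]] := iffLR (simple_reflectionsP r); first by apply: h; rewrite mem_rcons mem_head.
have rT : mulset r T = r by rewrite rE -mulsetA (mulsetTT fr).
have Tr : mulset T r = r by rewrite rE mulsetA (coset_comm pr ny) -mulsetA (mulsetTT fr).
exists (x *m y); split; first exact: (sgM sN).
  rewrite -(coset_mul fr pr x ny) -rE -xE foldr_rcons rT -{1}Tr.
  by elim: (s) => //= q l ->; rewrite mulsetA.
rewrite size_rcons; have := wlen_refl fr pr lreg nx ny sa hy.
by case: ifP => _ E; [rewrite E | apply: leq_trans (leqW xl); rewrite E leqnSn].
Qed.

Lemma has_word_wlen x : N x -> has_word G B T (cos x) (wlen x).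
Proof.
move=> nx; have [k] := ubnP (wlen x); elim: k x nx => // k IH x nx hk.
have [E|h] := eqVneq (wlen x) 0%N.
  rewrite E; exists [::]; split=> //=; apply: (coset_torus fr); exact: (wlen0 fr pr lreg nx E).
have [a [s [sa ns hs npa E]]] := wlen_descent fr pr lreg nx h.
have nxs := sgM sN nx ns.
have [|w [sw hw wE]] := IH _ nxs; first by rewrite -ltnS -E.
have Ts : simple_reflections G B T (cos s) by apply/simple_reflectionsP; exists a, s.
have rT : mulset (cos s) T = cos s by rewrite -mulsetA (mulsetTT fr).
have Tr : mulset T (cos s) = cos s by rewrite mulsetA (coset_comm pr ns) -mulsetA (mulsetTT fr).
exists (rcons w (cos s)); split; first by rewrite size_rcons sw E.
  by move=> r; rewrite mem_rcons inE => /predU1P[->//|]; exact: hw.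
rewrite foldr_rcons rT -{1}Tr.
have -> : foldr (@mulset R n) (mulset T (cos s)) w = mulset (foldr (@mulset R n) T w) (cos s).
  by elim: (w) => //= q l ->; rewrite mulsetA.
rewrite -wE (coset_mul fr pr _ ns); apply/(coset_eqP fr pr nx (sgM sN nxs ns)) => v Xv.
rewrite (act_mul fr pr nxs ns Xv) (act_mul fr pr nx ns (act_X fr pr ns Xv)).
rewrite [act g s (act g s v)]hs ?hs ?reflK //; first exact: (rootsq0 fr (pos_Phi sa.1)).
by rewrite -hs //; apply: (act_X fr pr ns Xv).
Qed.

(** A simple reflection adds at most one inversion, so words are at least as long as the inversion
    number; removing descents one by one produces a word of exactly that length. *)
Lemma weyl_lengthE x : N x -> weyl_length G B T (cos x) = wlen x.
Proof.
move=> nx; have wmin k : has_word G B T (cos x) k -> (wlen x <= k)%N.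
  move=> [s [<- hs E]]; have [y [ny yE yl]] := word_wlen hs.
  have E' : cos x = cos y by rewrite E yE.
  by rewrite (wlen_eq fr G la (iffLR (coset_eqP fr pr nx ny) E')).
have ex : exists k, [set k | has_word G B T (cos x) k /\ forall j, has_word G B T (cos x) j -> (k <= j)%N] k.
  by exists (wlen x); split; [exact: has_word_wlen | exact: wmin].
have [h1 h2] := xgetPex 0%N ex.
by apply/eqP; rewrite eqn_leq (h2 _ (has_word_wlen nx)) (wmin _ h1).
Qed.

Section MinReps.
Variables (mu : 'rV[rat]_n) (Xmu : X mu) (dmu : dominant Phi la mu).
Local Notation posl := (posl g P G la mu).

Lemma min_coset_repsE : min_coset_reps G B T (Pgrp g G (mu 0)) = [set cos x | x in [set x | N x /\ posl x]].
Proof.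
rewrite /min_coset_reps (weyl_parabolic_Pgrp fr pr Xmu); apply/seteqP; split.
  move=> _ [[x nx <-] h]; exists x => //; split=> //; apply/(posl_minP fr pr lreg Xmu dmu nx) => u su.
  have := h (cos u) (ex_intro2 _ _ u su erefl); rewrite (coset_mul fr pr x su.1) (weyl_lengthE nx).
  by rewrite (weyl_lengthE (sgM sN nx su.1)).
move=> _ [x [nx px] <-]; split; first by exists x.
move=> _ [u su <-]; rewrite (coset_mul fr pr x su.1) (weyl_lengthE nx) (weyl_lengthE (sgM sN nx su.1)).
exact: (iffLR (posl_minP fr pr lreg Xmu dmu nx) px).
Qed.

Lemma posl_coset_eqP x y : N x -> N y -> posl x -> posl y -> cos x = cos y <-> act g x mu = act g y mu.
Proof.
move=> nx ny px py; split=> [/(coset_eqP fr pr nx ny) h|E]; first exact: (h mu Xmu).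
have nxi := sgV sN nx; have nu := sgM sN nxi ny; set u := invmx x *m y in nu.
have xuE : x *m u = y := mulKVmx (sg_unit sN nx) y.
have su : stab g T G mu u.
  by split; [exact: nu | rewrite (act_mul fr pr nxi ny Xmu) -E (act_invK fr pr nx Xmu)].
have pxu : posl (x *m u) by rewrite xuE.
have Tu := posl_unique fr pr lreg dmu nx su px pxu.
by rewrite -xuE -mulset1 -mulsetA (coset_torus fr Tu).
Qed.

Lemma orbit_posl : [set act g x mu | x in [set x | N x /\ posl x]] = [set act g x mu | x in N].
Proof.
apply/seteqP; split=> [_ [x [nx _] <-]|_ [x nx <-]]; first by exists x.
have [u [nu umu] [pu _]] := posl_exists fr pr lreg Xmu dmu nx.
exists (x *m u); first by split=> //; apply: (sgM sN).
by rewrite (act_mul fr pr nx nu Xmu) umu.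
Qed.

End MinReps.
End Lengths.

(** * Counting orbits and cosets *)

Section Counting.
Variables (A : Type).

(** On [D] the map [F] factors through [Z], by a chosen section of [Z]. Finiteness is asked of the
    image, since in the applications [D] is a set of matrices. *)
Lemma ncard_image_le (U V : choiceType) (D : set A) (F : A -> U) (Z : A -> V) :
  finite_set (Z @` D) -> (forall a b, D a -> D b -> Z a = Z b -> F a = F b) ->
  finite_set (F @` D) /\ (ncard (F @` D) <= ncard (Z @` D))%N.
Proof.
move=> fin h.
have [[a0 Da0]|D0] := pselect (exists a, D a); last first.
  have E (W : choiceType) (Q : A -> W) : Q @` D = set0.
    by apply/seteqP; split=> // z [a Da _]; case: D0; exists a.
  by rewrite !E; split; [exact: finite_set0 | rewrite /ncard !fset_set0 cardfs0].
have /choice[r hr] : forall z : V, exists a, (Z @` D) z -> D a /\ Z a = z.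
  move=> z; have [[a Da E]|nz] := pselect ((Z @` D) z); first by exists a.
  by exists a0 => /nz.
have E : F @` D = (F \o r) @` (Z @` D).
  apply/seteqP; split=> [_ [a Da <-]|_ [z hz <-]]; last by exists (r z) => //; case: (hr z hz).
  have hz : (Z @` D) (Z a) by exists a.
  by exists (Z a) => //; have [Dr rE] := hr _ hz; apply: h.
split; first by rewrite E; apply: finite_image.
by rewrite E /ncard fset_set_image // leq_imfset_card.
Qed.

Lemma ncard_image_eq (U V : choiceType) (D : set A) (F : A -> U) (Z : A -> V) :
  finite_set (Z @` D) -> (forall a b, D a -> D b -> F a = F b <-> Z a = Z b) ->
  ncard (F @` D) = ncard (Z @` D).
Proof.
move=> fin h; have [finF le1] := ncard_image_le fin (fun a b Da Db => iffRL (h a b Da Db)).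
have [_ le2] := ncard_image_le finF (fun a b Da Db => iffLR (h a b Da Db)).
by apply/eqP; rewrite eqn_leq le1 le2.
Qed.

End Counting.

(** Double counting of the pairs of an index [v] and an element of [orb v]. *)
Lemma ncard_partition (U : choiceType) (O D : set U) (orb : U -> set U) : finite_set O -> D `<=` O ->
  (forall v, D v -> orb v `<=` O) -> (forall o, O o -> exists2 v, D v & orb v o) ->
  (forall o v v', D v -> D v' -> orb v o -> orb v' o -> v = v') ->
  (\sum_(v <- fset_set D) ncard (orb v))%N = ncard O.
Proof.
move=> fin DO orbO cover disj; have finD := sub_finite_set DO fin.
have E Q : Q `<=` O -> ncard Q = (\sum_(o <- fset_set O | `[< Q o >]) 1)%N.
  move=> QO; have finQ := sub_finite_set QO fin.
  rewrite sum1_count -size_filter /ncard; apply: perm_size; apply: uniq_perm.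
  - exact: fset_uniq.
  - exact/filter_uniq/fset_uniq.
  move=> o; rewrite mem_filter !in_fset_set //.
  apply/idP/andP => [/set_mem Qo|[/asboolP Qo _]]; last exact: mem_set.
  by split; [exact/asboolP | exact/mem_set/QO].
have DE v : v \in fset_set D -> D v by rewrite in_fset_set // => /set_mem.
rewrite big_seq (eq_bigr (fun v => \sum_(o <- fset_set O | `[< orb v o >]) 1)%N) => [|v /DE Dv]; last exact/E/orbO.
rewrite -big_seq (exchange_big_dep predT) //= /ncard card_fset_sum1 [LHS]big_seq [RHS]big_seq.
apply: eq_bigr => o; rewrite in_fset_set // => /set_mem Oo.
have [v Dv vo] := cover o Oo; have vD : v \in fset_set D by rewrite in_fset_set //; apply/mem_set.
rewrite big_mkcond (bigD1_seq v) ?fset_uniq //= asboolT // big_seq_cond big1 // => w /andP[/DE Dw /eqP wv].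
by case: asboolP => // wo; case: wv; apply: disj wo vo.
Qed.

Section FinalCount.
Variables (R : realType) (n : nat).
Local Notation C := R[i].
Local Notation M := 'M[C]_n.
Variables (g : M) (T : set M) (P : 'M[rat]_n) (fr : torus_frame g T P).
Let aT := fr_aT fr.
Let sT := alg_subgroup aT.
Local Notation X := (cochars g T).
Local Notation cos x := (mulset [set x] T).

Lemma orbit_finite (D : set M) mu : finite_set [set act g x mu | x in D].
Proof.
apply: (sub_finite_set (B := [set (\row_i mu 0 (s i) : 'rV[rat]_n) | s in [set: 'S_n]])).
  by move=> _ [x _ <-]; exists (wperm g x).
exact/finite_image/finite_finset.
Qed.

Section Cosets.
Variables (K : set M) (pr : torus_pair T K).
Local Notation N := (normalizer K T).
Let sN := normalizer_subgroup pr.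

(** The Weyl group of the parabolic is the stabilizer of [v], so cosets correspond to points of the
    orbit of [v]. *)
Lemma weyl_cosets_card v : X v ->
  ncard (weyl_cosets (weyl K T) (weyl_parabolic (Pgrp g K (v 0)) T)) = ncard [set act g x v | x in N].
Proof.
move=> Xv; rewrite (weyl_parabolic_Pgrp fr pr Xv).
set W' := [set cos u | u in _].
have -> : weyl_cosets (weyl K T) W' = [set [set mulset (cos x) u | u in W'] | x in N].
  apply/seteqP; split; first by move=> _ [_ [x nx <-] <-]; exists x.
  by move=> _ [x nx <-]; exists (cos x) => //; exists x.
apply: ncard_image_eq; first exact: orbit_finite.
have half x y : N x -> N y -> act g x v = act g y v ->
    [set mulset (cos x) u | u in W'] `<=` [set mulset (cos y) u | u in W'].
  move=> nx ny E _ [_ [u [nu uv] <-] <-]; have nyi := sgV sN ny; have nz := sgM sN nyi nx.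
  have zv : act g (invmx y *m x) v = v by rewrite (act_mul fr pr nyi nx Xv) E (act_invK fr pr ny Xv).
  exists (cos (invmx y *m x *m u)).
    exists (invmx y *m x *m u); last by [].
    split; first exact: (sgM sN nz nu).
    by rewrite (act_mul fr pr nz nu Xv) uv zv.
  rewrite (coset_mul fr pr y (sgM sN nz nu)) (coset_mul fr pr x nu).
  by rewrite -!mulmxA (mulKVmx (sg_unit sN ny)).
move=> x y nx ny; split=> [E|E]; last first.
  by apply/seteqP; split; [exact: (half x y nx ny E) | exact: (half y x ny nx (esym E))].
have W1 : W' T.
  exists 1%:M; last exact: (coset_torus fr (sg1 sT)).
  by split; [exact: (sg1 sN) | exact: (act1 fr)].
have : [set mulset (cos y) u | u in W'] (mulset (cos x) T) by rewrite -E; exists T.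
rewrite -mulsetA (mulsetTT fr) => -[_ [u [nu uv] <-]]; rewrite (coset_mul fr pr y nu).
move=> /esym/(coset_eqP fr pr nx (sgM sN ny nu))/(_ v Xv) ->.
by rewrite (act_mul fr pr ny nu Xv) uv.
Qed.

Lemma weyl_card v : X v -> (forall r, r \in rootsq g P K -> dot v r != 0) ->
  ncard (weyl K T) = ncard [set act g x v | x in N].
Proof.
move=> Xv vreg; apply: ncard_image_eq; first exact: orbit_finite.
move=> x y nx ny; split=> [/(coset_eqP fr pr nx ny) h|E]; first exact: (h v Xv).
exact: (coset_eq_regular fr pr nx ny Xv vreg E).
Qed.

End Cosets.
(** The point [x Q] is fixed by [b] when [b] lies in [x Q x^-1]; as [F] contains 1, the orbit being
    a single point amounts to this for all of [F]. *)
Lemma translate_fixed (Q F : set M) x : subgroup Q -> T `<=` Q -> x \in unitmx -> F 1%:M ->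
  [set mulset [set b] (mulset (cos x) Q) | b in F] = [set mulset (cos x) Q] <->
  F `<=` conjset (cos x) Q.
Proof.
move=> sQ TQ xu F1.
have TQQ : mulset T Q = Q.
  apply/seteqP; split; first by move=> _ [t Tt [q Qq <-]]; apply: (sgM sQ) => //; apply: TQ.
  by move=> q Qq; exists 1%:M; [exact: (sg1 sT) | exists q => //; exact: mul1mx].
have xQ : mulset (cos x) Q = mulset [set x] Q by rewrite -mulsetA TQQ.
have cx : cos x x by exists x => //; exists 1%:M; [exact: (sg1 sT) | exact: mulmx1].
rewrite /conjset xQ; split=> [E b Fb|sub].
  have : [set mulset [set x] Q] (mulset [set b] (mulset [set x] Q)) by rewrite -E; exists b.
  move=> E2; have : mulset [set x] Q (b *m x).
    rewrite -E2; exists b => //; exists x => //; exists x => //; exists 1%:M; [exact: (sg1 sQ) | exact: mulmx1].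
  move=> [_ -> [q Qq xq]]; exists (x *m q); first by exists x => //; exists q.
  by exists (invmx x); [exists x | rewrite xq mulmxK].
have bE b : F b -> mulset [set b] (mulset [set x] Q) = mulset [set x] Q.
  move=> /sub[_ [_ -> [q Qq <-]] [_ [_ [_ -> [t Tt <-]] <-] <-]].
  have Qt := TQ _ Tt; have tu := sg_unit sQ Qt; have qu := sg_unit sQ Qq; rewrite (invmxM xu tu).
  apply/seteqP; split.
    move=> _ [_ -> [_ [_ -> [p Qp <-]] <-]]; exists x => //; exists (q *m invmx t *m p).
      by apply: (sgM sQ _ Qp); apply: (sgM sQ Qq); apply: (sgV sQ).
    by rewrite !mulmxA mulmxKV.
  move=> _ [_ -> [p Qp <-]]; exists (x *m q *m (invmx t *m invmx x)) => //.
  exists (x *m (t *m invmx q *m p)).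
    by exists x => //; exists (t *m invmx q *m p) => //; apply: (sgM sQ _ Qp); apply: (sgM sQ Qt); apply: (sgV sQ).
  by rewrite !mulmxA mulmxKV // mulmxKV // mulmxK.
by apply/seteqP; split=> [_ [b Fb <-]|_ ->]; [exact: bE | exists 1%:M => //; exact: bE].
Qed.

End FinalCount.

Theorem lemma2p5 (R : realType) (n : nat) (G T B P S : set 'M[R[i]]_n)
    (hG : connected_reductive G)
    (hT : maximal_torus G T)
    (hB : borel_subgroup G B) (hTB : T `<=` B)
    (hP : parabolic_subgroup G P) (hBP : B `<=` P)
    (hS : subgroup S) (hST : S `<=` T) :
  let H := identity_component (fixed G S) in
  let Y := fixed_reps G B T P S in
  [/\ (\sum_(v <- fset_set Y)
         ncard (weyl_cosets (weyl H T)
                  (weyl_parabolic (H `&` conjset v P) T)))%N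
        = ncard (min_coset_reps G B T P),
      (ncard Y)%:R >=
        (ncard (min_coset_reps G B T P))%:R / (ncard (weyl H T))%:R :> rat &
      P = B ->
        (ncard Y)%:R = (ncard (weyl G T))%:R / (ncard (weyl H T))%:R :> rat].
Proof.
move=> H Y; have [aG cG _] := hG; have [[aT cT [g gu dT0]] TG _] := hT.
have dT t : T t -> is_diag_mx (ent g t) by move=> Tt; rewrite entE; apply: dT0.
have [E [Es EX Eid]] := projection_mx (cochars_linset gu aT).
have fr : torus_frame g T E by split.
have pr : torus_pair T G.
  split=> //; [exact: (centralizer_lie_torus hG hT gu dT) | exact: reductive_nondegenerate].
have [la [Xl lreg hla EB]] := borel_structure fr pr hB hTB.
have [[aB _ _] BG _] := hB; have [aP PG _] := hP; have TP : T `<=` P := subset_trans hTB hBP.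
have sG := alg_subgroup aG; have sT := alg_subgroup aT; have sP := alg_subgroup aP.
have sB := alg_subgroup aB; have sN := normalizer_subgroup pr.
have signed r : r \in rootsq g E G -> r \in rootsq g E B \/ - r \in rootsq g E B.
  move=> hr; rewrite !hla //; last exact: (rootsqN fr pr).
  by rewrite dotNr oppr_gt0; case: (ltgtP (dot la r) 0) (lreg r hr); [right | left |].
have total r : r \in rootsq g E G -> r \in rootsq g E P \/ - r \in rootsq g E P.
  by case/signed => h; [left | right]; apply: (rootsq_sub fr hBP).
pose mu := root_weight g E G P; have Xmu : cochars g T mu := root_weight_X fr G P.
have EP : P = Pgrp g G (mu 0) := parabolic_Pgrp fr pr aP TP PG total.
have dmu : dominant (rootsq g E G) la mu.
  move=> b pb; have hb := pos_Phi pb.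
  rewrite -(mem_psi_dot fr pr aP PG total hb); apply: (rootsq_sub fr hBP).
  by rewrite hla // (pos_gt0 pb).
have prH : torus_pair T H := fixed_pair fr pr hS hST.
have HG : H `<=` G by exact: idcomp_fixed_subG.
have sNH := normalizer_subgroup prH.
have NHG y : normalizer H T y -> normalizer G T y by move=> [Hy ny]; split; [exact: HG | exact: ny].
have lregH r : r \in rootsq g E H -> dot la r != 0 by move=> /(rootsq_sub fr HG)/lreg.
(* [O] is the orbit of the cocharacter of [P] and stands for the minimal representatives; its part
   [D], dominant for [H], stands for [Y]. *)
pose N := normalizer G T; pose O := [set act g x mu | x in N].
pose orb nu := [set act g y nu | y in normalizer H T].
pose D := [set nu | O nu /\ dominant (rootsq g E H) la nu].
have XO nu : O nu -> cochars g T nu by move=> [x nx <-]; apply: (act_X fr pr nx Xmu).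
have finO : finite_set O by exact: orbit_finite.
have DO : D `<=` O by move=> nu [].
have finD := sub_finite_set DO finO.
have minE : min_coset_reps G B T P = [set mulset [set x] T | x in [set x | N x /\ posl g E G la mu x]].
  by rewrite [X in min_coset_reps _ _ _ X]EP; apply: (min_coset_repsE fr pr aB hTB BG lreg hla Xmu dmu).
have cardO : ncard (min_coset_reps G B T P) = ncard O.
  rewrite minE /O -(orbit_posl fr pr lreg Xmu dmu); apply: ncard_image_eq; first exact: orbit_finite.
  by move=> x y [nx px] [ny py]; apply: (posl_coset_eqP fr pr lreg Xmu dmu nx ny px py).
(* Each point of the orbit is reached by an element of minimal length, and the coset [cs] of that
   element does not depend on the choice. *)
have /choice[rho hrho] : forall nu : 'rV[rat]_n, exists x, O nu -> [/\ N x, posl g E G la mu x & act g x mu = nu].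
  move=> nu; have [hO|nO] := pselect (O nu); last by exists 1%:M.
  by move: hO; rewrite /O -(orbit_posl fr pr lreg Xmu dmu) => -[x [nx px] <-]; exists x.
pose cs nu := mulset [set rho nu] T.
have csE x : N x -> posl g E G la mu x -> cs (act g x mu) = mulset [set x] T.
  move=> nx px; have [nr pr' rE] := hrho (act g x mu) (ex_intro2 _ _ x nx erefl).
  exact: (iffRL (posl_coset_eqP fr pr lreg Xmu dmu nr nx pr' px) rE).
have cs_inj nu nu' : O nu -> O nu' -> cs nu = cs nu' -> nu = nu'.
  move=> /hrho[nx px xE] /hrho[ny py yE] /(posl_coset_eqP fr pr lreg Xmu dmu nx ny px py).
  by rewrite xE yE.
have conjE x : N x -> conjset (mulset [set x] T) P = Pgrp g G (act g x mu 0).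
  by move=> nx; rewrite [X in conjset _ X]EP; apply: (conj_Pgrp fr pr nx Xmu).
(* The fixed group of [B] must lie in the conjugate of [P], which is the group of the cocharacter
   [act g x mu]; by [fixed_sub_Pgrp] this is dominance for [H]. *)
have condE x : N x -> [set mulset [set b] (mulset (mulset [set x] T) P) | b in fixed B S] =
    [set mulset (mulset [set x] T) P] <-> dominant (rootsq g E H) la (act g x mu).
  move=> nx; have F1 : fixed B S 1%:M := sg1 (fixed_subgroup hS sB).
  apply: iff_trans (translate_fixed fr sP TP (sg_unit sN nx) F1) _.
  rewrite (conjE x nx) [X in fixed X S]EB.
  apply: iff_trans (fixed_sub_Pgrp fr pr hS hST Xl lreg (act_X fr pr nx Xmu)) _.
  split=> [h b pb|h r hr lr]; first exact: (h b (pos_Phi pb) (pos_gt0 pb)).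
  by apply: h; apply/andP.
have YE : Y = cs @` D.
  apply/seteqP; split=> [v []|_ [nu [hO dnu] <-]].
    rewrite minE => -[x [nx px] <-] /(condE x nx) dx; exists (act g x mu); last exact: csE.
    by split=> //; exists x.
  have [nr pr' rE] := hrho nu hO; split; first by rewrite minE; exists (rho nu).
  by apply/(condE _ nr); rewrite rE.
have sumE (F : set 'M[R[i]]_n -> nat) : (\sum_(v <- fset_set Y) F v = \sum_(nu <- fset_set D) F (cs nu))%N.
  rewrite YE fset_set_image // big_imfset //= => nu nu'.
  by rewrite !in_fset_set // => /set_mem/DO h /set_mem/DO h'; apply: cs_inj.
(* Inside [H] the conjugate of [P] is the group of the same cocharacter, so the orbit count applies
   to the pair of [T] and [H]. *)
have termE nu : D nu -> ncard (weyl_cosets (weyl H T) (weyl_parabolic (H `&` conjset (cs nu) P) T)) = ncard (orb nu).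
  move=> [hO _]; have [nr _ rE] := hrho nu hO; rewrite (conjE _ nr) rE.
  rewrite -(weyl_cosets_card fr prH (XO nu hO)); congr (ncard (weyl_cosets _ (weyl_parabolic _ T))).
  by apply/seteqP; split=> [y [Hy [_ wy]]|y [Hy wy]]; split=> //; split=> //; apply: HG.
have orbO nu : D nu -> orb nu `<=` O.
  move=> [[x nx <-] _] _ [y ny <-]; exists (y *m x); first exact: (sgM sN (NHG _ ny) nx).
  exact: (act_mul fr pr (NHG _ ny) nx Xmu).
have cover o : O o -> exists2 nu, D nu & orb nu o.
  move=> hO; have [y ny dy] := dominant_exists fr prH la (XO o hO); exists (act g y o).
    split=> //; case: hO => x nx <-; exists (y *m x); first exact: (sgM sN (NHG _ ny) nx).
    exact: (act_mul fr pr (NHG _ ny) nx Xmu).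
  by exists (invmx y); [exact: (sgV sNH ny) | exact: (act_invK fr prH ny (XO o hO))].
have disj o nu nu' : D nu -> D nu' -> orb nu o -> orb nu' o -> nu = nu'.
  move=> [hO dn] [hO' dn'] [y ny yE] [y' ny' y'E]; have Xn := XO nu hO; have Xn' := XO nu' hO'.
  have nyi := sgV sNH ny'.
  have zE : act g (invmx y' *m y) nu = nu'.
    by rewrite (act_mul fr prH nyi ny Xn) yE -y'E (act_invK fr prH ny' Xn').
  rewrite -zE; symmetry; apply: (dominant_unique fr prH lregH (sgM sNH nyi ny) Xn dn).
  by rewrite zE.
have part := ncard_partition finO DO orbO cover disj.
have DE nu : nu \in fset_set D -> D nu by rewrite in_fset_set // => /set_mem.
have cardY : ncard Y = ncard D.
  rewrite YE -[in RHS](image_id D); apply: ncard_image_eq; first by rewrite image_id.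
  by move=> nu nu' /DO h /DO h'; split=> [|->]; first exact: cs_inj.
have wH := weyl_card fr prH Xl lregH.
have wH0 : (0 < ncard (weyl H T))%N.
  rewrite wH /ncard cardfs_gt0; apply/fset0Pn; exists la; rewrite in_fset_set; last exact: orbit_finite.
  by apply/mem_set; exists 1%:M; [exact: (sg1 sNH) | exact: (act1 fr)].
have wH0r : 0 < (ncard (weyl H T))%:R :> rat by rewrite ltr0n.
have sumD (k : nat) : (\sum_(nu <- fset_set D) k = ncard D * k)%N.
  by rewrite big_const_seq count_predT iter_addn_0 mulnC.
split.
- rewrite sumE cardO -part [LHS]big_seq [RHS]big_seq; apply: eq_bigr => nu /DE; exact: termE.
(* Every orbit is an image of the orbit of the regular [la], so it has at most as many points as the
   Weyl group of [H]. *)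
- rewrite ler_pdivrMr // -natrM ler_nat cardY cardO -part -sumD big_seq [leqRHS]big_seq.
  apply: leq_sum => nu /DE [hO _]; rewrite wH; apply: (ncard_image_le (orbit_finite _ _ _) _).2.
  move=> x y nx ny xyE; have := coset_eq_regular fr prH nx ny Xl lregH xyE.
  by move=> /(coset_eqP fr prH nx ny)/(_ nu (XO nu hO)).
(* When [P = B] no roots of [P] are paired, so [mu] is regular and every orbit under the Weyl group
   of [H] is free. *)
move=> EPB; have mureg r : r \in rootsq g E G -> dot mu r != 0.
  have gt b : b \in rootsq g E B -> 0 < dot mu b.
    move=> hb; have hbG := rootsq_sub fr BG hb; apply: (root_weight_gt fr pr aP PG); rewrite EPB // hla; last exact: (rootsqN fr pr).
    by move: hb; rewrite hla // dotNr oppr_gt0 -leNgt => /ltW.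
  by move=> /signed[/gt h|/gt]; [rewrite gt_eqF | rewrite dotNr oppr_gt0 => h; rewrite lt_eqF].
have orbE nu : D nu -> ncard (orb nu) = ncard (weyl H T).
  move=> [hO _]; rewrite (weyl_card fr prH (XO nu hO)) // => r /(rootsq_sub fr HG) hr.
  case: hO => x nx <-; rewrite -[r](act_Kinv fr pr nx (rootsqX fr hr)) act_dot; apply: mureg.
  by apply: (rootsq_act fr pr) => //; apply: (sgV sN).
rewrite (weyl_card fr pr Xmu mureg) -/O cardY -part big_seq (eq_bigr _ (fun nu h => orbE nu (DE nu h))) -big_seq sumD.
by rewrite natrM mulfK // gt_eqF.
Qed.
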